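(* Let $W\subset\hat W$ be a complex neighborhood of $H^1_r$ with $\mathcal I_{rec}(W)=W$ and let $\psi_n(\lambda,v)$, $n\ge0$, $v\in W$, be functions with the properties (a)–(e) listed in the context (such $W$ and $\psi_n$ are provided by the main theorem of the paper). For $n\ge1$, $v=(q,p)\in W$ and $\lambda\in\mathbb C^*$ define $$\psi_{-n}(\lambda,q,p):=\psi_n\Big(\frac1{16\lambda},-q,p\Big)\frac1{16\lambda^2}.$$ Then for any $n\ge1$ and $v\in W$, $$\int_{\Gamma_{1,m}}\frac{\psi_{-n}(\lambda,v)}{\sqrt[c]{\chi_p(\lambda,v)}}\,d\lambda=0,\qquad\int_{\Gamma_{2,m}}\frac{\psi_{-n}(\lambda,v)}{\sqrt[c]{\chi_p(\lambda,v)}}\,d\lambda=2\pi\,\delta_{-n,m},\qquad\forall m\in\mathbb Z.$$ The possibly complex roots $\sigma_{1,k}^{-n}(v)\in U_{1,k}$ ($k\in\mathbb Z$) and $(-16\sigma_{2,k}^{-n}(v))^{-1}\in U_{2,k}$ ($k\ne-n$) of $\psi_{-n}(\cdot,v)$ depend analytically on $v$ and satisfy $$\sigma_{j,k}^{-n}(v)-\tau_{j,k}(v)=\gamma_{j,k}(v)^2\,\ell^2_k\qquad\forall(j,k)\ne(2,-n).$$ Furthermore, if $v$ is real valued (i.e. $v\in H^1_r$), then $\lambda_{j,k}^-(v)\le\sigma_{j,k}^{-n}(v)\le\lambda_{j,k}^+(v)$ for all $(j,k)\ne(2,-n)$.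
   Context: Spaces and ODE. $\mathbb T=\mathbb R/\mathbb Z$, $\mathbb C^*=\mathbb C\setminus\{0\}$, $H^1_c=H^1(\mathbb T,\mathbb C)\times H^1(\mathbb T,\mathbb C)$, $H^1_r=H^1(\mathbb T,\mathbb R)\times H^1(\mathbb T,\mathbb R)$, $P=\sqrt{1-\partial_x^2}$. For $v=(q,p)\in H^1_c$ and $\lambda\in\mathbb C^*$, $M(x,\lambda,v)\in\mathbb C^{2\times2}$ solves $$\partial_xM=J\Big(\lambda+\tfrac14(Pp+q_x)Z-\tfrac1{16\lambda}\begin{pmatrix}e^{-q}&0\\0&e^{q}\end{pmatrix}\Big)M,\quad M(0,\lambda,v)=I,\qquad J=\begin{pmatrix}0&1\\-1&0\end{pmatrix},\ Z=\begin{pmatrix}0&1\\1&0\end{pmatrix}.$$ $\Delta(\lambda,v)=\frac12\operatorname{tr}M(1,\lambda,v)$, $\chi_p=\Delta^2-1$. The periodic eigenvalues are the zeros of $\chi_p(\cdot,v)$ in $\mathbb C^*$, counted with multiplicity; they are invariant under $\lambda\mapsto-\lambda$. Listing. $\mathbb C^+=\{\operatorname{Re}\lambda>0\}\cup\{\operatorname{Re}\lambda=0,\operatorname{Im}\lambda>0\}$; $a\preceq b$ iff $|a|<|b|$, or $|a|=|b|$ and $\operatorname{Im}a\le\operatorname{Im}b$. $D_0=\{|z-\frac14|<\frac1{4\pi}\}$, $D_n=\{|\lambda-n\pi|<\pi/3\}$, $D_{-n}=\{\lambda:\frac1{16\lambda}\in D_n\}$, $n\ge1$. The periodic eigenvalues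 in $\mathbb C^+$ are listed $\cdots\preceq\lambda_{-1}^-\preceq\lambda_{-1}^+\preceq\lambda_0^-\preceq\lambda_0^+\preceq\lambda_1^-\preceq\cdots$, indexed so that $\lambda_n^\pm\in D_n$ for $|n|$ large; $G_n=[\lambda_n^-,\lambda_n^+]$ (segment in $\mathbb C$). Isolating neighborhoods. For each $v_0\in H^1_r$ there is a ball $W_{v_0}\subset H^1_c$ centered at $v_0$ and pairwise disjoint open $U_n\subset\mathbb C^+$, $n\in\mathbb Z$, so that for every $v\in W_{v_0}$: (1) $G_n\subset U_n$; (2) for $n\ge0$, $U_n$ is a disc centered on the real axis and for some $c\ge1$, $c^{-1}|m-n|\le\operatorname{dist}(U_m,U_n)\le c|m-n|$ for $m\ne n$, $m,n\ge0$; (3) the sets $\{\frac1{16\lambda}:\lambda\in U_{-n}\}$, $n\ge0$, satisfy (2) with the same $c$; (4) $U_n=D_n$ for $|n|$ large. $\mathcal I_{rec}(q,p)=(-q,p)$; balls are chosen with $W_{\mathcal I_{rec}(v)}=\mathcal I_{rec}(W_v)$; $\hat W=\bigcup_{v\in H^1_r}W_v$. Relabelling. For $k\ge0$: $\lambda_{1,k}^\pm=\lambda_k^\pm$, $\lambda_{2,k}^\pm=\frac1{16\lambda_{-k}^\mp}$. For $k\le-1$: $\lambda_{1,k}^\pm=-\lambda_{-k}^\mp$, $\lambda_{2,k}^\pm=-\frac1{16\lambda_k^\pm}$. $\tau_{j,k}=(\lambda_{j,k}^++\lambda_{j,k}^-)/2$, $\gamma_{j,k}=\lambda_{j,k}^+-\lambda_{j,k}^-$.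 For $m\ge0$: $G_{1,m}=G_m$, $G_{2,m}=-G_{-m}$, $U_{1,m}=U_m$, $U_{2,m}=-U_{-m}$; for $m\ge1$: $G_{j,-m}=-G_{j,m}$, $U_{1,-m}=-U_m$, $U_{2,-m}=U_{-m}$. $\Gamma_{j,m}\subset U_{j,m}$ is a counterclockwise contour around $G_{j,m}$. The isolating neighborhoods are chosen so that $\{-\frac1{16\lambda}:\lambda\in U_{1,n}(q,p)\}=U_{2,n}(-q,p)$ and $\{-\frac1{16\lambda}:\lambda\in U_{2,n}(q,p)\}=U_{1,n}(-q,p)$. Notation. $\pi_n=n\pi$ for $n\ne0$, $\pi_0=1$; infinite products over $\mathbb Z$ are limits of products over $|k|\le N$. $a_k=b_k+\ell^2_k$ means $(a_k-b_k)_k\in\ell^2$; $a_k=c_k\ell^2_k$ means $|a_k|\le|c_k|\alpha_k$ with $(\alpha_k)\in\ell^2$. Canonical root. $w_{1,n}(\lambda,v)$ is the analytic branch of $\sqrt{(\lambda_{1,n}^+-\lambda)(\lambda_{1,n}^--\lambda)}$ on $\mathbb C\setminus G_{1,n}$ given by $(\tau_{1,n}-\lambda)\sqrt[+]{1-\gamma_{1,n}^2/4(\tau_{1,n}-\lambda)^2}$ where $|\gamma_{1,n}^2/4(\tau_{1,n}-\lambda)^2|<1$ ($\sqrt[+]{\cdot}$ principal branch). $w_{2,n}(\lambda,q,p)=w_{1,n}(-\frac1{16\lambda},-q,p)$; $\sqrt[c]{\chi_j(\lambda)}=\prod_{n\in\mathbb Z}\frac{w_{j,n}(\lambda)}{\pi_n}$,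 $j=1,2$; $\sqrt[c]{\chi_p(\lambda)}:=i\,\sqrt[c]{\chi_1(\lambda)}\sqrt[c]{\chi_2(\lambda)}/\sqrt[c]{\chi_1(0)}$ on $\mathbb C^*\setminus\bigcup_m(G_{1,m}\cup G_{2,m})$. Properties of $\psi_n$, $n\ge0$, for every $v\in W$: (a) $\psi_n(\lambda)=-\frac1{\pi_n}C_n\psi_{n,1}(\lambda)\psi_{n,2}(\lambda)$ with $\psi_{n,1}(\lambda)=\prod_{k\ne n}\frac{\sigma^n_{1,k}-\lambda}{\pi_k}$, $\psi_{n,2}(\lambda)=\prod_{k\in\mathbb Z}\frac{\sigma^n_{2,k}+\frac1{16\lambda}}{\pi_k}$, $C_n^{-1}=\prod_{k\in\mathbb Z}\frac{\sigma^n_{2,k}}{\pi_k}$, where $\sigma^n_{1,k}\in U_{1,k}$ ($k\ne n$), $(-16\sigma^n_{2,k})^{-1}\in U_{2,k}$ ($k\in\mathbb Z$), $\sigma^n_{j,k}=k\pi+\ell_k^2$; (b) $\frac1{2\pi}\int_{\Gamma_{1,m}}\frac{\psi_n}{\sqrt[c]{\chi_p}}d\lambda=\delta_{nm}$ and $\frac1{2\pi}\int_{\Gamma_{2,m}}\frac{\psi_n}{\sqrt[c]{\chi_p}}d\lambda=0$ for all $m\in\mathbb Z$; (c) the roots $\sigma^n_{1,k}$ ($k\ne n$) and $(-16\sigma^n_{2,k})^{-1}$ depend analytically on $v\in W$; (d) with $\sigma^n_{1,n}:=\tau_{1,n}$, $\sigma^n_{j,k}-\tau_{j,k}=\gamma_{j,k}^2\ell_k^2$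 for all $k\in\mathbb Z$, $j=1,2$; (e) if $v\in H^1_r$, then $\lambda_{j,k}^-\le\sigma^n_{j,k}\le\lambda_{j,k}^+$ for all $k$, $j$. *)

(* Defs.v *)
From HB Require Import structures.
From mathcomp Require Import all_boot all_order all_algebra.
From mathcomp Require Import complex.
From mathcomp Require Import all_classical all_reals all_analysis.

Set Implicit Arguments.
Unset Strict Implicit.
Unset Printing Implicit Defensive.

Import Order.TTheory GRing.Theory Num.Theory.
Import ComplexField.Normc.
Import numFieldNormedType.Exports.

Local Open Scope classical_set_scope.
Local Open Scope ring_scope.
Local Open Scope complex_scope.

Variant root_family := J1 | J2.

Section Defs.
Variable R : realType.
Local Notation C := R[i].
Local Notation cRe := (@complex.Re R).
Local Notation cIm := (@complex.Im R).

(** * Complex-valued calculus.  [R[i]] carries its topology as [R[i]^o]. *)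

Definition cexp (z : C) : C :=
  (expR (cRe z))%:C * (cos (cIm z) +i* sin (cIm z)).

Definition cderive (u : R -> C) (x : R) : C :=
  derive1 (cRe \o u) x +i* derive1 (cIm \o u) x.

Definition cintegrable (a b : R) (u : R -> C) : Prop :=
  lebesgue_measure.-integrable `[a, b] (EFin \o (cRe \o u)) /\
  lebesgue_measure.-integrable `[a, b] (EFin \o (cIm \o u)).

Definition cint (a b : R) (u : R -> C) : C :=
  (\int[lebesgue_measure]_(x in `[a, b]) cRe (u x)) +i*
  (\int[lebesgue_measure]_(x in `[a, b]) cIm (u x)).

Definition holo_at (f : C -> C) (z : C) : Prop :=
  derivable (f : C^o -> C^o) z 1.

Definition zero_order (f : C -> C) (z : C) (k : nat) : Prop :=
  exists g : C -> C, [/\ \forall u \near nbhs (z : C^o), holo_at g u,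
    g z != 0
    & \forall u \near nbhs (z : C^o), f u = (u - z) ^+ k * g u].

(** Infinite products over the integers, as limits of the products over
    [|k| <= N]. *)
Definition prodZ (a : int -> C) : C :=
  lim ((fun N : nat =>
    \prod_(i < (2 * N).+1) a (i%:Z - N%:Z) : C^o) @ \oo).

Definition ell2 (a : int -> R) : Prop :=
  (\esum_(k in [set: int]) ((a k) ^+ 2)%:E < +oo)%E.

Definition disc (c : C) (rho : R) : set C := [set z | normc (z - c) < rho].

Definition setdist (A B : set C) : R := inf [set normc (z - u) | z in A & u in B].

Definition Nset (A : set C) : set C := [set - z | z in A].

(** Inequalities between complex numbers assert in particular that these
    numbers are real. *)
Definition real_between (a x b : C) : Prop := a \is Num.real /\ a <= x <= b.

(** ** Contours *)

Definition C1 (f : R -> R) : Prop :=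
  (forall x, derivable f x 1) /\ continuous (derive1 f).

(** [g] agrees with a function of class C^1 on each interval of a finite
    subdivision of [0, 1]; [cderive g] is then defined off finitely many
    points. *)
Definition piecewise_C1 (g : R -> C) : Prop :=
  exists (N : nat) (t : nat -> R), [/\ t 0%N = 0, t N = 1,
    forall i, (i < N)%N -> t i < t i.+1
    & forall i, (i < N)%N -> exists h : R -> C,
        [/\ C1 (cRe \o h), C1 (cIm \o h)
          & forall x, t i <= x <= t i.+1 -> g x = h x]].

Definition contour_int (g : R -> C) (f : C -> C) : C :=
  cint 0 1 (fun t => f (g t) * cderive g t).

(** A closed path in [U] winding once counterclockwise around [K]. *)
Definition contour_around (U K : set C) (g : R -> C) : Prop :=
  [/\ piecewise_C1 g, g 0 = g 1,
    forall t, 0 <= t <= 1 -> U (g t) /\ ~ K (g t)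
    & forall a, K a ->
        contour_int g (fun z => (z - a)^-1) = 2 * pi%:C * 'i].

(** * The spaces H^1.  Functions on the circle are 1-periodic functions on the
    line, and elements of H^1 are identified with their continuous
    representatives. *)

Definition L2 (u : R -> C) : Prop :=
  [/\ measurable_fun (`[0, 1] : set R) (cRe \o u),
    measurable_fun (`[0, 1] : set R) (cIm \o u)
    & lebesgue_measure.-integrable `[0, 1]
        (EFin \o (fun x => normc (u x) ^+ 2))].

(** Absolutely continuous with derivative in L^2; the pointwise derivative
    exists almost everywhere and is the weak derivative. *)
Definition H1 (u : R -> C) : Prop :=
  [/\ forall x, u (x + 1) = u x, L2 (cderive u)
    & forall x, 0 <= x <= 1 -> u x = u 0 + cint 0 x (cderive u)].

Definition fourier (u : R -> C) (n : int) : C :=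
  cint 0 1 (fun x => u x * cexp (0 +i* - (2 * pi * n%:~R * x))).

(** [Pop u] represents sqrt(1 - d^2/dx^2) u in L^2(0, 1): the Fourier
    multiplier with symbol sqrt(1 + (2 pi n)^2). *)
Definition Pop (u : R -> C) : R -> C :=
  xget (fun=> 0) [set f | L2 f /\ forall n : int,
    fourier f n = (Num.sqrt (1 + (2 * pi * n%:~R) ^+ 2))%:C * fourier u n].

(** Potentials [(q, p)]. *)
Definition pot : Type := ((R -> C) * (R -> C))%type.

Definition H1c : set pot := [set v | H1 v.1 /\ H1 v.2].

Definition H1r : set pot :=
  [set v | H1c v /\
    forall x, cIm (v.1 x) = 0 /\ cIm (v.2 x) = 0].

Definition H1norm (v : pot) : R :=
  let sq (u : R -> C) :=
    \int[lebesgue_measure]_(x in `[0, 1]) (normc (u x) ^+ 2) in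
  Num.sqrt (sq v.1 + sq (cderive v.1) + sq v.2 + sq (cderive v.2)).

Definition H1ball (v0 : pot) (r : R) : set pot :=
  [set v | H1c v /\ H1norm (v - v0) < r].

Definition H1open (W : set pot) : Prop :=
  W `<=` H1c /\ forall v, W v -> exists r : R, 0 < r /\ H1ball v r `<=` W.

(** Complex Frechet differentiability at every point of [W]. *)
Definition H1analytic (W : set pot) (f : pot -> C) : Prop :=
  forall v, W v -> exists L : pot -> C,
    [/\ forall (a : C) (h k : pot), H1c h -> H1c k ->
          L (a *: h + k) = a * L h + L k,
      exists K : R, forall h, H1c h -> normc (L h) <= K * H1norm h
      & forall e : R, 0 < e -> exists d : R, 0 < d /\
          forall h, H1c h -> H1norm h < d ->
            normc (f (v + h) - f v - L h) <= e * H1norm h].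

Definition Irec (v : pot) : pot := (- v.1, v.2).

(** * The ODE and the periodic spectrum *)

Definition mx22 (a b c d : C) : 'M[C]_2 :=
  \matrix_(i < 2, j < 2)
    (if i == 0 then if j == 0 then a else b else if j == 0 then c else d).

Definition Jmx : 'M[C]_2 := mx22 0 1 (-1) 0.
Definition Zmx : 'M[C]_2 := mx22 0 1 1 0.

Definition ode_coef (l : C) (v : pot) (x : R) : 'M[C]_2 :=
  Jmx *m (l%:M + ((Pop v.2 x + cderive v.1 x) / 4) *: Zmx
          - (16 * l)^-1 *: mx22 (cexp (- v.1 x)) 0 0 (cexp (v.1 x))).

(** Solutions in the sense of Caratheodory, the coefficients being in L^2. *)
Definition fundamental_solution (l : C) (v : pot) (M : R -> 'M[C]_2) : Prop :=
  forall i j, cintegrable 0 1 (fun t => (ode_coef l v t *m M t) i j) /\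
    forall x, 0 <= x <= 1 ->
      M x i j = (1%:M : 'M[C]_2) i j
                + cint 0 x (fun t => (ode_coef l v t *m M t) i j).

Definition discriminant (M : R -> C -> pot -> 'M[C]_2) (v : pot) (l : C) : C :=
  \tr (M 1 l v) / 2.

Definition chi_p (M : R -> C -> pot -> 'M[C]_2) (v : pot) (l : C) : C :=
  discriminant M v l ^+ 2 - 1.

Definition Cplus : set C :=
  [set z | 0 < cRe z \/ (cRe z = 0 /\ 0 < cIm z)].

Definition prec (a b : C) : Prop :=
  normc a < normc b \/
  (normc a = normc b /\ cIm a <= cIm b).

Definition Dset (n : int) : set C :=
  if n == 0 then disc (4^-1) ((4 * pi)^-1)
  else if 0 < n then disc (n%:~R * pi%:C) (pi / 3)
  else [set z | disc ((- n)%:~R * pi%:C) (pi / 3) (16 * z)^-1].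

(** [l n true] and [l n false] stand for lambda_n^+ and lambda_n^-. *)
Definition listing : Type := int -> bool -> C.

Definition is_listing (chi : C -> C) (l : listing) : Prop :=
  [/\ forall n s, Cplus (l n s),
    forall z, Cplus z -> exists2 k : nat, zero_order chi z k &
      ([set i : int * bool | l i.1 i.2 = z] #= `I_k)%card,
    forall n, prec (l n false) (l n true) /\ prec (l n true) (l (n + 1) false)
    & exists N : nat, forall n : int, (N <= `|n|)%N -> forall s, Dset n (l n s)].

Definition gap (l : listing) (n : int) : set C :=
  [set z | exists t : R, 0 <= t <= 1 /\
    z = (1 - t)%:C * l n false + t%:C * l n true].

(** * Isolating neighborhoods *)

Definition separated_discs (c : R) (V : nat -> set C) : Prop :=
  (forall n, exists a rho : R, 0 < rho /\ V n = disc a%:C rho) /\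
  forall m n, m != n ->
    c^-1 * `|m%:R - n%:R| <= setdist (V m) (V n) <= c * `|m%:R - n%:R|.

Definition isolating (W0 : set pot) (lam : pot -> listing) (U : int -> set C)
    : Prop :=
  [/\ forall n, open (U n : set C^o) /\ U n `<=` Cplus,
    forall m n, m != n -> U m `&` U n = set0,
    forall v, W0 v -> forall n, gap (lam v) n `<=` U n,
    exists c : R, [/\ 1 <= c, separated_discs c (fun n => U n%:Z)
      & separated_discs c (fun n => [set (16 * z)^-1 | z in U (- n%:Z)])]
    & exists N : nat, forall n : int, (N <= `|n|)%N -> U n = Dset n].

(** * Relabelling *)

Definition lamj (l : listing) (j : root_family) (k : int) (s : bool) : C :=
  match j with
  | J1 => if 0 <= k then l k s else - l (- k) (~~ s)
  | J2 => if 0 <= k then (16 * l (- k) (~~ s))^-1 else - (16 * l k s)^-1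
  end.

Definition tau (l : listing) (j : root_family) (k : int) : C :=
  (lamj l j k true + lamj l j k false) / 2.

Definition gamma (l : listing) (j : root_family) (k : int) : C :=
  lamj l j k true - lamj l j k false.

(** The relabelling [G_{j,m}] of the [G_n], and likewise [U_{j,m}] of the
    [U_n]. *)
Definition relabel (S : int -> set C) (j : root_family) (m : int) : set C :=
  match j with
  | J1 => if 0 <= m then S m else Nset (S (- m))
  | J2 => if 0 <= m then Nset (S (- m)) else S m
  end.

(** [radius v0] and [U v0] are the radius of the ball W_{v0} and the isolating
    neighborhoods attached to the base point [v0]. *)
Definition Irec_compatible (radius : pot -> R) (U : pot -> int -> set C)
    : Prop :=
  forall v0, H1r v0 ->
    H1ball (Irec v0) (radius (Irec v0)) = [set Irec v | v in H1ball v0 (radius v0)]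
    /\ forall n : int,
      [set - (16 * z)^-1 | z in relabel (U v0) J1 n]
        = relabel (U (Irec v0)) J2 n /\
      [set - (16 * z)^-1 | z in relabel (U v0) J2 n]
        = relabel (U (Irec v0)) J1 n.

(** * Canonical roots *)

Definition pin (n : int) : C := if n == 0 then 1 else n%:~R * pi%:C.

(** [sqrtc] is the principal branch. *)
Definition is_canonical_root (l : listing) (n : int) (w : C -> C) : Prop :=
  forall z, ~ relabel (gap l) J1 n z ->
    let d := gamma l J1 n ^+ 2 / (4 * (tau l J1 n - z) ^+ 2) in
    [/\ holo_at w z,
      w z ^+ 2 = (lamj l J1 n true - z) * (lamj l J1 n false - z)
      & normc d < 1 -> w z = (tau l J1 n - z) * sqrtc (1 - d)].

(** From here on [w v n] is the canonical root w_{1,n}(., v). *)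
Definition wj (w : pot -> int -> C -> C) (j : root_family) (v : pot) (n : int) (z : C)
    : C :=
  match j with
  | J1 => w v n z
  | J2 => w (Irec v) n (- (16 * z)^-1)
  end.

Definition croot_chi (w : pot -> int -> C -> C) (j : root_family) (v : pot) (z : C)
    : C :=
  prodZ (fun n => wj w j v n z / pin n).

Definition croot_chi_p (w : pot -> int -> C -> C) (v : pot) (z : C) : C :=
  'i * croot_chi w J1 v z * croot_chi w J2 v z / croot_chi w J1 v 0.

(** The set to be encircled by Gamma_{j,m}.  For complex [v] the branch cut of
    w_{2,m}(., v) is the image of the segment G_{1,m}(Irec v) under
    z |-> -1/(16 z), in general a circular arc with the same end points as the segment
    G_{2,m}(v); a contour along which the canonical root is analytic has to
    encircle both.  The two coincide for real [v]. *)
Definition encircled (lam : pot -> listing) (v : pot) (j : root_family) (m : int)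
    : set C :=
  match j with
  | J1 => relabel (gap (lam v)) J1 m
  | J2 => relabel (gap (lam v)) J2 m `|`
          [set - (16 * z)^-1 | z in relabel (gap (lam (Irec v))) J1 m]
  end.

(** [Gam v0 v j m] is Gamma_{j,m} for the potential [v] and the isolating
    neighborhoods attached to [v0]. *)
Definition are_contours (W : set pot) (lam : pot -> listing)
    (radius : pot -> R) (U : pot -> int -> set C)
    (Gam : pot -> pot -> root_family -> int -> R -> C) : Prop :=
  forall v0 v, H1r v0 -> W v -> H1ball v0 (radius v0) v -> forall j m,
    contour_around (relabel (U v0) j m) (encircled lam v j m) (Gam v0 v j m).

(** * The functions psi_n *)

(** a_k = gamma_k^2 ell^2_k over the indices satisfying [D]. *)
Definition gamma2_ell2 (D : int -> Prop) (g a : int -> C) : Prop :=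
  exists al : int -> R, ell2 al /\
    forall k, D k -> normc (a k) <= normc (g k) ^+ 2 * al k.

(** Properties (a)-(e) of psi_n = [psi], with roots [sig j k v] =
    sigma^n_{j,k}(v), where sigma^n_{1,n} := tau_{1,n} by convention. *)
Definition psi_properties (W : set pot) (lam : pot -> listing)
    (radius : pot -> R) (U : pot -> int -> set C)
    (Gam : pot -> pot -> root_family -> int -> R -> C) (w : pot -> int -> C -> C)
    (n : nat) (psi : C -> pot -> C) (sig : root_family -> int -> pot -> C) : Prop :=
  [/\ forall v, W v -> sig J1 n%:Z v = tau (lam v) J1 n%:Z,
    (* (a) *)
    [/\ forall v z, W v -> z != 0 ->
          psi z v = - (pin n%:Z)^-1
            * (prodZ (fun k => sig J2 k v / pin k))^-1
            * prodZ (fun k => if k == n%:Z then 1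
                              else (sig J1 k v - z) / pin k)
            * prodZ (fun k => (sig J2 k v + (16 * z)^-1) / pin k),
      forall v0 v, H1r v0 -> W v -> H1ball v0 (radius v0) v ->
        forall k, (k != n%:Z -> relabel (U v0) J1 k (sig J1 k v)) /\
                  relabel (U v0) J2 k (- (16 * sig J2 k v))^-1
      & forall v j, W v -> ell2 (fun k => normc (sig j k v - k%:~R * pi%:C))],
    (* (b) *)
    forall v0 v, H1r v0 -> W v -> H1ball v0 (radius v0) v -> forall m : int,
      (2 * pi%:C)^-1 * contour_int (Gam v0 v J1 m)
        (fun z => psi z v / croot_chi_p w v z) = (m == n%:Z)%:R /\
      (2 * pi%:C)^-1 * contour_int (Gam v0 v J2 m)
        (fun z => psi z v / croot_chi_p w v z) = 0,
    (* (c) *)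
    forall k : int, (k != n%:Z -> H1analytic W (sig J1 k)) /\
      H1analytic W (fun v => (- (16 * sig J2 k v))^-1)
    & (* (d), (e) *)
    (forall v j, W v ->
      gamma2_ell2 (fun=> True) (gamma (lam v) j)
        (fun k => sig j k v - tau (lam v) j k)) /\
    (forall v j k, H1r v ->
      real_between (lamj (lam v) j k false) (sig j k v)
        (lamj (lam v) j k true))].

(** psi_{-n} in terms of psi_n = [psi]. *)
Definition psi_neg (psi : C -> pot -> C) (z : C) (v : pot) : C :=
  psi (16 * z)^-1 (Irec v) * (16 * z ^+ 2)^-1.

End Defs.

(* Main.v *)
Require Import Defs.
From HB Require Import structures.
From mathcomp Require Import all_boot all_order all_algebra.
From mathcomp Require Import complex.
From mathcomp Require Import all_classical all_reals all_analysis.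
From mathcomp Require Import measurable_realfun.
From mathcomp Require Import zify ring lra.

Set Implicit Arguments.
Unset Strict Implicit.
Unset Printing Implicit Defensive.

Import Order.TTheory GRing.Theory Num.Theory.
Import ComplexField.Normc.
Import numFieldNormedType.Exports.

Local Open Scope classical_set_scope.
Local Open Scope ring_scope.
Local Open Scope complex_scope.

(** Write v' = (-q, p) and r z = 1/(16 z).  Conjugating the equation by
    diag(e^(q/2), e^(-q/2)) gives chi_p (r z, v') = chi_p (z, v), hence
    lambda_{-n}(v') = r (lambda_n(v)) with the signs exchanged, and the roots of
    psi_{-n}(., v) are the images under r or -1 of those of psi_n(., v').

    For the integrals substitute z = r y: the integrand becomes
    psi_n(y, v') / chi_p^c(r y, v), whose canonical root differs from that of
    chi_p^c(y, v') only in the two factors w_0, by the oddness of the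
    J_1-listing.  Reciprocity of w_0 outside a disc around the gap, obtained by
    continuation from infinity, makes the two integrands opposite off
    U_0 and -U_0, up to the factor chi_1(0, v) / chi_1(0, v').  That factor is 1:
    psi_n / chi_p^c has integral 2 pi in total over all contours, and 2 pi times the
    factor over a large circle minus a small one.

    Cauchy's theorem is needed only for functions that are uniform limits, on
    the given curves, of rational functions with poles in the cuts; 1/w is such a
    limit by the expansion of the powers of tau - z + w as P + w Q. *)

(** * Complex-valued integrals and absolutely continuous paths *)

Section ComplexModulus.
Variable R : realType.
Local Notation C := R[i].
Local Notation cRe := (@complex.Re R).
Local Notation cIm := (@complex.Im R).
Implicit Types (z w : C).

(** Index 0 is the source of the case distinctions. For k <> 0 the first family contains with
    G_{1,k} its opposite G_{1,-k}, so inversion may be followed by a change of sign: it takes the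
    data (j, k) of v' to those of v in the other family with index -k. The gap of index 0 has no
    opposite in its own family. Inversion takes it to the gap of the same family and index, where
    the cuts before and after the substitution may differ and only integrals can be compared.

    For complex v the cuts of the second family are in general circular arcs. They are treated as
    preimages of the segments of v' under -1/(16 z), and the data of v and v' are carried along
    together.

    The zeros are only square summable perturbations of k pi, so the products converge through the
    cancellation between k and -k. On large circles the product of the ratios of zeros to roots is
    bounded, but close to 1 only far from the real axis; the normalization therefore rests on
    dominated convergence. *)

Lemma cReD z w : cRe (z + w) = cRe z + cRe w.
Proof. by case: z w => a b [c d]. Qed.
Lemma cImD z w : cIm (z + w) = cIm z + cIm w.
Proof. by case: z w => a b [c d]. Qed.
Lemma cReN z : cRe (- z) = - cRe z.
Proof. by case: z. Qed.
Lemma cImN z : cIm (- z) = - cIm z.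
Proof. by case: z. Qed.
Lemma cReM z w : cRe (z * w) = cRe z * cRe w - cIm z * cIm w.
Proof. by case: z w => a b [c d]. Qed.
Lemma cImM z w : cIm (z * w) = cRe z * cIm w + cIm z * cRe w.
Proof. by case: z w => a b [c d]. Qed.

Lemma complex_eq z w : cRe z = cRe w -> cIm z = cIm w -> z = w.
Proof. by case: z w => a b [c d] /= -> ->. Qed.

Lemma normrC z : `|z| = (normc z)%:C.
Proof. by case: z => a b; rewrite normc_def. Qed.

Lemma normc_ge0 z : 0 <= normc z.
Proof. by case: z => a b; exact: sqrtr_ge0. Qed.

Lemma normcD z w : normc (z + w) <= normc z + normc w.
Proof. exact: le_normcD. Qed.

Lemma normcNE z : normc (- z) = normc z.
Proof. exact: normcN. Qed.

Lemma normcB z w : normc (z - w) <= normc z + normc w.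
Proof. by rewrite -(normcNE w); exact: normcD. Qed.

Lemma normcC z w : normc (z - w) = normc (w - z).
Proof. by rewrite -normcNE opprB. Qed.

Lemma normc_eq0 z : (normc z == 0) = (z == 0).
Proof.
by apply/eqP/eqP => [/eq0_normc//|->]; rewrite normc0.
Qed.

Lemma normc_gt0 z : (0 < normc z) = (z != 0).
Proof. by rewrite lt_neqAle normc_ge0 andbT eq_sym normc_eq0. Qed.

Lemma normcX z n : normc (z ^+ n) = normc z ^+ n.
Proof. by elim: n => [|n IH]; rewrite ?expr0 ?normc1// !exprS normcM IH. Qed.

Lemma normc_real (x : R) : normc x%:C = `|x|.
Proof. by rewrite /= expr0n /= addr0 sqrtr_sqr. Qed.

Lemma normc_nat n : normc (n%:R : C) = n%:R.
Proof.
have -> : (n%:R : C) = (n%:R : R)%:C by rewrite rmorph_nat.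
by rewrite normc_real ger0_norm.
Qed.

Lemma sqr_normc_ReIm z : normc z ^+ 2 = cRe z ^+ 2 + cIm z ^+ 2.
Proof. by case: z => a b /=; rewrite sqr_sqrtr ?addr_ge0 ?sqr_ge0. Qed.

Lemma normc_dist z w : `|normc z - normc w| <= normc (z - w).
Proof.
have h1 := normcD (z - w) w; have h2 := normcD (w - z) z.
rewrite !subrK in h1 h2; rewrite (normcC w z) in h2.
by rewrite ler_norml; apply/andP; split; lra.
Qed.

Lemma normc_ge_B z w : normc z - normc w <= normc (z - w).
Proof. exact: le_trans (ler_norm _) (normc_dist z w). Qed.

Lemma Re_le_normc z : `|cRe z| <= normc z.
Proof.
rewrite -(@ler_pXn2r _ 2)// ?nnegrE ?normc_ge0//.
by rewrite sqr_normc_ReIm real_normK ?num_real// lerDl sqr_ge0.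
Qed.

Lemma Im_le_normc z : `|cIm z| <= normc z.
Proof.
rewrite -(@ler_pXn2r _ 2)// ?nnegrE ?normc_ge0//.
by rewrite sqr_normc_ReIm real_normK ?num_real// lerDr sqr_ge0.
Qed.

Lemma normc_le_ReIm z : normc z <= `|cRe z| + `|cIm z|.
Proof.
rewrite -(@ler_pXn2r _ 2)// ?nnegrE ?addr_ge0 ?normc_ge0//.
rewrite sqr_normc_ReIm sqrrD !real_normK ?num_real//.
by rewrite addrAC lerDl mulrn_wge0// mulr_ge0.
Qed.

(** Integrable as soon as both parts are, and submultiplicative. Bounds for complex integrals go
    through it, at the cost of the factor 2 in [nrm1_le]. *)
Definition nrm1 z : R := `|cRe z| + `|cIm z|.

Lemma nrm1_ge0 z : 0 <= nrm1 z. Proof. by rewrite /nrm1 addr_ge0. Qed.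
Lemma nrm1_le z : nrm1 z <= 2 * normc z.
Proof. by rewrite /nrm1 mulr_natl mulr2n lerD ?Re_le_normc ?Im_le_normc. Qed.
Lemma nrm1D z w : nrm1 (z + w) <= nrm1 z + nrm1 w.
Proof.
rewrite /nrm1 cReD cImD addrACA lerD// ler_normD//.
Qed.
Lemma nrm1M z w : nrm1 (z * w) <= nrm1 z * nrm1 w.
Proof.
rewrite /nrm1 cReM cImM (le_trans (lerD (ler_normB _ _) (ler_normD _ _)))//.
by rewrite !normrM; lra.
Qed.

End ComplexModulus.

(** * Linearity and bounds for integrals over intervals *)

Section Integral.
Variable R : realType.
Local Notation C := R[i].
Local Notation cRe := (@complex.Re R).
Local Notation cIm := (@complex.Im R).
Local Notation mu := (@lebesgue_measure R).
Implicit Types (a b c d x y : R) (u v : R -> C) (f g : R -> R).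

Definition rintegrable a b f := mu.-integrable `[a, b] (EFin \o f).
Definition rint a b f := \int[mu]_(x in `[a, b]) f x.

Lemma rintegrableS a b c d f : a <= c -> d <= b ->
  rintegrable a b f -> rintegrable c d f.
Proof.
move=> ac db; apply: integrableS => //.
by apply: subset_itv; rewrite bnd_simp.
Qed.

Lemma rintegrableD a b f g : rintegrable a b f -> rintegrable a b g ->
  rintegrable a b (fun t => f t + g t).
Proof.
move=> hf hg; rewrite /rintegrable.
rewrite (_ : EFin \o _ = (EFin \o f) \+ (EFin \o g))%E//.
exact: integrableD.
Qed.

Lemma rintegrableZ a b (k : R) f : rintegrable a b f ->
  rintegrable a b (fun t => k * f t).
Proof.
move=> hf; rewrite /rintegrable.
rewrite (_ : EFin \o _ = (fun x => k%:E * (EFin \o f) x))%E//.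
exact: integrableZl.
Qed.

Lemma rintegrable_norm a b f : rintegrable a b f ->
  rintegrable a b (fun t => `|f t|).
Proof. by move=> hf; exact: integrable_norm. Qed.

Lemma rintD a b f g : rintegrable a b f -> rintegrable a b g ->
  rint a b (fun t => f t + g t) = rint a b f + rint a b g.
Proof. by move=> hf hg; rewrite /rint RintegralD. Qed.

Lemma rintZ a b (k : R) f : rintegrable a b f ->
  rint a b (fun t => k * f t) = k * rint a b f.
Proof. by move=> hf; rewrite /rint RintegralZl. Qed.

Lemma rint_le a b f g : rintegrable a b f -> rintegrable a b g ->
  (forall t, a <= t <= b -> f t <= g t) -> rint a b f <= rint a b g.
Proof. by move=> hf hg fg; apply: le_Rintegral => // t; rewrite /= in_itv; apply: fg. Qed.

Lemma rint_split a x b f : a <= x -> x <= b -> rintegrable a b f ->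
  rint a b f = rint a x f + rint x b f.
Proof.
move=> ax xb hf; apply/eqP; rewrite addrC -subr_eq; apply/eqP.
rewrite /rint Rintegral_itvB// ?bnd_simp//.
rewrite Rintegral_itv_obnd_cbnd//.
by apply: integrableS hf => //; apply: subset_itvr; rewrite bnd_simp.
Qed.

Lemma rint_ge0 a b f : (forall t, a <= t <= b -> 0 <= f t) -> 0 <= rint a b f.
Proof. by move=> f0; apply: Rintegral_ge0 => t; rewrite /= in_itv /=; apply: f0. Qed.

(** The end points are null, but measurability of [g] on the closed interval has to be recovered
    from the open one. Equality inside is the useful assumption because derivatives of piecewise
    curves are known only between the nodes. *)
Lemma rint_eq a b f g : (forall t, a < t < b -> f t = g t) ->
  rintegrable a b f -> rint a b f = rint a b g /\ rintegrable a b g.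
Proof.
move=> fg hf.
have hfo : mu.-integrable `]a, b[ (EFin \o f).
  by apply: integrableS hf => //; apply: subset_itv; rewrite bnd_simp.
have hgo : mu.-integrable `]a, b[ (EFin \o g).
  apply: eq_integrable hfo => // t; rewrite inE /= in_itv /= => tab.
  by rewrite fg.
have mg : measurable_fun `[a, b] g.
  apply: (@measurable_fun_itv_cc _ a b false true).
  by apply/measurable_EFinP; case/integrableP : hgo.
have key h : measurable_fun `[a, b] h ->
   (\int[mu]_(x in `[a, b]) (EFin \o h) x = \int[mu]_(x in `]a, b[) (EFin \o h) x)%E.
  move=> mh; have [ab|ab] := ltP a b; last first.
    have [->|ab'] := eqVneq a b.
      by rewrite set_itv1 integral_set1 set_itv_ge ?integral_set0// bnd_simp ltxx.
    rewrite !set_itv_ge ?integral_set0// bnd_simp -?leNgt -?ltNge//.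
    by rewrite lt_neqAle eq_sym ab'.
  rewrite -integral_itv_obnd_cbnd; last first.
    apply/measurable_EFinP; apply: measurable_funS mh => //.
    by apply: subset_itv; rewrite bnd_simp.
  rewrite -integral_itv_bndo_bndc//.
  apply/measurable_EFinP; apply: measurable_funS mh => //.
  by apply: subset_itv; rewrite bnd_simp.
have mf : measurable_fun `[a, b] f.
  by apply/measurable_EFinP; case/integrableP : hf.
split.
  rewrite /rint /Rintegral (key f)// (key g)//; congr fine.
  by apply: eq_integral => t; rewrite inE /= in_itv /= => tab; rewrite fg.
apply/integrableP; split; first exact/measurable_EFinP.
have := key (fun t => `|g t|).
rewrite /= => ->; last exact: measurableT_comp.
by case/integrableP : hgo.
Qed.

Lemma cintegrableS a b c d u : a <= c -> d <= b ->
  cintegrable a b u -> cintegrable c d u.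
Proof. by move=> ac db [h1 h2]; split; exact: rintegrableS ac db _. Qed.

Lemma cintegrableD a b u v : cintegrable a b u -> cintegrable a b v ->
  cintegrable a b (fun t => u t + v t).
Proof.
move=> [h1 h2] [h3 h4]; split.
  rewrite (_ : cRe \o _ = fun t => cRe (u t) + cRe (v t)); first exact: rintegrableD.
  by apply/funext => t /=; rewrite cReD.
rewrite (_ : cIm \o _ = fun t => cIm (u t) + cIm (v t)); first exact: rintegrableD.
by apply/funext => t /=; rewrite cImD.
Qed.

Lemma cintegrableZ a b (k : C) u : cintegrable a b u ->
  cintegrable a b (fun t => k * u t).
Proof.
move=> [h1 h2]; split.
  rewrite (_ : cRe \o _ = fun t => cRe k * cRe (u t) + - cIm k * cIm (u t)).
    by apply: rintegrableD; exact: rintegrableZ.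
  by apply/funext => t /=; rewrite cReM mulNr.
rewrite (_ : cIm \o _ = fun t => cRe k * cIm (u t) + cIm k * cRe (u t)).
  by apply: rintegrableD; exact: rintegrableZ.
by apply/funext => t /=; rewrite cImM.
Qed.

Lemma cintegrableN a b u : cintegrable a b u -> cintegrable a b (fun t => - u t).
Proof.
move=> /(cintegrableZ (-1)); congr cintegrable.
by apply/funext => t; rewrite mulN1r.
Qed.

Lemma cintegrableB a b u v : cintegrable a b u -> cintegrable a b v ->
  cintegrable a b (fun t => u t - v t).
Proof. by move=> hu hv; apply: cintegrableD => //; exact: cintegrableN. Qed.

Lemma cintD a b u v : cintegrable a b u -> cintegrable a b v ->
  cint a b (fun t => u t + v t) = cint a b u + cint a b v.
Proof.
move=> [h1 h2] [h3 h4]; apply: complex_eq; rewrite ?cReD ?cImD /=.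
  rewrite -RintegralD//; apply: eq_Rintegral => t _; by rewrite cReD.
rewrite -RintegralD//; apply: eq_Rintegral => t _; by rewrite cImD.
Qed.

Lemma cintZ a b (k : C) u : cintegrable a b u ->
  cint a b (fun t => k * u t) = k * cint a b u.
Proof.
move=> [h1 h2]; apply: complex_eq; rewrite ?cReM ?cImM /=.
  rewrite -!RintegralZl// -RintegralB//; [|exact: rintegrableZ..].
  by apply: eq_Rintegral => t _; rewrite cReM.
rewrite -!RintegralZl// -RintegralD//; [|exact: rintegrableZ..].
by apply: eq_Rintegral => t _; rewrite cImM.
Qed.

Lemma cintN a b u : cintegrable a b u ->
  cint a b (fun t => - u t) = - cint a b u.
Proof.
move=> hu; rewrite -mulN1r -cintZ//; congr cint.
by apply/funext => t; rewrite mulN1r.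
Qed.

Lemma cintB a b u v : cintegrable a b u -> cintegrable a b v ->
  cint a b (fun t => u t - v t) = cint a b u - cint a b v.
Proof. by move=> hu hv; rewrite cintD ?cintN//; exact: cintegrableN. Qed.

Lemma cint_split a x b u : a <= x -> x <= b -> cintegrable a b u ->
  cint a b u = cint a x u + cint x b u.
Proof.
move=> ax xb [h1 h2]; apply: complex_eq; rewrite ?cReD ?cImD /=.
  exact: rint_split.
exact: rint_split.
Qed.

Lemma cint_point a u : cint a a u = 0.
Proof. by rewrite /cint set_itv1 !Rintegral_set1. Qed.

Lemma cint_eq a b u v : (forall t, a < t < b -> u t = v t) ->
  cintegrable a b u -> cint a b u = cint a b v /\ cintegrable a b v.
Proof.
move=> uv [h1 h2].
have [e1 i1] : rint a b (cRe \o u) = rint a b (cRe \o v) /\ rintegrable a b (cRe \o v).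
  by apply: rint_eq => // t /uv /= ->.
have [e2 i2] : rint a b (cIm \o u) = rint a b (cIm \o v) /\ rintegrable a b (cIm \o v).
  by apply: rint_eq => // t /uv /= ->.
by split; [apply: complex_eq | split].
Qed.

Lemma cint_eq_cc a b u v : (forall t, a <= t <= b -> u t = v t) ->
  cint a b u = cint a b v.
Proof.
move=> uv; apply: complex_eq; apply: eq_Rintegral => t; rewrite inE/= in_itv /=;
by move=> /uv ->.
Qed.

Lemma cintegrable_eq_cc a b u v : (forall t, a <= t <= b -> u t = v t) ->
  cintegrable a b u -> cintegrable a b v.
Proof.
move=> uv [h1 h2]; split.
  apply: eq_integrable h1 => // t; rewrite inE/= in_itv /= => /uv; by move=> ->.
apply: eq_integrable h2 => // t; rewrite inE/= in_itv /= => /uv; by move=> ->.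
Qed.

Lemma nrm1_integrable a b u : cintegrable a b u ->
  rintegrable a b (fun t => nrm1 (u t)).
Proof. by move=> [h1 h2]; apply: rintegrableD; exact: rintegrable_norm. Qed.

Lemma cint_bound a b u g : cintegrable a b u -> rintegrable a b g ->
  (forall t, a <= t <= b -> nrm1 (u t) <= g t) -> normc (cint a b u) <= rint a b g.
Proof.
move=> hu hg ug; have [h1 h2] := hu.
apply: le_trans (normc_le_ReIm _) _.
apply: le_trans (rint_le (nrm1_integrable hu) hg ug).
rewrite rintD; [|exact: rintegrable_norm..].
by apply: lerD; exact: le_normr_Rintegral.
Qed.

End Integral.

(** * Absolutely continuous paths with prescribed density *)

Section AbsolutelyContinuous.
Variable R : realType.
Local Notation C := R[i].
Local Notation cRe := (@complex.Re R).
Local Notation cIm := (@complex.Im R).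
Local Notation mu := (@lebesgue_measure R).
Implicit Types (a b c d x y : R) (u v du dv : R -> C) (f g : R -> R).

(** Uniform continuity, stated without subspace topologies, is preserved by products, inverses and
    uniform limits; [pcont] serves compositions with functions that are continuous point by
    point. *)
Definition ucont a b u := forall e : R, 0 < e -> exists2 d : R, 0 < d &
  forall x y, a <= x <= b -> a <= y <= b -> `|x - y| < d -> normc (u x - u y) < e.

Definition pcont a b u := forall x, a <= x <= b -> forall e : R, 0 < e ->
  exists2 d : R, 0 < d & forall y, a <= y <= b -> `|x - y| < d -> normc (u x - u y) < e.

Lemma ucont_pcont a b u : ucont a b u -> pcont a b u.
Proof.
by move=> h x xab e e0; have [d d0 hd] := h e e0; exists d => // y yab; exact: hd.
Qed.

Lemma pcont_within a b u f : (forall x y, `|f x - f y| <= normc (u x - u y)) ->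
  pcont a b u -> {within `[a, b], continuous f}.
Proof.
move=> fu hu; apply/subspace_continuousP => x; rewrite /= in_itv /= => xab.
apply/cvgrPdist_lt => e e0; have [d d0 hd] := hu x xab e e0.
rewrite near_withinE; near=> y => yab.
move: yab; rewrite /= in_itv /= => yab.
apply: le_lt_trans (fu x y) _; apply: hd => //.
Unshelve. all: by end_near. Qed.

Lemma ucont_within a b u f : (forall x y, `|f x - f y| <= normc (u x - u y)) ->
  ucont a b u -> {within `[a, b], continuous f}.
Proof. by move=> fu /ucont_pcont; exact: pcont_within. Qed.

Lemma Re_dist z w : `|cRe z - cRe w| <= normc (z - w).
Proof. by rewrite -cReN -cReD; exact: Re_le_normc. Qed.
Lemma Im_dist z w : `|cIm z - cIm w| <= normc (z - w).
Proof. by rewrite -cImN -cImD; exact: Im_le_normc. Qed.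

Lemma ucont_Re_within a b u : ucont a b u -> {within `[a, b], continuous (cRe \o u)}.
Proof. by apply: ucont_within => x y; exact: Re_dist. Qed.
Lemma ucont_Im_within a b u : ucont a b u -> {within `[a, b], continuous (cIm \o u)}.
Proof. by apply: ucont_within => x y; exact: Im_dist. Qed.

Lemma pcont_ge_pos a b u : a <= b -> pcont a b u -> (forall t, a <= t <= b -> u t != 0) ->
  exists2 m : R, 0 < m & forall t, a <= t <= b -> m <= normc (u t).
Proof.
move=> ab hu u0.
have hc : {within `[a, b], continuous (fun t => normc (u t))}.
  by apply: pcont_within hu => x y; exact: normc_dist.
have [c cab hmin] := EVT_min ab hc.
move: cab; rewrite in_itv /= => cab.
exists (normc (u c)); first by rewrite normc_gt0 u0.
by move=> t tab; apply: hmin; rewrite in_itv.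
Qed.

Lemma ucont_ge_pos a b u : a <= b -> ucont a b u -> (forall t, a <= t <= b -> u t != 0) ->
  exists2 m : R, 0 < m & forall t, a <= t <= b -> m <= normc (u t).
Proof. by move=> ab /ucont_pcont; exact: pcont_ge_pos. Qed.

Lemma ucont_bounded a b u : a <= b -> ucont a b u ->
  exists2 K : R, 0 < K & forall t, a <= t <= b -> normc (u t) <= K.
Proof.
move=> ab hu.
have hc : {within `[a, b], continuous (fun t => normc (u t))}.
  by apply: ucont_within hu => x y; exact: normc_dist.
have [c cab hmin] := EVT_max ab hc.
exists (normc (u c) + 1); first by rewrite ltr_wpDl ?normc_ge0.
by move=> t tab; rewrite (le_trans (hmin t _)) ?in_itv// lerDl.
Qed.

Lemma ucont_cst a b (k : C) : ucont a b (fun=> k).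
Proof. by move=> e e0; exists 1 => // x y _ _ _; rewrite subrr normc0. Qed.

Lemma ucontD a b u v : ucont a b u -> ucont a b v -> ucont a b (fun t => u t + v t).
Proof.
move=> hu hv e e0.
have e20 : 0 < e / 2 by rewrite divr_gt0.
have [d1 d10 h1] := hu _ e20; have [d2 d20 h2] := hv _ e20.
exists (Num.min d1 d2); first by rewrite lt_min d10.
move=> x y xab yab; rewrite lt_min => /andP[xy1 xy2].
rewrite opprD addrACA (le_lt_trans (normcD _ _))// [e]splitr ltrD// ?h1 ?h2//.
Qed.

Lemma ucontM a b u v : a <= b -> ucont a b u -> ucont a b v ->
  ucont a b (fun t => u t * v t).
Proof.
move=> ab hu hv e e0.
have [K K0 hK] := ucont_bounded ab hu; have [L L0 hL] := ucont_bounded ab hv.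
have e1 : 0 < e / (2 * L) by rewrite divr_gt0// mulr_gt0.
have e2 : 0 < e / (2 * K) by rewrite divr_gt0// mulr_gt0.
have [d1 d10 h1] := hu _ e1; have [d2 d20 h2] := hv _ e2.
exists (Num.min d1 d2); first by rewrite lt_min d10.
move=> x y xab yab; rewrite lt_min => /andP[xy1 xy2].
have -> : u x * v x - u y * v y = (u x - u y) * v x + u y * (v x - v y) by ring.
apply: le_lt_trans (normcD _ _) _; rewrite !normcM [e]splitr.
apply: ltr_leD.
  have := h1 _ _ xab yab xy1.
  rewrite invfM mulrA ltr_pdivlMr// => h; apply: le_lt_trans h.
  by rewrite ler_wpM2l ?normc_ge0 ?hL.
have := h2 _ _ xab yab xy2.
rewrite invfM mulrA ltr_pdivlMr// => /ltW h; apply: le_trans h.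
by rewrite mulrC ler_wpM2l ?normc_ge0 ?hK.
Qed.

Lemma ucontV a b u : a <= b -> (forall t, a <= t <= b -> u t != 0) -> ucont a b u ->
  ucont a b (fun t => (u t)^-1).
Proof.
move=> ab u0 hu e e0.
have [m m0 hm] := ucont_ge_pos ab hu u0.
have e1 : 0 < e * (m * m) by rewrite !mulr_gt0.
have [d d0 hd] := hu _ e1; exists d => // x y xab yab xy.
have ux := u0 _ xab; have uy := u0 _ yab.
have -> : (u x)^-1 - (u y)^-1 = - (u x - u y) / (u x * u y).
  by field; rewrite ux uy.
rewrite normcM normcNE normcV normcM ltr_pdivrMr; last first.
  by rewrite mulr_gt0// normc_gt0.
apply: lt_le_trans (hd _ _ xab yab xy) _.
by rewrite ler_wpM2l ?(ltW e0)// ler_pM ?(ltW m0) ?hm.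
Qed.

Lemma ucont_ulim a b u (h : nat -> R -> C) : (forall n, ucont a b (h n)) ->
  (forall e, 0 < e -> exists n, forall t, a <= t <= b -> normc (u t - h n t) <= e) ->
  ucont a b u.
Proof.
move=> hh hl e e0; have e40 : 0 < e / 4 by rewrite divr_gt0.
have [n hn] := hl _ e40; have [d d0 hd] := hh n _ e40.
exists d => // x y xab yab xy.
have -> : u x - u y = (u x - h n x) + (h n x - h n y) - (u y - h n y) by ring.
apply: le_lt_trans (normcB _ _) _; have := normcD (u x - h n x) (h n x - h n y).
have := hn _ xab; have := hn _ yab; have := hd _ _ xab yab xy; lra.
Qed.

Lemma ucont_eq a b u v : (forall t, a <= t <= b -> u t = v t) -> ucont a b u -> ucont a b v.
Proof.
move=> uv hu e e0; have [d d0 hd] := hu e e0; exists d => // x y xab yab xy.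
by rewrite -!uv// hd.
Qed.

Lemma ucontX a b u n : a <= b -> ucont a b u -> ucont a b (fun t => u t ^+ n).
Proof.
move=> ab hu; elim: n => [|n IH].
  by apply: ucont_eq (ucont_cst a b 1) => t _; rewrite expr0.
by apply: ucont_eq (ucontM ab hu IH) => t _; rewrite exprS.
Qed.

Lemma within_mbounded a b f : {within `[a, b], continuous f} ->
  measurable_fun `[a, b] f /\ [bounded f x | x in `[a, b]].
Proof.
move=> cf; split; first exact: subspace_continuous_measurable_fun.
have hc : compact (f @` `[a, b]).
  by apply: continuous_compact => //; exact: segment_compact.
have [M [Mr hM]] := compact_bounded hc.
by exists M; split => // x Mx y yab; apply: (hM x Mx); exists y.
Qed.

Lemma rintegrableM_cont a b f g : {within `[a, b], continuous f} -> rintegrable a b g ->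
  rintegrable a b (fun t => f t * g t).
Proof.
move=> /within_mbounded[mf bf] hg; rewrite /rintegrable.
rewrite (_ : EFin \o _ = ((EFin \o f) \* (EFin \o g))%E)//.
exact: integrableMr.
Qed.

Lemma cintegrableM a b u du : ucont a b u -> cintegrable a b du ->
  cintegrable a b (fun t => u t * du t).
Proof.
move=> hu [h1 h2]; have hr := ucont_Re_within hu; have hi := ucont_Im_within hu.
have A := rintegrableM_cont hr h1; have B := rintegrableM_cont hi h2.
have A' := rintegrableM_cont hr h2; have B' := rintegrableM_cont hi h1.
split.
  rewrite (_ : cRe \o _ = fun t => (cRe \o u) t * (cRe \o du) t + -1 * ((cIm \o u) t * (cIm \o du) t)).
    by apply: rintegrableD => //; exact: rintegrableZ.
  by apply/funext => t /=; rewrite cReM mulN1r.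
rewrite (_ : cIm \o _ = fun t => (cRe \o u) t * (cIm \o du) t + (cIm \o u) t * (cRe \o du) t).
  exact: rintegrableD.
by apply/funext => t /=; rewrite cImM.
Qed.

Lemma rintegrable_cst a b (k : R) : rintegrable a b (fun=> k).
Proof.
apply: measurable_bounded_integrable => //.
  by rewrite /= lebesgue_measure_itv /=; case: ifP => _; rewrite ?ltry.
by exists `|k|; split; [exact: num_real|move=> x /ltW ? y _].
Qed.

(** The density [du] is data and need not be the pointwise derivative, so that products, inverses
    and exponentials of paths come with explicit densities. *)
Definition isAC a b u du := cintegrable a b du /\
  forall x, a <= x <= b -> u x = u a + cint a x du.

Lemma isAC_diff a b u du x y : isAC a b u du -> a <= x -> x <= y -> y <= b ->
  u y - u x = cint x y du.
Proof.
move=> [idu hu] ax xy yb.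
rewrite (hu y) ?(hu x); [|by rewrite ?ax ?(le_trans ax xy) ?(le_trans xy yb)..].
rewrite (@cint_split _ a x y)//; first by ring.
exact: cintegrableS idu.
Qed.

(** Absolute continuity of the integral of [nrm1 du], extended by 0 to the line. *)
Lemma isAC_ucont a b u du : isAC a b u du -> ucont a b u.
Proof.
move=> hu e e0; have [idu _] := hu.
have ig := nrm1_integrable idu.
pose g := (fun t => nrm1 (du t)) \_ `[a, b].
have ig' : mu.-integrable setT (EFin \o g).
  by rewrite /g -restrict_EFin; apply/integrable_restrict => //=; rewrite setTI.
have [d [d0 hd]] := integral_normr_continuous ig' e0.
exists d => //.
have main x y : a <= x -> x <= y -> y <= b -> y - x < d -> normc (u y - u x) < e.
  move=> ax xy yb xyd; rewrite (isAC_diff hu)//.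
  apply: (@le_lt_trans _ _ (rint x y (fun t => nrm1 (du t)))).
    apply: cint_bound => //.
    - exact: cintegrableS idu.
    - exact: rintegrableS ig.
  have [<-|xney] := eqVneq x y; first by rewrite /rint set_itv1 Rintegral_set1.
  have xlty : x < y by rewrite lt_neqAle xney.
  have : (mu `[x, y]%classic < d%:E)%E.
    by rewrite lebesgue_measure_itv /= lte_fin xlty -EFinB lte_fin.
  move=> /(hd _ (measurable_itv _)); apply: le_lt_trans.
  rewrite le_eqVlt; apply/orP; left; apply/eqP; apply: eq_Rintegral => t.
  rewrite inE/= in_itv /= => /andP[xt ty]; rewrite /g patchE mem_set.
    by rewrite ger0_norm ?nrm1_ge0.
  by rewrite /= in_itv /= (le_trans ax xt) (le_trans ty yb).
move=> x y /andP[ax xb] /andP[ay yb]; have [xy|xy] := leP x y.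
  by rewrite distrC ger0_norm ?subr_ge0// normcC; apply: main.
by rewrite ger0_norm ?subr_ge0 ?(ltW xy)//; apply: main => //; exact: ltW.
Qed.

(** The source of the product and chain rules without almost everywhere differentiation: over short
    intervals the increments of the defect [r] are at most e times those of the integral [P] of [g],
    and a fine partition adds them up. *)
Lemma isAC_local a b u du g : cintegrable a b du -> rintegrable a b g ->
  (forall t, a <= t <= b -> 0 <= g t) ->
  (forall e, 0 < e -> exists2 d, 0 < d & forall x y, a <= x -> x <= y -> y <= b ->
     y - x < d -> normc (u y - u x - cint x y du) <= e * rint x y g) ->
  isAC a b u du.
Proof.
move=> idu ig g0 hloc; split => // x /andP[ax xb].
pose r t := u t - cint a t du.
suff : r x = r a by rewrite /r cint_point subr0 => /eqP; rewrite subr_eq => /eqP.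
apply/eqP; rewrite -subr_eq0 -normc_eq0 eq_le normc_ge0 andbT.
pose P t := rint a t g.
have P0 : 0 <= P x by apply: rint_ge0 => t /andP[at_ tx]; rewrite g0// at_ (le_trans tx).
have step e : 0 < e -> exists2 d, 0 < d & forall s t, a <= s -> s <= t -> t <= b ->
    t - s < d -> normc (r t - r s) <= e * (P t - P s).
  move=> e0; have [d d0 hd] := hloc e e0; exists d => // s t as_ st tb std.
  have i1 : cintegrable a t du by exact: cintegrableS idu.
  have i2 : rintegrable a t g by exact: rintegrableS ig.
  have := hd s t as_ st tb std.
  rewrite /P (@rint_split _ a s t)// [rint a s g + _]addrC addrK.
  congr (_ <= _); congr normc.
  by rewrite /r (@cint_split _ a s t)//; ring.
suff main e : 0 < e -> normc (r x - r a) <= e * (P x + 1).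
  rewrite leNgt; apply/negP => h0.
  (* With this e the defect is at most half of itself; the 1 added to [P x] keeps the denominator
     positive. *)
  have := main (normc (r x - r a) / (2 * (P x + 1))).
  rewrite divr_gt0 ?mulr_gt0 ?ltr_wpDl// => /(_ isT).
  have -> : normc (r x - r a) / (2 * (P x + 1)) * (P x + 1) = normc (r x - r a) / 2.
    by field; rewrite gt_eqF// ltr_wpDl.
  lra.
move=> e0; have [d d0 hd] := step e e0.
have Pa : P a = 0 by rewrite /P /rint set_itv1 Rintegral_set1.
pose n := (Num.truncn ((x - a) / d)).+1.
have n0 : 0 < n%:R :> R by rewrite ltr0n.
have nd : (x - a) / n%:R < d.
  rewrite ltr_pdivrMr// mulrC -ltr_pdivrMr//.
  by apply: truncnS_gt.
pose s k : R := a + k%:R * ((x - a) / n%:R).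
have h0 : 0 <= (x - a) / n%:R by rewrite divr_ge0 ?subr_ge0// ltW.
have smono k : s k <= s k.+1 by rewrite /s lerD2l ler_wpM2r// ler_nat.
have sn : s n = x by rewrite /s mulrC divfK ?gt_eqF//; ring.
have sle k : (k <= n)%N -> s k <= x.
  by move=> kn; rewrite -sn /s lerD2l ler_wpM2r// ler_nat.
have sge k : a <= s k by rewrite /s lerDl mulr_ge0.
have ind k : (k <= n)%N -> normc (r (s k) - r a) <= e * (P (s k) - P a).
  elim: k => [|k IH] kn; first by rewrite /s mul0r addr0 !subrr mulr0 normc0.
  have -> : r (s k.+1) - r a = (r (s k.+1) - r (s k)) + (r (s k) - r a) by ring.
  apply: le_trans (normcD _ _) _.
  have -> : e * (P (s k.+1) - P a) = e * (P (s k.+1) - P (s k)) + e * (P (s k) - P a) by ring.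
  apply: lerD; last exact/IH/ltnW.
  apply: hd => //; first exact: le_trans (sle _ kn) xb.
  have -> : s k.+1 - s k = (x - a) / n%:R by rewrite /s -natr1; ring.
  exact: nd.
have := ind n (leqnn n); rewrite sn Pa subr0 => /le_trans; apply.
by rewrite ler_wpM2l ?(ltW e0)// lerDl.
Qed.

Lemma isAC_eq a b u du v dv : (forall t, a <= t <= b -> u t = v t) ->
  (forall t, a < t < b -> du t = dv t) -> isAC a b u du -> isAC a b v dv.
Proof.
move=> uv duv [idu hu].
have [_ idv] := cint_eq duv idu.
split => // x /[dup] xab /andP[ax xb]; rewrite -!uv ?lexx ?(le_trans ax xb)// hu//; congr (_ + _).
apply: (cint_eq _ _).1; last exact: cintegrableS idu.
by move=> t /andP[at_ tx]; rewrite duv// at_ (lt_le_trans tx xb).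
Qed.

Lemma isAC_cst a b (k : C) : isAC a b (fun=> k) (fun=> 0).
Proof.
have i0 c d : cintegrable c d (fun=> 0) by split; exact: rintegrable_cst.
split => // x _; rewrite (_ : cint _ _ _ = 0) ?addr0//.
by apply: complex_eq; rewrite /cint /= Rintegral_cst// mul0r.
Qed.

Lemma isACD a b u du v dv : isAC a b u du -> isAC a b v dv ->
  isAC a b (fun t => u t + v t) (fun t => du t + dv t).
Proof.
move=> [iu hu] [iv hv]; split; first exact: cintegrableD.
move=> x /[dup] xab /andP[ax xb]; rewrite hu// hv// cintD; first by ring.
  exact: cintegrableS iu.
exact: cintegrableS iv.
Qed.

Lemma isACZ a b u du (k : C) : isAC a b u du ->
  isAC a b (fun t => k * u t) (fun t => k * du t).
Proof.
move=> [iu hu]; split; first exact: cintegrableZ.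
move=> x /[dup] xab /andP[ax xb]; rewrite hu// cintZ; first by ring.
exact: cintegrableS iu.
Qed.

Lemma isACB a b u du v dv : isAC a b u du -> isAC a b v dv ->
  isAC a b (fun t => u t - v t) (fun t => du t - dv t).
Proof.
move=> hu hv; apply: isAC_eq (isACD hu (isACZ (-1) hv)) => t _; by rewrite mulN1r.
Qed.

(* The chain rule: [G] stands for the slope of [F] between u(x) and u(y). *)
Lemma isAC_chain a b u du v dF : a <= b -> isAC a b u du -> ucont a b dF ->
  (forall e, 0 < e -> exists2 d, 0 < d & forall x y, a <= x -> x <= y -> y <= b ->
     y - x < d -> exists2 G : C, v y - v x = G * (u y - u x) &
       forall s, x <= s <= y -> normc (G - dF s) <= e) ->
  isAC a b v (fun t => dF t * du t).
Proof.
move=> ab hu hF hloc; have [iu _] := hu.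
have iFu := cintegrableM hF iu.
apply: (@isAC_local _ _ _ _ (fun t => nrm1 (du t))) => //.
- exact: nrm1_integrable.
- by move=> t _; exact: nrm1_ge0.
move=> e e0; have e20 : 0 < e / 2 by rewrite divr_gt0.
have [d d0 hd] := hloc _ e20; exists d => // x y ax xy yb xyd.
have [G GE Gs] := hd x y ax xy yb xyd.
have i1 : cintegrable x y du by exact: cintegrableS iu.
have i2 : cintegrable x y (fun t => dF t * du t) by exact: cintegrableS iFu.
rewrite GE (isAC_diff hu)// -cintZ// -cintB//; last exact: cintegrableZ.
have i3 := nrm1_integrable i1.
rewrite -rintZ//; apply: cint_bound.
- by apply: cintegrableB => //; exact: cintegrableZ.
- exact: rintegrableZ.
move=> t xty; rewrite -mulrBl (le_trans (nrm1M _ _))// ler_wpM2r ?nrm1_ge0//.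
by rewrite (le_trans (nrm1_le _))// -ler_pdivlMl// mulrC Gs.
Qed.

Lemma isACM a b u du v dv : a <= b -> isAC a b u du -> isAC a b v dv ->
  isAC a b (fun t => u t * v t) (fun t => du t * v t + u t * dv t).
Proof.
move=> ab hu hv; have [iu _] := hu; have [iv _] := hv.
have cu := isAC_ucont hu; have cv := isAC_ucont hv.
have i1 := cintegrableM cv iu; have i2 := cintegrableM cu iv.
have i3 : cintegrable a b (fun t => du t * v t + u t * dv t).
  by apply: cintegrable_eq_cc (cintegrableD i1 i2) => t _; rewrite [du t * _]mulrC.
apply: (@isAC_local _ _ _ _ (fun t => nrm1 (du t) + nrm1 (dv t))) => //.
- by apply: rintegrableD; exact: nrm1_integrable.
- by move=> t _; rewrite addr_ge0 ?nrm1_ge0.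
move=> e e0; have e20 : 0 < e / 2 by rewrite divr_gt0.
have [d1 d10 h1] := cu _ e20; have [d2 d20 h2] := cv _ e20.
exists (Num.min d1 d2); first by rewrite lt_min d10.
move=> x y ax xy yb; rewrite lt_min => /andP[xy1 xy2].
have -> : u y * v y - u x * v x = v y * (u y - u x) + u x * (v y - v x) by ring.
have j1 : cintegrable x y du by exact: cintegrableS iu.
have j2 : cintegrable x y dv by exact: cintegrableS iv.
have j3 : cintegrable x y (fun t => du t * v t + u t * dv t) by exact: cintegrableS i3.
have k1 := nrm1_integrable j1; have k2 := nrm1_integrable j2.
rewrite (isAC_diff hu)// (isAC_diff hv)// -!cintZ// -cintD; [|exact: cintegrableZ..].
rewrite -cintB//; last by apply: cintegrableD; exact: cintegrableZ.
rewrite -rintZ; last exact: rintegrableD.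
apply: cint_bound.
- by apply: cintegrableB => //; apply: cintegrableD; exact: cintegrableZ.
- by apply: rintegrableZ; exact: rintegrableD.
move=> t /andP[xt ty].
have -> : v y * du t + u x * dv t - (du t * v t + u t * dv t) =
   (v y - v t) * du t + (u x - u t) * dv t by ring.
have tab : a <= t <= b by rewrite (le_trans ax xt) (le_trans ty yb).
have xab : a <= x <= b by rewrite ax (le_trans xy yb).
have yab : a <= y <= b by rewrite yb (le_trans ax xy).
apply: le_trans (nrm1D _ _) _; rewrite mulrDr; apply: lerD;
  rewrite (le_trans (nrm1M _ _))// ler_wpM2r ?nrm1_ge0//.
  rewrite (le_trans (nrm1_le _))// -ler_pdivlMl// mulrC ltW// h2//.
  by rewrite ger0_norm ?subr_ge0// (le_lt_trans _ xy2)// lerD2l lerN2.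
rewrite (le_trans (nrm1_le _))// -ler_pdivlMl// mulrC ltW// h1//.
by rewrite distrC ger0_norm ?subr_ge0// (le_lt_trans _ xy1)// lerD2r.
Qed.

Lemma isACV a b u du : a <= b -> (forall t, a <= t <= b -> u t != 0) -> isAC a b u du ->
  isAC a b (fun t => (u t)^-1) (fun t => - (u t) ^- 2 * du t).
Proof.
move=> ab u0 hu; have cu := isAC_ucont hu.
have cV := ucontV ab u0 cu.
apply: (isAC_chain ab hu).
  apply: ucont_eq (ucontM ab (ucont_cst a b (-1)) (ucontX 2 ab cV)) => t _.
  by rewrite mulN1r exprVn.
move=> e e0; have [K K0 hK] := ucont_bounded ab cV.
have e1 : 0 < e / (2 * K) by rewrite divr_gt0 ?mulr_gt0.
have [d d0 hd] := cV _ e1; exists d => // x y ax xy yb xyd.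
have xab : a <= x <= b by rewrite ax (le_trans xy yb).
have yab : a <= y <= b by rewrite yb (le_trans ax xy).
(* The exact difference quotient of the inverse, close to -1/u(s)^2 by the uniform continuity of
   1/u. *)
exists (- (u x)^-1 * (u y)^-1); first by field; rewrite !u0.
move=> s /andP[xs sy]; have sab : a <= s <= b by rewrite (le_trans ax xs) (le_trans sy yb).
have -> : - (u x)^-1 * (u y)^-1 - - u s ^- 2 =
  ((u s)^-1 - (u x)^-1) * (u y)^-1 + ((u s)^-1 - (u y)^-1) * (u s)^-1.
  by field; rewrite !u0.
apply: le_trans (normcD _ _) _; rewrite !normcM.
have A : normc ((u s)^-1 - (u x)^-1) * normc (u y)^-1 <= e / (2 * K) * K.
  rewrite ler_pM ?normc_ge0 ?hK// ltW// hd//.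
  by rewrite ger0_norm ?subr_ge0// (le_lt_trans _ xyd)// lerD2r.
have B : normc ((u s)^-1 - (u y)^-1) * normc (u s)^-1 <= e / (2 * K) * K.
  rewrite ler_pM ?normc_ge0 ?hK// ltW// hd//.
  by rewrite distrC ger0_norm ?subr_ge0// (le_lt_trans _ xyd)// lerD2l lerN2.
have E : e / (2 * K) * K = e / 2 by field; rewrite gt_eqF.
by rewrite E in A B; lra.
Qed.

Lemma isACX a b u du n : a <= b -> isAC a b u du ->
  isAC a b (fun t => u t ^+ n.+1) (fun t => n.+1%:R * (u t ^+ n * du t)).
Proof.
move=> ab hu; elim: n => [|n IH].
  by apply: isAC_eq hu => t _; rewrite ?expr1 ?expr0 ?mul1r.
apply: isAC_eq (isACM ab hu IH) => t _; first by rewrite -exprS.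
by rewrite -[in RHS]natr1 !exprS; ring.
Qed.

End AbsolutelyContinuous.

(** * Rational approximation and Cauchy's theorem *)

Section Runge.
Variable R : realType.
Local Notation C := R[i].
Implicit Types (A X : set C) (f g : C -> C).

(** The uniform closure on [X] of the rational functions with poles in [A],
    spanned by powers and by polar parts. *)
Inductive unifrat A X : (C -> C) -> Prop :=
| unifrat_pow k : unifrat A X (fun z => z ^+ k)
| unifrat_pole a k : A a -> unifrat A X (fun z => (z - a)^-1 ^+ k.+1)
| unifrat_lin c f g : unifrat A X f -> unifrat A X g ->
    unifrat A X (fun z => c * f z + g z)
| unifrat_lim f (h : nat -> C -> C) : (forall n, unifrat A X (h n)) ->
    (forall e : R, 0 < e -> exists n, forall z, X z -> normc (f z - h n z) <= e) ->
    unifrat A X f.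

(** The distance may depend on the point of [A], so that [A] may be any set off the curves, closed
    or not. *)
Definition separated_from A X :=
  (exists2 K : R, 0 < K & forall z, X z -> normc z <= K) /\
  forall a, A a -> exists2 d : R, 0 < d & forall z, X z -> d <= normc (z - a).

(** A constant sequence in [unifrat_lim] makes membership depend on the values on [X] alone. *)
Lemma unifrat_eq A X f g : (forall z, X z -> f z = g z) -> unifrat A X f -> unifrat A X g.
Proof.
move=> fg hf; apply: (@unifrat_lim _ _ _ (fun=> f)) => // e e0; exists 0%N => z Xz.
by rewrite fg// subrr normc0 ltW.
Qed.

Lemma unifrat_ulim A X f : (forall e : R, 0 < e -> exists2 g, unifrat A X g &
  forall z, X z -> normc (f z - g z) <= e) -> unifrat A X f.
Proof.
move=> h.
have /choice[hs hsP] : forall n : nat, exists g, unifrat A X g /\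
    forall z, X z -> normc (f z - g z) <= n.+1%:R^-1.
  by move=> n; have [|g hg fg] := h (n.+1%:R^-1); [rewrite invr_gt0|exists g].
apply: (@unifrat_lim _ _ _ hs) => [n|e e0]; first by have [] := hsP n.
exists (Num.truncn e^-1) => z Xz; have [_ /(_ z Xz)] := hsP (Num.truncn e^-1).
move=> /le_trans; apply; rewrite invf_ple ?posrE//.
exact/ltW/truncnS_gt.
Qed.

Lemma unifrat0 A X : unifrat A X (fun=> 0).
Proof.
apply: unifrat_eq (unifrat_lin (-1) (unifrat_pow A X 0) (unifrat_pow A X 0)) => z _.
by rewrite mulN1r addNr.
Qed.

Lemma unifratZ A X c f : unifrat A X f -> unifrat A X (fun z => c * f z).
Proof.
move=> hf; apply: unifrat_eq (unifrat_lin c hf (unifrat0 A X)) => z _.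
by rewrite addr0.
Qed.

Lemma unifratD A X f g : unifrat A X f -> unifrat A X g -> unifrat A X (fun z => f z + g z).
Proof.
move=> hf hg; apply: unifrat_eq (unifrat_lin 1 hf hg) => z _.
by rewrite mul1r.
Qed.

Lemma unifratB A X f g : unifrat A X f -> unifrat A X g -> unifrat A X (fun z => f z - g z).
Proof.
move=> hf hg; apply: unifrat_eq (unifrat_lin (-1) hg hf) => z _.
by rewrite mulN1r addrC.
Qed.

Lemma unifrat_cst A X c : unifrat A X (fun=> c).
Proof.
apply: unifrat_eq (unifratZ c (unifrat_pow A X 0)) => z _.
by rewrite expr0 mulr1.
Qed.

Lemma unifrat_id A X : unifrat A X (fun z => z).
Proof. exact: unifrat_eq (unifrat_pow A X 1). Qed.

Lemma unifrat_inv A X a : A a -> unifrat A X (fun z => (z - a)^-1).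
Proof. by move=> Aa; exact: unifrat_eq (unifrat_pole X 0 Aa). Qed.

Section Separated.
Variables (A X : set C).
Hypothesis AX : separated_from A X.

Lemma separated_neq a z : A a -> X z -> z - a != 0.
Proof.
move=> Aa Xz; have [d d0 hd] := AX.2 a Aa.
by rewrite -normc_gt0 (lt_le_trans d0)// hd.
Qed.

Lemma unifrat_bounded f : unifrat A X f -> exists2 K : R, 0 < K & forall z, X z -> normc (f z) <= K.
Proof.
elim=> [k|a k Aa|c {}f g _ [K K0 hK] _ [L L0 hL]|{}f h _ IH hl].
- have [K K0 hK] := AX.1; exists (K ^+ k); first exact: exprn_gt0.
  by move=> z Xz; rewrite normcX lerXn2r ?nnegrE ?normc_ge0 ?(ltW K0) ?hK.
- have [d d0 hd] := AX.2 a Aa; exists (d^-1 ^+ k.+1); first by rewrite exprn_gt0// invr_gt0.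
  move=> z Xz; rewrite normcX lerXn2r ?nnegrE ?normc_ge0 ?invr_ge0 ?(ltW d0)//.
  rewrite normcV lef_pV2 ?posrE ?hd// normc_gt0; exact: separated_neq.
- exists (normc c * K + L); first by rewrite ltr_wpDl// mulr_ge0 ?normc_ge0 ?ltW.
  move=> z Xz; rewrite (le_trans (normcD _ _))// normcM lerD ?hL//.
  by rewrite ler_wpM2l ?normc_ge0 ?hK.
- have [n hn] := hl 1 ltr01; have [K K0 hK] := IH n.
  exists (1 + K) => [|z Xz]; first by rewrite addr_gt0.
  by rewrite -(subrK (h n z) (f z)) (le_trans (normcD _ _))// lerD ?hn ?hK.
Qed.

Lemma unifrat_mul_lim f h g : (exists2 K : R, 0 < K & forall z, X z -> normc (g z) <= K) ->
  (forall n : nat, unifrat A X (fun z => g z * h n z)) ->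
  (forall e : R, 0 < e -> exists n, forall z, X z -> normc (f z - h n z) <= e) ->
  unifrat A X (fun z => g z * f z).
Proof.
move=> [K K0 hK] hh hl; apply: (@unifrat_lim _ _ _ (fun n z => g z * h n z)) => //.
move=> e e0; have [|n hn] := hl (e / K); first by rewrite divr_gt0.
exists n => z Xz; rewrite -mulrBr normcM.
apply: (@le_trans _ _ (K * (e / K))); last by rewrite mulrC divfK ?gt_eqF.
by rewrite ler_pM ?normc_ge0 ?hK ?hn.
Qed.

Lemma unifrat_mulX f : unifrat A X f -> unifrat A X (fun z => z * f z).
Proof.
elim=> [k|a k Aa|c {}f g _ IHf _ IHg|{}f h _ IH hl].
- by apply: unifrat_eq (unifrat_pow A X k.+1) => z _; rewrite exprS.
- have hk : unifrat A X (fun z => (z - a)^-1 ^+ k).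
    by case: k => [|k]; [exact: unifrat_pow A X 0 |exact: unifrat_pole].
  apply: unifrat_eq (unifrat_lin a (unifrat_pole X k Aa) hk) => z Xz.
  by rewrite exprS; field; exact: separated_neq.
- by apply: unifrat_eq (unifrat_lin c IHf IHg) => z _; ring.
- exact: unifrat_mul_lim AX.1 IH hl.
Qed.

(** Partial fractions: a pole at b itself has its order raised, and for a <> b the product of the
    two poles is a multiple of their difference, by induction on the order. *)
Lemma unifrat_mulV b f : A b -> unifrat A X f -> unifrat A X (fun z => (z - b)^-1 * f z).
Proof.
move=> Ab; elim=> [k|a k Aa|c {}f g _ IHf _ IHg|{}f h _ IH hl].
- elim: k => [|k IH].
    by apply: unifrat_eq (unifrat_inv X Ab) => z _; rewrite expr0 mulr1.
  apply: unifrat_eq (unifrat_lin b IH (unifrat_pow A X k)) => z Xz.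
  by rewrite exprS; field; exact: separated_neq.
- have [->|ab] := eqVneq a b.
    apply: unifrat_eq (unifrat_pole X k.+1 Ab) => z _; exact: exprS.
  have ab0 : a - b != 0 by rewrite subr_eq0.
  elim: k => [|k IH].
    apply: unifrat_eq (unifratZ ((a - b)^-1) (unifratB (unifrat_inv X Aa) (unifrat_inv X Ab))) => z Xz.
    by rewrite expr1; field; rewrite ab0 (separated_neq Aa Xz) (separated_neq Ab Xz).
  apply: unifrat_eq (unifratZ ((a - b)^-1) (unifratB (unifrat_pole X k.+1 Aa) IH)) => z Xz.
  by rewrite [_ ^+ k.+2]exprS; field; rewrite ab0 (separated_neq Aa Xz) (separated_neq Ab Xz).
- by apply: unifrat_eq (unifrat_lin c IHf IHg) => z _; ring.
- apply: unifrat_mul_lim IH hl.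
  exact: (unifrat_bounded (unifrat_inv X Ab)).
Qed.

(** Induction on the first factor with the second one fixed; the generators are covered by
    [unifrat_mulX] and [unifrat_mulV]. *)
Lemma unifratM f g : unifrat A X f -> unifrat A X g -> unifrat A X (fun z => f z * g z).
Proof.
move=> + hg; elim=> [k|a k Aa|c {}f h _ IHf _ IHg|{}f h _ IH hl].
- elim: k => [|k IH]; first by apply: unifrat_eq hg => z _; rewrite mul1r.
  by apply: unifrat_eq (unifrat_mulX IH) => z _; rewrite exprS mulrA.
- elim: k => [|k IH]; first exact: unifrat_eq (unifrat_mulV Aa hg).
  by apply: unifrat_eq (unifrat_mulV Aa IH) => z _; rewrite [_ ^+ k.+2]exprS mulrA.
- by apply: unifrat_eq (unifrat_lin c IHf IHg) => z _; ring.
- have hgh n : unifrat A X (fun z => g z * h n z).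
    by apply: unifrat_eq (IH n) => z _; rewrite mulrC.
  by apply: unifrat_eq (unifrat_mul_lim (unifrat_bounded hg) hgh hl) => z _; rewrite mulrC.
Qed.

Lemma unifratX f n : unifrat A X f -> unifrat A X (fun z => f z ^+ n).
Proof.
move=> hf; elim: n => [|n IH]; first exact: unifrat_cst.
by apply: unifrat_eq (unifratM hf IH) => z _; rewrite exprS.
Qed.

Lemma unifrat_prod (I : Type) (r : seq I) (F : I -> C -> C) :
  (forall i, unifrat A X (F i)) -> unifrat A X (fun z => \prod_(i <- r) F i z).
Proof.
move=> hF; elim: r => [|i r IH].
  by apply: unifrat_eq (unifrat_cst A X 1) => z _; rewrite big_nil.
by apply: unifrat_eq (unifratM (hF i) IH) => z _; rewrite big_cons.
Qed.

Lemma unifrat_poly (p : {poly C}) : unifrat A X (horner p).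
Proof.
elim/poly_ind: p => [|p c IH].
  by apply: unifrat_eq (unifrat0 A X) => z _; rewrite horner0.
apply: unifrat_eq (unifratD (unifrat_mulX IH) (unifrat_cst A X c)) => z _.
by rewrite hornerMXaddC mulrC.
Qed.

Lemma unifrat_polyV (p : {poly C}) : p != 0 -> (forall z, root p z -> A z) ->
  unifrat A X (fun z => (p.[z])^-1).
Proof.
move=> p0 hp; have [rs Ers] := closed_field_poly_normal p.
have hrs a : a \in rs -> A a.
  by move=> ars; apply: hp; rewrite Ers rootZ ?lead_coef_eq0// root_prod_XsubC.
have main : unifrat A X (fun z => \prod_(a <- rs) (z - a)^-1).
  elim: rs hrs {Ers} => [|a rs IH] hrs.
    by apply: unifrat_eq (unifrat_cst A X 1) => z _; rewrite big_nil.
  have Aa : A a by apply: hrs; rewrite mem_head.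
  have IH' : unifrat A X (fun z => \prod_(a <- rs) (z - a)^-1).
    by apply: IH => b brs; apply: hrs; rewrite in_cons brs orbT.
  apply: unifrat_eq (unifrat_mulV Aa IH') => z _; by rewrite big_cons.
apply: unifrat_eq (unifratZ (lead_coef p)^-1 main) => z Xz.
rewrite [in RHS]Ers hornerZ horner_prod invfM; congr (_ * _).
by rewrite prodfV; congr (_^-1); apply: eq_bigr => a _; rewrite hornerXsubC.
Qed.

End Separated.

(** The density takes the place of [cderive] in [contour_int], for curves obtained by inversion or
    change of sign, whose densities are given by formulas. *)
Definition pint (x dx : R -> C) f : C := cint 0 1 (fun t => f (x t) * dx t).

Lemma finite_min (I : finType) (m : I -> R) : (forall i, 0 < m i) ->
  exists2 d : R, 0 < d & forall i, d <= m i.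
Proof.
(* A positive lower bound without a minimum, which also covers an empty [I]. *)
move=> m0; exists ((1 + \sum_i (m i)^-1)^-1).
  by rewrite invr_gt0 ltr_pwDl// sumr_ge0// => i _; rewrite invr_ge0 ltW.
move=> i; rewrite invf_ple ?posrE// ?ltr_pwDl ?sumr_ge0//; last first.
  by move=> j _; rewrite invr_ge0 ltW.
rewrite (bigD1 i)//= addrCA lerDl addr_ge0// sumr_ge0// => j _.
by rewrite invr_ge0 ltW.
Qed.

Section Cauchy.
Variables (I : finType) (c : I -> C) (x dx : I -> R -> C) (A : set C).
Hypothesis xAC : forall i, isAC 0 1 (x i) (dx i).
Hypothesis x_closed : forall i, x i 0 = x i 1.
Hypothesis xA : forall i t, 0 <= t <= 1 -> ~ A (x i t).

Definition trace : set C := [set z | exists i t, 0 <= t <= 1 /\ z = x i t].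

Let ab : (0 : R) <= 1. Proof. exact: ler01. Qed.

Lemma trace_pos (phi : C -> C) :
  (forall i, pcont 0 1 (fun t => phi (x i t))) -> (forall z, trace z -> phi z != 0) ->
  exists2 d : R, 0 < d & forall z, trace z -> d <= normc (phi z).
Proof.
move=> hphi phi0.
have /choice[m hm] : forall i, exists d : R, 0 < d /\
    forall t, 0 <= t <= 1 -> d <= normc (phi (x i t)).
  move=> i; have [t t01|d d0 hd] := pcont_ge_pos ab (hphi i).
    by apply: phi0; exists i, t.
  by exists d.
have [d d0 hd] := finite_min (fun i => (hm i).1).
exists d => // z [i [t [t01 ->]]]; apply: le_trans (hd i) _.
exact: (hm i).2.
Qed.

Lemma trace_separated : separated_from A trace.
Proof.
split.
  have /choice[m hm] : forall i, exists d : R, 0 < d /\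
      forall t, 0 <= t <= 1 -> normc (x i t) <= d.
    by move=> i; have [K K0 hK] := ucont_bounded ab (isAC_ucont (xAC i)); exists K.
  exists (1 + \sum_i m i).
    by rewrite ltr_pwDl// sumr_ge0// => i _; rewrite ltW// (hm i).1.
  move=> z [i [t [t01 ->]]]; apply: le_trans ((hm i).2 t t01) _.
  rewrite (bigD1 i)//= addrCA lerDl addr_ge0// sumr_ge0// => j _.
  by rewrite ltW// (hm j).1.
move=> a Aa; apply: (@trace_pos (fun z => z - a)).
  move=> i; apply: ucont_pcont.
  exact: ucontD (isAC_ucont (xAC i)) (ucont_cst _ _ _).
move=> z [i [t [t01 ->]]]; rewrite subr_eq0; apply/eqP => E.
by apply: (xA (i := i) t01); rewrite E.
Qed.

Lemma pintD i f g : ucont 0 1 (f \o x i) -> ucont 0 1 (g \o x i) -> forall k,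
  pint (x i) (dx i) (fun z => k * f z + g z) = k * pint (x i) (dx i) f + pint (x i) (dx i) g.
Proof.
move=> cf cg k; have [idx _] := xAC i.
rewrite /pint -cintZ; last exact: (cintegrableM cf idx).
rewrite -cintD; [|exact/cintegrableZ/(cintegrableM cf idx)|exact: (cintegrableM cg idx)].
by apply: cint_eq_cc => t _; ring.
Qed.

Hypothesis wind0 : forall a, A a ->
  \sum_i c i * pint (x i) (dx i) (fun z => (z - a)^-1) = 0.

Lemma pint_pow i k : pint (x i) (dx i) (fun z => z ^+ k) = 0.
Proof.
have [_ /(_ 1)] := isACX k ab (xAC i).
rewrite lexx ab -x_closed => /(_ isT); rewrite -[LHS]addr0 => /addrI /esym.
rewrite cintZ.
  by move=> /eqP; rewrite mulf_eq0 pnatr_eq0 /= => /eqP.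
exact: cintegrableM (ucontX k ab (isAC_ucont (xAC i))) (xAC i).1.
Qed.

Lemma pint_pole i a k : A a -> pint (x i) (dx i) (fun z => (z - a)^-1 ^+ k.+2) = 0.
Proof.
move=> Aa.
have hB : isAC 0 1 (fun t => x i t - a) (dx i).
  by apply: isAC_eq (isACB (xAC i) (isAC_cst 0 1 a)) => t _ //; rewrite subr0.
have n0 t : 0 <= t <= 1 -> x i t - a != 0.
  move=> t01; rewrite subr_eq0; apply/eqP => E.
  by apply: (xA (i := i) t01); rewrite E.
have hV := isACV ab n0 hB.
have [_ /(_ 1)] := isACX k ab hV.
rewrite lexx ab -x_closed => /(_ isT); rewrite -[LHS]addr0 => /addrI /esym.
rewrite (cint_eq_cc (v := fun t => - k.+1%:R * ((x i t - a)^-1 ^+ k.+2 * dx i t))); last first.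
  by move=> t _; rewrite -exprVn !exprS; ring.
rewrite cintZ.
  by move=> /eqP; rewrite mulf_eq0 oppr_eq0 pnatr_eq0 /= => /eqP.
exact: cintegrableM (ucontX k.+2 ab (isAC_ucont hV)) (xAC i).1.
Qed.

(** Powers and poles of order at least 2 have primitives, [wind0] takes care of the simple poles,
    and uniform limits are controlled by the lengths of the curves. Continuity along the curves is
    proved in the same induction because additivity of the integral needs integrability. *)
Theorem cauchy f : unifrat A trace f ->
  (forall i, ucont 0 1 (f \o x i)) /\ \sum_i c i * pint (x i) (dx i) f = 0.
Proof.
have AX := trace_separated.
elim=> [k|a k Aa|k {}f g hf [cf If] hg [cg Ig]|{}f h hh IH hl].
- split => [i|]; first exact: ucontX (isAC_ucont (xAC i)).
  by rewrite big1// => i _; rewrite pint_pow mulr0.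
- have hV i : ucont 0 1 (fun t => (x i t - a)^-1).
    apply: ucontV ab _ _ => [t t01|].
      by apply: separated_neq AX _ _ Aa _; exists i, t.
    exact: ucontD (isAC_ucont (xAC i)) (ucont_cst _ _ _).
  split => [i|]; first exact: ucontX.
  case: k => [|k]; first by rewrite -[RHS](wind0 Aa).
  by rewrite big1// => i _; rewrite pint_pole// mulr0.
- split => [i|]; first exact: ucontD (ucontM ab (ucont_cst _ _ k) (cf i)) (cg i).
  under eq_bigr do rewrite pintD// mulrDr mulrCA.
  by rewrite big_split /= -mulr_sumr If Ig mulr0 addr0.
- have cfx i : ucont 0 1 (f \o x i).
    apply: (ucont_ulim (h := fun n => h n \o x i)) => [n|e e0]; first exact: (IH n).1.
    by have [n hn] := hl e e0; exists n => t t01; apply: hn; exists i, t.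
  split => //.
  (* [B] bounds the weighted lengths of the curves; the 2 comes from [nrm1_le]. *)
  pose B := \sum_i normc (c i) * rint 0 1 (fun t => 2 * nrm1 (dx i t)).
  have B0 i : 0 <= rint 0 1 (fun t => 2 * nrm1 (dx i t)).
    by apply: rint_ge0 => t _; rewrite mulr_ge0// nrm1_ge0.
  have hB : 0 <= B by apply: sumr_ge0 => i _; rewrite mulr_ge0 ?normc_ge0.
  apply/eqP; rewrite -normc_eq0 eq_le normc_ge0 andbT.
  apply/ler_addgt0Pr => e e0; rewrite add0r.
  have [|n hn] := hl (e / (B + 1)); first by rewrite divr_gt0// ltr_wpDl.
  apply: (@le_trans _ _ (e / (B + 1) * B)); last first.
    by rewrite mulrAC ler_pdivrMr ?ltr_wpDl// ler_wpM2l ?(ltW e0)// lerDl.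
  have -> : \sum_i c i * pint (x i) (dx i) f =
      \sum_i c i * pint (x i) (dx i) f - \sum_i c i * pint (x i) (dx i) (h n).
    by rewrite (IH n).2 subr0.
  rewrite -sumrB.
  rewrite mulr_sumr; elim/big_ind2 : _ => [|u1 v1 u2 v2 h1 h2|i _].
  + by rewrite normc0.
  + by rewrite (le_trans (normcD _ _))// lerD.
  rewrite -mulrBr normcM mulrCA ler_wpM2l ?normc_ge0//.
  have [idx _] := xAC i.
  have i1 := cintegrableM (cfx i) idx; have i2 := cintegrableM ((IH n).1 i) idx.
  rewrite /pint -cintB// -rintZ; last exact/rintegrableZ/nrm1_integrable.
  apply: cint_bound => [||t t01]; first exact: cintegrableB.
    by apply: rintegrableZ; apply: rintegrableZ; exact: nrm1_integrable.
  rewrite -mulrBl (le_trans (nrm1M _ _))// mulrA ler_wpM2r ?nrm1_ge0//.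
  rewrite (le_trans (nrm1_le _))// mulrC ler_wpM2r// hn//.
  by exists i, t.
Qed.

End Cauchy.

End Runge.

(** * Curves, winding numbers and the inversion z |-> 1/(16 z) *)

Section Curves.
Variable R : realType.
Local Notation C := R[i].
Local Notation cRe := (@complex.Re R).
Local Notation cIm := (@complex.Im R).
Local Notation mu := (@lebesgue_measure R).
Implicit Types (a b c : R) (u v du x dx : R -> C).

Lemma isAC_cat a b c u du : a <= b -> b <= c -> isAC a b u du -> isAC b c u du ->
  isAC a c u du.
Proof.
move=> ab bc [[i1 i2] h1] [[j1 j2] h2].
have key f : rintegrable a b f -> rintegrable b c f -> rintegrable a c f.
  move=> /integrableP[mf If] /integrableP[mg Ig].
  have E : `[a, c]%classic = `[a, b] `|` `[b, c] :> set R.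
    rewrite eqEsubset; split => t /=; rewrite !in_itv /=.
      by move=> /andP[at_ tc]; have [tb|/ltW tb] := leP t b; [left|right]; rewrite ?at_ ?tc ?tb.
    by move=> [/andP[at_ tb]|/andP[bt tc]]; rewrite ?at_ ?tc ?(le_trans tb bc) ?(le_trans ab bt).
  apply/integrableP; rewrite E; split; first by apply/measurable_funU.
  apply: (@le_lt_trans _ _ (\int[mu]_(t in `[a, b]) `|(EFin \o f) t| + \int[mu]_(t in `[b, c]) `|(EFin \o f) t|)%E); last exact: lte_add_pinfty.
  have -> : `[a, b] `|` `[b, c] = `[a, b] `|` `]b, c] :> set R.
    rewrite eqEsubset; split => t /=; rewrite !in_itv /=.
      by move=> [->|/andP[bt tc]]; [left|have [tb|tb] := leP t b; [left; rewrite (le_trans ab bt)|right; rewrite tc]].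
    by move=> [->|/andP[bt tc]]; [left|right; rewrite tc ltW].
  have mabs (D : set R) : measurable_fun D (EFin \o f) -> measurable_fun D (fun t => `|f t|%:E).
    by move=> /measurable_EFinP h; apply/measurable_EFinP; exact: measurableT_comp h.
  have mg' : measurable_fun `]b, c] (EFin \o f).
    by apply: measurable_funS mg => //; apply: subset_itvr; rewrite bnd_simp.
  rewrite ge0_integral_setU//=.
  - apply: leeD => //; apply: ge0_subset_integral => //.
      exact: mabs.
    by apply: subset_itvr; rewrite bnd_simp.
  - by apply: mabs; apply/measurable_funU.
  - apply/disj_setPS => t /=; rewrite !in_itv /= => -[/andP[_ tb] /andP[bt _]].
    by move: (le_lt_trans tb bt); rewrite ltxx.
split; first by split; apply: key.
have ii : cintegrable a c du by split; apply: key.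
move=> t /andP[at_ tc]; have [tb|/ltW tb] := leP t b; first by rewrite h1// at_.
have bt : b <= t <= c by rewrite tb.
have bb : a <= b <= b by rewrite ab lexx.
rewrite (h2 t bt) (h1 b bb) (@cint_split _ a b t) ?addrA//.
exact: cintegrableS ii.
Qed.

Lemma C1_FTC (f : R -> R) a b : C1 f -> a <= b ->
  rint a b (derive1 f) = f b - f a.
Proof.
move=> [df cf]; rewrite le_eqVlt => /predU1P[->|ab].
  by rewrite /rint set_itv1 Rintegral_set1 subrr.
have -> : f b - f a = fine ((f b)%:E - (f a)%:E)%E by [].
rewrite /rint /Rintegral; congr fine.
apply: (continuous_FTC2 ab); last by move=> t _.
- exact: continuous_subspaceT.
- have cff t : {for t, continuous f}.
    by apply: differentiable_continuous; exact/derivable1_diffP.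
  split => [t _||]; first exact: df.
    exact/cvg_at_right_filter/cff.
  exact/cvg_at_left_filter/cff.
Qed.

Lemma C1_isAC (h : R -> C) a b : C1 (cRe \o h) -> C1 (cIm \o h) -> a <= b ->
  isAC a b h (cderive h).
Proof.
move=> hr hi ab.
have ic f : C1 f -> rintegrable a b (derive1 f).
  move=> [_ cf]; apply: continuous_compact_integrable; first exact: segment_compact.
  exact: continuous_subspaceT.
split; first by split; [exact: ic hr|exact: ic hi].
move=> t /andP[at_ tb]; apply: complex_eq; rewrite ?cReD ?cImD /=.
  by have := C1_FTC hr at_; rewrite /rint => ->; rewrite addrC subrK.
by have := C1_FTC hi at_; rewrite /rint => ->; rewrite addrC subrK.
Qed.

Lemma cderive_near (g h : R -> C) (t : R) : (\near t, g t = h t) -> cderive g t = cderive h t.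
Proof.
move=> gh; rewrite /cderive; congr (_ +i* _); rewrite !derive1E; apply: near_eq_derive.
  by apply: filterS gh => s /= ->.
by apply: filterS gh => s /= ->.
Qed.

(** At the nodes of the subdivision [cderive g] is uncontrolled; this is harmless since [isAC_eq]
    compares densities on the open pieces only. *)
Lemma piecewise_isAC (g : R -> C) : piecewise_C1 g -> isAC 0 1 g (cderive g).
Proof.
move=> [N [t [t0 tN tlt hpc]]].
have tle i j : (i <= j <= N)%N -> t i <= t j.
  elim: j => [|j IH] /andP[ij jN]; first by move: ij; rewrite leqn0 => /eqP ->.
  move: ij; rewrite leq_eqVlt => /predU1P[->//|ij].
  have ij' : (i <= j)%N by rewrite -ltnS.
  apply: (@le_trans _ _ (t j)); last exact/ltW/tlt.
  by apply: IH; rewrite ij' (ltnW jN).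
suff main n : (n <= N)%N -> isAC 0 (t n) g (cderive g) by rewrite -tN; exact: main.
elim: n => [|n IH] nN.
  rewrite t0; split; first by split; rewrite set_itv1; apply/integrableP; (split;
    [exact: measurable_fun_set1|by rewrite integral_set1]).
  by move=> x /le_anti <-; rewrite cint_point addr0.
apply: (@isAC_cat _ (t n)).
- by rewrite -t0 tle// leq0n ltnW.
- by rewrite ltW// tlt.
- exact/IH/ltnW.
have [h [hr hi gh]] := hpc n nN.
apply: isAC_eq (C1_isAC hr hi (ltW (tlt n nN))) => s.
  by move=> sn; rewrite gh.
move=> /andP[s1 s2]; apply: cderive_near; near=> y.
rewrite gh//; apply/andP; split; apply: ltW.
  by near: y; exact: lt_nbhsr.
by near: y; exact: lt_nbhsl.
Unshelve. all: by end_near. Qed.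

(** Valid without differentiability: a derivative that does not exist has the default value 0. *)
Lemma derive1N (f : R -> R) t : derive1 (fun s => - f s) t = - derive1 f t.
Proof.
have [df|ndf] := pselect (derivable f t 1).
  by rewrite !derive1E deriveN.
have ndf' : ~ derivable (fun s => - f s) t 1.
  move=> h; apply: ndf; have := derivableN h.
  have -> // : - (fun s => - f s) = f by apply/funext => s; exact: opprK.
have key (h : R -> R) : ~ derivable h t 1 -> derive1 h t = 0.
  by move=> nh; rewrite derive1E /derive dvgP.
by rewrite !key// oppr0.
Qed.

Lemma cderiveN u t : cderive (fun s => - u s) t = - cderive u t.
Proof.
rewrite /cderive.
have -> : cRe \o (fun s => - u s) = fun s => - (cRe \o u) s.
  by apply/funext => s /=; rewrite cReN.
have -> : cIm \o (fun s => - u s) = fun s => - (cIm \o u) s.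
  by apply/funext => s /=; rewrite cImN.
by rewrite !derive1N.
Qed.

Lemma L2_cintegrable u : L2 u -> cintegrable 0 1 u.
Proof.
move=> [mr mi isq].
have i1 : rintegrable 0 1 (fun t => 1 + normc (u t) ^+ 2).
  apply: rintegrableD => //; exact: rintegrable_cst.
have key (f : R -> R) : measurable_fun (`[0, 1] : set R) f -> (forall t, `|f t| <= normc (u t)) ->
    rintegrable 0 1 f.
  move=> mf hf; apply: le_integrable i1 => //; first exact/measurable_EFinP.
  move=> t _ /=; rewrite lee_fin (le_trans (hf t))// ger0_norm ?addr_ge0 ?sqr_ge0//.
  have := sqr_ge0 (normc (u t) - 1); have := normc_ge0 (u t).
  by rewrite sqrrB1; lra.
by split; apply: key => // t; [exact: Re_le_normc|exact: Im_le_normc].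
Qed.

Lemma H1_isAC u : H1 u -> isAC 0 1 u (cderive u).
Proof. by move=> [_ hL2 hu]; split => //; exact: L2_cintegrable. Qed.

Lemma pint_affine x dx (c0 : C) f :
  pint (fun t => x t - c0) dx f = pint x dx (fun z => f (z - c0)).
Proof. by []. Qed.

Lemma isAC_shift x dx (c0 : C) : isAC 0 1 x dx -> isAC 0 1 (fun t => x t - c0) dx.
Proof.
by move=> h; apply: isAC_eq (isACB h (isAC_cst 0 1 c0)) => t _ //; rewrite subr0.
Qed.

(** With no admissible poles the hypothesis on winding numbers is empty. *)
Lemma pint_poly x dx f : isAC 0 1 x dx -> x 0 = x 1 ->
  unifrat set0 [set x t | t in `[0, 1]] f -> pint x dx f = 0.
Proof.
move=> hx xc hf.
have E : trace (fun _ : unit => x) = [set x t | t in `[0, 1]].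
  rewrite eqEsubset; split => z.
    by move=> [_ [t [t01 ->]]]; exists t => //=; rewrite in_itv.
  by move=> [t /=]; rewrite in_itv /= => t01 <-; exists tt, t.
rewrite -E in hf.
have A0 (i : unit) t : 0 <= t <= 1 -> ~ (set0 : set C) (x t) by move=> _; exact.
have W0 (a : C) : (set0 : set C) a -> \sum_(i : unit) 1 * pint x dx (fun z => (z - a)^-1) = 0 by [].
have [_] := cauchy (fun _ : unit => hx) (fun _ : unit => xc) A0 W0 hf.
by rewrite (bigD1 tt)//= big1 ?addr0 ?mul1r// => -[].
Qed.

(** Geometric series in z/a, of ratio at most rho/|a| < 1. *)
Lemma unifrat_geometric (X : set C) (rho : R) (a : C) :
  (forall z, X z -> normc z <= rho) -> rho < normc a ->
  unifrat set0 X (fun z => (z - a)^-1).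
Proof.
move=> hX ra; have [X0|] := pselect (exists z, X z); last first.
  move=> nX; apply: unifrat_eq (unifrat0 _ _) => z Xz.
  by case: nX; exists z.
have rho0 : 0 <= rho by have [z Xz] := X0; apply: le_trans (hX z Xz); exact: normc_ge0.
have a0 : 0 < normc a by exact: le_lt_trans ra.
have an0 : a != 0 by rewrite -normc_gt0.
have AX : separated_from set0 X.
  split => //; exists (rho + 1); first by rewrite ltr_wpDl.
  by move=> z /hX /le_trans; apply; rewrite lerDl.
pose q := rho / normc a.
have q0 : 0 <= q by rewrite divr_ge0// ltW.
have q1 : q < 1 by rewrite ltr_pdivrMr// mul1r.
apply: unifrat_ulim => e e0.
have d0 : 0 < normc a - rho by rewrite subr_gt0.
have [n hn] : exists n : nat, q ^+ n <= e * (normc a - rho).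
  have := cvg_expr (_ : `|q| < 1); rewrite ger0_norm// => /(_ q1).
  move=> /cvgrPdist_le /(_ (e * (normc a - rho))).
  rewrite mulr_gt0// => /(_ isT) [n _ hn]; exists n.
  by have := hn n (leqnn n); rewrite /= sub0r normrN ger0_norm// exprn_ge0.
exists (fun z => - a^-1 * \sum_(i < n) (a^-1 * z) ^+ i).
  apply: unifratZ.
  elim: n {hn} => [|n IH].
    by apply: unifrat_eq (unifrat0 _ _) => z _; rewrite big_ord0.
  have hz : unifrat set0 X (fun z => (a^-1 * z) ^+ n).
    by apply: unifratX => //; apply: unifratZ; exact: unifrat_id.
  by apply: unifrat_eq (unifratD IH hz) => z _; rewrite big_ord_recr.
move=> z Xz.
have za : z - a != 0.
  rewrite -normc_gt0 normcC; apply: lt_le_trans (normc_ge_B a z).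
  by rewrite subr_gt0 (le_lt_trans (hX z Xz)).
have -> : (z - a)^-1 - - a^-1 * (\sum_(i < n) (a^-1 * z) ^+ i) = (a^-1 * z) ^+ n / (z - a).
  have := subrX1 (a^-1 * z) n; set S := \sum_(i < n) _; set P := _ ^+ n => E.
  have -> : P = (a^-1 * z - 1) * S + 1 by rewrite -E subrK.
  by field; rewrite an0 za.
rewrite normcM normcX normcM !normcV ler_pdivrMr ?normc_gt0//.
apply: (@le_trans _ _ (q ^+ n)).
  rewrite lerXn2r// ?nnegrE ?mulr_ge0 ?invr_ge0 ?normc_ge0//.
  by rewrite mulrC /q ler_wpM2r ?invr_ge0 ?normc_ge0 ?hX.
apply: le_trans hn _; rewrite ler_wpM2l ?(ltW e0)//.
have := normc_ge_B a z; rewrite normcC; have := hX z Xz; lra.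
Qed.

Lemma winding_outside x dx (c0 a : C) (rho : R) : isAC 0 1 x dx -> x 0 = x 1 ->
  (forall t, 0 <= t <= 1 -> normc (x t - c0) <= rho) -> rho < normc (a - c0) ->
  pint x dx (fun z => (z - a)^-1) = 0.
Proof.
move=> hx xc hr ra.
have := @pint_poly (fun t => x t - c0) dx (fun z => (z - (a - c0))^-1) (isAC_shift _ hx).
rewrite xc => /(_ erefl); rewrite pint_affine => <-.
  by congr pint; apply/funext => z; congr (_^-1); ring.
apply: unifrat_geometric ra => z [t /=]; rewrite in_itv /= => t01 <-; exact: hr.
Qed.

(** The point [a] may lie on the boundary circle. The maximum of |x - c0| over the compact parameter
    interval is still smaller than |a - c0|. *)
Lemma winding_disc x dx (c0 a : C) (rho : R) : isAC 0 1 x dx -> x 0 = x 1 ->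
  (forall t, 0 <= t <= 1 -> disc c0 rho (x t)) -> ~ disc c0 rho a ->
  pint x dx (fun z => (z - a)^-1) = 0.
Proof.
move=> hx xc hr /negP; rewrite /disc /= -leNgt => ra.
have ab : (0 : R) <= 1 by exact: ler01.
have hc : {within `[0, 1], continuous (fun t => normc (x t - c0))}.
  apply: ucont_within (isAC_ucont (isAC_shift c0 hx)) => s t.
  exact: normc_dist.
have [s s01 hs] := EVT_max ab hc.
rewrite in_itv /= in s01.
have sa : normc (x s - c0) < normc (a - c0) by apply: lt_le_trans ra; exact: (hr s s01).
exact: (winding_outside hx xc hs sa).
Qed.

Definition inv_path (x : R -> C) : R -> C := fun t => (16 * x t)^-1.
Definition inv_dpath x dx : R -> C := fun t => - (16 * x t ^+ 2)^-1 * dx t.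

Lemma inv_path_isAC x dx : isAC 0 1 x dx -> (forall t, 0 <= t <= 1 -> x t != 0) ->
  isAC 0 1 (inv_path x) (inv_dpath x dx).
Proof.
move=> hx x0; have ab : (0 : R) <= 1 by exact: ler01.
apply: isAC_eq (isACZ (16^-1) (isACV ab x0 hx)) => t tt.
  by rewrite /inv_path invfM.
have x0t : x t != 0 by apply: x0; move: tt => /andP[/ltW -> /ltW ->].
by rewrite /inv_dpath; field.
Qed.

(** d log(1/(16 x) - 1/(16 a)) = d log(x - a) - d log x. *)
Lemma inv_winding x dx (a : C) : isAC 0 1 x dx -> (forall t, 0 <= t <= 1 -> x t != 0) ->
  (forall t, 0 <= t <= 1 -> x t != a) -> a != 0 ->
  pint (inv_path x) (inv_dpath x dx) (fun z => (z - (16 * a)^-1)^-1) =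
  pint x dx (fun z => (z - a)^-1) - pint x dx (fun z => (z - 0)^-1).
Proof.
move=> hx x0 xa a0; have ab : (0 : R) <= 1 by exact: ler01.
have cx := isAC_ucont hx.
have hi (b : C) : (forall t, 0 <= t <= 1 -> x t != b) -> cintegrable 0 1 (fun t => (x t - b)^-1 * dx t).
  move=> xb; apply: cintegrableM hx.1.
  apply: ucontV ab _ (ucontD cx (ucont_cst _ _ _)) => t t01.
  by rewrite subr_eq0 xb.
rewrite /pint -cintB; [|exact: hi..].
apply: cint_eq_cc => t t01; rewrite /inv_path /inv_dpath subr0.
have xt := x0 t t01; have xat : x t - a != 0 by rewrite subr_eq0 xa.
have xat' : a - x t != 0 by rewrite subr_eq0 eq_sym xa.
by field; rewrite xat xt a0 mulN1r xat'.
Qed.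

Lemma inv_winding0 x dx : isAC 0 1 x dx -> (forall t, 0 <= t <= 1 -> x t != 0) ->
  pint (inv_path x) (inv_dpath x dx) (fun z => (z - 0)^-1) =
  - pint x dx (fun z => (z - 0)^-1).
Proof.
move=> hx x0; have ab : (0 : R) <= 1 by exact: ler01.
rewrite /pint -cintN; last first.
  apply: cintegrableM hx.1; apply: ucontV ab _ _ => [t t01|].
    by rewrite subr0 x0.
  exact: ucontD (isAC_ucont hx) (ucont_cst _ _ _).
apply: cint_eq_cc => t t01; rewrite /inv_path /inv_dpath !subr0.
by field; rewrite x0.
Qed.

End Curves.

(** * Reciprocity of the spectrum *)

Section ExponentialChainRule.
Variable R : realType.
Local Notation C := R[i].
Local Notation cRe := (@complex.Re R).
Local Notation cIm := (@complex.Im R).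
Implicit Types (u du : R -> C).

Lemma MVT_between (F dF : R -> R) (x y : R) : (forall t : R, is_derive t 1 F (dF t)) ->
  exists2 c, `|c - x| <= `|y - x| /\ `|c - y| <= `|y - x| & F y - F x = dF c * (y - x).
Proof.
move=> hF.
have cF : continuous F.
  by move=> t; apply: differentiable_continuous; apply/derivable1_diffP; case: (hF t).
wlog xy : x y / x <= y => [h|].
  have [/h//|/ltW /h[c [c1 c2] e]] := leP x y.
  exists c; first by rewrite (distrC y x).
  by rewrite -opprB e; ring.
have [|c] := MVT_segment xy (fun t _ => hF t); first exact: continuous_subspaceT.
rewrite in_itv /= => /andP[xc cy] e; exists c => //.
rewrite (distrC c y) !ger0_norm ?subr_ge0//; split; lra.
Qed.

Lemma isAC_Re a b u du : isAC a b u du -> isAC a b (fun t => (cRe (u t))%:C) (fun t => (cRe (du t))%:C).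
Proof.
move=> [[i1 i2] h]; have z0 : rintegrable a b (fun=> 0) by exact: rintegrable_cst.
split; first by split.
move=> t tab; rewrite h// cReD; apply: complex_eq; rewrite ?cReD ?cImD//=.
by rewrite Rintegral_cst// mul0r addr0.
Qed.

Lemma isAC_Im a b u du : isAC a b u du -> isAC a b (fun t => (cIm (u t))%:C) (fun t => (cIm (du t))%:C).
Proof.
move=> [[i1 i2] h]; have z0 : rintegrable a b (fun=> 0) by exact: rintegrable_cst.
split; first by split.
move=> t tab; rewrite h// cImD; apply: complex_eq; rewrite ?cReD ?cImD//=.
by rewrite Rintegral_cst// mul0r addr0.
Qed.

Lemma isAC_real_chain a b (F dF : R -> R) (r : R -> R) dr : a <= b ->
  (forall t : R, is_derive t 1 F (dF t)) ->
  (forall M, exists2 K, 0 < K & forall x y, `|x| <= M -> `|y| <= M ->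
     `|dF x - dF y| <= K * `|x - y|) ->
  isAC a b (fun t => (r t)%:C) dr ->
  isAC a b (fun t => (F (r t))%:C) (fun t => (dF (r t))%:C * dr t).
Proof.
move=> ab hF hL hr; have cr := isAC_ucont hr.
have rB (x y : R) : normc (x%:C - y%:C) = `|x - y| by rewrite -rmorphB normc_real.
have [M M0 hM] := ucont_bounded ab cr.
have {}hM t : a <= t <= b -> `|r t| <= M by move=> /hM; rewrite normc_real.
(* The intermediate point is within |r y - r x| <= 2 M of r x, so its modulus is at most 3 M. *)
have [K K0 hK] := hL (3 * M).
have M3 : M <= 3 * M by lra.
apply: (isAC_chain ab hr).
  move=> e e0; have [|d d0 hd] := cr (e / K); first by rewrite divr_gt0.
  exists d => // x y xab yab xy; rewrite rB.
  have := hd x y xab yab xy; rewrite rB ltr_pdivlMr// mulrC => /le_lt_trans; apply.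
  by apply: hK; apply: le_trans (hM _ _) M3.
move=> e e0; have e1 : 0 < e / (2 * K) by rewrite divr_gt0// mulr_gt0.
have [d d0 hd] := cr _ e1; exists d => // x y ax xy yb xyd.
have [c [c1 c2] Ec] := MVT_between (r x) (r y) hF.
exists (dF c)%:C; first by rewrite -!rmorphB -rmorphM Ec.
move=> s /andP[xs sy]; rewrite rB.
have sab : a <= s <= b by rewrite (le_trans ax xs) (le_trans sy yb).
have xab : a <= x <= b by rewrite ax (le_trans xy yb).
have yab : a <= y <= b by rewrite yb (le_trans ax xy).
have xyn : `|y - x| < d by rewrite ger0_norm ?subr_ge0.
have xsn : `|x - s| < d by rewrite distrC ger0_norm ?subr_ge0//; lra.
have h1 := hd _ _ yab xab xyn; have h2 := hd _ _ xab sab xsn.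
rewrite !rB in h1 h2.
have cM : `|c| <= 3 * M.
  have := hM _ xab; have := hM _ yab; have := ler_normB (r y) (r x).
  have := ler_normD (c - r x) (r x); rewrite subrK; lra.
apply: (le_trans (hK _ _ cM _)); first exact: le_trans (hM _ sab) M3.
rewrite mulrC -ler_pdivlMr//.
have -> : e / K = e / (2 * K) + e / (2 * K) by field; rewrite gt_eqF.
have := ler_normD (c - r x) (r x - r s); rewrite addrA subrK; lra.
Qed.

Lemma lip_of_derive (F dF : R -> R) M K : (forall t : R, is_derive t 1 F (dF t)) ->
  (forall x, `|x| <= M -> `|dF x| <= K) -> forall x y, `|x| <= M -> `|y| <= M ->
  `|F x - F y| <= K * `|x - y|.
Proof.
move=> hF hK x y xM yM; wlog xy : x y xM yM / x <= y => [h|].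
  have [/h|/ltW /h] := leP x y; first exact.
  by rewrite (distrC (F x)) (distrC x); exact.
have cF : continuous F.
  by move=> t; apply: differentiable_continuous; apply/derivable1_diffP; case: (hF t).
have [|c] := MVT_segment xy (fun t _ => hF t); first exact: continuous_subspaceT.
rewrite in_itv /= => /andP[xc cy] e.
rewrite (distrC (F x)) (distrC x) e normrM ler_wpM2r// hK//.
by move: xM yM; rewrite !ler_norml => /andP[h1 _] /andP[_ h2]; apply/andP; split; lra.
Qed.

Lemma cexpD (z w : C) : cexp (z + w) = cexp z * cexp w.
Proof.
rewrite /cexp cReD cImD expRD cosD sinD; apply: complex_eq; rewrite !(cReM, cImM) /=; ring.
Qed.

Lemma cexp0 : cexp (0 : C) = 1.
Proof. by rewrite /cexp /= expR0 cos0 sin0; apply: complex_eq; rewrite !(cReM, cImM) /=; ring. Qed.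

Lemma cexp_neq0 (z : C) : cexp z != 0.
Proof.
apply/eqP => h; have := cexpD z (- z); rewrite subrr cexp0 h mul0r => /eqP.
by rewrite oner_eq0.
Qed.

Lemma cexpN (z : C) : cexp (- z) = (cexp z)^-1.
Proof.
apply: (mulfI (cexp_neq0 z)); rewrite -cexpD subrr cexp0 divff//.
exact: cexp_neq0.
Qed.

Lemma isAC_cexp a b u du : a <= b -> isAC a b u du ->
  isAC a b (fun t => cexp (u t)) (fun t => cexp (u t) * du t).
Proof.
move=> ab hu; have hr := isAC_Re hu; have hi := isAC_Im hu.
have lsin M : exists2 K, 0 < K & forall x y : R, `|x| <= M -> `|y| <= M -> `|sin x - sin y| <= K * `|x - y|.
  by exists 1 => //; apply: lip_of_derive => x _; exact: cos_max.
have lcos M : exists2 K, 0 < K & forall x y : R, `|x| <= M -> `|y| <= M -> `|cos x - cos y| <= K * `|x - y|.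
  by exists 1 => //; apply: lip_of_derive => x _; rewrite normrN; exact: sin_max.
have lNsin M : exists2 K, 0 < K & forall x y : R, `|x| <= M -> `|y| <= M -> `|- sin x - - sin y| <= K * `|x - y|.
  have [K K0 hK] := lsin M; exists K => // x y hx hy.
  by rewrite -opprD normrN hK.
have lexp M : exists2 K, 0 < K & forall x y : R, `|x| <= M -> `|y| <= M -> `|expR x - expR y| <= K * `|x - y|.
  exists (expR M); first exact: expR_gt0.
  apply: lip_of_derive => x xM; rewrite ger0_norm ?expR_ge0// ler_expR.
  by rewrite (le_trans (ler_norm _)).
have hE := isAC_real_chain ab (@is_derive_expR R) lexp hr.
have hc := isAC_real_chain ab (@is_derive_cos R) lNsin hi.
have hs := isAC_real_chain ab (@is_derive_sin R) lcos hi.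
apply: isAC_eq (isACM ab hE (isACD hc (isACZ 'i hs))) => t _.
  by rewrite /cexp; apply: complex_eq; rewrite !(cReM, cImM, cReD, cImD) /=; ring.
by rewrite /cexp; apply: complex_eq; rewrite !(cReM, cImM, cReD, cImD) /=; ring.
Qed.

End ExponentialChainRule.

Section Reciprocity.
Variable R : realType.
Local Notation C := R[i].

(** The system has trace zero, so the determinant of two solutions has density 0. *)
Lemma wronskian_const (b11 b12 b21 p1 p2 q1 q2 : R -> C) :
  isAC 0 1 p1 (fun t => b11 t * p1 t + b12 t * p2 t) ->
  isAC 0 1 p2 (fun t => b21 t * p1 t - b11 t * p2 t) ->
  isAC 0 1 q1 (fun t => b11 t * q1 t + b12 t * q2 t) ->
  isAC 0 1 q2 (fun t => b21 t * q1 t - b11 t * q2 t) ->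
  p1 1 * q2 1 - p2 1 * q1 1 = p1 0 * q2 0 - p2 0 * q1 0.
Proof.
move=> hp1 hp2 hq1 hq2; have ab : (0 : R) <= 1 by exact: ler01.
have [_ ->] := isACB (isACM ab hp1 hq2) (isACM ab hp2 hq1); last by rewrite ab lexx.
rewrite -[RHS]addr0; congr (_ + _).
have Z : cint 0 1 (fun=> 0 : C) = 0.
  have [_ /(_ 1)] := isAC_cst 0 1 (0 : C); rewrite ab lexx => /(_ isT).
  by rewrite add0r.
by rewrite -[RHS]Z; apply: cint_eq_cc => t _; ring.
Qed.

Lemma sum2 (f : 'I_2 -> C) : \sum_(i < 2) f i = f ord0 + f ord_max.
Proof. by rewrite big_ord_recl big_ord1; congr (_ + f _); apply: val_inj. Qed.

Lemma ode_coefE (l : C) (v : pot R) (x : R) (N : 'M[C]_2) j :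
  ((ode_coef l v x *m N) ord0 j = (Pop v.2 x + cderive v.1 x) / 4 * N ord0 j
     + (l - (16 * l)^-1 * cexp (v.1 x)) * N ord_max j) /\
  ((ode_coef l v x *m N) ord_max j = (- l + (16 * l)^-1 * cexp (- v.1 x)) * N ord0 j
     - (Pop v.2 x + cderive v.1 x) / 4 * N ord_max j).
Proof.
rewrite /ode_coef; split; rewrite !mxE sum2 !mxE !sum2 !mxE !eqxx /=; ring.
Qed.

Variable M : R -> C -> pot R -> 'M[C]_2.
Hypothesis M_solution : forall (v : pot R) (z : C), H1c v -> z != 0 ->
  fundamental_solution z v (fun x => M x z v).

Lemma solution_isAC v z i j : H1c v -> z != 0 ->
  isAC 0 1 (fun t => M t z v i j) (fun t => (ode_coef z v t *m M t z v) i j) /\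
  M 0 z v i j = (1%:M : 'M[C]_2) i j.
Proof.
move=> hv z0; have [h1 h2] := M_solution hv z0 i j.
have M0 : M 0 z v i j = (1%:M : 'M[C]_2) i j by rewrite h2 ?lexx ?ler01// cint_point addr0.
by split => //; split => // x x01; rewrite M0 h2.
Qed.

(* Conjugating by diag(e^(q/2), e^(-q/2)) exchanges the two spectral terms. *)
Lemma chi_p_reciprocal v z : H1c v -> H1c (Irec v) -> z != 0 ->
  chi_p M v z = chi_p M (Irec v) (16 * z)^-1.
Proof.
move=> hv hv' z0; have ab : (0 : R) <= 1 by exact: ler01.
set w := (16 * z)^-1; have w0 : w != 0 by rewrite invr_eq0 mulf_neq0 ?pnatr_eq0.
have hq := H1_isAC hv.1.
have hq2 := isACZ (2^-1) hq.
have hqN := isACZ (- 2^-1) hq.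
pose e t := cexp (2^-1 * v.1 t).
have eE t : cexp (- 2^-1 * v.1 t) = (e t)^-1 by rewrite mulNr cexpN.
have he : isAC 0 1 e (fun t => e t * (2^-1 * cderive v.1 t)) := isAC_cexp ab hq2.
have hei : isAC 0 1 (fun t => (e t)^-1) (fun t => (e t)^-1 * (- 2^-1 * cderive v.1 t)).
  by apply: isAC_eq (isAC_cexp ab hqN) => t _; rewrite eE.
have e0 t : e t != 0 by exact: cexp_neq0.
have eq t : cexp (v.1 t) = e t ^+ 2.
  by rewrite expr2 -cexpD; congr cexp; field.
have eqN t : cexp (- v.1 t) = (e t ^+ 2)^-1 by rewrite cexpN eq.
(* Coefficients of a single trace-free system with two kinds of solutions: the columns for v
   rescaled by 1/e and e, and those for [Irec v] at w with the second component negated. *)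
pose b11 t := (Pop v.2 t - cderive v.1 t) / 4.
pose b12 t := z * (e t ^+ 2)^-1 - w.
pose b21 t := w - z * e t ^+ 2.
have hM i j := (solution_isAC i j hv z0).1.
have hN i j := (solution_isAC i j hv' w0).1.
have hM0 i j := (solution_isAC i j hv z0).2.
have hN0 i j := (solution_isAC i j hv' w0).2.
have p1 j : isAC 0 1 (fun t => (e t)^-1 * M t z v ord0 j)
    (fun t => b11 t * ((e t)^-1 * M t z v ord0 j) + b12 t * (e t * M t z v ord_max j)).
  apply: isAC_eq (isACM ab hei (hM ord0 j)) => t _ //.
  by rewrite (ode_coefE _ _ _ _ _).1 /b11 /b12 eq -/w; field.
have p2 j : isAC 0 1 (fun t => e t * M t z v ord_max j)
    (fun t => b21 t * ((e t)^-1 * M t z v ord0 j) - b11 t * (e t * M t z v ord_max j)).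
  apply: isAC_eq (isACM ab he (hM ord_max j)) => t _ //.
  by rewrite (ode_coefE _ _ _ _ _).2 /b11 /b21 eqN -/w; field.
have wz : (16 * w)^-1 = z by rewrite /w; field.
have q1 j s : isAC 0 1 (fun t => s * M t w (Irec v) ord0 j)
    (fun t => b11 t * (s * M t w (Irec v) ord0 j) + b12 t * (- s * M t w (Irec v) ord_max j)).
  apply: isAC_eq (isACZ s (hN ord0 j)) => t _ //.
  by rewrite (ode_coefE _ _ _ _ _).1 wz /= cderiveN /b11 /b12 eqN; ring.
have q2 j s : isAC 0 1 (fun t => - s * M t w (Irec v) ord_max j)
    (fun t => b21 t * (s * M t w (Irec v) ord0 j) - b11 t * (- s * M t w (Irec v) ord_max j)).
  apply: isAC_eq (isACZ (- s) (hN ord_max j)) => t _ //.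
  by rewrite (ode_coefE _ _ _ _ _).2 wz /= cderiveN opprK /b11 /b21 eq; ring.
have e1 : e 1 = e 0 by rewrite /e; have [[per _ _] _] := hv; have := per 0; rewrite add0r => ->.
(* Each of these determinants has equal values at 0 and 1. They are relations between the entries at
   1 that force equal diagonals; periodicity, in the form [e1], makes the rescaling the same at both
   ends. *)
have E := wronskian_const (q1 ord0 1) (q2 ord0 1) (q1 ord_max (-1)) (q2 ord_max (-1)).
have A0 := wronskian_const (p1 ord0) (p2 ord0) (q1 ord_max (-1)) (q2 ord_max (-1)).
have B0 := wronskian_const (p1 ord0) (p2 ord0) (q1 ord0 1) (q2 ord0 1).
have A1 := wronskian_const (p1 ord_max) (p2 ord_max) (q1 ord_max (-1)) (q2 ord_max (-1)).
have B1 := wronskian_const (p1 ord_max) (p2 ord_max) (q1 ord0 1) (q2 ord0 1).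
move: E A0 B0 A1 B1.
rewrite e1 !hM0 !hN0 !mxE /=.
rewrite !mulr1n !mulr0n !(mulr0, mulr1, mul1r, mulNr, mul0r, subr0, sub0r, oppr0, opprK, addr0, add0r).
set m00 := M 1 z v _ _; set m10 := M 1 z v _ _; set m01 := M 1 z v _ _; set m11 := M 1 z v _ _.
set n00 := M 1 w _ _ _; set n11 := M 1 w _ _ _; set n10 := M 1 w _ _ _; set n01 := M 1 w _ _ _.
have f0 := e0 0; set f := e 0 in f0 * => E A0 B0 A1 B1.
have E00 : m00 = n00.
  have -> : n00 = n00 * f * f^-1 by field.
  rewrite -A0 -[LHS]mulr1 -E -[LHS]addr0 -(mulr0 (- n01 * f)) -B0.
  by field.
have E11 : m11 = n11.
  have -> : n11 = n11 * - f^-1 * - f by field.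
  rewrite -B1 -[LHS]mulr1 -E -[LHS]addr0 -(mulr0 (n10 * f^-1)) -A1.
  by field.
rewrite /chi_p /discriminant /mxtrace !sum2 -/m00 -/m11 -/n00 -/n11.
by rewrite E00 E11.
Qed.

End Reciprocity.

(** * The involution on potentials and on the listed eigenvalues *)

Section Reflection.
Variable R : realType.
Local Notation C := R[i].
Local Notation cRe := (@complex.Re R).
Local Notation cIm := (@complex.Im R).
Implicit Types (v : pot R) (z u : C) (f g : C -> C).

Lemma IrecK v : Irec (Irec v) = v.
Proof. by case: v => q p; rewrite /Irec /= opprK. Qed.

Lemma H1N (u : R -> C) : H1 u -> H1 (- u).
Proof.
move=> hu; have [per [mr mi i2] _] := hu.
have E : cderive (- u) = fun t => - cderive u t.
  by apply/funext => t; rewrite -cderiveN.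
have hAC : isAC 0 1 (- u) (cderive (- u)).
  apply: isAC_eq (isACZ (-1) (H1_isAC hu)) => t _; first by rewrite mulN1r.
  by rewrite E mulN1r.
split => [x||]; first by rewrite /= !fctE per.
- rewrite E; split.
  + by rewrite (_ : _ \o _ = \- (cRe \o cderive u))%R; [exact: measurable_funN|apply/funext => t; exact: cReN].
  + by rewrite (_ : _ \o _ = \- (cIm \o cderive u))%R; [exact: measurable_funN|apply/funext => t; exact: cImN].
  + apply: eq_integrable i2 => // t _; congr (_ ^+ 2)%:E; exact/esym/normcNE.
- exact: hAC.2.
Qed.

Lemma H1c_Irec v : H1c v -> H1c (Irec v).
Proof. by case=> h1 h2; exact: (conj (H1N h1) h2). Qed.

Lemma H1r_Irec v : H1r v -> H1r (Irec v).
Proof.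
move=> [h hr]; split; first exact: H1c_Irec.
by move=> x; have [h1 h2] := hr x; rewrite /= fctE cImN h1 oppr0.
Qed.

Lemma H1norm_Irec v : H1norm (Irec v) = H1norm v.
Proof.
case: v => q p; rewrite /Irec /H1norm; cbv beta zeta; cbn [fst snd].
have Eq : (fun x => normc ((- q) x) ^+ 2) = (fun x => normc (q x) ^+ 2).
  by apply/funext => x; rewrite fctE normcNE.
have Ed : (fun x => normc (cderive (- q) x) ^+ 2) = (fun x => normc (cderive q x) ^+ 2).
  apply/funext => x; have -> : cderive (- q) x = - cderive q x by rewrite -cderiveN.
  by rewrite normcNE.
by rewrite Eq Ed.
Qed.

Lemma nbhsCP z (P : C -> Prop) : (\forall u \near nbhs (z : C^o), P u) <->
  exists2 d : R, 0 < d & forall u, normc (u - z) < d -> P u.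
Proof.
split.
  move=> /nbhs_ballP[e /= e0 he]; have eE : e = (cRe e)%:C.
    by rewrite RRe_real// gtr0_real.
  exists (cRe e); first by rewrite -ltcR -eE.
  move=> u uz; apply: he; rewrite -ball_normE /= normrC eE ltcR.
  by rewrite normcC.
move=> [d d0 hd]; apply/nbhs_ballP; exists d%:C; first by rewrite /= ltcR.
move=> u; rewrite -ball_normE /= normrC ltcR normcC; exact: hd.
Qed.

(** Continuity in terms of the real-valued modulus; the balls of [C^o] have radii in C. *)
Definition ccont f z := forall e : R, 0 < e ->
  exists2 d : R, 0 < d & forall u, normc (u - z) < d -> normc (f u - f z) < e.

Lemma holo_ccont f z : holo_at f z -> ccont f z.
Proof.
move=> /derivable1_diffP/differentiable_continuous hc e e0.
have /hc : nbhs (f z : C^o) [set y | normc (y - f z) < e].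
  by apply/nbhsCP; exists e.
by move=> /nbhsCP.
Qed.

Lemma ccont_cst (k : C) z : ccont (fun=> k) z.
Proof. by move=> e e0; exists 1 => // u _; rewrite subrr normc0. Qed.

Lemma ccont_id z : ccont id z.
Proof. by move=> e e0; exists e. Qed.

Lemma ccontD f g z : ccont f z -> ccont g z -> ccont (fun u => f u + g u) z.
Proof.
move=> hf hg e e0; have e20 : 0 < e / 2 by rewrite divr_gt0.
have [d1 d10 h1] := hf _ e20; have [d2 d20 h2] := hg _ e20.
exists (Num.min d1 d2); first by rewrite lt_min d10.
move=> u; rewrite lt_min => /andP[u1 u2].
by rewrite opprD addrACA (le_lt_trans (normcD _ _))// [e]splitr ltrD// ?h1 ?h2.
Qed.

Lemma ccontM f g z : ccont f z -> ccont g z -> ccont (fun u => f u * g u) z.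
Proof.
move=> hf hg e e0.
pose K := normc (g z) + 1; pose L := normc (f z) + 1.
have K0 : 0 < K by rewrite ltr_wpDl ?normc_ge0.
have L0 : 0 < L by rewrite ltr_wpDl ?normc_ge0.
have e1 : 0 < e / (2 * K) by rewrite divr_gt0// mulr_gt0.
have e2 : 0 < e / (2 * L) by rewrite divr_gt0// mulr_gt0.
have [d1 d10 h1] := hf _ e1; have [d2 d20 h2] := hg _ e2.
have [d3 d30 h3] := hf _ ltr01.
exists (Num.min d1 (Num.min d2 d3)); first by rewrite !lt_min d10 d20.
move=> u; rewrite !lt_min => /and3P[u1 u2 u3].
have -> : f u * g u - f z * g z = (f u - f z) * g z + f u * (g u - g z) by ring.
apply: le_lt_trans (normcD _ _) _; rewrite !normcM.
have A : normc (f u - f z) * normc (g z) <= e / (2 * K) * K.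
  by rewrite ler_pM ?normc_ge0 ?(ltW (h1 _ u1))// lerDl.
have fu : normc (f u) <= L.
  by have := normcD (f u - f z) (f z); rewrite subrK; have := h3 _ u3; rewrite /L; lra.
have B : normc (f u) * normc (g u - g z) < L * (e / (2 * L)).
  apply: le_lt_trans (_ : _ <= L * normc (g u - g z)) _; first by rewrite ler_wpM2r ?normc_ge0.
  by rewrite ltr_pM2l// h2.
have E1 : e / (2 * K) * K = e / 2 by field; rewrite gt_eqF.
have E2 : L * (e / (2 * L)) = e / 2 by field; rewrite gt_eqF.
by rewrite E1 in A; rewrite E2 in B; lra.
Qed.

Lemma ccont_comp f g z : ccont g z -> ccont f (g z) -> ccont (f \o g) z.
Proof.
move=> hg hf e e0; have [d d0 hd] := hf e e0; have [d' d'0 hd'] := hg d d0.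
by exists d' => // u /hd' /hd.
Qed.

Lemma ccontV z : z != 0 -> ccont (fun u => u^-1) z.
Proof.
move=> z0 e e0; have n0 : 0 < normc z by rewrite normc_gt0.
have d0 : 0 < Num.min (normc z / 2) (e * (normc z ^+ 2 / 2)).
  by rewrite lt_min !divr_gt0//= mulr_gt0// divr_gt0// exprn_gt0.
exists (Num.min (normc z / 2) (e * (normc z ^+ 2 / 2))) => // u; rewrite lt_min => /andP[u1 u2].
have un : normc z / 2 <= normc u.
  by have := normc_ge_B z (z - u); rewrite subKr normcC; lra.
have u0 : u != 0 by rewrite -normc_gt0 (lt_le_trans _ un)// divr_gt0.
have -> : u^-1 - z^-1 = - (u - z) / (u * z) by field; rewrite u0 z0.
rewrite normcM normcNE normcV normcM ltr_pdivrMr ?mulr_gt0 ?normc_gt0//.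
apply: lt_le_trans u2 _; rewrite ler_wpM2l ?(ltW e0)//.
rewrite expr2 mulrAC ler_wpM2r ?normc_ge0//; lra.
Qed.

Lemma ccontVf f z : f z != 0 -> ccont f z -> ccont (fun u => (f u)^-1) z.
Proof. by move=> f0 hf; exact: ccont_comp hf (ccontV f0). Qed.

Lemma ccontX f z n : ccont f z -> ccont (fun u => f u ^+ n) z.
Proof.
move=> hf; elim: n => [|n IH]; first exact: ccont_cst.
have := ccontM hf IH; rewrite /ccont => h e e0; have [d d0 hd] := h e e0.
by exists d => // u /hd; rewrite !exprS.
Qed.

Lemma ccont_eq f g z : (forall u, f u = g u) -> ccont f z -> ccont g z.
Proof. by move=> /funext ->. Qed.

(** If k < l, cancelling (u - z)^k and letting u tend to z would give f(z) = 0. *)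
Lemma zero_order_lt f g z k l : ccont f z -> ccont g z -> f z != 0 ->
  (\forall u \near nbhs (z : C^o), (u - z) ^+ k * f u = (u - z) ^+ l * g u) -> (l <= k)%N.
Proof.
move=> hf hg f0 /nbhsCP[d d0 hd]; rewrite leqNgt; apply/negP => kl.
have n0 : 0 < normc (f z) by rewrite normc_gt0.
have [|d1 d10 h1] := hf (normc (f z) / 2); first by rewrite divr_gt0.
have [d2 d20 h2] := hg 1 ltr01.
pose K := normc (g z) + 1.
have K0 : 0 < K by rewrite ltr_wpDl ?normc_ge0.
have m0 : 0 < Num.min (Num.min d 1) (Num.min (Num.min d1 d2) (normc (f z) / (2 * K))).
  by rewrite !lt_min d0 d10 d20 ltr01 /= divr_gt0// mulr_gt0.
(* Half of the minimum of all constraints. The last one makes |t g| smaller than |f(z)|/2 at [u],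
   and t < 1 disposes of the remaining powers. *)
pose t := Num.min (Num.min d 1) (Num.min (Num.min d1 d2) (normc (f z) / (2 * K))) / 2.
have t0 : 0 < t by rewrite divr_gt0.
have : t < Num.min (Num.min d 1) (Num.min (Num.min d1 d2) (normc (f z) / (2 * K))).
  by rewrite /t; lra.
rewrite !lt_min => /andP[/andP[td t1] /andP[/andP[td1 td2] tK]].
pose u := z + t%:C.
have uz : u - z = t%:C by rewrite /u addrAC subrr add0r.
have un : normc (u - z) = t by rewrite uz normc_real ger0_norm// ltW.
have tC : t%:C != 0 by rewrite -normc_gt0 normc_real ger0_norm// ltW.
have El : l = (k + (l - k.+1).+1)%N by rewrite addnS -addSn subnKC.
have E : f u = t%:C ^+ (l - k.+1).+1 * g u.
  apply: (mulfI (expf_neq0 k tC)); rewrite mulrA -exprD -El -uz.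
  by apply: hd; rewrite un.
have := h1 u; rewrite un => /(_ td1) H1'; have := h2 u; rewrite un => /(_ td2) H2'.
have A : normc (f z) / 2 < normc (f u).
  by have := normc_ge_B (f z) (f z - f u); rewrite subKr (normcC (f z)); lra.
have B : normc (g u) <= K.
  by have := normcD (g u - g z) (g z); rewrite subrK /K; lra.
move: A; rewrite E normcM normcX normc_real ger0_norm ?(ltW t0)// exprS => A.
have C1 : t * t ^+ (l - k.+1) * normc (g u) <= t * K.
  have t0' := ltW t0.
  have P0 : 0 <= t ^+ (l - k.+1) by exact: exprn_ge0.
  have P1 : t ^+ (l - k.+1) <= 1 by rewrite exprn_ile1// ltW.
  apply: ler_pM => //; [exact: mulr_ge0|exact: normc_ge0|].
  by rewrite ler_piMr.
move: tK; rewrite ltr_pdivlMr ?mulr_gt0//; lra.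
Qed.

Definition recip z : C := (16 * z)^-1.

Lemma recipK z : recip (recip z) = z.
Proof.
rewrite /recip; have [->|z0] := eqVneq z 0; first by rewrite mulr0 invr0 mulr0 invr0.
by field.
Qed.

Lemma recip_inj : injective recip. Proof. exact: can_inj recipK. Qed.

Lemma recip_eq0 z : (recip z == 0) = (z == 0).
Proof. by rewrite invr_eq0 mulf_eq0 pnatr_eq0. Qed.

Lemma recipN z : recip (- z) = - recip z.
Proof. by rewrite /recip mulrN invrN. Qed.

Lemma normc_recip z : normc (recip z) = (16 * normc z)^-1.
Proof. by rewrite normcV normcM normc_nat. Qed.

Lemma recip_ReIm z : cRe (recip z) = cRe z / (16 * normc z ^+ 2) /\
  cIm (recip z) = - cIm z / (16 * normc z ^+ 2).
Proof.
have [->|z0] := eqVneq z 0; first by rewrite /recip mulr0 invr0 /= mul0r oppr0 mul0r.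
have n0 : normc z ^+ 2 != 0 by rewrite expf_neq0// normc_eq0.
have -> : recip z = (cRe z / (16 * normc z ^+ 2)) +i* (- cIm z / (16 * normc z ^+ 2)); last by [].
apply: (@mulIf _ (16 * z)); first by rewrite mulf_neq0 ?pnatr_eq0.
rewrite /recip mulVf ?mulf_neq0 ?pnatr_eq0//.
have R16 : (16 : C) = (16 : R)%:C by rewrite rmorph_nat.
apply: complex_eq; rewrite R16 !(cReM, cImM) /= !(mul0r, subr0, addr0).
  transitivity ((cRe z ^+ 2 + cIm z ^+ 2) / normc z ^+ 2).
    by rewrite -sqr_normc_ReIm divff.
  by field; rewrite normc_eq0.
by field; rewrite normc_eq0.
Qed.

Lemma recip_Re_gt0 z : 0 < cRe z -> 0 < cRe (recip z).
Proof.
move=> z0; rewrite (recip_ReIm z).1 divr_gt0// mulr_gt0// exprn_gt0// normc_gt0.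
by apply: contraTneq z0 => ->; rewrite ltxx.
Qed.

Lemma prec_recip a b : 0 < cRe a -> 0 < cRe b -> prec a b -> prec (recip b) (recip a).
Proof.
have nz z : 0 < cRe z -> 0 < normc z.
  by move=> z0; rewrite normc_gt0; apply: contraTneq z0 => ->; rewrite ltxx.
move=> /nz a0 /nz b0 [ab|[ab iab]]; [left|right].
  by rewrite !normc_recip ltf_pV2 ?posrE ?mulr_gt0// ltr_pM2l.
rewrite !normc_recip ab !(recip_ReIm _).2 ab; split => //.
by rewrite ler_wpM2r ?invr_ge0 ?mulr_ge0 ?exprn_ge0 ?normc_ge0// lerN2.
Qed.

Lemma prec_anti a b : 0 < cRe a -> 0 < cRe b -> prec a b -> prec b a -> a = b.
Proof.
move=> a0 b0 [ab|[ab iab]] [ba|[ba iba]].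
- by move: (lt_trans ab ba); rewrite ltxx.
- by move: ab; rewrite ba ltxx.
- by move: ba; rewrite ab ltxx.
have iE : cIm a = cIm b by apply/le_anti; rewrite iab iba.
apply: complex_eq => //.
have := sqr_normc_ReIm a; rewrite ab sqr_normc_ReIm iE => /addIr h.
by apply/eqP; rewrite -(@eqrXn2 _ 2)// ?(ltW a0) ?(ltW b0)// h.
Qed.

Lemma card_eq_inj (T : Type) (A B : set T) : (A #= B)%card -> exists f : T -> T,
  (forall x, A x -> B (f x)) /\ (forall x y, A x -> A y -> f x = f y -> x = y).
Proof.
move=> /card_bijP[f fbij].
pose g x := match pselect (A x) with
  | left h => val (f (SigSub (mem_set h))) | right _ => x end.
exists g; split => [x Ax|x y Ax Ay]; rewrite /g.
  by case: pselect => // h; apply: set_mem; exact: valP.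
by case: pselect => // hx; case: pselect => // hy /val_inj /(bij_inj fbij) [].
Qed.

Section Listing.
Variables (radius : pot R -> R) (U : pot R -> int -> set C) (lam : pot R -> listing R).
Variable chi : pot R -> C -> C.
Hypothesis U_compatible : Irec_compatible radius U.
Hypothesis lam_listing : forall v0 v : pot R, H1r v0 -> H1ball v0 (radius v0) v ->
  is_listing (chi v) (lam v).
Hypothesis U_isolating : forall v0 : pot R, H1r v0 ->
  isolating (H1ball v0 (radius v0)) lam (U v0).
Hypothesis chi_recip : forall v z, H1c v -> z != 0 -> chi v z = chi (Irec v) (recip z).

Lemma ball_Irec v0 v : H1r v0 -> H1ball v0 (radius v0) v ->
  H1ball (Irec v0) (radius (Irec v0)) (Irec v).
Proof. by move=> h0 hv; rewrite (U_compatible h0).1; exists v. Qed.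

(** [Cplus] contains the upper imaginary axis, but a point of an open subset can be moved to the
    left. On that axis inversion would leave [Cplus]. *)
Lemma U_Re_gt0 v0 n z : H1r v0 -> U v0 n z -> 0 < cRe z.
Proof.
move=> h0 Uz; have [hU _ _ _ _] := U_isolating h0; have [oU UC] := hU n.
have [//|[Re0 _]] := UC z Uz.
have /nbhsCP[d d0 hd] : nbhs (z : C^o) (U v0 n) by exact: open_nbhs_nbhs.
have : U v0 n (z - (d / 2)%:C).
  apply: hd; rewrite addrAC subrr add0r normcNE normc_real ger0_norm ?divr_ge0 ?ltW//.
  by rewrite ltr_pdivrMr// ltr_pMr// ltr1n.
move=> /UC; rewrite /Cplus /= cReD cReN Re0 /= sub0r => -[|[]]; rewrite ?oppr_gt0; lra.
Qed.

Lemma U_recip v0 n z : H1r v0 -> U v0 n z -> U (Irec v0) (- n) (recip z).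
Proof.
move=> h0 Uz; have [_ /(_ n) [E1 E2]] := U_compatible h0.
have [n0|n0] := leP 0 n.
  have : [set - (16 * z)^-1 | z in relabel (U v0) J1 n] (- recip z).
    by exists z => //=; rewrite n0.
  by rewrite E1 /= n0 => -[u Uu /oppr_inj <-].
have : [set - (16 * z)^-1 | z in relabel (U v0) J2 n] (- recip z).
  by exists z => //=; rewrite leNgt n0.
by rewrite E2 /= leNgt n0 /= => -[u Uu /oppr_inj <-].
Qed.

Lemma lam_in_U v0 v n s : H1r v0 -> H1ball v0 (radius v0) v -> U v0 n (lam v n s).
Proof.
move=> h0 hv; have [_ _ hg _ _] := U_isolating h0; apply: (hg v hv n).
case: s; [exists 1|exists 0]; rewrite ?ler01 ?lexx; split => //.
  by rewrite subrr mul0r add0r mul1r.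
by rewrite subr0 mul0r addr0 mul1r.
Qed.

Lemma U_disjoint v0 m n z : H1r v0 -> U v0 m z -> U v0 n z -> m = n.
Proof.
move=> h0 Um Un; have [_ hd _ _ _] := U_isolating h0.
apply/eqP; apply: contraT => mn; have := hd m n mn.
by move=> /seteqP[/(_ z (conj Um Un))].
Qed.

Lemma listing_card v0 v n z : H1r v0 -> H1ball v0 (radius v0) v -> U v0 n z ->
  ([set i : int * bool | lam v i.1 i.2 = z] #=
   [set i : int * bool | lam (Irec v) i.1 i.2 = recip z])%card.
Proof.
move=> h0 hv Uz; have h0' := H1r_Irec h0; have hv' := ball_Irec h0 hv.
have zR := U_Re_gt0 h0 Uz; have zR' := recip_Re_gt0 zR.
have z0 : z != 0 by apply: contraTneq zR => ->; rewrite ltxx.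
have Cz : Cplus z by left.
have Cz' : Cplus (recip z) by left.
have [_ /(_ z Cz) [k hk ck] _ _] := lam_listing h0 hv.
have [_ /(_ (recip z) Cz') [l hl cl] _ _] := lam_listing h0' hv'.
suff kl : k = l by apply: card_eq_trans ck _; rewrite kl card_eq_sym.
have [g [hg gz Eg]] := hk; have [h [hh hz Eh]] := hl.
have cg : ccont g z.
  by apply: holo_ccont; move: hg => /nbhsCP[d d0 hd]; apply: hd; rewrite subrr normc0.
have ch : ccont h (recip z).
  by apply: holo_ccont; move: hh => /nbhsCP[d d0 hd]; apply: hd; rewrite subrr normc0.
have ci : ccont recip z.
  apply: (@ccont_comp (fun u => u^-1) (fun u => 16 * u)).
    by apply: ccontM; [exact: ccont_cst|exact: ccont_id].
  by apply: ccontV; rewrite mulf_neq0 ?pnatr_eq0.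
(* recip u - recip z = - (u - z)/(16 u z), so (recip u - recip z)^l is (u - z)^l times a factor that
   does not vanish at z. *)
pose H u := (- (16 * u * z)^-1) ^+ l * h (recip u).
have cH : ccont H z.
  apply: ccontM; last exact: ccont_comp ci ch.
  apply: ccontX; apply: (ccont_eq (f := fun u => - 1 * (16 * z * u)^-1)).
    by move=> u; rewrite mulN1r mulrAC.
  apply: ccontM; first exact: ccont_cst.
  apply: ccontVf; first by rewrite !mulf_neq0 ?pnatr_eq0.
  by apply: ccontM; [exact: ccont_cst|exact: ccont_id].
have Hz : H z != 0 by rewrite mulf_neq0// expf_neq0// oppr_eq0 invr_eq0 !mulf_neq0 ?pnatr_eq0.
have near_eq : \forall u \near nbhs (z : C^o), (u - z) ^+ k * g u = (u - z) ^+ l * H u.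
  apply/nbhsCP; have /nbhsCP[d1 d10 h1] := Eg; have /nbhsCP[d2 d20 h2] := Eh.
  have [d3 d30 h3] := ci _ d20.
  have nz : 0 < normc z by rewrite normc_gt0.
  exists (Num.min d1 (Num.min d3 (normc z))); first by rewrite !lt_min d10 d30.
  move=> u; rewrite !lt_min => /and3P[u1 u2 u3].
  have u0 : u != 0.
    by apply: contraTneq u3 => ->; rewrite sub0r normcNE ltxx.
  rewrite -h1// chi_recip//; last by case: hv.
  rewrite h2; last exact: h3.
  rewrite /H mulrA -exprMn; congr (_ ^+ _ * _).
  by rewrite /recip; field; rewrite u0 z0.
apply/eqP; rewrite eqn_leq (zero_order_lt cH cg Hz) ?(zero_order_lt cg cH gz)//.
by apply: filterS near_eq => u ->.
Qed.

(** Disjointness of the neighborhoods forces the index -n. Inversion reverses [prec], as moduli are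
    inverted and imaginary parts change sign; hence the exchange of the two signs. A double
    eigenvalue needs the count of multiplicities, to see that both entries of index -n are its
    image. *)
Lemma lam_Irec v0 v n s : H1r v0 -> H1ball v0 (radius v0) v ->
  lam (Irec v) (- n) s = recip (lam v n (~~ s)).
Proof.
move=> h0 hv; have h0' := H1r_Irec h0; have hv' := ball_Irec h0 hv.
have onlyn (i : int * bool) z : U v0 n z -> lam (Irec v) i.1 i.2 = recip z -> i.1 = - n.
  move=> Uz Ei; apply: (U_disjoint h0' _ (U_recip h0 Uz)).
  by rewrite -Ei; exact: lam_in_U.
have Us := lam_in_U n _ h0 hv.
set a := lam v n false; set b := lam v n true.
have [ab|ab] := eqVneq a b.
  have [f [fA fI]] := card_eq_inj (listing_card h0 hv (Us false)).
  have hf s' : lam (Irec v) (f (n, s')).1 (f (n, s')).2 = recip a.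
    by apply: (fA (n, s')); rewrite /= -/a; case: s' => //; rewrite -/b ab.
  have f1 s' : (f (n, s')).1 = - n by exact: (onlyn _ _ (Us false) (hf s')).
  have f2 : (f (n, true)).2 != (f (n, false)).2.
    apply/eqP => E; have : f (n, true) = f (n, false).
      by move: (f1 true) (f1 false) E; case: (f (n, true)) => x y; case: (f (n, false)) => x' y' /= -> -> ->.
    by move=> /fI; rewrite /= -/a -/b => /(_ (esym ab) erefl).
  have -> : lam v n (~~ s) = a by case: s => //; rewrite -/b -ab.
  have [E|E] := eqVneq (f (n, true)).2 s.
    by rewrite -E -(f1 true) hf.
  have {}E : (f (n, false)).2 = s by move: f2 E; case: s (f _).2 (f _).2 => [] [] [].
  by rewrite -E -(f1 false) hf.
have ex s' : exists t, lam (Irec v) (- n) t = recip (lam v n s').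
  have [f [fA _]] := card_eq_inj (listing_card h0 hv (Us s')).
  have := fA (n, s') erefl; move: (f _) => [x y] /= E.
  by exists y; rewrite -(onlyn (x, y) _ (Us s') E).
have [ta Ea] := ex false; have [tb Eb] := ex true.
have tab : ta != tb.
  apply/eqP => E; move: ab => /eqP; apply; apply: recip_inj.
  by rewrite -Ea -Eb E.
have aR : 0 < cRe a := U_Re_gt0 h0 (Us false).
have bR : 0 < cRe b := U_Re_gt0 h0 (Us true).
(* The tags differ, so it remains to exclude that the signs are preserved: [prec] would then hold
   both ways between the two images. *)
case: ta tb Ea Eb tab => [] [] // Ea Eb _; first by case: s.
have [_ _ /(_ n) [pab _] _] := lam_listing h0 hv.
have [_ _ /(_ (- n)) [pab' _] _] := lam_listing h0' hv'.
rewrite Ea Eb in pab'.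
move: ab => /eqP; case; apply: recip_inj.
apply: prec_anti => //; try exact: recip_Re_gt0.
exact: prec_recip.
Qed.

(** Through this identity the second family of v is read off from the first family of [Irec v]. *)
Lemma lamj_Irec v0 v k s : H1r v0 -> H1ball v0 (radius v0) v ->
  lamj (lam v) J2 k s = lamj (lam (Irec v)) J1 k s.
Proof.
move=> h0 hv; rewrite /lamj; case: ifP => k0.
  by rewrite -[X in _ = lam _ X _]opprK (lam_Irec _ _ h0 hv).
by rewrite (lam_Irec _ _ h0 hv) negbK.
Qed.

End Listing.
End Reflection.

(** * Canonical roots *)

Section CanonicalRoot.
Variable R : realType.
Local Notation C := R[i].
Local Notation cRe := (@complex.Re R).
Local Notation cIm := (@complex.Im R).
Implicit Types (z u q : C) (tau g : C) (w : C -> C).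

(** Centre and half-length instead of end points: g^2/(tau - z)^2 is then the quantity in the
    normalization of the canonical root, and a change of sign affects the centre only. *)
Definition seg tau g : set C := [set z | exists s : R, -1 <= s <= 1 /\ z = tau + s%:C * g].

Definition croot tau g w := forall z, ~ seg tau g z ->
  [/\ ccont w z, w z ^+ 2 = (tau - z) ^+ 2 - g ^+ 2
    & normc (g ^+ 2 / (tau - z) ^+ 2) < 1 ->
      w z = (tau - z) * sqrtc (1 - g ^+ 2 / (tau - z) ^+ 2)].

Lemma seg_center tau g : seg tau g tau.
Proof. by exists 0; rewrite mul0r addr0 lerN10 ler01. Qed.

Lemma seg_neq tau g z : ~ seg tau g z -> tau - z != 0.
Proof.
move=> hz; rewrite subr_eq0; apply/eqP => E; apply: hz; rewrite -E; exact: seg_center.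
Qed.

Lemma seg_opp tau g z : seg tau g z <-> seg (- tau) g (- z).
Proof.
split => -[s [/andP[s1 s2] E]]; exists (- s); (split; first by apply/andP; split; lra).
  by rewrite rmorphN mulNr E; ring.
by rewrite -[z]opprK E rmorphN; ring.
Qed.

Lemma sqr_real_neg (q : C) : cRe q = 0 -> q ^+ 2 = - (cIm q ^+ 2)%:C.
Proof.
by move=> q0; apply: complex_eq; rewrite expr2 !(cReM, cImM, cReN, cImN) q0 /=; ring.
Qed.

Lemma sqrt_unique q q' : q ^+ 2 = q' ^+ 2 -> 0 < cRe q -> 0 < cRe q' -> q = q'.
Proof.
move=> /eqP; rewrite eqf_sqr => /orP[/eqP //|/eqP ->].
by rewrite cReN oppr_gt0 => h1 h2; move: (lt_trans h1 h2); rewrite ltxx.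
Qed.

Lemma ccont_pcont a b (f : C -> C) (x : R -> C) : pcont a b x ->
  (forall t, a <= t <= b -> ccont f (x t)) -> pcont a b (f \o x).
Proof.
move=> hx hf t tab e e0; have [d d0 hd] := hf t tab e e0.
have [d' d'0 hd'] := hx t tab d d0; exists d' => // s sab ts /=.
by rewrite normcC; apply: hd; rewrite normcC; apply: hd'.
Qed.

Lemma sqrtc_Re_ge0 z : 0 <= cRe (sqrtc z).
Proof. by case: z => a b; rewrite /sqrtc /=; exact: sqrtr_ge0. Qed.

(* On the ray from the centre of the cut through [z] the quotient w/(tau - z) never
   becomes imaginary, and at infinity it is the principal root. *)
Lemma croot_factor tau g w z : croot tau g w -> ~ seg tau g z ->
  exists q, [/\ 0 < cRe q, q ^+ 2 = 1 - g ^+ 2 / (tau - z) ^+ 2 & w z = (tau - z) * q].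
Proof.
move=> hw hz; have z0 := seg_neq hz.
pose y (t : R) := tau + t%:C * (z - tau).
have ytau t : tau - y t = t%:C * (tau - z) by rewrite /y; ring.
have tC (t : R) : 1 <= t -> t%:C != 0.
  by move=> t1; rewrite -normc_gt0 normc_real normr_gt0 gt_eqF// (lt_le_trans ltr01).
have yseg t : 1 <= t -> ~ seg tau g (y t).
  move=> t1 [s [s11 E]]; apply: hz; exists (s / t).
  have t0 : 0 < t by exact: lt_le_trans ltr01 t1.
  split.
    rewrite ler_pdivlMr// ler_pdivrMr//; case/andP: s11 => s1 s2.
    by apply/andP; split; lra.
  have -> : z = tau + (t%:C)^-1 * (t%:C * (z - tau)) by field; exact: tC.
  have -> : t%:C * (z - tau) = s%:C * g.
    by apply: (addrI tau); rewrite -E.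
  by rewrite rmorphM /= fmorphV; field; exact: tC.
pose q t := w (y t) / (tau - y t).
have y0 t : 1 <= t -> tau - y t != 0 by move=> t1; rewrite ytau mulf_neq0// tC.
have q2 t : 1 <= t -> q t ^+ 2 = 1 - g ^+ 2 / (tau - y t) ^+ 2.
  move=> t1; have [_ h2 _] := hw _ (yseg t t1).
  by rewrite /q expr_div_n h2; field; exact: y0.
(* If q were imaginary, g^2 = r^2 (tau - y)^2 with r >= 1 would put y on the cut. *)
have qRe t : 1 <= t -> cRe (q t) != 0.
  move=> t1; apply/eqP => q0; have := q2 t t1; rewrite (sqr_real_neg q0) => E.
  pose r := Num.sqrt (1 + cIm (q t) ^+ 2).
  have h1 : 1 <= 1 + cIm (q t) ^+ 2 by rewrite lerDl sqr_ge0.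
  have r2 : r ^+ 2 = 1 + cIm (q t) ^+ 2 by rewrite sqr_sqrtr// (le_trans ler01).
  have r1 : 1 <= r.
    by rewrite -(@ler_pXn2r _ 2)// ?nnegrE ?ler01 ?sqrtr_ge0// expr1n r2.
  have rC := tC r r1.
  have : g ^+ 2 = (r%:C * (tau - y t)) ^+ 2.
    rewrite exprMn -rmorphXn r2 rmorphD rmorph1 /=.
    have -> : (cIm (q t) ^+ 2)%:C = - (1 - g ^+ 2 / (tau - y t) ^+ 2) by rewrite -E opprK.
    by field; exact: y0.
  have r0 : 0 < r by exact: lt_le_trans ltr01 r1.
  have rV : r^-1 <= 1 by rewrite invf_le1.
  have rV0 : 0 <= r^-1 by rewrite invr_ge0 ltW.
  move=> /eqP; rewrite eqf_sqr => /orP[/eqP|/eqP] Eg; apply: (yseg t t1).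
    exists (- r^-1); split; first by apply/andP; split; lra.
    by rewrite Eg rmorphN fmorphV; field.
  exists (r^-1); split; first by apply/andP; split; lra.
  by rewrite Eg fmorphV; field.
have yc (T : R) : pcont 1 T y.
  move=> t _ e e0; exists (e / (normc (z - tau) + 1)).
    by rewrite divr_gt0// ltr_wpDl ?normc_ge0.
  move=> s _; rewrite ltr_pdivlMr ?ltr_wpDl ?normc_ge0// => h.
  apply: le_lt_trans h.
  have -> : y t - y s = (t - s)%:C * (z - tau) by rewrite /y rmorphB; ring.
  by rewrite normcM normc_real ler_wpM2l// lerDl.
have qc (T : R) : pcont 1 T q.
  apply: (@ccont_pcont _ _ (fun u => w u * (tau - u)^-1) y); first exact: yc.
  move=> t /andP[t1 _]; have [h1 _ _] := hw _ (yseg t t1).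
  apply: ccontM => //; apply: ccontVf; first exact: y0.
  apply: (ccont_eq (f := fun u => tau + -1 * u)); first by move=> u; rewrite mulN1r.
  apply: ccontD; first exact: ccont_cst.
  by apply: ccontM; [exact: ccont_cst|exact: ccont_id].
have y1 : y 1 = z by rewrite /y mul1r addrC subrK.
exists (q 1); split; last by rewrite /q y1 mulrCA mulfV ?mulr1.
- rewrite lt_neqAle eq_sym qRe//= leNgt; apply/negP => qneg.
  (* At y(T) one has |g/(tau - y)| < 1, where the root is the principal one by normalization. *)
  pose T := normc (g / (tau - z)) + 1.
  have T1 : 1 <= T by rewrite lerDr normc_ge0.
  have T0 : 0 < T by exact: lt_le_trans ltr01 T1.
  have [_ _ hT] := hw _ (yseg T T1).
  have qT : 0 < cRe (q T).
    rewrite lt_neqAle eq_sym qRe//= /q hT; last first.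
      rewrite ytau exprMn invfM mulrCA -expr_div_n normcM normcV !normcX normc_real.
      rewrite ger0_norm ?(ltW T0)// mulrC ltr_pdivrMr ?exprn_gt0//.
      rewrite mul1r ltrXn2r// ?nnegrE ?normc_ge0 ?(ltW T0)//.
      by rewrite /T ltrDl.
    by rewrite mulrAC mulfV ?y0// mul1r sqrtc_Re_ge0.
  have hc : {within `[1, T], continuous (cRe \o q)}.
    by apply: pcont_within (qc T) => s t; exact: Re_dist.
  have [|c] := @IVT _ (cRe \o q) 1 T 0 T1 hc.
    by rewrite /= ge_min le_max (ltW qneg) (ltW qT) !orbT.
  by rewrite in_itv /= => /andP[c1 _] /eqP; apply/negP/qRe.
- by rewrite q2// y1.
Qed.

Lemma croot_neq0 tau g w z : croot tau g w -> ~ seg tau g z -> w z != 0.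
Proof.
move=> hw hz; have [q [q0 _ ->]] := croot_factor hw hz.
rewrite mulf_neq0 ?(seg_neq hz)//; apply: contraTneq q0 => ->.
by rewrite /= ltxx.
Qed.

Lemma croot_opp tau g w w' z : croot tau g w -> croot (- tau) g w' ->
  ~ seg tau g z -> w' (- z) = - w z.
Proof.
move=> hw hw' hz; have hz' : ~ seg (- tau) g (- z) by move=> h; apply: hz; apply/seg_opp.
have [q [q0 q2 ->]] := croot_factor hw hz.
have [q' [q'0 q'2 ->]] := croot_factor hw' hz'.
have -> : q' = q.
  apply: sqrt_unique => //; rewrite q2 q'2.
  have -> : - tau - - z = - (tau - z) by ring.
  by rewrite sqrrN.
ring.
Qed.

(** |q + 1| >= 1 because Re q > 0, and d = - (q - 1)(q + 1). *)
Lemma croot_quotient_bound (d q : C) : 0 < cRe q -> q ^+ 2 = 1 - d ->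
  normc (q - 1) <= normc d /\ 1 - normc d <= normc q ^+ 2.
Proof.
move=> q0 E; split.
  have h1 : 1 <= normc (q + 1).
    apply: le_trans (le_trans (ler_norm _) (Re_le_normc _)).
    by rewrite cReD /= lerDr ltW.
  have -> : d = - ((q - 1) * (q + 1)) by rewrite -subr_sqr_1 E; ring.
  by rewrite normcNE normcM ler_peMr ?normc_ge0.
by rewrite -normcX E; have := normc_ge_B 1 d; rewrite normc1.
Qed.

End CanonicalRoot.

(** * Rational approximation of the inverse of a canonical root *)

Section RootApproximation.
Variable R : realType.
Local Notation C := R[i].
Variables (tau g : C) (w : C -> C).
Hypothesis hw : croot tau g w.

(** Repeated multiplication by tau - z + w in the basis 1, w, where w^2 = (tau - z)^2 - g^2. *)
Fixpoint root_num (n : nat) : {poly C} * {poly C} :=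
  if n is m.+1 then
    let: (P, Q) := root_num m in
    ((tau%:P - 'X) * P + ((tau%:P - 'X) ^+ 2 - (g ^+ 2)%:P) * Q, P + (tau%:P - 'X) * Q)
  else (1, 0).

Lemma root_numE n z : ~ seg tau g z ->
  ((tau - z) + w z) ^+ n = (root_num n).1.[z] + w z * (root_num n).2.[z] /\
  ((tau - z) - w z) ^+ n = (root_num n).1.[z] - w z * (root_num n).2.[z].
Proof.
move=> hz; have [_ h2 _] := hw hz.
elim: n => [|n [IH1 IH2]]; first by rewrite !expr0 /= hornerC horner0 mulr0 addr0 subr0.
rewrite !exprS IH1 IH2 /=; case: (root_num n) => P Q /=.
rewrite !hornerE -h2; split; ring.
Qed.

(** With w = (tau - z) q this is |1 - q| < |1 + q|, that is Re q > 0. It keeps the zeros of [P] on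
    the cut and makes the remainder (tau - z - w)^n/(w P) of 1/w - Q/P small. *)
Lemma root_dominates z : ~ seg tau g z -> normc (tau - z - w z) < normc (tau - z + w z).
Proof.
move=> hz; have [q [q0 _ ->]] := croot_factor hw hz.
have -> : tau - z - (tau - z) * q = (tau - z) * (1 - q) by ring.
have -> : tau - z + (tau - z) * q = (tau - z) * (1 + q) by ring.
rewrite !normcM ltr_pM2l ?normc_gt0 ?(seg_neq hz)//.
rewrite -(@ltr_pXn2r _ 2)// ?nnegrE ?normc_ge0//.
rewrite !sqr_normc_ReIm !(cReD, cImD, cReN, cImN) /=; lra.
Qed.

Lemma root_num_neq0 n z : ~ seg tau g z -> (root_num n).1.[z] != 0.
Proof.
move=> hz; have [h1 h2] := root_numE n hz.
apply/eqP => P0; have hd := root_dominates hz.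
case: n h1 h2 P0 => [|n] h1 h2 P0; first by move: P0; rewrite hornerC => /eqP; rewrite oner_eq0.
have : normc ((tau - z - w z) ^+ n.+1) < normc ((tau - z + w z) ^+ n.+1).
  by rewrite !normcX ltrXn2r ?nnegrE ?normc_ge0.
by rewrite h1 h2 P0 sub0r add0r normcNE ltxx.
Qed.

Lemma seg_bounded z : seg tau g z -> normc (z - tau) <= normc g.
Proof.
move=> [s [s11 ->]]; rewrite addrAC subrr add0r normcM normc_real ler_piMl ?normc_ge0//.
by rewrite ler_norml.
Qed.

Variables (I : finType) (x dx : I -> R -> C) (A : set C).
Hypothesis xAC : forall i, isAC 0 1 (x i) (dx i).
Hypothesis xA : forall i t, 0 <= t <= 1 -> ~ A (x i t).
Hypothesis segA : seg tau g `<=` A.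

(* 1/w is the limit of the quotients Q/P, where (tau - z + w)^n = P + w Q. *)
Lemma unifrat_rootV : unifrat A (trace x) (fun z => (w z)^-1).
Proof.
have AX := trace_separated xAC xA.
have Xseg z : trace x z -> ~ seg tau g z.
  by move=> [i [t [t01 ->]]] /segA; exact: xA.
have xc i : pcont 0 1 (x i) by apply: ucont_pcont; exact: isAC_ucont (xAC i).
have tr i t : 0 <= t <= 1 -> trace x (x i t) by exists i, t.
have cw i t : 0 <= t <= 1 -> ccont w (x i t).
  by move=> t01; have [] := hw (Xseg _ (tr i t t01)).
have cy z : ccont (fun u => tau - u) z.
  apply: (ccont_eq (f := fun u => tau + -1 * u)); first by move=> u; rewrite mulN1r.
  by apply: ccontD; [exact: ccont_cst|apply: ccontM; [exact: ccont_cst|exact: ccont_id]].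
have cn (f : C -> C) z : ccont f z -> ccont (fun u => (normc (f u))%:C) z.
  move=> hf e e0; have [d d0 hd] := hf e e0; exists d => // u /hd; apply: le_lt_trans.
  by rewrite -rmorphB normc_real normc_dist.
have cN (f : C -> C) z : ccont f z -> ccont (fun u => - f u) z.
  move=> hf; apply: (ccont_eq (f := fun u => -1 * f u)); first by move=> u; rewrite mulN1r.
  by apply: ccontM => //; exact: ccont_cst.
have [m m0 hm] : exists2 d, 0 < d & forall z, trace x z -> d <= normc (w z).
  apply: trace_pos => [i|z /Xseg hz]; first by apply: ccont_pcont (xc i) _ => t; exact: cw.
  exact: croot_neq0 hw hz.
have [m' m'0 hm'] : exists2 d, 0 < d & forall z, trace x z ->
    d <= normc ((normc (tau - z + w z))%:C - (normc (tau - z - w z))%:C).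
  apply: trace_pos => [i|z /Xseg /root_dominates hz].
    apply: (@ccont_pcont _ _ _ (fun u => (normc (tau - u + w u))%:C - (normc (tau - u - w u))%:C) (x i) (xc i)) => t t01.
    apply: ccontD; first by apply/cn/ccontD; [exact: cy|exact: cw].
    by apply/cN/cn/ccontD; [exact: cy|apply: cN; exact: cw].
  by rewrite -rmorphB -normc_gt0 normc_real normr_gt0 subr_eq0 gt_eqF.
have [K K0 hK] : exists2 K, 0 < K & forall z, trace x z -> normc (tau - z + w z) <= K.
  have [[K K0 hK] _] := AX.
  have hK' : forall i, exists K, 0 < K /\ forall t, 0 <= t <= 1 -> normc (w (x i t)) <= K.
    move=> i; have hc : {within `[0, 1], continuous (fun t => normc (w (x i t)))}.
      apply: (@pcont_within _ _ _ (w \o x i)) => [s t|]; first exact: normc_dist.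
      by apply: ccont_pcont (xc i) _ => t; exact: cw.
    have [c _ hc'] := EVT_max ler01 hc.
    exists (normc (w (x i c)) + 1); split; first by rewrite ltr_wpDl ?normc_ge0.
    by move=> t t01; rewrite (le_trans (hc' t _)) ?in_itv// lerDl.
  have [k hk] := choice hK'.
  exists (normc tau + K + (1 + \sum_i k i)).
    by rewrite ltr_wpDl ?addr_ge0 ?normc_ge0 ?(ltW K0)// ltr_pwDl// sumr_ge0// => i _; rewrite ltW// (hk i).1.
  move=> z [i [t [t01 ->]]]; rewrite (le_trans (normcD _ _))// lerD//.
    by rewrite (le_trans (normcB _ _))// lerD2l hK//; exact: tr.
  rewrite (le_trans ((hk i).2 t t01))// (bigD1 i)//= addrCA lerDl addr_ge0// sumr_ge0// => j _.
  by rewrite ltW// (hk j).1.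
have mK z : trace x z -> normc (tau - z - w z) <= (1 - m' / K) * normc (tau - z + w z).
  move=> Xz; have := hm' z Xz; rewrite -rmorphB normc_real ger0_norm; last first.
    by rewrite subr_ge0 ltW//; exact: root_dominates (Xseg _ Xz).
  have : m' / K * normc (tau - z + w z) <= m'.
    by rewrite mulrAC ler_pdivrMr// ler_wpM2l ?(ltW m'0)// hK.
  by lra.
(* A uniform ratio below 1 in [root_dominates], truncated at 0 so that its powers can be
   compared. *)
pose rho := Num.max (1 - m' / K) 0.
have rho0 : 0 <= rho by rewrite le_max lexx orbT.
have rho1 : rho < 1 by rewrite gt_max ltr01 andbT gtrBl divr_gt0.
have {}mK z : trace x z -> normc (tau - z - w z) <= rho * normc (tau - z + w z).
  move=> Xz; apply: le_trans (mK z Xz) _; rewrite ler_wpM2r ?normc_ge0//.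
  by rewrite le_max lexx.
apply: unifrat_ulim => e e0.
(* The bound 1/2 gives |P| >= Y/4 in [p2], and e m/4 then bounds the remainder by e. *)
have [n hn] : exists n : nat, rho ^+ n.+1 <= Num.min (1 / 2) (e * m / 4).
  have := cvg_expr (_ : `|rho| < 1); rewrite ger0_norm// => /(_ rho1).
  move=> /cvgrPdist_le /(_ (Num.min (1 / 2) (e * m / 4))).
  rewrite lt_min !divr_gt0// ?mulr_gt0// => /(_ isT) [n _ hn]; exists n.
  by have := hn n.+1 (leqnSn n); rewrite /= sub0r normrN ger0_norm// exprn_ge0.
have [P0 hr] : (root_num n.+1).1 != 0 /\ forall z, root (root_num n.+1).1 z -> A z.
  split; last first.
    move=> z /rootP Pz; apply: contrapT => nA.
    have hz : ~ seg tau g z by move=> /segA.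
    by have := root_num_neq0 n.+1 hz; rewrite Pz eqxx.
  have hz : ~ seg tau g (tau + (normc g + 1)%:C).
    move=> /seg_bounded; rewrite addrAC subrr add0r normc_real ger0_norm ?addr_ge0 ?normc_ge0//.
    by rewrite leNgt ltrDl ltr01.
  by have := root_num_neq0 n.+1 hz; apply: contra_neq => ->; rewrite horner0.
exists (fun z => (root_num n.+1).2.[z] * ((root_num n.+1).1.[z])^-1).
  apply: unifratM => //; first exact: unifrat_poly.
  exact: unifrat_polyV.
move=> z Xz; have hz := Xseg z Xz; have [E1 E2] := root_numE n.+1 hz.
have P := root_num_neq0 n.+1 hz; have wz := croot_neq0 hw hz.
set p := (root_num n.+1).1.[z] in E1 E2 P *; set s := (root_num n.+1).2.[z] in E1 E2 *.
have -> : (w z)^-1 - s * p^-1 = (tau - z - w z) ^+ n.+1 / (w z * p).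
  by rewrite E2; field; rewrite wz P.
set Y := normc ((tau - z + w z) ^+ n.+1).
have Y1 : normc ((tau - z - w z) ^+ n.+1) <= rho ^+ n.+1 * Y.
  by rewrite /Y !normcX -exprMn lerXn2r ?nnegrE ?mulr_ge0 ?normc_ge0// mK.
have [h1 h2] : rho ^+ n.+1 <= 1 / 2 /\ rho ^+ n.+1 <= e * m / 4.
  by move: hn; rewrite le_min => /andP[].
have Y0 : 0 <= Y by exact: normc_ge0.
have p2 : Y / 4 <= normc p.
  have : normc (p + p) = normc ((tau - z + w z) ^+ n.+1 + (tau - z - w z) ^+ n.+1).
    by rewrite E1 E2; congr normc; ring.
  have -> : p + p = 2 * p by ring.
  rewrite normcM normc_nat => E.
  have := normc_ge_B ((tau - z + w z) ^+ n.+1) (- (tau - z - w z) ^+ n.+1).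
  rewrite opprK -E normcNE -/Y.
  have : rho ^+ n.+1 * Y <= 1 / 2 * Y by rewrite ler_wpM2r.
  by lra.
rewrite normcM normcV normcM ler_pdivrMr ?mulr_gt0 ?normc_gt0//.
apply: le_trans Y1 _; apply: (@le_trans _ _ (e * m / 4 * Y)); first by rewrite ler_wpM2r.
have -> : e * m / 4 * Y = e * (m * (Y / 4)) by field.
rewrite ler_wpM2l ?(ltW e0)// ler_pM ?(ltW m0) ?divr_ge0 ?hm//.
Qed.

End RootApproximation.

(** * Reciprocity of a canonical root *)

Section RootReciprocity.
Variable R : realType.
Local Notation C := R[i].
Local Notation cRe := (@complex.Re R).
Local Notation cIm := (@complex.Im R).
Implicit Types (z mu : C).

Lemma seg_Re tau g z : 0 < cRe (tau + g) -> 0 < cRe (tau - g) -> seg tau g z -> 0 < cRe z.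
Proof.
rewrite !cReD !cReN => h1 h2 [s [/andP[s1 s2] ->]].
rewrite cReD cReM /= mul0r subr0.
have s1' : 0 <= 1 + s by lra.
have s2' : 0 <= 1 - s by lra.
have a := mulr_ge0 s2' (ltW h2); have b := mulr_ge0 s1' (ltW h1).
have [s0|s0] := leP 0 s.
  by have := mulr_ge0 s0 (ltW h1); lra.
have s0' : 0 <= - s by lra.
by have := mulr_ge0 s0' (ltW h2); lra.
Qed.

(* Both sides are roots of the same function of [mu]; the sign is found by
   moving [mu] vertically to infinity, outside the disc. *)
Lemma croot_recip tau g w tau' g' w' (c rho : R) mu :
  croot tau g w -> croot tau' g' w' ->
  0 < cRe (tau + g) -> 0 < cRe (tau - g) ->
  tau' + g' = recip (tau - g) -> tau' - g' = recip (tau + g) ->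
  seg tau' g' `<=` disc c%:C rho ->
  (forall z, seg tau g z -> disc c%:C rho (recip z)) ->
  mu != 0 -> rho <= normc (mu - c%:C) ->
  w (recip mu) = - w 0 * w' mu / mu.
Proof.
move=> hw hw' a0 b0 Ea Eb hS hS' mu0 hmu.
(* The direction away from the real axis, so that the distance from the real centre c does not
   decrease along [m]. *)
pose sg : R := if 0 <= cIm mu then 1 else -1.
pose m (t : R) := mu + (0 +i* (t * sg)).
have m_far t : 0 <= t -> rho <= normc (m t - c%:C).
  move=> t0; apply: le_trans hmu _; rewrite -(@ler_pXn2r _ 2)// ?nnegrE ?normc_ge0//.
  rewrite !sqr_normc_ReIm /m !(cReD, cReN, cImD, cImN) /= addr0 lerD2l oppr0 !addr0.
  rewrite /sg; case: (leP 0 (cIm mu)) => h; first by rewrite mulr1 lerXn2r ?nnegrE ?addr_ge0// lerDl.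
  rewrite mulrN1 -[leLHS]sqrrN -[leRHS]sqrrN lerXn2r ?nnegrE//; lra.
have m_Im t : 0 <= t -> t <= normc (m t).
  move=> t0; apply: le_trans (Im_le_normc _); rewrite /m cImD /= /sg.
  case: (leP 0 (cIm mu)) => h; first by rewrite mulr1 ger0_norm ?addr_ge0// lerDr.
  by rewrite mulrN1 ltr0_norm//; lra.
have m0 t : 0 <= t -> m t != 0.
  move=> t0; apply/eqP => E; have := m_Im t t0; rewrite E normc0 => t0'.
  have t00 : t = 0 by apply/le_anti; rewrite t0 t0'.
  move: E; rewrite /m t00 mul0r => /eqP.
  have -> : 0 +i* 0 = 0 :> C by [].
  by rewrite addr0 (negbTE mu0).
have mS' t : 0 <= t -> ~ seg tau' g' (m t).
  by move=> t0 /hS; rewrite /disc /= ltNge m_far.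
have mS t : 0 <= t -> ~ seg tau g (recip (m t)).
  by move=> t0 /hS'; rewrite recipK /disc /= ltNge m_far.
have S0 : ~ seg tau g 0.
  by move=> /(seg_Re a0 b0); rewrite ltxx.
have w0 := croot_neq0 hw S0.
have w02 : w 0 ^+ 2 = (tau - g) * (tau + g).
  by have [_ -> _] := hw _ S0; ring.
have na : tau + g != 0 by apply: contraTneq a0 => ->; rewrite ltxx.
have nb : tau - g != 0 by apply: contraTneq b0 => ->; rewrite ltxx.
(* The quotient of the two sides. Being continuous with square 1 it is constant, and its value is
   found far away. *)
pose r t := m t * w (recip (m t)) / (- w 0 * w' (m t)).
have w'0 t : 0 <= t -> w' (m t) != 0 by move=> t0; exact: croot_neq0 hw' (mS' t t0).
have r2 t : 0 <= t -> r t ^+ 2 = 1.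
  move=> t0; rewrite /r expr_div_n !exprMn sqrrN w02.
  have [_ -> _] := hw _ (mS t t0); have [_ E2 _] := hw' _ (mS' t t0).
  have E3 : w' (m t) ^+ 2 = (recip (tau - g) - m t) * (recip (tau + g) - m t).
    by rewrite E2 -Ea -Eb; ring.
  have n3 : (recip (tau - g) - m t) * (recip (tau + g) - m t) != 0.
    by rewrite -E3 expf_neq0// w'0.
  rewrite E3; move: n3; rewrite /recip => n3.
  rewrite [X in X / _](_ : _ = (tau - g) * (tau + g) * ((16 * (tau - g))^-1 - m t) * ((16 * (tau + g))^-1 - m t)).
    by rewrite -[X in X / _]mulrA divff// !mulf_neq0//; move: n3; rewrite mulf_eq0 => /norP[].
  by field; rewrite na nb m0.
have rpm t : 0 <= t -> r t = 1 \/ r t = -1.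
  by move=> /r2 /eqP; rewrite -(expr1n _ 2) eqf_sqr expr1n => /orP[] /eqP; [left|right].
have mc (T : R) : pcont 0 T m.
  move=> t _ e e0; exists e => // s _ h; apply: le_lt_trans h.
  have -> : m t - m s = 0 +i* ((t - s) * sg).
    by apply: complex_eq; rewrite /m !(cReD, cImD, cReN, cImN) /=; ring.
  rewrite (le_trans (normc_le_ReIm _))//= normr0 add0r normrM ler_piMr//.
  by rewrite /sg; case: ifP => _; rewrite ?normrN normr1.
have rc (T : R) : pcont 0 T r.
  apply: (@ccont_pcont _ _ _ (fun u => u * w (recip u) * (- w 0 * w' u)^-1) m); first exact: mc.
  move=> t /andP[t0 _].
  have [c1 _ _] := hw _ (mS t t0); have [c2 _ _] := hw' _ (mS' t t0).
  apply: ccontM.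
    apply: ccontM; first exact: ccont_id.
    apply: ccont_comp c1; apply: ccontVf; first by rewrite mulf_neq0 ?pnatr_eq0 ?m0.
    by apply: ccontM; [exact: ccont_cst|exact: ccont_id].
  apply: ccontVf; first by rewrite mulf_neq0 ?oppr_eq0 ?w'0.
  by apply: ccontM => //; exact: ccont_cst.
have [T T0 rT] : exists2 T, 0 <= T & r T = 1.
  have [cw0 _ _] := hw _ S0.
  have nw : 0 < normc (w 0) by rewrite normc_gt0.
  have [|d d0 hd] := cw0 (normc (w 0) / 4); first by rewrite divr_gt0.
  pose K := normc tau' + normc g'.
  have K0 : 0 <= K by rewrite addr_ge0 ?normc_ge0.
  (* 1/d brings 1/(16 m) so close to 0 that w differs from w(0) by less than |w(0)|/4; 16 K brings
     w'(m) within |m|/4 of -m. Together they exclude r = -1. *)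
  pose T := d^-1 + 16 * K + 1.
  have T0 : 0 < T by rewrite ltr_wpDl// addr_ge0 ?mulr_ge0// invr_ge0 ltW.
  have dV : 0 < d^-1 by rewrite invr_gt0.
  exists T; first exact: ltW.
  have [//|rT] := rpm T (ltW T0).
  have mT := m_Im T (ltW T0).
  have mT0 : 0 < normc (m T) by exact: lt_le_trans mT.
  have A : normc (w (recip (m T)) - w 0) < normc (w 0) / 4.
    apply: hd; rewrite subr0 normc_recip invf_plt ?posrE ?mulr_gt0//.
    apply: (@lt_le_trans _ _ T); first by rewrite /T -addrA ltrDl ltr_wpDl// mulr_ge0.
    by apply: le_trans mT _; rewrite ler_peMl ?normc_ge0// ler1n.
  have [q [q0 q2 E']] := croot_factor hw' (mS' T (ltW T0)).
  have [q1 _] := croot_quotient_bound q0 q2.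
  have d1 : normc (g' ^+ 2 / (tau' - m T) ^+ 2) <= 1 / 16.
    rewrite -expr_div_n normcX normcM normcV.
    have h : normc g' / normc (tau' - m T) <= 1 / 4.
      rewrite ler_pdivrMr ?normc_gt0 ?(seg_neq (mS' T (ltW T0)))//.
      have := normc_ge_B (m T) tau'; rewrite normcC.
      have := normc_ge0 tau'; have := normc_ge0 g'.
      have : 16 * K <= normc (m T) by apply: le_trans mT; rewrite /T; lra.
      rewrite /K; lra.
    have -> : 1 / 16 = (1 / 4) ^+ 2 :> R by rewrite expr2; field.
    by rewrite lerXn2r ?nnegrE ?divr_ge0 ?normc_ge0.
  exfalso; move: rT; rewrite /r E' => rT.
  have Eq : m T * w (recip (m T)) = w 0 * ((tau' - m T) * q).
    have n0 : - w 0 * ((tau' - m T) * q) != 0 by rewrite -E' mulf_neq0 ?oppr_eq0 ?w'0 ?(ltW T0).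
    by rewrite -[LHS](divfK n0) rT mulN1r mulNr opprK.
  have B : normc (m T * (w (recip (m T)) - w 0)) <= normc (m T) * (normc (w 0) / 4).
    by rewrite normcM ler_wpM2l ?normc_ge0// ltW.
  have D : normc (w 0 * ((tau' - m T) * q + m T)) <= normc (w 0) * (normc (m T) / 4).
    rewrite normcM ler_wpM2l ?normc_ge0//.
    have -> : (tau' - m T) * q + m T = tau' * q - m T * (q - 1) by ring.
    apply: le_trans (normcB _ _) _; rewrite !normcM.
    have nq : normc q <= 2 by have := normcD (q - 1) 1; rewrite subrK normc1; lra.
    have : normc tau' * normc q <= normc tau' * 2 by rewrite ler_wpM2l ?normc_ge0.
    have : normc (m T) * normc (q - 1) <= normc (m T) * (1 / 16).
      by rewrite ler_wpM2l ?normc_ge0//; exact: le_trans d1.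
    have : 16 * normc tau' <= normc (m T).
      by apply: le_trans mT; rewrite /T /K; have := normc_ge0 g'; lra.
    lra.
  have E2 : (2 * m T) * w 0 = w 0 * ((tau' - m T) * q + m T) - m T * (w (recip (m T)) - w 0).
    by rewrite [m T * (_ - _)]mulrBr Eq; ring.
  have := normcB (w 0 * ((tau' - m T) * q + m T)) (m T * (w (recip (m T)) - w 0)).
  rewrite -E2 !normcM normc_nat.
  have := mulr_gt0 mT0 nw; rewrite normcM in B; rewrite normcM in D; lra.
have r0 : r 0 = 1.
  have [//|rN] := rpm 0 (lexx 0).
  have hc : {within `[0, T], continuous (cRe \o r)}.
    by apply: pcont_within (rc T) => s t; exact: Re_dist.
  have [|t] := @IVT _ (cRe \o r) 0 T 0 T0 hc.
    by rewrite /= rT rN /= ge_min le_max lerN10 ler01 orbT.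
  by rewrite in_itv /= => /andP[t0 _]; have [->|->] := rpm t t0 => /= /eqP; rewrite ?oppr_eq0 oner_eq0.
have m00 : m 0 = mu.
  by rewrite /m mul0r; have -> : 0 +i* 0 = 0 :> C by []; rewrite addr0.
move: r0; rewrite /r m00 => r0.
have n0 : - w 0 * w' mu != 0 by rewrite mulf_neq0 ?oppr_eq0// -m00 w'0.
apply: (@mulfI _ mu) => //.
by rewrite -[LHS](divfK n0) r0 mul1r mulrCA mulfV// mulr1.
Qed.

End RootReciprocity.

(** * Infinite products *)

Section Products.
Variable R : realType.
Local Notation C := R[i].
Local Notation cRe := (@complex.Re R).
Implicit Types (a : int -> C) (b : nat -> R) (u : nat -> C) (l z : C).

Definition csum b := (forall i, 0 <= b i) /\ exists B, forall n, \sum_(i < n) b i <= B.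

Lemma csumD b c : csum b -> csum c -> csum (fun i => b i + c i).
Proof.
move=> [b0 [B hB]] [c0 [D hD]]; split => [i|]; first exact: addr_ge0.
by exists (B + D) => n; rewrite big_split lerD.
Qed.

Lemma csumZ b (k : R) : 0 <= k -> csum b -> csum (fun i => k * b i).
Proof.
move=> k0 [b0 [B hB]]; split => [i|]; first exact: mulr_ge0.
by exists (k * B) => n; rewrite -mulr_sumr ler_wpM2l.
Qed.

Lemma csum_le b c K : (forall i, 0 <= b i) -> (forall i, (K <= i)%N -> b i <= c i) ->
  csum c -> csum b.
Proof.
move=> b0 bc [c0 [D hD]]; split => //; exists (\sum_(i < K) b i + D) => n.
have [nK|Kn] := leqP n K.
  apply: (@le_trans _ _ (\sum_(i < K) b i)).
    rewrite -!(big_mkord xpredT b) (big_cat_nat (n := n) _ nK)//= lerDl.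
    by rewrite sumr_ge0.
  rewrite lerDl; apply: le_trans (hD 0%N); by rewrite big_ord0.
rewrite -!(big_mkord xpredT b) (big_cat_nat (n := K) _ (ltnW Kn))//= lerD2l.
apply: le_trans (hD n); rewrite -(big_mkord xpredT c) [leRHS](big_cat_nat (n := K) _ (ltnW Kn))//=.
apply: (@le_trans _ _ (\sum_(K <= i < n) c i)); last by rewrite lerDr sumr_ge0.
by rewrite !big_nat ler_sum// => i /andP[Ki _]; exact: bc.
Qed.

Lemma csumM b c : csum b -> csum c -> csum (fun i => b i * c i).
Proof.
move=> [b0 [B hB]] hc; have [c0 _] := hc.
have bB i : b i <= B.
  by apply: le_trans (hB i.+1); rewrite big_ord_recr /= lerDr sumr_ge0.
apply: (@csum_le _ (fun i => B * c i) 0%N).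
- by move=> i; exact: mulr_ge0.
- by move=> i _; rewrite ler_wpM2r.
- by apply: csumZ => //; exact: le_trans (b0 0%N) (bB 0%N).
Qed.

Lemma csum_sqrV : csum (fun i => (i%:R ^+ 2)^-1).
Proof.
split => [i|]; first by rewrite invr_ge0 sqr_ge0.
(* The telescoping starts at i = 1; the term i = 0 is 0 because the inverse of 0 is 0. *)
exists 2; suff h n : \sum_(i < n.+2) (i%:R ^+ 2)^-1 <= 2 - n.+1%:R^-1 :> R.
  move=> [|[|n]]; rewrite ?big_ord0 ?ler0n//.
    by rewrite big_ord_recr big_ord0 /= add0r expr0n invr0.
  by apply: le_trans (h n) _; rewrite gerBl invr_ge0.
elim: n => [|n IH].
  by rewrite !big_ord_recr big_ord0 /= expr0n invr0 expr1n invr1; lra.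
rewrite big_ord_recr /=; apply: le_trans (lerD IH (lexx _)) _.
rewrite -[n.+2%:R]natr1; set m : R := n.+1%:R.
have m0 : 0 < m by rewrite ltr0n.
have m1 : 0 < m + 1 by rewrite addr_gt0.
have : ((m + 1) ^+ 2)^-1 <= m^-1 - (m + 1)^-1.
  have -> : m^-1 - (m + 1)^-1 = (m * (m + 1))^-1 by field; rewrite !gt_eqF.
  by rewrite lef_pV2 ?posrE ?exprn_gt0 ?mulr_gt0// expr2 ler_wpM2r ?(ltW m1)// lerDl.
move=> h; have -> : 2 - (m + 1)^-1 = 2 - m^-1 + (m^-1 - (m + 1)^-1) by ring.
by rewrite lerD2l.
Qed.

(** Otherwise blocks of sum larger than e could be appended without end. *)
Lemma csum_tail b : csum b -> forall e : R, 0 < e ->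
  exists n, forall m, \sum_(n <= i < m) b i <= e.
Proof.
move=> [b0 [B hB]] e e0; apply: contrapT => hn.
have step n : exists m, e < \sum_(n <= i < m) b i.
  apply: contrapT => h; apply: hn; exists n => m.
  by rewrite leNgt; apply/negP => hm; apply: h; exists m.
have [f hf] := choice step.
have nf n : (n <= f n)%N.
  rewrite leqNgt; apply/negP => h; have := hf n.
  by rewrite big_geq ?(ltnW h)// => /lt_trans /(_ e0); rewrite ltxx.
have grow j : exists n, e *+ j <= \sum_(i < n) b i.
  elim: j => [|j [n hn']]; first by exists 0%N; rewrite big_ord0 mulr0n.
  exists (f n); rewrite mulrSr -(big_mkord xpredT b) (big_cat_nat (n := n) _ (nf n))//=.
  by rewrite lerD ?big_mkord// ltW.
have [n hn'] := grow (Num.truncn (B / e)).+1.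
have := le_trans hn' (hB n).
rewrite -[e *+ _]mulr_natl -ler_pdivlMr// leNgt => /negP; apply.
exact: truncnS_gt.
Qed.

Lemma csum_small b : csum b -> forall e : R, 0 < e -> exists n, forall i, (n <= i)%N -> b i <= e.
Proof.
move=> hb e e0; have [n hn] := csum_tail hb e0; exists n => i ni.
apply: le_trans (hn i.+1); rewrite big_nat_recr//= lerDr sumr_ge0// => j _.
exact: hb.1.
Qed.

Definition ccvg u l := forall e : R, 0 < e -> exists N, forall n, (N <= n)%N -> normc (u n - l) <= e.

Lemma ccvg_unique u l l' : ccvg u l -> ccvg u l' -> l = l'.
Proof.
move=> h h'; apply/eqP; rewrite -subr_eq0 -normc_eq0 eq_le normc_ge0 andbT.
apply/ler_addgt0Pr => e e0; rewrite add0r.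
have e2 : 0 < e / 2 by rewrite divr_gt0.
have [N hN] := h _ e2; have [N' hN'] := h' _ e2.
have := hN _ (leq_maxl N N'); have := hN' _ (leq_maxr N N').
set m := maxn N N' => h1 h2; have -> : l - l' = (u m - l') - (u m - l) by ring.
by have := normcB (u m - l') (u m - l); lra.
Qed.

Lemma ccvgM u l u' l' : ccvg u l -> ccvg u' l' -> ccvg (fun n => u n * u' n) (l * l').
Proof.
move=> h h' e e0.
pose K := normc l + 1; pose K' := normc l' + 1.
have K0 : 0 < K by rewrite ltr_wpDl ?normc_ge0.
have K'0 : 0 < K' by rewrite ltr_wpDl ?normc_ge0.
have [N hN] := h (e / (2 * K')) (divr_gt0 e0 (mulr_gt0 (ltr0Sn _ 1) K'0)).
have [N' hN'] := h' (e / (2 * K)) (divr_gt0 e0 (mulr_gt0 (ltr0Sn _ 1) K0)).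
have [N1 hN1] := h 1 ltr01.
exists (maxn N (maxn N' N1)) => n; rewrite !geq_max => /and3P[n1 n2 n3].
have -> : u n * u' n - l * l' = (u n - l) * l' + u n * (u' n - l') by ring.
apply: le_trans (normcD _ _) _; rewrite !normcM.
have A : normc (u n - l) * normc l' <= e / (2 * K') * K'.
  by rewrite ler_pM ?normc_ge0 ?hN// lerDl.
have un : normc (u n) <= K.
  by have := normcD (u n - l) l; rewrite subrK; have := hN1 _ n3; rewrite /K; lra.
have B : normc (u n) * normc (u' n - l') <= K * (e / (2 * K)).
  by rewrite ler_pM ?normc_ge0 ?hN'.
have E1 : e / (2 * K') * K' = e / 2 by field; rewrite gt_eqF.
have E2 : K * (e / (2 * K)) = e / 2 by field; rewrite gt_eqF.
by rewrite E1 in A; rewrite E2 in B; lra.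
Qed.

Lemma ccvgV u l : l != 0 -> ccvg u l -> ccvg (fun n => (u n)^-1) l^-1.
Proof.
move=> l0 h e e0; have [d d0 hd] := ccontV l0 e0.
have [N hN] := h (d / 2) (divr_gt0 d0 (ltr0Sn _ 1)).
by exists N => n /hN un; rewrite ltW// hd// (le_lt_trans un)// ltr_pdivrMr// ltr_pMr// ltr1n.
Qed.

Lemma ccvg_cst l : ccvg (fun=> l) l.
Proof. by move=> e e0; exists 0%N => n _; rewrite subrr normc0 ltW. Qed.

Lemma ccvg_eq u u' l : (exists N, forall n, (N <= n)%N -> u n = u' n) -> ccvg u l -> ccvg u' l.
Proof.
move=> [N0 E] h e e0; have [N hN] := h e e0; exists (maxn N0 N) => n.
by rewrite geq_max => /andP[n0 n1]; rewrite -E// hN.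
Qed.

Lemma ccvg_norm_le u l (B : R) : (exists N, forall n, (N <= n)%N -> normc (u n) <= B) ->
  ccvg u l -> normc l <= B.
Proof.
move=> [N0 hB] h; apply/ler_addgt0Pr => e e0; have [N hN] := h e e0.
have := hB _ (leq_maxl N0 N); have := hN _ (leq_maxr N0 N).
set m := maxn _ _ => h1 h2; have -> : l = u m - (u m - l) by ring.
by have := normcB (u m) (u m - l); lra.
Qed.

Lemma cauchy_ccvg u : (forall e : R, 0 < e -> exists N, forall m n, (N <= n <= m)%N ->
   normc (u m - u n) <= e) -> exists l, ccvg u l.
Proof.
move=> hc.
have key (f : C -> R) : (forall x y, `|f x - f y| <= normc (x - y)) ->
    exists r : R, forall e, 0 < e -> exists N, forall n, (N <= n)%N -> `|f (u n) - r| <= e.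
  move=> hf; have : cvgn (fun n => f (u n)).
    apply/cauchy_cvgP/cauchy_exP => e e0.
    have [N hN] := hc (e / 2) (divr_gt0 e0 (ltr0Sn _ 1)).
    exists (f (u N)); exists N => // n /= Nn.
    rewrite -ball_normE /=; apply: le_lt_trans (hf _ _) _.
    rewrite normcC; apply: le_lt_trans (hN n N _) _; first by rewrite leqnn.
    by rewrite ltr_pdivrMr// ltr_pMr// ltr1n.
  move=> /cvg_ex[r /= /cvgrPdist_le hr]; exists r => e e0.
  have [N _ hN] := hr e e0; exists N => n Nn; rewrite distrC.
  exact: hN.
have [r hr] := key _ (@Re_dist R); have [s hs] := key _ (@Im_dist R).
exists (r +i* s) => e e0; have e2 : 0 < e / 2 by rewrite divr_gt0.
have [N hN] := hr _ e2; have [N' hN'] := hs _ e2.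
exists (maxn N N') => n; rewrite geq_max => /andP[n1 n2].
apply: le_trans (normc_le_ReIm _) _; rewrite cReD cImD cReN cImN /=.
by rewrite [e]splitr lerD ?hN ?hN'.
Qed.

Lemma prod_bound (I : Type) (r : seq I) (P : pred I) (F : I -> C) :
  normc (\prod_(i <- r | P i) F i - 1) <= expR (\sum_(i <- r | P i) normc (F i - 1)) - 1.
Proof.
elim: r => [|i r IH]; first by rewrite !big_nil subrr normc0 expR0 subrr.
rewrite !big_cons; case: ifP => // _.
set p := \prod_(j <- r | P j) F j in IH *; set s := \sum_(j <- r | P j) _ in IH *.
have -> : F i * p - 1 = (F i - 1) * (p - 1) + (F i - 1) + (p - 1) by ring.
have h1 := expR_ge1Dx (normc (F i - 1)).
rewrite expRD; have n0 := normc_ge0 (F i - 1).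
apply: (@le_trans _ _ (normc (F i - 1) * (expR s - 1) + normc (F i - 1) + (expR s - 1))).
  apply: le_trans (normcD _ _) (lerD _ IH); apply: le_trans (normcD _ _) _.
  by rewrite normcM lerD2r ler_wpM2l.
have : (1 + normc (F i - 1)) * expR s <= expR (normc (F i - 1)) * expR s.
  by rewrite ler_wpM2r ?expR_ge0.
lra.
Qed.

Definition pp a (N : nat) : C := \prod_(i < (2 * N).+1) a (i%:Z - N%:Z).

(** The deviations of the single factors from 1 are of order 1/k and not summable; in the product of
    the factors at i and -i the leading terms cancel. *)
Definition pairf a (i : nat) : C := if i is j.+1 then a i%:Z * a (- i%:Z) else a 0.

Lemma ppS a N : pp a N.+1 = pp a N * pairf a N.+1.
Proof.
rewrite /pp /= -(big_mkord xpredT (fun i => a (i%:Z - N.+1%:Z))) -(big_mkord xpredT (fun i => a (i%:Z - N%:Z))).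
rewrite mulnS add2n big_nat_recr//= big_nat_recl//=.
have -> : (0%:Z - N.+1%:Z = - N.+1%:Z :> int) by rewrite sub0r.
have -> : ((2 * N).+2%:Z - N.+1%:Z = N.+1%:Z :> int) by lia.
have -> : \prod_(0 <= i < (2 * N).+1) a (i.+1%:Z - N.+1%:Z) =
    \prod_(0 <= i < (2 * N).+1) a (i%:Z - N%:Z).
  by apply: eq_big_nat => i _; congr a; lia.
by ring.
Qed.

Lemma ppE a N : pp a N = \prod_(i < N.+1) pairf a i.
Proof.
elim: N => [|N IH]; first by rewrite /pp !big_ord1 /= subrr.
by rewrite ppS IH [RHS]big_ord_recr.
Qed.

Lemma ppM a a' N : pp (fun k => a k * a' k) N = pp a N * pp a' N.
Proof. by rewrite /pp big_split. Qed.

Lemma ppV a N : pp (fun k => (a k)^-1) N = (pp a N)^-1.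
Proof. by rewrite /pp prodfV. Qed.

Lemma pp_mem (N : nat) (k : int) : (`|k| <= N)%N -> exists i : 'I_(2 * N).+1, i%:Z - N%:Z = k.
Proof.
move=> kN; have h : (absz (k + N%:Z)%R < (2 * N).+1)%N by lia.
by exists (Ordinal h); rewrite /=; lia.
Qed.

Lemma pp_eq0 a N k : (`|k| <= N)%N -> a k = 0 -> pp a N = 0.
Proof.
move=> kN ak; have [i Ei] := pp_mem kN; apply/eqP.
by rewrite /pp; apply/prodf_eq0; exists i => //; rewrite Ei ak.
Qed.

Lemma prodZ_lim a l : ccvg (pp a) l -> prodZ a = l.
Proof.
move=> h; have hc : (pp a : nat -> C^o) n @[n --> \oo] --> (l : C^o); last first.
  have E := @cvg_lim C^o (@norm_hausdorff _ C^o) nat \oo _ (pp a) l hc.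
  exact: E.
apply/cvgrPdist_le => e /= e0.
have eE : e = (cRe e)%:C by rewrite RRe_real// gtr0_real.
have [|N hN] := h (cRe e); first by rewrite -ltcR -eE.
exists N => // n /= Nn; rewrite normrC eE lecR normcC.
exact: hN.
Qed.

Lemma prodZ_eq0 a k : a k = 0 -> prodZ a = 0.
Proof.
move=> ak; apply: prodZ_lim; apply: ccvg_eq (ccvg_cst 0); exists `|k|%N => n kn.
by rewrite (pp_eq0 kn ak).
Qed.

Definition tame a := csum (fun i => normc (pairf a i - 1)).

Lemma pp_tail a n m : (n <= m)%N ->
  pp a m = pp a n * \prod_(n.+1 <= i < m.+1) pairf a i.
Proof.
move=> nm; rewrite !ppE -!(big_mkord xpredT (pairf a)).
by rewrite (big_cat_nat (n := n.+1)).
Qed.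

Lemma pp_dist a n m : (n <= m)%N -> normc (pp a m - pp a n) <=
  normc (pp a n) * (expR (\sum_(n.+1 <= i < m.+1) normc (pairf a i - 1)) - 1).
Proof.
move=> nm; rewrite (pp_tail a nm).
have -> (x y : C) : x * y - x = x * (y - 1) by ring.
by rewrite normcM ler_wpM2l ?normc_ge0// prod_bound.
Qed.

Lemma expR_small (e : R) : 0 < e -> exists2 d : R, 0 < d & forall x, x <= d -> expR x - 1 <= e.
Proof.
move=> e0; exists (ln (1 + e)); first by rewrite ln_gt0// ltrDl.
by move=> x; rewrite -ler_expR lnK ?posrE ?addr_gt0//; lra.
Qed.

Lemma tame_cvg a : tame a -> exists l, [/\ ccvg (pp a) l, prodZ a = l &
  (forall k, a k != 0) -> l != 0].
Proof.
move=> ha; have [b0 [B hB]] := ha.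
have ppB n : normc (pp a n) <= expR B.
  rewrite ppE; have := prod_bound (index_enum 'I_n.+1) xpredT (fun i : 'I_n.+1 => pairf a i).
  have := hB n.+1; rewrite -ler_expR => h1 h2.
  set p := \prod_(_ < _) _ in h2 *.
  by have := normcD (p - 1) 1; rewrite subrK normc1; lra.
have [|l hl] := @cauchy_ccvg (pp a).
  move=> e e0; have [d d0 hd] := expR_small (divr_gt0 e0 (expR_gt0 B)).
  have [n hn] := csum_tail ha d0; exists n => m k /andP[nk km].
  apply: le_trans (pp_dist a km) _; apply: (@le_trans _ _ (expR B * (e / expR B))).
    apply: ler_pM; rewrite ?normc_ge0 ?ppB//.
      by rewrite subr_ge0 -{1}expR0 ler_expR sumr_ge0.
    apply: hd; apply: le_trans (hn m.+1).
    rewrite [leRHS](big_cat_nat (n := k.+1)) ?lerDr ?sumr_ge0//.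
    exact: leqW.
  by rewrite mulrC divfK// gt_eqF ?expR_gt0.
exists l; split => //; first exact: prodZ_lim.
(* Beyond [n] the partial products stay within half of |pp a n|, which is not 0. *)
move=> a0; have [d d0 hd] := expR_small (divr_gt0 ltr01 (ltr0Sn R 1)).
have [n hn] := csum_tail ha d0.
have p0 : pp a n != 0 by apply/prodf_neq0 => i _; exact: a0.
have : normc (l - pp a n) <= normc (pp a n) / 2.
  apply: (@ccvg_norm_le (fun m => pp a m - pp a n)).
    exists n => m nm; apply: le_trans (pp_dist a nm) _.
    rewrite ler_wpM2l ?normc_ge0// -[2^-1]mul1r; apply: hd; apply: le_trans (hn m.+1).
    by rewrite [leRHS](big_cat_nat (n := n.+1)) ?lerDr ?sumr_ge0.
  move=> e e0; have [N hN] := hl e e0; exists N => m Nm.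
  have -> : pp a m - pp a n - (l - pp a n) = pp a m - l by ring.
  exact: hN.
move=> h; apply/eqP => l0; move: h; rewrite l0 sub0r normcNE.
have : 0 < normc (pp a n) by rewrite normc_gt0.
lra.
Qed.

Lemma prodZ_mul a a' l l' : ccvg (pp a) l -> ccvg (pp a') l' ->
  prodZ (fun k => a k * a' k) = l * l'.
Proof.
move=> h h'; apply: prodZ_lim; apply: ccvg_eq (ccvgM h h'); exists 0%N => n _.
by rewrite ppM.
Qed.

Lemma prodZ_div a a' l l' : l' != 0 -> ccvg (pp a) l -> ccvg (pp a') l' ->
  prodZ (fun k => a k / a' k) = l / l'.
Proof.
move=> l'0 h h'; apply: prodZ_mul h _; apply: ccvg_eq (ccvgV l'0 h'); exists 0%N => n _.
by rewrite ppV.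
Qed.

Lemma prodZ_norm_bound a l (B : R) : ccvg (pp a) l ->
  (forall N, \sum_(i < (2 * N).+1) normc (a (i%:Z - N%:Z) - 1) <= B) ->
  normc (l - 1) <= expR B - 1.
Proof.
move=> hl hB; apply: (@ccvg_norm_le (fun n => pp a n - 1)).
  exists 0%N => n _; apply: le_trans (prod_bound _ _ _) _.
  by rewrite lerD2r ler_expR hB.
move=> e e0; have [N hN] := hl e e0; exists N => m Nm.
have -> : pp a m - 1 - (l - 1) = pp a m - l by ring.
exact: hN.
Qed.

(* Weierstrass' test. *)
Lemma prodZ_uniform (X : set C) (u : int -> C -> C) (K : nat) (b : nat -> R) :
  (forall i, (i < K)%N -> exists D : R, forall x, X x -> normc (pairf (fun k => u k x) i) <= D) ->
  (forall i x, (K <= i)%N -> X x -> normc (pairf (fun k => u k x) i - 1) <= b i) ->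
  csum b ->
  (forall x, X x -> tame (fun k => u k x)) /\
  forall e : R, 0 < e -> exists M, forall x, X x ->
    normc (prodZ (fun k => u k x) - pp (fun k => u k x) M) <= e.
Proof.
move=> hD hb sb; have [b0 [B hB]] := sb.
have ht x : X x -> tame (fun k => u k x).
  by move=> Xx; apply: (csum_le (K := K) _ _ sb) => [i|i Ki]; [exact: normc_ge0|exact: hb].
split => // e e0.
have [D [D0 hDK]] : exists D : R, 0 < D /\ forall x, X x ->
    normc (\prod_(i < K) pairf (fun k => u k x) i) <= D.
  elim: K hD {hb ht} => [|K IH] hD.
    by exists 1; split => // x _; rewrite big_ord0 normc1.
  have [i iK|D [D0 hDD]] := IH; first by apply: hD; exact: ltnW.
  have [D' hD'] := hD K (ltnSn K).
  exists (D * (`|D'| + 1)); split; first by rewrite mulr_gt0// ltr_wpDl.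
  move=> x Xx; rewrite big_ord_recr /= normcM ler_pM ?normc_ge0 ?hDD//.
  by rewrite (le_trans (hD' x Xx))// (le_trans (ler_norm _))// lerDl.
have [d d0 hd] := expR_small (divr_gt0 e0 (mulr_gt0 D0 (expR_gt0 B))).
have [n hn] := csum_tail sb d0; exists (maxn n K) => x Xx.
have [l [hl -> _]] := tame_cvg (ht x Xx); set M := maxn n K.
apply: (@ccvg_norm_le (fun m => pp (fun k => u k x) m - pp (fun k => u k x) M)); last first.
  move=> e' e'0; have [N hN] := hl e' e'0; exists N => m Nm.
  have -> (p q r : C) : p - q - (r - q) = p - r by ring.
  exact: hN.
exists M => m Mm; apply: le_trans (pp_dist _ Mm) _.
have pM : normc (pp (fun k => u k x) M) <= D * expR B.
  rewrite ppE -(big_mkord xpredT (pairf _)) (big_cat_nat (n := K)) ?leqW ?leq_maxr//= normcM.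
  rewrite big_mkord ler_pM ?normc_ge0 ?hDK//.
  have := prod_bound (index_iota K M.+1) xpredT (pairf (fun k => u k x)).
  have : \sum_(K <= i < M.+1) normc (pairf (fun k => u k x) i - 1) <= B.
    apply: le_trans (hB M.+1); rewrite -(big_mkord xpredT b) [leRHS](big_cat_nat (n := K)) ?leqW ?leq_maxr//=.
    apply: (@le_trans _ _ (\sum_(K <= i < M.+1) b i)); last by rewrite lerDr sumr_ge0.
    by rewrite !big_nat ler_sum// => i /andP[Ki _]; exact: hb.
  rewrite -ler_expR => h1 h2; set p := \prod_(_ <= _ < _) _ in h2 *.
  by have := normcD (p - 1) 1; rewrite subrK normc1; lra.
apply: (@le_trans _ _ (D * expR B * (e / (D * expR B)))); last first.
  by rewrite mulrC divfK// gt_eqF ?mulr_gt0 ?expR_gt0.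
apply: ler_pM; rewrite ?normc_ge0//.
  by rewrite subr_ge0 -{1}expR0 ler_expR sumr_ge0// => i _; exact: normc_ge0.
apply: hd; apply: le_trans (hn m.+1).
apply: (@le_trans _ _ (\sum_(M.+1 <= i < m.+1) b i)).
  rewrite !big_nat ler_sum// => i /andP[Mi _]; apply: hb => //.
  by rewrite (leq_trans (leq_maxr n K))// ltnW.
rewrite [leRHS](big_cat_nat (n := M.+1)) ?lerDr ?sumr_ge0//.
by rewrite leqW// leq_maxl.
Qed.

Lemma unifrat_prodZ (A X : set C) (u : int -> C -> C) (K : nat) (b : nat -> R) :
  separated_from A X -> (forall k, unifrat A X (u k)) ->
  (forall i x, (K <= i)%N -> X x -> normc (pairf (fun k => u k x) i - 1) <= b i) ->
  csum b -> unifrat A X (fun x => prodZ (fun k => u k x)).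
Proof.
move=> AX hu hb sb.
have hp i : unifrat A X (fun x => pairf (fun k => u k x) i).
  by case: i => [|i] /=; [exact: hu|exact: unifratM].
have [i _|_ hl] := prodZ_uniform (K := K) _ hb sb.
  by have [D _ hD] := unifrat_bounded AX (hp i); exists D.
apply: unifrat_ulim => e e0; have [M hM] := hl e e0.
exists (fun x => pp (fun k => u k x) M); last exact: hM.
by apply: unifrat_prod => // i; exact: hu.
Qed.

(** On a neighborhood where the finitely many first pairs are bounded, the product is a uniform
    limit of continuous functions. *)
Lemma ccont_prodZ (u : int -> C -> C) (z : C) (r : R) (K : nat) (b : nat -> R) :
  0 < r -> (forall k, ccont (u k) z) ->
  (forall i x, (K <= i)%N -> normc (x - z) < r -> normc (pairf (fun k => u k x) i - 1) <= b i) ->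
  csum b -> ccont (fun x => prodZ (fun k => u k x)) z.
Proof.
move=> r0 hu hb sb.
have hp i : ccont (fun x => pairf (fun k => u k x) i) z.
  by case: i => [|i] /=; [exact: hu|exact: ccontM].
have [r' r'0 hr'] : exists2 r' : R, 0 < r' & forall i, (i < K)%N -> forall x, normc (x - z) < r' ->
    normc (pairf (fun k => u k x) i) <= normc (pairf (fun k => u k z) i) + 1.
  elim: (K) => [|K' [r1 r10 h1]]; first by exists 1.
  have [r2 r20 h2] := hp K' 1 ltr01.
  exists (Num.min r1 r2); first by rewrite lt_min r10.
  move=> i; rewrite ltnS leq_eqVlt => /predU1P[->|iK] x; rewrite lt_min => /andP[x1 x2]; last exact: h1.
  have := normcD (pairf (fun k => u k x) K' - pairf (fun k => u k z) K') (pairf (fun k => u k z) K').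
  by rewrite subrK; have := h2 x x2; lra.
pose X : set C := [set x | normc (x - z) < Num.min r r'].
have Xz : X z by rewrite /X /= subrr normc0 lt_min r0.
have hD i : (i < K)%N -> exists D : R, forall x, X x -> normc (pairf (fun k => u k x) i) <= D.
  move=> iK; exists (normc (pairf (fun k => u k z) i) + 1) => x.
  by rewrite /X /= lt_min => /andP[_ xr]; exact: hr'.
have hb' i x : (K <= i)%N -> X x -> normc (pairf (fun k => u k x) i - 1) <= b i.
  by move=> Ki; rewrite /X /= lt_min => /andP[xr _]; exact: hb.
have [_ hl] := prodZ_uniform hD hb' sb.
move=> e e0; have [M hM] := hl (e / 4) (divr_gt0 e0 (ltr0Sn _ 3)).
have hprod (I : Type) (s : seq I) (F : I -> C -> C) : (forall i, ccont (F i) z) ->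
    ccont (fun x => \prod_(i <- s) F i x) z.
  move=> hF; elim: s => [|i s IH].
    by apply: ccont_eq (ccont_cst 1 z) => x; rewrite big_nil.
  by apply: ccont_eq (ccontM (hF i) IH) => x; rewrite big_cons.
have cp : ccont (fun x => pp (fun k => u k x) M) z by apply: hprod => i; exact: hu.
have [d d0 hd] := cp (e / 4) (divr_gt0 e0 (ltr0Sn _ 3)).
exists (Num.min d (Num.min r r')); first by rewrite !lt_min d0 r0.
move=> x; rewrite lt_min => /andP[xd xr].
have hx := hM x xr; have hz := hM z Xz; have hxz := hd x xd.
have tri (f f' p p' : C) : normc (f - p) <= e / 4 -> normc (f' - p') <= e / 4 ->
    normc (p - p') < e / 4 -> normc (f - f') < e.
  move=> h1 h2 h3; have -> : f - f' = (f - p) + (p - p') - (f' - p') by ring.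
  by apply: le_lt_trans (normcB _ _) _; have := normcD (f - p) (p - p'); lra.
exact: tri hx hz hxz.
Qed.

End Products.

(** * Products of canonical roots and of the ratios of zeros to roots *)

Section RootProducts.
Variable R : realType.
Local Notation C := R[i].
Local Notation cIm := (@complex.Im R).
Local Notation pin := (@pin R).
Implicit Types (z x : C) (k : int) (f : int -> R).

Definition kpi k : C := k%:~R * pi%:C.

Lemma normc_int k : normc (k%:~R : C) = `|k|%N%:R.
Proof.
have -> : (k%:~R : C) = (k%:~R : R)%:C by rewrite rmorph_int.
by rewrite normc_real -intr_norm -abszE pmulrn.
Qed.

Lemma normc_kpi k : normc (kpi k) = `|k|%N%:R * pi.
Proof. by rewrite normcM normc_int normc_real ger0_norm ?pi_ge0. Qed.

Lemma pinE k : k != 0 -> pin k = kpi k :> C.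
Proof. by rewrite /pin => /negbTE ->. Qed.

Lemma kpi_neq0 k : k != 0 -> kpi k != 0.
Proof.
move=> k0; rewrite -normc_gt0 normc_kpi mulr_gt0 ?pi_gt0// ltr0n absz_gt0//.
Qed.

Lemma pin_neq0 k : pin k != 0 :> C.
Proof.
have [->|k0] := eqVneq k 0; first by rewrite /pin eqxx oner_eq0.
by rewrite pinE// kpi_neq0.
Qed.

Lemma kpiN k : kpi (- k) = - kpi k.
Proof. by rewrite /kpi rmorphN mulNr. Qed.

Definition csum2 f := csum (fun i : nat => f i%:Z ^+ 2) /\ csum (fun i : nat => f (- i%:Z) ^+ 2).

Lemma ell2_csum2 f : ell2 f -> csum2 f.
Proof.
rewrite /ell2 => hf.
have key (e : nat -> int) : injective e -> csum (fun i => f (e i) ^+ 2).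
  move=> einj; split => [i|]; first exact: sqr_ge0.
  have f0 k : (0 <= (f k ^+ 2)%:E)%E by rewrite lee_fin sqr_ge0.
  have E : (\esum_(k in range e) (f k ^+ 2)%:E = \esum_(i in [set: nat]) (f (e i) ^+ 2)%:E)%E.
    by apply: esum_image => i j _ _ /einj.
  have le1 : (\esum_(k in range e) (f k ^+ 2)%:E <= \esum_(k in [set: int]) (f k ^+ 2)%:E)%E.
    by rewrite esum_mkcond; apply: le_esum => k _; case: ifP.
  have fin : (\esum_(i in [set: nat]) (f (e i) ^+ 2)%:E < +oo)%E by rewrite -E (le_lt_trans le1).
  have fin' : (\esum_(i in [set: nat]) (f (e i) ^+ 2)%:E)%E \is a fin_num.
    by rewrite ge0_fin_numE// esum_ge0.
  exists (fine (\esum_(i in [set: nat]) (f (e i) ^+ 2)%:E)%E) => n.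
  rewrite -lee_fin fineK// -nneseries_esumT//.
  apply: (le_trans _ (nneseries_lim_ge n _)) => //.
  by rewrite -sumEFin big_mkord.
by split; apply: key => i j; lia.
Qed.

Lemma csum2_le f f' K : (forall k, 0 <= f k) -> (forall k, (K <= `|k|)%N -> f k <= f' k) ->
  csum2 f' -> csum2 f.
Proof.
move=> f0 ff' [h1 h2]; split.
  apply: (csum_le (K := K) _ _ h1) => [i|i Ki]; first exact: sqr_ge0.
  by rewrite lerXn2r ?nnegrE ?(le_trans (f0 _) (ff' _ _))// ff'.
apply: (csum_le (K := K) _ _ h2) => [i|i Ki]; first exact: sqr_ge0.
by rewrite lerXn2r ?nnegrE ?(le_trans (f0 _) (ff' _ _)) ?ff' ?abszN.
Qed.

Lemma csum2D f f' : csum2 f -> csum2 f' -> csum2 (fun k => f k + f' k).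
Proof.
have key (a b : nat -> R) : csum (fun i => a i ^+ 2) -> csum (fun i => b i ^+ 2) ->
    csum (fun i => (a i + b i) ^+ 2).
  move=> ha hb; apply: (csum_le (K := 0) _ _ (csumD (csumZ (ler0n _ 2) ha) (csumZ (ler0n _ 2) hb))) => i.
    exact: sqr_ge0.
  move=> _; have := sqr_ge0 (a i - b i); rewrite sqrrB sqrrD; lra.
by move=> [h1 h2] [h3 h4]; split; exact: key.
Qed.

Lemma csum2Z f (c : R) : csum2 f -> csum2 (fun k => c * f k).
Proof.
have key (a : nat -> R) : csum (fun i => a i ^+ 2) -> csum (fun i => (c * a i) ^+ 2).
  move=> ha; have := csumZ (sqr_ge0 c) ha; congr csum.
  by apply/funext => i; rewrite exprMn.
by move=> [h1 h2]; split; exact: key.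
Qed.

Lemma csum2V : csum2 (fun k => `|k|%N%:R^-1).
Proof.
have h : csum (fun i => i%:R^-1 ^+ 2 : R).
  by have := csum_sqrV R; congr csum; apply/funext => i; rewrite exprVn.
by split; [exact: h|have := h; congr csum; apply/funext => i; rewrite abszN].
Qed.

Lemma csum2_small f e : csum2 f -> (forall k, 0 <= f k) -> 0 < e ->
  exists K, forall k, (K <= `|k|)%N -> f k <= e.
Proof.
move=> [h1 h2] f0 e0; have e2 : 0 < e ^+ 2 by rewrite exprn_gt0.
have [n1 hn1] := csum_small h1 e2; have [n2 hn2] := csum_small h2 e2.
exists (maxn n1 n2) => k; rewrite geq_max => /andP[k1 k2].
rewrite -(@ler_pXn2r _ 2) ?nnegrE ?f0 ?(ltW e0)//.
have [k0|k0] := leP 0 k.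
  by have := hn1 _ k1; rewrite gez0_abs.
by have := hn2 _ k2; rewrite ltz0_abs// opprK.
Qed.

Lemma bounded_except f K (B : R) : (forall k, 0 <= f k) ->
  (forall k, (K <= `|k|)%N -> f k <= B) -> exists2 D, 0 < D & forall k, f k <= D.
Proof.
move=> f0 hB; pose S := \sum_(i < K) (f i%:Z + f (- i%:Z)).
have S0 : 0 <= S by apply: sumr_ge0 => i _; rewrite addr_ge0.
exists (`|B| + S + 1) => [|k]; first by rewrite ltr_wpDl ?addr_ge0.
have [kK|kK] := leqP K `|k|%N.
  by apply: le_trans (hB k kK) _; have := ler_norm B; lra.
apply: (@le_trans _ _ S); last by have := normr_ge0 B; lra.
rewrite /S (bigD1 (Ordinal kK))//= -addrA.
have h (r : R) : 0 <= r -> f k <= f `|k|%:Z + (f (- `|k|%:Z) + r).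
  move=> r0; have [k0|k0] := leP 0 k.
    by rewrite gez0_abs// lerDl addr_ge0.
  by rewrite ltz0_abs// opprK addrCA lerDl addr_ge0.
by apply: h; apply: sumr_ge0 => i _; rewrite addr_ge0.
Qed.

Lemma sumZ_le f N : (forall k, 0 <= f k) ->
  \sum_(i < (2 * N).+1) f (i%:Z - N%:Z) <= \sum_(i < N.+1) f i%:Z + \sum_(i < N.+1) f (- i%:Z).
Proof.
move=> f0; elim: N => [|N IH].
  by rewrite !big_ord_recr !big_ord0 /= subrr oppr0 !add0r lerDl.
rewrite -(big_mkord xpredT (fun i => f (i%:Z - N.+1%:Z))) mulnS add2n big_nat_recr//= big_nat_recl//=.
have -> : (0%:Z - N.+1%:Z = - N.+1%:Z :> int) by rewrite sub0r.
have -> : ((2 * N).+2%:Z - N.+1%:Z = N.+1%:Z :> int) by lia.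
have -> : \sum_(0 <= i < (2 * N).+1) f (i.+1%:Z - N.+1%:Z) = \sum_(i < (2 * N).+1) f (i%:Z - N%:Z).
  by rewrite big_mkord; apply: eq_bigr => i _; congr f; lia.
rewrite [X in _ <= X + _]big_ord_recr [X in _ <= _ + X]big_ord_recr /=; lra.
Qed.

(** In a pair the terms -z/P and z/P cancel. What is left are (y - x)/P, summable since both e and
    1/k are square summable, and a term of order 1/P^2. *)
Lemma tame_lin (a : int -> C) (e : int -> C) z K : csum2 (fun k => normc (e k)) ->
  (forall k, (K <= `|k|)%N -> a k = (kpi k - z + e k) / pin k) -> tame a.
Proof.
move=> [h1 h2] ha; rewrite /tame.
pose Z := normc z.
have Z2 : 0 <= 2 + 2 * Z ^+ 2 by rewrite addr_ge0// mulr_ge0// sqr_ge0.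
apply: (csum_le (K := K.+1) _ _ (csumD (csumZ (ler0n _ 2) h1) (csumD (csumZ (ler0n _ 2) h2)
  (csumZ Z2 (csum_sqrV R))))) => [i|[//|j] Kj]; first exact: normc_ge0.
set i := j.+1 in Kj *.
have i0 : i%:Z != 0 by [].
have Ki : (K <= absz i%:Z)%N by exact: ltnW.
have Ki' : (K <= absz (- i%:Z)%R)%N by rewrite abszN.
rewrite /= -/i (ha _ Ki) (ha _ Ki').
rewrite !pinE ?oppr_eq0// !kpiN; set P := kpi i%:Z.
have P0 : P != 0 by exact: kpi_neq0.
set x := e i%:Z; set y := e (- i%:Z).
have -> : (P - z + x) / P * ((- P - z + y) / - P) - 1 = - ((y - x) / P + (x - z) * (y - z) / P ^+ 2).
  by field.
rewrite normcNE (le_trans (normcD _ _))// !normcM !normcV normcX.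
have nP : i%:R <= normc P.
  by rewrite normc_kpi ler_peMr// (le_trans _ (pi_ge2 R))// ler1n.
have i1 : 0 < i%:R :> R by rewrite ltr0n.
have VP : (normc P)^-1 <= i%:R^-1 by rewrite lef_pV2 ?posrE// (lt_le_trans i1).
have VP2 : (normc P ^+ 2)^-1 <= (i%:R ^+ 2)^-1.
  by rewrite lef_pV2 ?posrE ?exprn_gt0 ?(lt_le_trans i1)// lerXn2r ?nnegrE ?normc_ge0.
set X := normc x; set Y := normc y; have X0 : 0 <= X by exact: normc_ge0.
have Y0 : 0 <= Y by exact: normc_ge0.
have Z0 : 0 <= Z by exact: normc_ge0.
have A : normc (y - x) * (normc P)^-1 <= X ^+ 2 + Y ^+ 2 + (i%:R ^+ 2)^-1.
  apply: (@le_trans _ _ ((X + Y) * i%:R^-1)).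
    rewrite ler_pM ?normc_ge0 ?invr_ge0 ?normc_ge0//.
    by rewrite (addrC X); exact: normcB.
  rewrite -exprVn; set v := i%:R^-1.
  have := sqr_ge0 (X - v); have := sqr_ge0 (Y - v); rewrite !sqrrB.
  have := sqr_ge0 v; have := sqr_ge0 X; have := sqr_ge0 Y; nra.
have B : normc (x - z) * normc (y - z) * (normc P ^+ 2)^-1 <= X ^+ 2 + Y ^+ 2 + (2 * Z ^+ 2) * (i%:R ^+ 2)^-1.
  apply: (@le_trans _ _ ((X + Z) * (Y + Z) * (i%:R ^+ 2)^-1)).
    rewrite ler_pM ?mulr_ge0 ?normc_ge0 ?invr_ge0 ?exprn_ge0 ?normc_ge0//.
    by rewrite ler_pM ?normc_ge0//; exact: normcB.
  have v1 : (i%:R ^+ 2)^-1 <= 1 :> R.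
    by rewrite invf_le1 ?exprn_gt0// exprn_ege1// ler1n.
  have v0 : 0 <= (i%:R ^+ 2)^-1 :> R by rewrite invr_ge0 sqr_ge0.
  set v := (i%:R ^+ 2)^-1 in v0 v1 *.
  have h : (X + Z) * (Y + Z) <= X ^+ 2 + Y ^+ 2 + 2 * Z ^+ 2.
    have := sqr_ge0 (X - Y); have := sqr_ge0 (X - Z); have := sqr_ge0 (Y - Z); rewrite !sqrrB; nra.
  apply: (@le_trans _ _ ((X ^+ 2 + Y ^+ 2 + 2 * Z ^+ 2) * v)); first by rewrite ler_wpM2r.
  rewrite mulrDl lerD2r ler_piMr// addr_ge0 ?sqr_ge0//.
apply: le_trans (lerD A B) _; rewrite -/X -/Y.
have v0 : 0 <= (i%:R ^+ 2)^-1 :> R by rewrite invr_ge0 sqr_ge0.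
rewrite -subr_ge0; have -> : forall p q r t : R, 2 * p + (2 * q + (2 + 2 * t) * r) -
  (p + q + r + (p + q + 2 * t * r)) = r by move=> *; ring.
exact: v0.
Qed.

(** With w = (tau - z) q and d = g^2/(tau - z)^2, the constant 3/4 makes |q|^2 >= 1 - |d| >= 1/4,
    and |q - 1| <= |d| gives the last bound. *)
Lemma root_estimate tau g w z (D : R) : croot tau g w -> 0 < D -> D <= normc (tau - z) ->
  normc g ^+ 2 <= 3 / 4 * D ^+ 2 ->
  [/\ ~ seg tau g z, D / 2 <= normc (w z) & normc (tau - z - w z) <= normc g ^+ 2 / D].
Proof.
move=> hw D0 hD hg.
have T0 : 0 < normc (tau - z) by exact: lt_le_trans hD.
have hD2 : D ^+ 2 <= normc (tau - z) ^+ 2 by rewrite lerXn2r ?nnegrE ?normc_ge0 ?(ltW D0).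
have nz : ~ seg tau g z.
  move=> /seg_bounded; rewrite normcC => h.
  have : normc (tau - z) ^+ 2 <= normc g ^+ 2 by rewrite lerXn2r ?nnegrE ?normc_ge0.
  have := exprn_gt0 2 D0; lra.
have [q [q0 q2 E]] := croot_factor hw nz.
have [h1 h2] := croot_quotient_bound q0 q2.
have d1 : normc (g ^+ 2 / (tau - z) ^+ 2) <= 3 / 4.
  rewrite normcM normcV !normcX ler_pdivrMr ?exprn_gt0//.
  by apply: le_trans hg _; rewrite ler_wpM2l// divr_ge0.
split => //.
  rewrite E normcM; apply: (@le_trans _ _ (normc (tau - z) * (1 / 2))).
    by rewrite mul1r ler_wpM2r// invr_ge0.
  rewrite ler_wpM2l ?normc_ge0// -(@ler_pXn2r _ 2) ?nnegrE ?normc_ge0 ?divr_ge0//.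
  by rewrite expr_div_n expr1n; lra.
have -> : tau - z - w z = - ((tau - z) * (q - 1)) by rewrite E; ring.
rewrite normcNE normcM; apply: (@le_trans _ _ (normc (tau - z) * (normc g ^+ 2 / normc (tau - z) ^+ 2))).
  by rewrite ler_wpM2l ?normc_ge0//; move: h1; rewrite normcM normcV !normcX.
have -> : normc (tau - z) * (normc g ^+ 2 / normc (tau - z) ^+ 2) = normc g ^+ 2 / normc (tau - z).
  by move: (normc (tau - z)) T0 => L L0; field; rewrite gt_eqF.
by rewrite ler_wpM2l ?sqr_ge0// lef_pV2.
Qed.

Variables (tau g sig : int -> C) (w : int -> C -> C) (al : int -> R).
Hypothesis w_root : forall k, croot (tau k) (g k) (w k).
Hypothesis sig_l2 : csum2 (fun k => normc (sig k - kpi k)).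
Hypothesis al0 : forall k, 0 <= al k.
Hypothesis al_l2 : csum2 al.
Hypothesis sig_tau : forall k, normc (sig k - tau k) <= 4 * normc (g k) ^+ 2 * al k.
Hypothesis ends : exists N : nat, forall k, (N <= `|k|)%N ->
  normc (tau k + g k - kpi k) < pi / 3 /\ normc (tau k - g k - kpi k) < pi / 3.

Lemma g_lt : exists N : nat, forall k, (N <= `|k|)%N -> normc (g k) < pi / 3.
Proof.
have [N hN] := ends; exists N => k /hN[h1 h2].
have : normc (2 * g k) < pi / 3 + pi / 3.
  have -> : 2 * g k = (tau k + g k - kpi k) - (tau k - g k - kpi k) by ring.
  by apply: le_lt_trans (normcB _ _) _; exact: ltrD.
by rewrite normcM normc_nat; lra.
Qed.

Lemma g_bound : exists2 G : R, 0 < G & forall k, normc (g k) <= G.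
Proof.
have [N hN] := g_lt; apply: (@bounded_except _ N (pi / 3)) => k; first exact: normc_ge0.
by move=> /hN /ltW.
Qed.

Lemma tau_l2 : csum2 (fun k => normc (tau k - kpi k)).
Proof.
have [G G0 hG] := g_bound.
apply: (@csum2_le _ (fun k => normc (sig k - kpi k) + 4 * G ^+ 2 * al k) 0%N) => [k|k _|].
- exact: normc_ge0.
- have -> : tau k - kpi k = (sig k - kpi k) - (sig k - tau k) by ring.
  apply: le_trans (normcB _ _) _; rewrite lerD2l; apply: le_trans (sig_tau k) _.
  by rewrite ler_wpM2r// ler_wpM2l// lerXn2r ?nnegrE ?normc_ge0 ?(ltW G0).
- by apply: csum2D => //; exact: csum2Z.
Qed.

Lemma tau_bound : exists2 T : R, 0 < T & forall k, normc (tau k - kpi k) <= T.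
Proof.
have [K hK] := csum2_small tau_l2 (fun k => normc_ge0 _) ltr01.
by apply: bounded_except hK => k; exact: normc_ge0.
Qed.

Lemma w_far (Z : R) : exists2 K : nat, (0 < K)%N & forall k z, (K <= `|k|)%N -> normc z <= Z ->
  `|k|%N%:R <= normc (tau k - z) /\ normc (g k) ^+ 2 <= 3 / 4 * `|k|%N%:R ^+ 2.
Proof.
have [G G0 hG] := g_bound; have [T T0 hT] := tau_bound.
exists (Num.truncn (T + `|Z| + 2 * G)).+1 => // k z Kk zZ.
have h : T + `|Z| + 2 * G <= `|k|%N%:R.
  by apply/ltW; apply: lt_le_trans (truncnS_gt _) _; rewrite ler_nat.
have zZ' : normc z <= `|Z| by exact: le_trans (ler_norm _).
have Z0 := normr_ge0 Z.
split.
  have := normc_ge_B (kpi k) (kpi k - (tau k - z)).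
  rewrite subKr normc_kpi.
  have -> : kpi k - (tau k - z) = z - (tau k - kpi k) by ring.
  have := normcB z (tau k - kpi k); have := hT k.
  have : `|k|%N%:R * 2 <= `|k|%N%:R * pi :> R by rewrite ler_wpM2l// pi_ge2.
  lra.
have : normc (g k) <= `|k|%N%:R / 2 by have := hG k; lra.
move=> /(lerXn2r 2); rewrite !nnegrE normc_ge0 divr_ge0// => /(_ isT isT).
rewrite expr_div_n => /le_trans; apply.
have := sqr_ge0 (`|k|%N%:R : R); lra.
Qed.

Lemma tame_w z : tame (fun k => w k z / pin k).
Proof.
have [G G0 hG] := g_bound; have [K K0 hK] := w_far (normc z).
apply: (@tame_lin _ (fun k => w k z - (kpi k - z)) z 0%N); last by move=> k _; congr (_ / _); ring.
apply: (@csum2_le _ (fun k => normc (tau k - kpi k) + G ^+ 2 * `|k|%N%:R^-1) K) => [k|k Kk|].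
- exact: normc_ge0.
- have [h1 h2] := hK k z Kk (lexx _).
  have k0 : 0 < `|k|%N%:R :> R by rewrite ltr0n (leq_trans K0).
  have [_ _ h3] := root_estimate (@w_root k) k0 h1 h2.
  have -> : w k z - (kpi k - z) = (tau k - kpi k) - (tau k - z - w k z) by ring.
  apply: le_trans (normcB _ _) _; rewrite lerD2l; apply: le_trans h3 _.
  by rewrite ler_wpM2r ?invr_ge0// lerXn2r ?nnegrE ?normc_ge0 ?(ltW G0).
- by apply: csum2D; [exact: tau_l2|apply: csum2Z; exact: csum2V].
Qed.

Definition ratio k z := (sig k - z) / w k z.

(** The numerator of ratio - 1 splits into the distance of the zero from the midpoint and the error
    of w against tau - z. *)
Lemma ratio_estimate k z (D : R) : 0 < D -> D <= normc (tau k - z) ->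
  normc (g k) ^+ 2 <= 3 / 4 * D ^+ 2 ->
  normc (ratio k z - 1) <= 2 * (4 * normc (g k) ^+ 2 * al k + normc (g k) ^+ 2 / D) / D.
Proof.
move=> D0 h1 h2; have [h3 h4 h5] := root_estimate (@w_root k) D0 h1 h2.
have w0 := croot_neq0 (@w_root k) h3.
have -> : ratio k z - 1 = ((sig k - tau k) + (tau k - z - w k z)) / w k z.
  by rewrite /ratio; field; exact: w0.
rewrite normcM normcV ler_pdivrMr ?normc_gt0//.
apply: le_trans (normcD _ _) _.
apply: (@le_trans _ _ (4 * normc (g k) ^+ 2 * al k + normc (g k) ^+ 2 / D)); first exact: lerD.
set S := _ + _; have S0 : 0 <= S.
  rewrite /S addr_ge0//; first by rewrite mulr_ge0// mulr_ge0// sqr_ge0.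
  by rewrite divr_ge0 ?sqr_ge0 ?(ltW D0).
have -> : 2 * S / D * normc (w k z) = S * (normc (w k z) / (D / 2)) by field; rewrite gt_eqF.
by rewrite ler_peMr// ler_pdivlMr ?divr_gt0// mul1r.
Qed.

(** The ratios deviate from 1 by O(al_k/|k| + 1/k^2), which is summable without any cancellation in
    the pairs. *)
Lemma ratio_pair_bound (Z : R) : exists K b, csum b /\ forall i z, (K <= i)%N -> normc z <= Z ->
  normc (pairf (fun k => ratio k z) i - 1) <= b i.
Proof.
have [G G0 hG] := g_bound; have [K K0 hK] := w_far Z.
pose c k : R := (4 * G ^+ 2 + 2 * G ^+ 2 + 1) * (al k ^+ 2 + (`|k|%N%:R ^+ 2)^-1).
have cc : csum (fun i => c i%:Z) /\ csum (fun i => c (- i%:Z)).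
  have E : 0 <= 4 * G ^+ 2 + 2 * G ^+ 2 + 1 by have := sqr_ge0 G; lra.
  have [h1 h2] := al_l2; split; apply: csumZ => //.
    by apply: csumD h1 _; exact: csum_sqrV.
  apply: csumD h2 _; have := csum_sqrV R; congr csum; apply/funext => i.
  by rewrite abszN.
have hc k z : (K <= `|k|)%N -> normc z <= Z -> normc (ratio k z - 1) <= c k.
  move=> Kk zZ; have [h1 h2] := hK k z Kk zZ.
  have k0 : 0 < `|k|%N%:R :> R by rewrite ltr0n (leq_trans K0).
  apply: le_trans (ratio_estimate k0 h1 h2) _; rewrite /c.
  set v : R := `|k|%N%:R^-1; have v0 : 0 <= v by rewrite invr_ge0 ltW.
  have -> : (`|k|%N%:R ^+ 2)^-1 = v ^+ 2 :> R by rewrite exprVn.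
  have g2 : normc (g k) ^+ 2 <= G ^+ 2 by rewrite lerXn2r ?nnegrE ?normc_ge0 ?(ltW G0).
  have a0 := al0 k.
  apply: (@le_trans _ _ (2 * (4 * G ^+ 2 * al k + G ^+ 2 * v) * v)).
    by rewrite ler_wpM2r// ler_wpM2l// lerD ?ler_wpM2r// ler_wpM2l.
  have G2 := sqr_ge0 G; set H := G ^+ 2 in G2 *.
  have := sqr_ge0 (al k - v); rewrite sqrrB => h.
  have : H * (al k * v *+ 2) <= H * (al k ^+ 2 + v ^+ 2).
    rewrite ler_wpM2l//; lra.
  have : 0 <= H * al k ^+ 2 by rewrite mulr_ge0 ?sqr_ge0.
  have := sqr_ge0 (al k); have := sqr_ge0 v.
  rewrite !expr2; nra.
have [c1 c2] := cc.
exists K, (fun i => c i%:Z * c (- i%:Z) + (c i%:Z + c (- i%:Z))); split.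
  by apply: csumD; [exact: csumM|exact: csumD].
move=> i z Ki zZ.
case: i Ki => [|j] Ki; first by move: Ki; rewrite leqn0 => /eqP E; move: K0; rewrite E.
rewrite /=; set i := j.+1 in Ki *.
have hx := hc i%:Z z Ki zZ; have hy : normc (ratio (- i%:Z) z - 1) <= c (- i%:Z).
  by apply: hc => //; rewrite abszN.
set x := ratio i%:Z z in hx *; set y := ratio (- i%:Z) z in hy *.
have -> : x * y - 1 = (x - 1) * (y - 1) + ((x - 1) + (y - 1)) by ring.
apply: le_trans (normcD _ _) _; rewrite normcM; apply: lerD.
  by rewrite ler_pM ?normc_ge0.
by apply: le_trans (normcD _ _) _; exact: lerD.
Qed.

(** Half-integer multiples of pi keep the circle at distance at least pi/2 from every k pi. *)
Definition Rad (N : nat) : R := (N%:R + 1 / 2) * pi.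

Lemma Rad_gt0 N : 0 < Rad N.
Proof. by rewrite mulr_gt0 ?pi_gt0// ltr_wpDl// divr_gt0. Qed.

(** The number |n - N - 1/2| - 1/2, so that k pi is at distance at least (1/2 + gapn) pi from the
    circle of radius [Rad N]. *)
Definition gapn (N n : nat) : nat := if (n <= N)%N then (N - n)%N else (n - N.+1)%N.

Lemma kpi_dist N k x : normc x = Rad N ->
  (1 + 2 * (gapn N `|k|)%:R) * (pi / 2) <= normc (kpi k - x).
Proof.
move=> nx; set n := `|k|%N.
have h := normc_dist (kpi k) x; rewrite normc_kpi nx -/n /Rad -mulrBl normrM in h.
apply: le_trans h; rewrite (ger0_norm (pi_ge0 R)).
have -> (p q : R) : p * (q / 2) = p / 2 * q by field.
rewrite ler_wpM2r ?pi_ge0//.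
rewrite /gapn; case: (leqP n N) => nN.
  by rewrite natrB// distrC ger0_norm; [lra|rewrite -(ler_nat R) in nN; lra].
rewrite -(ler_nat R) -natr1 in nN.
rewrite natrB; last by rewrite -(ler_nat R) -natr1.
by rewrite -[N.+1%:R]natr1 ger0_norm; lra.
Qed.

(** On the circle L = |k pi - x| is at least pi/2. For large |k| the midpoint is within pi/20 <=
    L/10 of k pi and the half-gap is below pi/3 <= 2 L/3; for the finitely many other indices L
    itself is large once N is. *)
Lemma ratio_circle : exists N1 C0, 0 <= C0 /\ forall N k x, (N1 <= N)%N -> normc x = Rad N ->
  ~ seg (tau k) (g k) x /\
  normc (ratio k x - 1) <= C0 * (al k / normc (kpi k - x) + (normc (kpi k - x) ^+ 2)^-1).
Proof.
have [G G0 hG] := g_bound; have [T T0 hT] := tau_bound.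
have pi0 := pi_gt0 R.
have [K1 hK1] := g_lt.
have [|K2 hK2] := csum2_small tau_l2 (fun k => normc_ge0 _) (_ : 0 < pi / 20).
  by rewrite divr_gt0.
pose K := maxn K1 K2.
exists (K + Num.truncn (10 * T + 3 * G)).+1, (10 * G ^+ 2 + 10 * G ^+ 2).
split; first by have := sqr_ge0 G; lra.
move=> N k x NN nx; set L := normc (kpi k - x).
have hL : pi / 2 <= L.
  apply: le_trans (kpi_dist k nx); rewrite ler_peMl ?divr_ge0 ?pi_ge0//.
  by rewrite lerDl mulr_ge0.
have L0 : 0 < L by apply: lt_le_trans hL; rewrite divr_gt0.
have [ht hg] : normc (tau k - kpi k) <= L / 10 /\ normc (g k) <= 2 / 3 * L.
  have [Kk|Kk] := leqP K `|k|%N.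
    move: Kk; rewrite geq_max => /andP[k1 k2]; split.
      by apply: le_trans (hK2 k k2) _; lra.
    by apply/ltW; apply: lt_le_trans (hK1 k k1) _; lra.
  have big : 10 * T + 3 * G <= L.
    apply: le_trans (kpi_dist k nx).
    have gn : (Num.truncn (10 * T + 3 * G) < gapn N `|k|)%N by rewrite /gapn; case: ifP; lia.
    have h1 : 10 * T + 3 * G <= (gapn N `|k|)%:R.
      by apply/ltW; apply: lt_le_trans (truncnS_gt _) _; rewrite ler_nat.
    apply: le_trans h1 _; have := pi_ge2 R => p2.
    have g0 : 0 <= (gapn N `|k|)%:R :> R by [].
    have : (1 + 2 * (gapn N `|k|)%:R) * 1 <= (1 + 2 * (gapn N `|k|)%:R) * (pi / 2) :> R.
      rewrite ler_wpM2l//; lra.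
    lra.
  by have := hT k; have := hG k; split; lra.
have hD : 9 / 10 * L <= normc (tau k - x).
  have := normc_ge_B (kpi k - x) (kpi k - tau k).
  have -> : kpi k - x - (kpi k - tau k) = tau k - x by ring.
  rewrite (normcC (kpi k) (tau k)) -/L; lra.
have D0 : 0 < 9 / 10 * L by rewrite mulr_gt0// divr_gt0.
have hg2 : normc (g k) ^+ 2 <= 3 / 4 * (9 / 10 * L) ^+ 2.
  apply: (@le_trans _ _ ((2 / 3 * L) ^+ 2)).
    by rewrite lerXn2r ?nnegrE ?normc_ge0// mulr_ge0 ?divr_ge0// ltW.
  have -> : (2 / 3 * L) ^+ 2 = 4 / 9 * L ^+ 2 by field.
  have -> : 3 / 4 * (9 / 10 * L) ^+ 2 = 243 / 400 * L ^+ 2 by field.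
  rewrite ler_wpM2r ?sqr_ge0//; lra.
have [h3 _ _] := root_estimate (@w_root k) D0 hD hg2; split => //.
apply: le_trans (ratio_estimate D0 hD hg2) _.
have g2 : normc (g k) ^+ 2 <= G ^+ 2 by rewrite lerXn2r ?nnegrE ?normc_ge0 ?(ltW G0).
have a0 := al0 k.
have -> : 2 * (4 * normc (g k) ^+ 2 * al k + normc (g k) ^+ 2 / (9 / 10 * L)) / (9 / 10 * L) =
  normc (g k) ^+ 2 * (80 / 9 * (al k / L) + 200 / 81 * (L ^+ 2)^-1).
  by field; rewrite gt_eqF.
have aL : 0 <= al k / L by rewrite divr_ge0// ltW.
have L2 : 0 <= (L ^+ 2)^-1 by rewrite invr_ge0 sqr_ge0.
apply: (@le_trans _ _ (G ^+ 2 * (80 / 9 * (al k / L) + 200 / 81 * (L ^+ 2)^-1))).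
  have c1 : 0 <= 80 / 9 :> R by lra.
  have c2 : 0 <= 200 / 81 :> R by lra.
  exact: ler_wpM2r (addr_ge0 (mulr_ge0 c1 aL) (mulr_ge0 c2 L2)) _ _ g2.
have := mulr_ge0 (sqr_ge0 G) aL; have := mulr_ge0 (sqr_ge0 G) L2; lra.
Qed.

(** 1/a^2 <= 1/(a - 1) - 1/a telescopes on either side of N + 1/2 and gives 2/(Y - 1), which is at
    most 4/Y for Y >= 2. *)
Lemma gap_sum (Y : R) N n : 2 <= Y -> \sum_(i < n) ((Y + (gapn N i)%:R) ^+ 2)^-1 <= 4 / Y.
Proof.
move=> Y2.
have tele (a : R) : 1 < a -> (a ^+ 2)^-1 <= (a - 1)^-1 - a^-1.
  move=> a1; have a0 : 0 < a by lra.
  have a10 : 0 < a - 1 by lra.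
  have -> : (a - 1)^-1 - a^-1 = ((a - 1) * a)^-1 by field; rewrite !gt_eqF.
  rewrite lef_pV2 ?posrE ?exprn_gt0 ?mulr_gt0// expr2 ler_wpM2r ?(ltW a0)//; lra.
have Y1 : 0 < Y - 1 by lra.
have low m : (m <= N.+1)%N -> \sum_(i < m) ((Y + (gapn N i)%:R) ^+ 2)^-1 <= (Y - 1 + (N.+1 - m)%:R)^-1.
  elim: m => [|m IH] mN; first by rewrite big_ord0 invr_ge0 addr_ge0// ltW.
  rewrite big_ord_recr /=; apply: le_trans (lerD (IH (ltnW mN)) (lexx _)) _.
  rewrite /gapn; have -> : (m <= N)%N by [].
  rewrite subSn// -[(N - m).+1%:R]natr1; set d : R := (N - m)%:R.
  have d0 : 0 <= d by [].
  have := tele (Y + d) (_ : 1 < Y + d).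
  have -> : 1 < Y + d by lra.
  move=> /(_ isT); rewrite -/d.
  have -> : Y - 1 + (d + 1) = Y + d by ring.
  have -> : Y - 1 + d = Y + d - 1 by ring.
  lra.
have high m : \sum_(i < N.+1 + m) ((Y + (gapn N i)%:R) ^+ 2)^-1 <= 2 / (Y - 1) - (Y - 1 + m%:R)^-1.
  elim: m => [|m IH].
    rewrite addn0; apply: le_trans (low _ (leqnn _)) _.
    by rewrite subnn addr0; lra.
  rewrite addnS big_ord_recr /=; apply: le_trans (lerD IH (lexx _)) _.
  rewrite /gapn; have -> : (N.+1 + m <= N)%N = false by lia.
  rewrite addKn -[m.+1%:R]natr1; set d : R := m%:R; have d0 : 0 <= d by [].
  have := tele (Y + d) (_ : 1 < Y + d).
  have -> : 1 < Y + d by lra.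
  move=> /(_ isT).
  have -> : Y - 1 + (d + 1) = Y + d by ring.
  have -> : Y - 1 + d = Y + d - 1 by ring.
  lra.
have fin : 2 / (Y - 1) <= 4 / Y.
  rewrite ler_pdivrMr// mulrAC ler_pdivlMr; lra.
have [nN|nN] := leqP n N.+1.
  apply: le_trans (low n nN) _; apply: (@le_trans _ _ (Y - 1)^-1).
    by rewrite lef_pV2 ?posrE ?lerDl// ltr_wpDr.
  have : 0 < (Y - 1)^-1 by rewrite invr_gt0.
  lra.
have := high (n - N.+1)%N; rewrite subnKC ?(ltnW nN)// => /le_trans; apply.
apply: le_trans fin; rewrite gerBl invr_ge0 addr_ge0//.
exact: ltW.
Qed.

(** The weight [eta] splits al_k/L into eta al_k^2 + 1/(eta L^2), and L >= (Y + gapn)/2 leads to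
    [gap_sum]. The alternative for Y serves two purposes: Y = 2 is available on the whole circle, a
    large Y only far from the real axis. *)
Lemma ratio_circle_sum : exists N1 C1, 0 <= C1 /\ forall N x (eta Y : R) M, (N1 <= N)%N ->
  normc x = Rad N -> 0 < eta -> 2 <= Y -> (Y <= 2 \/ Y <= `|cIm x|) ->
  \sum_(i < (2 * M).+1) normc (ratio (i%:Z - M%:Z) x - 1) <= C1 * (eta + (eta^-1 + 1) / Y).
Proof.
have [N1 [C0 [C00 h]]] := ratio_circle.
have [[_ [B1 hB1]] [_ [B2 hB2]]] := al_l2.
have B0 : 0 <= B1 + B2.
  have := hB1 0%N; have := hB2 0%N; rewrite !big_ord0; lra.
exists N1, (C0 * (B1 + B2 + 32)); split; first by rewrite mulr_ge0// addr_ge0.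
move=> N x eta Y M NN nx e0 Y2 hY.
have pi2 := pi_ge2 R.
have dist k : (Y + (gapn N `|k|)%:R) / 2 <= normc (kpi k - x).
  have h1 := kpi_dist k nx; set d : R := (gapn N `|k|)%:R in h1 *.
  have d0 : 0 <= d by [].
  have h2 : 1 + 2 * d <= normc (kpi k - x).
    apply: le_trans h1; rewrite ler_peMr//; lra.
  case: hY => hY; first lra.
  have : `|cIm x| <= normc (kpi k - x).
    have -> : `|cIm x| = `|cIm (kpi k - x)|.
      rewrite cImD cImN /kpi.
      have -> : (k%:~R : C) = (k%:~R : R)%:C by rewrite rmorph_int.
      by rewrite cImM /= !mul0r mulr0 addr0 sub0r normrN.
    exact: Im_le_normc.
  lra.
pose f k := C0 * (eta * al k ^+ 2 + (eta^-1 + 1) * (4 * ((Y + (gapn N `|k|)%:R) ^+ 2)^-1)).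
have fr k : normc (ratio k x - 1) <= f k.
  have [_ h2] := h N k x NN nx; apply: le_trans h2 _; rewrite /f ler_wpM2l//.
  set L := normc _; set d := (Y + _) in dist *.
  have d0 : 0 < d by rewrite /d ltr_wpDr//; lra.
  have L0 : 0 < L by apply: lt_le_trans (dist k); rewrite divr_gt0.
  have VL : (L ^+ 2)^-1 <= 4 * (d ^+ 2)^-1.
    have -> : 4 * (d ^+ 2)^-1 = ((d / 2) ^+ 2)^-1 by field; rewrite gt_eqF.
    rewrite lef_pV2 ?posrE ?exprn_gt0 ?divr_gt0// lerXn2r ?nnegrE ?divr_ge0 ?(ltW L0) ?(ltW d0)//.
    exact: dist.
  have eV : 0 < eta^-1 by rewrite invr_gt0.
  apply: (@le_trans _ _ (eta * al k ^+ 2 + (eta^-1 + 1) * (L ^+ 2)^-1)); last first.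
    by rewrite lerD2l ler_wpM2l// addr_ge0// ltW.
  rewrite mulrDl mul1r addrA lerD2r -exprVn; set v := L^-1.
  have : 0 <= eta * (al k - eta^-1 * v) ^+ 2 by rewrite mulr_ge0 ?sqr_ge0// ltW.
  have -> : eta * (al k - eta^-1 * v) ^+ 2 = eta * al k ^+ 2 - 2 * (al k * v) + eta^-1 * v ^+ 2.
    by field; rewrite gt_eqF.
  have := addr_ge0 (mulr_ge0 (ltW e0) (sqr_ge0 (al k))) (mulr_ge0 (ltW eV) (sqr_ge0 v)).
  lra.
have f0 k : 0 <= f k by apply: le_trans (fr k); exact: normc_ge0.
apply: (@le_trans _ _ (\sum_(i < (2 * M).+1) f (i%:Z - M%:Z))); first by apply: ler_sum => i _; exact: fr.
apply: le_trans (sumZ_le M f0) _.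
have eV : 0 < eta^-1 by rewrite invr_gt0.
have half (a : nat -> R) B : (forall n, \sum_(i < n) a i ^+ 2 <= B) ->
    \sum_(i < M.+1) (C0 * (eta * a i ^+ 2 + (eta^-1 + 1) * (4 * ((Y + (gapn N i)%:R) ^+ 2)^-1)))
    <= C0 * (eta * B + (eta^-1 + 1) * (16 / Y)).
  move=> hB; rewrite -mulr_sumr ler_wpM2l// big_split /= -!mulr_sumr lerD//.
    exact: ler_wpM2l (ltW e0) _ _ (hB M.+1).
  rewrite ler_wpM2l ?addr_ge0 ?(ltW eV)//.
  have := gap_sum N M.+1 Y2; lra.
have -> : C0 * (B1 + B2 + 32) * (eta + (eta^-1 + 1) / Y) =
  C0 * (eta * B1 + (eta^-1 + 1) * (16 / Y)) + C0 * (eta * B2 + (eta^-1 + 1) * (16 / Y))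
  + C0 * (32 * eta + (B1 + B2) * ((eta^-1 + 1) / Y)) by ring.
have rest : 0 <= C0 * (32 * eta + (B1 + B2) * ((eta^-1 + 1) / Y)).
  have Y0 : 0 <= Y by lra.
  have q0 : 0 <= (eta^-1 + 1) / Y by rewrite divr_ge0// addr_ge0// ltW.
  by rewrite mulr_ge0// addr_ge0// mulr_ge0// ltW.
have s1 := half (fun i => al i%:Z) B1 hB1; have s2 := half (fun i => al (- i%:Z)) B2 hB2.
have E1 : \sum_(i < M.+1) f i%:Z = \sum_(i < M.+1) (C0 * (eta * al i%:Z ^+ 2 + (eta^-1 + 1) * (4 * ((Y + (gapn N i)%:R) ^+ 2)^-1))) by [].
have E2 : \sum_(i < M.+1) f (- i%:Z) = \sum_(i < M.+1) (C0 * (eta * al (- i%:Z) ^+ 2 + (eta^-1 + 1) * (4 * ((Y + (gapn N i)%:R) ^+ 2)^-1))).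
  by apply: eq_bigr => i _; rewrite /f abszN.
rewrite E1 E2; lra.
Qed.

Lemma tame_ratio z : tame (fun k => ratio k z).
Proof.
have [K [b [sb hb]]] := ratio_pair_bound (normc z).
apply: (csum_le (K := K) _ _ sb) => [i|i Ki]; first exact: normc_ge0.
exact: hb.
Qed.

Definition ratio_prod z := prodZ (fun k => ratio k z).

(** Boundedness comes from eta = 1 and Y = 2. Closeness to 1 needs a small eta and then Y of the
    order of eta^-2, hence points far from the real axis. *)
Lemma ratio_prod_circle : exists N1, 
  (exists B, forall N x, (N1 <= N)%N -> normc x = Rad N -> normc (ratio_prod x) <= B) /\
  forall e : R, 0 < e -> exists Y, forall N x, (N1 <= N)%N -> normc x = Rad N -> Y <= `|cIm x| ->
    normc (ratio_prod x - 1) <= e.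
Proof.
have [N1 [C1 [C10 h]]] := ratio_circle_sum; exists N1; split.
  exists (expR (C1 * (1 + (1^-1 + 1) / 2))) => N x NN nx.
  have [l [hl El _]] := tame_cvg (tame_ratio x).
  have := prodZ_norm_bound hl (fun M => h N x 1 2 M NN nx ltr01 (lexx _) (or_introl (lexx _))).
  rewrite /ratio_prod El; have := normcD (l - 1) 1; rewrite subrK normc1; lra.
move=> e e0; have [d d0 hd] := expR_small e0.
have C2 : 0 < C1 + 1 by rewrite ltr_wpDl.
pose eta := d / (2 * (C1 + 1)); have eta0 : 0 < eta by rewrite divr_gt0// mulr_gt0.
have eV : 0 < eta^-1 + 1 by rewrite addr_gt0// invr_gt0.
exists (2 + (eta^-1 + 1) / eta) => N x NN nx hY.
set Y := 2 + (eta^-1 + 1) / eta in hY.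
have Y2 : 2 <= Y by rewrite /Y lerDl divr_ge0// ltW.
have [l [hl El _]] := tame_cvg (tame_ratio x).
have := prodZ_norm_bound hl (fun M => h N x eta Y M NN nx eta0 Y2 (or_intror hY)).
rewrite /ratio_prod El => /le_trans; apply; apply: hd.
have hle : (eta^-1 + 1) / Y <= eta.
  have Y0 : 0 < Y by lra.
  rewrite ler_pdivrMr// mulrC -ler_pdivrMr// /Y; lra.
apply: (@le_trans _ _ (C1 * (eta + eta))); first by rewrite ler_wpM2l// lerD2l.
have -> : C1 * (eta + eta) = C1 / (C1 + 1) * d by rewrite /eta; field; rewrite gt_eqF.
by rewrite ler_piMl ?(ltW d0)// ler_pdivrMr// mul1r lerDl.
Qed.

Lemma ratio_prod_ccont0 : (forall k, ~ seg (tau k) (g k) 0) -> ccont ratio_prod 0.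
Proof.
move=> h0; have [K [b [sb hb]]] := ratio_pair_bound 1.
apply: (@ccont_prodZ _ _ _ 1 K b) => // [k|i x Ki].
  rewrite /ratio; apply: ccontM.
    apply: (ccont_eq (f := fun u => sig k + -1 * u)); first by move=> u; rewrite mulN1r.
    by apply: ccontD; [exact: ccont_cst|apply: ccontM; [exact: ccont_cst|exact: ccont_id]].
  apply: ccontVf; first exact: croot_neq0 (@w_root k) (h0 k).
  by have [] := w_root (h0 k).
by rewrite subr0 => /ltW; exact: hb.
Qed.

End RootProducts.

(** * Root families, pullbacks, circles and inverted discs *)

Section Families.
Variable R : realType.
Local Notation C := R[i].
Local Notation cIm := (@complex.Im R).
Local Notation pin := (@pin R).
Implicit Types (z x a : C) (k : int) (f : C -> C).

(** The factor 4 appears because [g] is half of the gap length, so that 4 |g|^2 = |gamma|^2; pi/3 is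
    the radius of the discs D_k. *)
Definition rootfam (tau g sig : int -> C) (w : int -> C -> C) :=
  [/\ forall k, croot (tau k) (g k) (w k),
      csum2 (fun k => normc (sig k - kpi R k)),
      exists al : int -> R, [/\ forall k, 0 <= al k, csum2 al &
        forall k, normc (sig k - tau k) <= 4 * normc (g k) ^+ 2 * al k]
    & exists N : nat, forall k, (N <= `|k|)%N ->
        normc (tau k + g k - kpi R k) < pi / 3 /\ normc (tau k - g k - kpi R k) < pi / 3].

Section RootFamily.
Variables (tau g sig : int -> C) (w : int -> C -> C).
Hypothesis F : rootfam tau g sig w.

Lemma rootfam_croot k : croot (tau k) (g k) (w k).
Proof. by have [h _ _ _] := F; exact: h. Qed.

Lemma rootfam_tame_w z : tame (fun k => w k z / pin k).
Proof. by have [h1 h2 [al [h3 h4 h5]] h6] := F; exact: tame_w h1 h2 h3 h4 h5 h6 z. Qed.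

Lemma rootfam_tame_sig z : tame (fun k => (sig k - z) / pin k).
Proof.
have [_ h2 _ _] := F; apply: (@tame_lin _ _ (fun k => sig k - kpi R k) z 0%N) => // k _.
by congr (_ / _); ring.
Qed.

Lemma rootfam_pair_bound (Z : R) : exists K b, csum b /\ forall i z, (K <= i)%N -> normc z <= Z ->
  normc (pairf (fun k => ratio sig w k z) i - 1) <= b i.
Proof. by have [h1 h2 [al [h3 h4 h5]] h6] := F; exact: ratio_pair_bound h1 h2 h3 h4 h5 h6 Z. Qed.

Lemma rootfam_tame_ratio z : tame (fun k => ratio sig w k z).
Proof. by have [h1 h2 [al [h3 h4 h5]] h6] := F; exact: tame_ratio h1 h2 h3 h4 h5 h6 z. Qed.

Lemma rootfam_circle : exists N1 : nat,
  (exists B, forall N x, (N1 <= N)%N -> normc x = Rad R N -> normc (ratio_prod sig w x) <= B) /\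
  forall e : R, 0 < e -> exists Y, forall N x, (N1 <= N)%N -> normc x = Rad R N -> Y <= `|cIm x| ->
    normc (ratio_prod sig w x - 1) <= e.
Proof. by have [h1 h2 [al [h3 h4 h5]] h6] := F; exact: ratio_prod_circle h1 h2 h3 h4 h5 h6. Qed.

Lemma rootfam_ccont0 : (forall k, ~ seg (tau k) (g k) 0) -> ccont (ratio_prod sig w) 0.
Proof. by have [h1 h2 [al [h3 h4 h5]] h6] := F; exact: ratio_prod_ccont0 h1 h2 h3 h4 h5 h6. Qed.

(** Index 0 is set apart because it is the one factor in which the quotient and its reflection will
    differ. *)
Definition ratio_prod0 z := prodZ (fun k => if k == 0 then 1 else ratio sig w k z).

Lemma pairf_skip0 (a : int -> C) i : (0 < i)%N ->
  pairf (fun k => if k == 0 then 1 else a k) i = pairf a i.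
Proof. by case: i => // i _ /=. Qed.

Lemma tame_skip0 (a : int -> C) : tame a -> tame (fun k => if k == 0 then 1 else a k).
Proof.
move=> ha; apply: (csum_le (K := 1) _ _ ha) => [i|i i0]; first exact: normc_ge0.
by rewrite pairf_skip0.
Qed.

Lemma pp_skip0 (a : int -> C) N : pp a N = a 0 * pp (fun k => if k == 0 then 1 else a k) N.
Proof.
by rewrite !ppE !big_ord_recl /= mul1r.
Qed.

Lemma ratio_prodE z : ratio_prod sig w z = ratio sig w 0 z * ratio_prod0 z.
Proof.
have [l [hl El _]] := tame_cvg (tame_skip0 (rootfam_tame_ratio z)).
rewrite /ratio_prod /ratio_prod0 El; apply: prodZ_lim.
apply: ccvg_eq (ccvgM (ccvg_cst (ratio sig w 0 z)) hl); exists 0%N => N _.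
by rewrite [RHS]pp_skip0.
Qed.

Lemma ratio_prod0_unifrat (A X : set C) (phi : C -> C) (Z : R) :
  separated_from A X -> unifrat A X phi -> (forall x, X x -> normc (phi x) <= Z) ->
  (forall k, k != 0 -> unifrat A X (fun x => (w k (phi x))^-1)) ->
  unifrat A X (fun x => ratio_prod0 (phi x)).
Proof.
move=> AX hphi hZ hw; have [K [b [sb hb]]] := rootfam_pair_bound Z.
apply: (@unifrat_prodZ _ _ _ (fun k x => if k == 0 then 1 else ratio sig w k (phi x)) K.+1 b AX) => //.
  move=> k; have [k0|k0] := eqVneq k 0; first exact: unifrat_cst.
  rewrite /ratio; apply: unifratM => //; last exact: hw.
  by apply: unifratB => //; exact: unifrat_cst.
move=> i x Ki Xx; rewrite pairf_skip0 ?(leq_trans _ Ki)//.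
by apply: hb; [exact: ltnW|exact: hZ].
Qed.

End RootFamily.

(** It is enough to approximate [phi] and the polar parts 1/(phi - a). *)
Lemma unifrat_pullback (A X A' X' : set C) (phi : C -> C) f : separated_from A X ->
  (forall x, X x -> X' (phi x)) -> unifrat A X phi ->
  (forall a, A' a -> unifrat A X (fun x => (phi x - a)^-1)) ->
  unifrat A' X' f -> unifrat A X (fun x => f (phi x)).
Proof.
move=> AX hX hphi hp; elim=> [k|a k Aa|c {}f h _ IHf _ IHg|{}f h _ IH hl].
- exact: unifratX.
- by apply: unifratX => //; exact: hp.
- exact: unifrat_lin.
- apply: (@unifrat_lim _ _ _ _ (fun n x => h n (phi x))) => // e e0.
  by have [n hn] := hl e e0; exists n => x /hX; exact: hn.
Qed.

Lemma unifrat_recip (A X : set C) : separated_from A X -> A 0 -> unifrat A X (@recip R).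
Proof.
move=> AX A0; apply: unifrat_eq (unifratZ (16^-1) (unifrat_inv X A0)) => z _.
by rewrite subr0 /recip invfM.
Qed.

(** 1/(recip x - a) = - a^-1 x/(x - recip a), and 16 x for a = 0. *)
Lemma unifrat_recip_inv (A X : set C) a : separated_from A X -> A 0 -> A (recip a) ->
  unifrat A X (fun x => (recip x - a)^-1).
Proof.
move=> AX A0 Aa; have [a0|a0] := eqVneq a 0.
  apply: unifrat_eq (unifratZ 16 (unifrat_id A X)) => z _.
  by rewrite a0 subr0 /recip invrK.
apply: unifrat_eq (unifratZ (- a^-1) (unifrat_mulX AX (unifrat_inv X Aa))) => z Xz.
have z0 := separated_neq AX A0 Xz; have za := separated_neq AX Aa Xz.
rewrite subr0 in z0; rewrite /recip in za *.
have n1 : (16 * z)^-1 - a != 0.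
  apply: contra za; rewrite !subr_eq0 => /eqP <-.
  by rewrite invfM invrK mulrA mulVf ?mul1r// pnatr_eq0.
have n2 : 1 - 16 * z * a != 0.
  apply: contra n1; rewrite subr_eq0 => /eqP E.
  rewrite subr_eq0; apply/eqP; apply: (@mulfI _ (16 * z)); first by rewrite mulf_neq0 ?pnatr_eq0.
  by rewrite mulfV ?mulf_neq0 ?pnatr_eq0.
have n3 : 16 * z * a - 1 != 0 by rewrite -oppr_eq0 opprB.
have E1 : z - (16 * a)^-1 = (16 * z * a - 1) / (16 * a) by field.
have E2 : (16 * z)^-1 - a = (1 - 16 * z * a) / (16 * z) by field.
rewrite E1 E2 !invfM !invrK.
have -> : (16 * z * a - 1)^-1 = - (1 - 16 * z * a)^-1 by rewrite -invrN opprB.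
by field; rewrite n2 a0.
Qed.

Lemma unifrat_opp_inv (A X : set C) a : separated_from A X -> A (- a) ->
  unifrat A X (fun x => (- x - a)^-1).
Proof.
move=> AX Aa; apply: unifrat_eq (unifratZ (-1) (unifrat_inv X Aa)) => z _.
by rewrite mulN1r opprK -invrN opprD.
Qed.

Lemma unifrat_Nrecip_inv (A X : set C) a : separated_from A X -> A 0 -> A (- recip a) ->
  unifrat A X (fun x => (- recip x - a)^-1).
Proof.
move=> AX A0 Aa.
have Aa' : A (recip (- a)) by rewrite recipN.
apply: unifrat_eq (unifratZ (-1) (unifrat_recip_inv AX A0 Aa')) => z _.
by rewrite mulN1r opprK -invrN opprD.
Qed.

Lemma isAC_id : isAC 0 1 (fun t : R => t%:C) (fun=> 1 : C).
Proof.
split; first by split; exact: rintegrable_cst.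
move=> x /andP[x0 x1]; rewrite rmorph0 add0r; apply: complex_eq; rewrite /cint /=.
  rewrite Rintegral_cst//= lebesgue_measure_itv /= lte_fin; case: ltP => h /=.
    by rewrite ?subr0 ?mul1r.
  by rewrite ?mulr0; apply/le_anti; rewrite h x0.
by rewrite Rintegral_cst// mul0r.
Qed.

Definition circ (t : R) : C := cexp ((2 * pi)%:C * 'i * t%:C).

Lemma circE t : circ t = cos (2 * pi * t) +i* sin (2 * pi * t).
Proof.
have E : (2 * pi)%:C * 'i * t%:C = 0 +i* (2 * pi * t) :> C.
  by apply: complex_eq; rewrite !(cReM, cImM) /=; ring.
by rewrite /circ E /cexp /= expR0 mul1r.
Qed.

Lemma normc_circ t : normc (circ t) = 1.
Proof. by rewrite circE /= cos2Dsin2 sqrtr1. Qed.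

Lemma circ_neq0 t : circ t != 0. Proof. exact: cexp_neq0. Qed.

Lemma circ01 : circ 0 = circ 1.
Proof.
rewrite !circE mulr0 cos0 sin0 mulr1.
have -> : 2 * pi = pi *+ 2 :> R by rewrite mulr_natl.
by rewrite cos2pi sin2pi.
Qed.

Lemma isAC_circ : isAC 0 1 circ (fun t => circ t * ((2 * pi)%:C * 'i)).
Proof.
have := isAC_cexp ler01 (isACZ ((2 * pi)%:C * 'i) isAC_id).
by apply: isAC_eq => t _ //; rewrite mulr1.
Qed.

Definition circle (c : C) (rho : R) (t : R) : C := c + rho%:C * circ t.
Definition dcircle (rho : R) (t : R) : C := rho%:C * (circ t * ((2 * pi)%:C * 'i)).

Lemma isAC_circle c rho : isAC 0 1 (circle c rho) (dcircle rho).
Proof.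
apply: isAC_eq (isACD (isAC_cst 0 1 c) (isACZ rho%:C isAC_circ)) => t _ //.
by rewrite add0r.
Qed.

Lemma circle01 c rho : circle c rho 0 = circle c rho 1.
Proof. by rewrite /circle circ01. Qed.

Lemma circle_dist c rho t : 0 <= rho -> normc (circle c rho t - c) = rho.
Proof.
by move=> r0; rewrite /circle addrAC subrr add0r normcM normc_circ mulr1 normc_real ger0_norm.
Qed.

Lemma circle_wind_out c rho a : 0 <= rho -> rho < normc (a - c) ->
  pint (circle c rho) (dcircle rho) (fun z => (z - a)^-1) = 0.
Proof.
move=> r0 ra; apply: (winding_outside (isAC_circle c rho) (circle01 c rho) _ ra) => t _.
by rewrite circle_dist.
Qed.

(** At the centre the integrand is constant. The image of any other interior point under inversion
    lies outside the inverted circle, so [inv_winding] gives that point the winding number of the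
    centre. *)
Lemma circle_wind_in c rho a : 0 < rho -> normc (a - c) < rho ->
  pint (circle c rho) (dcircle rho) (fun z => (z - a)^-1) = 2 * pi%:C * 'i.
Proof.
move=> r0 ra; have rC : rho%:C != 0 :> C.
  by rewrite -normc_gt0 normc_real ger0_norm// ltW.
have center : pint (circle 0 rho) (dcircle rho) (fun z => (z - 0)^-1) = 2 * pi%:C * 'i.
  rewrite /pint (@cint_eq_cc _ _ _ _ (fun=> (2 * pi)%:C * 'i * 1)); last first.
    by move=> t _; rewrite /circle /dcircle subr0 add0r; field; rewrite rC circ_neq0.
  rewrite cintZ; last exact: isAC_id.1.
  have [_ /(_ 1)] := isAC_id; rewrite ler01 lexx => /(_ isT); rewrite rmorph0 add0r => <-.
  by rewrite mulr1 rmorphM rmorph_nat.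
have shift : pint (circle c rho) (dcircle rho) (fun z => (z - a)^-1) =
    pint (circle 0 rho) (dcircle rho) (fun z => (z - (a - c))^-1).
  apply: cint_eq_cc => t _; congr (_^-1 * _); rewrite /circle; ring.
rewrite shift; set b := a - c in ra *.
have [->|b0] := eqVneq b 0; first exact: center.
have x0 t : 0 <= t <= 1 -> circle 0 rho t != 0.
  by move=> _; rewrite /circle add0r mulf_neq0// circ_neq0.
have xb t : 0 <= t <= 1 -> circle 0 rho t != b.
  move=> _; apply: contraTneq ra => <-; have := circle_dist 0 t (ltW r0).
  by rewrite subr0 => ->; rewrite ltxx.
have E := inv_winding (isAC_circle 0 rho) x0 xb b0.
have hI := inv_path_isAC (isAC_circle 0 rho) x0.
have cl : inv_path (circle 0 rho) 0 = inv_path (circle 0 rho) 1 by rewrite /inv_path circle01.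
have Z : pint (inv_path (circle 0 rho)) (inv_dpath (circle 0 rho) (dcircle rho))
    (fun z => (z - (16 * b)^-1)^-1) = 0.
  apply: (@winding_outside _ _ _ 0 _ (16 * rho)^-1 hI cl) => [t _|].
    rewrite subr0 /inv_path normcV normcM normc_nat.
    by have := circle_dist 0 t (ltW r0); rewrite subr0 => ->.
  rewrite subr0 normcV normcM normc_nat ltf_pV2 ?posrE ?mulr_gt0 ?normc_gt0//.
  by rewrite ltr_pM2l.
by rewrite -center; apply/eqP; rewrite -subr_eq0 -E Z.
Qed.

(** The second form covers the neighborhoods of the second family, which are obtained from discs by
    inversion, without a computation of their shape. *)
Definition diskoid (V : set C) := (exists c rho, V = disc c rho) \/
  (~ V 0 /\ exists c rho, [set recip z | z in V] = disc c rho).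

(** Winding numbers are carried over to the disc by inversion. The one around 0 is settled
    separately: [recip 0] is 0, which lies outside the disc. *)
Lemma diskoid_winding V (x dx : R -> C) a : diskoid V -> isAC 0 1 x dx -> x 0 = x 1 ->
  (forall t, 0 <= t <= 1 -> V (x t)) -> ~ V a -> pint x dx (fun z => (z - a)^-1) = 0.
Proof.
move=> [[c [rho ->]]|[V0 [c [rho E]]]] hx xc hV Va; first exact: winding_disc hV Va.
have x0 t : 0 <= t <= 1 -> x t != 0.
  by move=> /hV Vx; apply/eqP => x0; rewrite x0 in Vx.
have hI := inv_path_isAC hx x0.
have cl : inv_path x 0 = inv_path x 1 by rewrite /inv_path xc.
have hD t : 0 <= t <= 1 -> disc c rho (inv_path x t).
  by move=> t01; rewrite -E; exists (x t) => //; exact: hV.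
have out b : ~ V b -> pint (inv_path x) (inv_dpath x dx) (fun z => (z - recip b)^-1) = 0.
  move=> Vb; apply: winding_disc hD _ => //.
  by rewrite -E => -[z Vz /recip_inj zb]; apply: Vb; rewrite -zb.
have W0 : pint x dx (fun z => (z - 0)^-1) = 0.
  apply: oppr_inj; rewrite -(inv_winding0 hx x0) [RHS]oppr0; have := out 0 V0.
  by rewrite /recip mulr0 invr0.
have [->//|a0] := eqVneq a 0.
have xa t : 0 <= t <= 1 -> x t != a.
  by move=> /hV Vx; apply/eqP => xa; rewrite xa in Vx.
have := inv_winding hx x0 xa a0; rewrite W0 subr0 => <-.
exact: (out a Va).
Qed.

End Families.

(** * The quotient of psi_n by the root of chi_p *)

Section Quotients.
Variable R : realType.
Local Notation C := R[i].
Local Notation pin := (@pin R).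
Implicit Types (z a : C) (k : int).

Definition skip0 (a : int -> C) k : C := if k == 0 then 1 else a k.

Lemma pin0 : pin 0 = 1.
Proof. by rewrite /pin eqxx. Qed.

Lemma prodZ_split0 (a : int -> C) : tame a -> prodZ a = a 0 * prodZ (skip0 a).
Proof.
move=> ha; have [l [hl El _]] := tame_cvg (tame_skip0 ha).
rewrite [prodZ (skip0 a)]El; apply: prodZ_lim.
by apply: ccvg_eq (ccvgM (ccvg_cst (a 0)) hl); exists 0%N => N _; rewrite [RHS]pp_skip0.
Qed.

(* [t], [g], [w] are the midpoints, half-lengths and canonical roots of the gaps G_{1,k} of
   a potential v, and [A] the neighborhoods U_{1,k}; the primed data and [B] below are those
   of Irec v, so that the gaps and neighborhoods of the second family of v are their images
   under -1/(16 z). *)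
Definition half (t g : int -> C) (w : int -> C -> C) (A : int -> set C) :=
  [/\ forall k, croot (t k) (g k) (w k),
      forall k, seg (t k) (g k) `<=` A k,
      (forall k, exists c rho, A k = disc c rho) /\ (forall k, ~ A k 0),
      (forall k l z, A k z -> A l z -> k = l) /\
        exists N : nat, forall k, (N <= `|k|)%N -> A k = disc (kpi R k) (pi / 3)
    & forall k, k != 0 -> [/\ forall z, A (- k) z -> A k (- z), t (- k) = - t k & g (- k) = g k]].

Section Half.
Variables (t g : int -> C) (w : int -> C -> C) (A : int -> set C).
Hypothesis hA : half t g w A.

Lemma half_root k : croot (t k) (g k) (w k).
Proof. by have [h _ _ _ _] := hA. Qed.

Lemma half_seg k z : seg (t k) (g k) z -> A k z.
Proof. by have [_ h _ _ _] := hA; exact: h. Qed.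

Lemma half_off0 k : ~ seg (t k) (g k) 0.
Proof. by move=> /half_seg; have [_ _ [_ h] _ _] := hA; exact: h. Qed.

Lemma half_segN k z : k != 0 -> seg (t (- k)) (g (- k)) (- z) <-> seg (t k) (g k) z.
Proof.
by move=> k0; have [_ _ _ _ /(_ k k0)[_ -> ->]] := hA; rewrite -seg_opp.
Qed.

Lemma half_opp k z : k != 0 -> ~ seg (t k) (g k) z -> w (- k) (- z) = - w k z.
Proof.
move=> k0 hz; have [_ _ _ _ /(_ k k0)[_ tk gk]] := hA.
have hN := @half_root (- k); rewrite tk gk in hN.
exact: croot_opp (@half_root k) hN hz.
Qed.

(** For k <> 0 both w_{-k}(-z) = - w_k(z) and pi_{-k} = - pi_k, so the change of sign only swaps the
    factors within the pairs; index 0 alone notices it. *)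
Lemma chi_flip z : tame (fun k => w k z / pin k) -> (forall k, k != 0 -> ~ seg (t k) (g k) z) ->
  prodZ (fun k => w k (- z) / pin k) = w 0 (- z) * prodZ (skip0 (fun k => w k z / pin k)).
Proof.
move=> hw hz; have [l [hl El _]] := tame_cvg (tame_skip0 hw); rewrite El.
apply: prodZ_lim; apply: ccvg_eq (ccvgM (ccvg_cst (w 0 (- z))) hl); exists 0%N => N _.
rewrite [RHS]pp_skip0 pin0 divr1; congr (_ * _); rewrite !ppE; apply: eq_bigr => i _.
case: (i : nat) => [|j] /=; first by [].
have j0 : (j.+1%:Z : int) != 0 by [].
have jN0 : - (j.+1%:Z : int) != 0 by [].
have e1 := half_opp j0 (hz _ j0); have e2 := half_opp jN0 (hz _ jN0); rewrite opprK in e2.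
rewrite e1 e2 !pinE// kpiN; field; exact: kpi_neq0.
Qed.

End Half.

(** Each zero is compared with the root of the same index. The product of the roots of index k <> 0
    is a nonzero factor which also occurs in chi_p and cancels there. *)
Lemma numerator_split (t g s : int -> C) (w : int -> C -> C) z : rootfam t g s w ->
  (forall k, k != 0 -> ~ seg (t k) (g k) z) ->
  prodZ (fun k => (s k - z) / pin k) =
  (s 0 - z) * (ratio_prod0 s w z * prodZ (skip0 (fun k => w k z / pin k))) /\
  prodZ (skip0 (fun k => w k z / pin k)) != 0.
Proof.
move=> F hz; have hs := rootfam_tame_sig F z; have hw := rootfam_tame_w F z.
rewrite prodZ_split0//.
have [l [hl El _]] := tame_cvg (tame_skip0 hs); have [l' [hl' El' nz]] := tame_cvg (tame_skip0 hw).
have l'0 : l' != 0.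
  apply: nz => k; rewrite /skip0; have [k0|k0] := eqVneq k 0; first exact: (oner_neq0 C).
  rewrite mulf_neq0 ?invr_eq0 ?pin_neq0//.
  exact: croot_neq0 (rootfam_croot F (k := k)) (hz k k0).
have E : ratio_prod0 s w z = l / l'.
  rewrite /ratio_prod0 -(prodZ_div l'0 hl hl'); congr prodZ; apply/funext => k; rewrite /skip0.
  case: eqVneq => k0; first by rewrite invr1 mulr1.
  by rewrite /ratio invfM invrK mulrACA mulVf ?pin_neq0// mulr1.
split; last by rewrite [prodZ _]El'.
by rewrite [prodZ (skip0 _)]El [prodZ (skip0 _)]El' E divfK// pin0 divr1.
Qed.

Definition chi1 (w : int -> C -> C) z : C := prodZ (fun k => w k z / pin k).

Definition chi_form (w w' : int -> C -> C) z : C :=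
  'i * chi1 w z * chi1 w' (- recip z) / chi1 w 0.

Section Quotient.
Variables (t g s1 t' g' s2 : int -> C) (w w' : int -> C -> C) (A B : int -> set C) (n : int).
Hypothesis hA : half t g w A.
Hypothesis hB : half t' g' w' B.
Hypothesis F1 : rootfam t g s1 w.
Hypothesis F2 : rootfam t' g' s2 w'.
Hypothesis s1n : s1 n = t n.
Hypothesis n0 : n != 0.

Definition psi_form z : C := - (pin n)^-1 * (prodZ (fun k => s2 k / pin k))^-1
  * prodZ (fun k => if k == n then 1 else (s1 k - z) / pin k)
  * prodZ (fun k => (s2 k + recip z) / pin k).

(** What psi_n leaves after cancellation of the roots of index k <> 0. It is the same for the
    quotient and for its reflection, which differ in the roots of index 0 and in the constant. *)
Definition common z : C := (t n - z)^-1 * ((s1 0 - z) * (s2 0 + recip z))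
  * (ratio_prod0 s1 w z * ratio_prod0 s2 w' (- recip z)).

Definition off0 z := (forall k, k != 0 -> ~ seg (t k) (g k) z) /\
  (forall k, k != 0 -> ~ seg (t' k) (g' k) (- recip z)).

Lemma psi_split z : z != 0 -> off0 z -> ~ seg (t n) (g n) z ->
  psi_form z = - (prodZ (fun k => s2 k / pin k))^-1 * common z *
    (prodZ (skip0 (fun k => w k z / pin k)) * prodZ (skip0 (fun k => w' k (- recip z) / pin k))).
Proof.
move=> z0 [h1 h2] hn; have [e1 _] := numerator_split F1 h1; have [e2 _] := numerator_split F2 h2.
have tn := seg_neq hn.
(* Restores the missing factor of index n, which is (t n - z)/pi_n by the convention sigma_{1,n} =
   tau_{1,n}. *)
have e3 : prodZ (fun k => if k == n then 1 else (s1 k - z) / pin k) =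
    pin n / (t n - z) * prodZ (fun k => (s1 k - z) / pin k).
  have [l [hl El _]] := tame_cvg (rootfam_tame_sig F1 z); rewrite El.
  apply: prodZ_lim; apply: ccvg_eq (ccvgM (ccvg_cst (pin n / (t n - z))) hl); exists `|n|%N => N nN.
  have [i Ei] := pp_mem nN; rewrite /pp (bigD1 i)//= Ei [RHS](bigD1 i)//= Ei eqxx mul1r s1n mulrA.
  rewrite mulf_div [(t n - z) * _]mulrC divff ?mulf_neq0 ?pin_neq0// mul1r.
  apply: eq_bigr => j ji.
  by rewrite ifF//; apply: contraNF ji => /eqP E; rewrite -val_eqE /=; lia.
have e4 : prodZ (fun k => (s2 k + recip z) / pin k) = prodZ (fun k => (s2 k - - recip z) / pin k).
  by congr prodZ; apply/funext => k; rewrite opprK.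
rewrite /psi_form e3 e1 e4 e2 /common opprK; set q := prodZ (fun k => s2 k / pin k).
set p1 := prodZ (skip0 _); set p2 := prodZ (skip0 _).
have pn := pin_neq0 R n; set r1 := ratio_prod0 s1 w z; set r2 := ratio_prod0 s2 w' _.
have -> : - (pin n)^-1 * q^-1 * (pin n / (t n - z) * ((s1 0 - z) * (r1 * p1))) =
  (pin n)^-1 * pin n * (- q^-1 * (t n - z)^-1 * ((s1 0 - z) * (r1 * p1))) by ring.
by rewrite mulVf// mul1r; ring.
Qed.

(** This is -C_n chi_1(0)/i, where [u] is the first root family of the denominator: [w] for the
    original quotient, [w'] for the reflected one. *)
Definition amplitude (u : int -> C -> C) : C :=
  - (prodZ (fun k => s2 k / pin k))^-1 * chi1 u 0 / 'i.

Lemma quotient_form z : z != 0 -> off0 z -> ~ seg (t 0) (g 0) z -> ~ seg (t' 0) (g' 0) (- recip z) ->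
  ~ seg (t n) (g n) z ->
  psi_form z / chi_form w w' z = amplitude w * common z / (w 0 z * w' 0 (- recip z)).
Proof.
move=> z0 hz a0 b0 an; rewrite (psi_split z0 hz an); have [h1 h2] := hz.
have [_ p10] := numerator_split F1 h1; have [_ p20] := numerator_split F2 h2.
rewrite /chi_form /amplitude /chi1 (prodZ_split0 (rootfam_tame_w F1 z)).
rewrite (prodZ_split0 (rootfam_tame_w F2 (- recip z))) pin0 !divr1.
set p1 := prodZ (skip0 _) in p10 *; set p2 := prodZ (skip0 _) in p20 *.
have w0 := croot_neq0 (half_root hA (k := 0)) a0; have w'0 := croot_neq0 (half_root hB (k := 0)) b0.
move: p1 p10 p2 p20 => p1 p10 p2 p20.
rewrite !invfM !invrK; set c0 := prodZ (fun k => w k 0 / _); set q := (prodZ _)^-1.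
set u := w 0 z in w0 *; set u' := w' 0 _ in w'0 *; move: (common z) => G.
have -> : - q * G * (p1 * p2) * ('i^-1 * (u^-1 * p1^-1) * (u'^-1 * p2^-1) * c0) =
  (p1 * p1^-1) * (p2 * p2^-1) * (- q * c0 * 'i^-1 * G * (u^-1 * u'^-1)) by ring.
by rewrite !divff// !mul1r.
Qed.

Lemma quotient_flip z : z != 0 -> off0 z -> ~ seg (t 0) (g 0) (- z) -> ~ seg (t' 0) (g' 0) (recip z) ->
  ~ seg (t n) (g n) z ->
  psi_form z / chi_form w' w (recip z) = amplitude w' * common z / (w 0 (- z) * w' 0 (recip z)).
Proof.
move=> z0 hz a0 b0 an; rewrite (psi_split z0 hz an); have [h1 h2] := hz.
have [_ p10] := numerator_split F1 h1; have [_ p20] := numerator_split F2 h2.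
rewrite /chi_form recipK /amplitude /chi1.
have e2 := chi_flip hB (rootfam_tame_w F2 (- recip z)) h2; rewrite opprK in e2.
rewrite e2 (chi_flip hA (rootfam_tame_w F1 z) h1).
set p1 := prodZ (skip0 _) in p10 *; set p2 := prodZ (skip0 _) in p20 *.
have w0 := croot_neq0 (half_root hA (k := 0)) a0; have w'0 := croot_neq0 (half_root hB (k := 0)) b0.
move: p1 p10 p2 p20 => p1 p10 p2 p20.
rewrite !invfM !invrK; set c0 := prodZ (fun k => w' k 0 / _); set q := (prodZ _)^-1.
set u := w 0 _ in w0 *; set u' := w' 0 _ in w'0 *; move: (common z) => G.
have -> : - q * G * (p1 * p2) * ('i^-1 * (u'^-1 * p2^-1) * (u^-1 * p1^-1) * c0) =
  (p1 * p1^-1) * (p2 * p2^-1) * (- q * c0 * 'i^-1 * G * (u^-1 * u'^-1)) by ring.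
by rewrite !divff// !mul1r.
Qed.

End Quotient.
End Quotients.

(** * Approximability of the quotients along curves *)

Section Curves.
Variable R : realType.
Local Notation C := R[i].
Implicit Types (z a tau g : C) (A : set C).

Definition curves (I : finType) A (x dx : I -> R -> C) := forall i,
  [/\ isAC 0 1 (x i) (dx i), x i 0 = x i 1 & forall t, 0 <= t <= 1 -> ~ A (x i t)].

Section Family.
Variables (I : finType) (x dx : I -> R -> C) (A : set C).
Hypothesis hx : curves A x dx.

Lemma curves_AC i : isAC 0 1 (x i) (dx i). Proof. by have [] := hx i. Qed.
Lemma curves_closed i : x i 0 = x i 1. Proof. by have [] := hx i. Qed.
Lemma curves_off i t : 0 <= t <= 1 -> ~ A (x i t). Proof. by have [_ _] := hx i; exact. Qed.
Lemma curves_sep : separated_from A (trace x). Proof. exact: trace_separated curves_AC curves_off. Qed.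
Lemma trace_off z : trace x z -> ~ A z. Proof. by move=> [i [t [t01 ->]]]; exact: curves_off. Qed.

(** [unifrat_rootV] is applied along the image curves phi(x), with the cut itself as set of poles,
    and the result is pulled back. *)
Lemma unifrat_root_comp tau g (w phi : C -> C) (dy : I -> R -> C) : croot tau g w ->
  (forall i, isAC 0 1 (fun t => phi (x i t)) (dy i)) ->
  (forall z, trace x z -> ~ seg tau g (phi z)) -> unifrat A (trace x) phi ->
  (forall a, seg tau g a -> unifrat A (trace x) (fun z => (phi z - a)^-1)) ->
  unifrat A (trace x) (fun z => (w (phi z))^-1).
Proof.
move=> hw hy hoff hphi hinv.
have yoff i t : 0 <= t <= 1 -> ~ seg tau g (phi (x i t)).
  by move=> t01; apply: hoff; exists i, t.
have hu := unifrat_rootV hw hy yoff (@subset_refl _ (seg tau g)).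
apply: (unifrat_pullback curves_sep _ hphi hinv hu) => z [i [t [t01 ->]]].
by exists i, t.
Qed.

Section Zero.
Hypothesis A0 : A 0.

Lemma curves_neq0 i t : 0 <= t <= 1 -> x i t != 0.
Proof. by move=> t01; apply/eqP => E; apply: (curves_off (i := i) t01); rewrite E. Qed.

Lemma unifrat_Nrecip : unifrat A (trace x) (fun z => - recip z).
Proof.
apply: unifrat_eq (unifratZ (-1) (unifrat_recip curves_sep A0)) => z _.
by rewrite mulN1r.
Qed.

Lemma unifrat_root_recip tau g (w : C -> C) : croot tau g w ->
  (forall a, seg tau g a -> A (recip a)) -> unifrat A (trace x) (fun z => (w (recip z))^-1).
Proof.
move=> hw hs; apply: (@unifrat_root_comp tau g w (@recip R) (fun i => inv_dpath (x i) (dx i))) => //.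
- by move=> i; apply: inv_path_isAC (curves_AC i) _ => t; exact: curves_neq0.
- by move=> z Xz /hs; rewrite recipK; exact: trace_off.
- exact: unifrat_recip curves_sep A0.
- by move=> a /hs; exact: unifrat_recip_inv curves_sep A0.
Qed.

Lemma unifrat_root_Nrecip tau g (w : C -> C) : croot tau g w ->
  (forall a, seg tau g a -> A (- recip a)) -> unifrat A (trace x) (fun z => (w (- recip z))^-1).
Proof.
move=> hw hs.
apply: (@unifrat_root_comp tau g w (fun z => - recip z) (fun i t => -1 * inv_dpath (x i) (dx i) t)) => //.
- move=> i; have hi := inv_path_isAC (curves_AC i) (fun t => @curves_neq0 i t).
  by apply: isAC_eq (isACZ (-1) hi) => t _ //; rewrite mulN1r.
- by move=> z Xz /hs; rewrite recipN recipK opprK; exact: trace_off.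
- exact: unifrat_Nrecip.
- by move=> a /hs; exact: unifrat_Nrecip_inv curves_sep A0.
Qed.

End Zero.

Lemma unifrat_root_opp tau g (w : C -> C) : croot tau g w ->
  (forall a, seg tau g a -> A (- a)) -> unifrat A (trace x) (fun z => (w (- z))^-1).
Proof.
move=> hw hs; apply: (@unifrat_root_comp tau g w (fun z => - z) (fun i t => -1 * dx i t)) => //.
- by move=> i; apply: isAC_eq (isACZ (-1) (curves_AC i)) => t _ //; rewrite mulN1r.
- by move=> z Xz /hs; rewrite opprK; exact: trace_off.
- by apply: unifrat_eq (unifratZ (-1) (unifrat_id A (trace x))) => z _; rewrite mulN1r.
- by move=> a /hs; exact: unifrat_opp_inv curves_sep.
Qed.

Lemma unifrat_common (t g s1 t' g' s2 : int -> C) (w w' : int -> C -> C) (n : int) :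
  rootfam t g s1 w -> rootfam t' g' s2 w' -> A 0 -> A (t n) ->
  (forall k, k != 0 -> seg (t k) (g k) `<=` A) ->
  (forall k a, k != 0 -> seg (t' k) (g' k) a -> A (- recip a)) ->
  unifrat A (trace x) (common t s1 s2 w w' n).
Proof.
move=> F1 F2 A0 An c1 c2; have S := curves_sep; have hN := unifrat_Nrecip A0.
have [Z1 _ hZ1] := unifrat_bounded S (unifrat_id A (trace x)).
have [Z2 _ hZ2] := unifrat_bounded S hN.
have i0 : unifrat A (trace x) (fun z => (t n - z)^-1).
  apply: unifrat_eq (unifratZ (-1) (unifrat_inv (trace x) An)) => z _.
  by rewrite mulN1r -invrN opprB.
have i1 : unifrat A (trace x) (fun z => s1 0 - z) by apply: unifratB; [exact: unifrat_cst|exact: unifrat_id].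
have i2 : unifrat A (trace x) (fun z => s2 0 + recip z).
  by apply: unifratD; [exact: unifrat_cst|exact: unifrat_recip].
have i3 : unifrat A (trace x) (ratio_prod0 s1 w).
  apply: (ratio_prod0_unifrat F1 (phi := id) S (unifrat_id _ _) hZ1) => k k0.
  have := unifrat_rootV (rootfam_croot F1 (k := k)) curves_AC curves_off (c1 k k0); exact: id.
have i4 : unifrat A (trace x) (fun z => ratio_prod0 s2 w' (- recip z)).
  apply: (ratio_prod0_unifrat F2 S hN hZ2) => k k0.
  by apply: unifrat_root_Nrecip (rootfam_croot F2 (k := k)) _ => // a; exact: c2.
have h := unifratM S (unifratM S i0 (unifratM S i1 i2)) (unifratM S i3 i4).
by apply: unifrat_eq h => z _; rewrite /common.
Qed.

End Family.

Definition two (x y : R -> C) (b : bool) := if b then x else y.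

Lemma same_pint A (x dx y dy : R -> C) f : curves A (two x y) (two dx dy) ->
  (forall a, A a -> pint x dx (fun z => (z - a)^-1) = pint y dy (fun z => (z - a)^-1)) ->
  unifrat A (trace (two x y)) f -> pint x dx f = pint y dy f.
Proof.
move=> h hwind hf.
have wind0 a : A a -> \sum_b two (fun=> 1) (fun=> -1) b 0 *
    pint (two x y b) (two dx dy b) (fun z => (z - a)^-1) = 0.
  by move=> Aa; rewrite big_bool /= mul1r mulN1r (hwind a Aa) subrr.
have [_] := cauchy (curves_AC h) (curves_closed h) (curves_off h) wind0 hf.
by rewrite big_bool /= mul1r mulN1r => /eqP; rewrite subr_eq0 => /eqP.
Qed.

(** By compactness of the parameter interval; applied to the cuts, this provides the inner radius of
    the annulus in [swap_disc]. *)
Lemma path_in_disc (y : R -> C) c (rho : R) : pcont 0 1 y ->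
  (forall t, 0 <= t <= 1 -> disc c rho (y t)) ->
  exists2 r : R, r < rho & forall t, 0 <= t <= 1 -> normc (y t - c) <= r.
Proof.
move=> hy hd.
pose f t : C := (rho - normc (y t - c))%:C.
have hf : pcont 0 1 f.
  move=> t t01 e e0; have [d d0 hdd] := hy t t01 e e0; exists d => // s s01 ts.
  apply: le_lt_trans (hdd s s01 ts); rewrite /f -rmorphB normc_real.
  have -> : rho - normc (y t - c) - (rho - normc (y s - c)) = normc (y s - c) - normc (y t - c) by ring.
  by apply: le_trans (normc_dist _ _) _; rewrite normcC opprB addrA subrK.
have [|m m0 hm] := pcont_ge_pos ler01 hf.
  move=> t t01; rewrite -normc_gt0 normc_real normr_gt0 subr_eq0 gt_eqF//.
  exact: hd t01.
exists (rho - m); first by rewrite gtrBl.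
move=> t t01; have := hm t t01; rewrite normc_real ger0_norm; last by rewrite subr_ge0 ltW//; exact: hd.
lra.
Qed.

Definition seg_path tau g (t : R) : C := tau + (2 * t - 1)%:C * g.

Lemma seg_pathP tau g z : seg tau g z -> exists2 t : R, 0 <= t <= 1 & z = seg_path tau g t.
Proof.
move=> [s [/andP[s1 s2] ->]]; exists ((s + 1) / 2).
  by apply/andP; split; [rewrite divr_ge0//|rewrite ler_pdivrMr//]; lra.
by rewrite /seg_path; congr (_ + _%:C * _); field.
Qed.

Lemma seg_path_in tau g (t : R) : 0 <= t <= 1 -> seg tau g (seg_path tau g t).
Proof. by move=> /andP[t0 t1]; exists (2 * t - 1); split => //; apply/andP; split; lra. Qed.

Lemma seg_path_isAC tau g : isAC 0 1 (seg_path tau g) (fun=> (2%:C * g)).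
Proof.
have h := isACZ (2%:C * g) (isAC_id R).
apply: isAC_eq (isACD (isAC_cst 0 1 (tau - g)) h) => t _; last by rewrite add0r mulr1.
by rewrite /seg_path rmorphB rmorphM rmorph1; ring.
Qed.

Lemma seg_in_disc tau g c (rho : R) : seg tau g `<=` disc c rho ->
  exists2 r : R, r < rho & forall z, seg tau g z -> normc (z - c) <= r.
Proof.
move=> h; have [||r rr hr] := @path_in_disc (seg_path tau g) c rho.
- exact: ucont_pcont (isAC_ucont (seg_path_isAC tau g)).
- by move=> t /(seg_path_in tau g) /h.
- by exists r => // z /seg_pathP[t t01 ->]; exact: hr.
Qed.

Lemma recip_seg_in_disc tau g c (rho : R) : ~ seg tau g 0 ->
  (forall z, seg tau g z -> disc c rho (recip z)) ->
  exists2 r : R, r < rho & forall z, seg tau g z -> normc (recip z - c) <= r.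
Proof.
move=> h0 h; have [||r rr hr] := @path_in_disc (inv_path (seg_path tau g)) c rho.
- apply/ucont_pcont/(isAC_ucont (du := inv_dpath (seg_path tau g) (fun=> 2%:C * g))).
  apply: inv_path_isAC (seg_path_isAC tau g) _ => t /(seg_path_in tau g) ht.
  by apply/eqP => E; apply: h0; rewrite -E.
- by move=> t /(seg_path_in tau g) /h.
- by exists r => // z /seg_pathP[t t01 ->]; exact: hr.
Qed.

End Curves.

(** * The quotient and its reflection near the gaps of index 0 *)

Section Swap.
Variable R : realType.
Local Notation C := R[i].
Local Notation cRe := (@complex.Re R).
Local Notation twopii := (2 * pi%:C * 'i : C).
Implicit Types (z a tau g : C) (k : int).

(* Both integrals are moved to a circle in the annulus where [f2 = - f1]. *)
Lemma swap_disc (A1 A2 : set C) (f1 f2 : C -> C) c (rho r : R) (x dx y dy : R -> C) :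
  0 <= r < rho ->
  (forall a, A1 a -> disc c rho a -> normc (a - c) <= r) ->
  (forall a, A2 a -> disc c rho a -> normc (a - c) <= r) ->
  isAC 0 1 x dx -> x 0 = x 1 -> (forall t, 0 <= t <= 1 -> disc c rho (x t) /\ ~ A1 (x t)) ->
  isAC 0 1 y dy -> y 0 = y 1 -> (forall t, 0 <= t <= 1 -> disc c rho (y t) /\ ~ A2 (y t)) ->
  (forall a, A1 a -> disc c rho a -> pint x dx (fun z => (z - a)^-1) = twopii) ->
  (forall a, A2 a -> disc c rho a -> pint y dy (fun z => (z - a)^-1) = twopii) ->
  (forall x dx : bool -> R -> C, curves A1 x dx -> unifrat A1 (trace x) f1) ->
  (forall x dx : bool -> R -> C, curves A2 x dx -> unifrat A2 (trace x) f2) ->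
  (forall z, r < normc (z - c) < rho -> f2 z = - f1 z) ->
  pint y dy f2 = - pint x dx f1.
Proof.
move=> /andP[r0 rr] h1 h2 hx xc xd hy yc yd wx wy u1 u2 f12.
pose r' := (r + rho) / 2; have rr' : r < r' by rewrite /r'; lra.
have r'r : r' < rho by rewrite /r'; lra.
have r'0 : 0 < r' by lra.
pose K := circle c r'; pose dK := dcircle r' : R -> C.
have Kd t : normc (K t - c) = r' by apply: circle_dist; exact: ltW.
have Koff (A' : set C) t : (forall a, A' a -> disc c rho a -> normc (a - c) <= r) -> ~ A' (K t).
  move=> hA' /hA'; rewrite /disc /= Kd => /(_ r'r); lra.
have wind (A' : set C) (z dz : R -> C) (f : C -> C) : (forall a, A' a -> disc c rho a -> normc (a - c) <= r) ->
    isAC 0 1 z dz -> z 0 = z 1 -> (forall t, 0 <= t <= 1 -> disc c rho (z t) /\ ~ A' (z t)) ->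
    (forall a, A' a -> disc c rho a -> pint z dz (fun u => (u - a)^-1) = twopii) ->
    (forall x dx : bool -> R -> C, curves A' x dx -> unifrat A' (trace x) f) ->
    pint z dz f = pint K dK f.
  move=> hA' hz zc zd wz uf.
  have hc : curves A' (two z K) (two dz dK).
    case; split => //=; [by move=> t /zd[]|exact: isAC_circle|exact: circle01|].
    by move=> t _; exact: Koff.
  apply: (same_pint hc) (uf _ _ hc) => a Aa.
  have [da|da] := pselect (disc c rho a).
    rewrite wz// circle_wind_in//; apply: le_lt_trans rr'; exact: hA'.
  rewrite (winding_disc hz zc _ da); last by move=> t /zd[].
  rewrite circle_wind_out ?(ltW r'0)//; move: da => /negP; rewrite /disc /= -leNgt.
  exact: lt_le_trans.
rewrite (wind A2 y dy f2)// (wind A1 x dx f1)//.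
have hcK : curves A1 (two K K) (two dK dK).
  by case; split => //=; [exact: isAC_circle|exact: circle01|move=> t _; exact: Koff|
    exact: isAC_circle|exact: circle01|move=> t _; exact: Koff].
(* With zero coefficients [cauchy] is called for the continuity of [f1] along the circle. *)
have wind0 a : A1 a -> \sum_(b : bool) (0 : C) *
    pint (two K K b) (two dK dK b) (fun z => (z - a)^-1) = 0.
  by move=> _; apply: big1 => b _; rewrite mul0r.
have [hu _] := cauchy (curves_AC hcK) (curves_closed hcK) (curves_off hcK) wind0 (u1 _ _ hcK).
have fi : cintegrable 0 1 (fun t => f1 (K t) * dK t).
  exact: cintegrableM (hu true) (isAC_circle c r').1.
rewrite /pint -cintN//; apply: cint_eq_cc => t _.
by rewrite f12 ?mulNr// Kd rr' r'r.
Qed.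

Section Quotients.
Variables (t g s1 t' g' s2 : int -> C) (w w' : int -> C -> C) (A B : int -> set C) (n : int).
Hypothesis hA : half t g w A.
Hypothesis hB : half t' g' w' B.
Hypothesis F1 : rootfam t g s1 w.
Hypothesis F2 : rootfam t' g' s2 w'.
Hypothesis n0 : n != 0.

(** The cuts shared by the quotient and its reflection. The point 0 is a pole because of recip z,
    and the pole at t n lies on the cut of index n; [cuts] and [cuts_flip] add the respective cuts
    of index 0. *)
Definition cuts0 : set C := [set z | z = 0 \/ exists2 k, k != 0 & seg (t k) (g k) z \/ seg (t' k) (g' k) (- recip z)].
Definition cuts : set C := [set z | cuts0 z \/ (seg (t 0) (g 0) z \/ seg (t' 0) (g' 0) (- recip z))].
Definition cuts_flip : set C :=
  [set z | cuts0 z \/ (seg (t 0) (g 0) (- z) \/ seg (t' 0) (g' 0) (recip z))].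

Local Notation G := (common t s1 s2 w w' n).
Definition quot z : C := amplitude s2 w * G z / (w 0 z * w' 0 (- recip z)).
Definition quot_flip z : C := amplitude s2 w' * G z / (w 0 (- z) * w' 0 (recip z)).

Lemma off_cuts0 z : ~ cuts0 z -> [/\ z != 0, off0 t g t' g' z & ~ seg (t n) (g n) z].
Proof.
move=> h; split.
- by apply/eqP => z0; apply: h; left.
- by split => k k0 hk; apply: h; right; exists k => //; [left|right].
- by move=> hn; apply: h; right; exists n => //; left.
Qed.

Lemma cuts0E (A' : set C) : cuts0 `<=` A' -> [/\ A' 0, A' (t n),
  forall k, k != 0 -> seg (t k) (g k) `<=` A' &
  forall k a, k != 0 -> seg (t' k) (g' k) a -> A' (- recip a)].
Proof.
move=> h; split.
- by apply: h; left.
- by apply: h; right; exists n => //; left; exact: seg_center.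
- by move=> k k0 z hz; apply: h; right; exists k => //; left.
- by move=> k a k0 ha; apply: h; right; exists k => //; right; rewrite recipN recipK opprK.
Qed.

Lemma unifrat_quot (I : finType) (x dx : I -> R -> C) : curves cuts x dx ->
  unifrat cuts (trace x) quot.
Proof.
move=> hx; have S := curves_sep hx.
have sub : cuts0 `<=` cuts by move=> z; left.
have [c0 cn c1 c2] := cuts0E sub.
have hG := unifrat_common hx F1 F2 c0 cn c1 c2.
have h1 : unifrat cuts (trace x) (fun z => (w 0 z)^-1).
  have sub0 : seg (t 0) (g 0) `<=` cuts by move=> z hz; right; left.
  have h := unifrat_rootV (rootfam_croot F1 (k := 0)) (curves_AC hx) (curves_off hx) sub0.
  exact: h.
have h2 : unifrat cuts (trace x) (fun z => (w' 0 (- recip z))^-1).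
  apply: (unifrat_root_Nrecip hx c0 (rootfam_croot F2 (k := 0))) => a ha; right; right.
  by rewrite recipN recipK opprK.
apply: unifrat_eq (unifratM S (unifratZ (amplitude s2 w) hG) (unifratM S h1 h2)) => z _.
by rewrite /quot invfM.
Qed.

Lemma unifrat_quot_flip (I : finType) (x dx : I -> R -> C) : curves cuts_flip x dx ->
  unifrat cuts_flip (trace x) quot_flip.
Proof.
move=> hx; have S := curves_sep hx.
have sub : cuts0 `<=` cuts_flip by move=> z; left.
have [c0 cn c1 c2] := cuts0E sub.
have hG := unifrat_common hx F1 F2 c0 cn c1 c2.
have h1 : unifrat cuts_flip (trace x) (fun z => (w 0 (- z))^-1).
  apply: (unifrat_root_opp hx (rootfam_croot F1 (k := 0))) => z hz; right; left.
  by rewrite opprK.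
have h2 : unifrat cuts_flip (trace x) (fun z => (w' 0 (recip z))^-1).
  apply: (unifrat_root_recip hx c0 (rootfam_croot F2 (k := 0))) => a ha; right; right.
  by rewrite recipK.
apply: unifrat_eq (unifratM S (unifratZ (amplitude s2 w') hG) (unifratM S h1 h2)) => z _.
by rewrite /quot_flip invfM.
Qed.

Section Reflected.
Variables (c rho : R).
Hypothesis A0 : A 0 = disc c%:C rho.
Hypothesis B0 : forall z, B 0 z <-> A 0 (recip z).
Hypothesis cross : forall k l z, A k z -> ~ B l (- recip z).
Hypothesis Re0 : 0 < cRe (t' 0 + g' 0) /\ 0 < cRe (t' 0 - g' 0).
Hypothesis ends0 : t 0 + g 0 = recip (t' 0 - g' 0) /\ t 0 - g 0 = recip (t' 0 + g' 0).
Hypothesis chi0 : chi1 w 0 = chi1 w' 0.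

(** By [B0], a point -z in U_0 would put -recip z into the neighborhood of index 0 of [Irec v],
    against [cross]. *)
Lemma A0N z : A 0 z -> ~ A 0 (- z).
Proof.
move=> /(@cross 0 0) h hz; apply: h; apply/B0; rewrite recipN recipK //.
Qed.

(* The reciprocity of w_0 exchanges the two factors belonging to the gaps of index 0 *)
Lemma quot_flipE (r : R) z : (forall a, seg (t 0) (g 0) a -> normc (a - c%:C) <= r) ->
  (forall a, seg (t' 0) (g' 0) a -> normc (recip a - c%:C) <= r) ->
  z != 0 -> r < normc (z - c%:C) -> r < normc (- z - c%:C) -> quot_flip z = - quot z.
Proof.
move=> hr1 hr2 z0 h1 h2.
(* Larger than r, so that both cuts lie in the open disc, but not larger than the distances of z and
   -z from c. *)
pose r' := Num.min (normc (z - c%:C)) (normc (- z - c%:C)).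
have rr' : r < r' by rewrite lt_min h1.
have d1 : seg (t 0) (g 0) `<=` disc c%:C r' by move=> a /hr1 h; exact: le_lt_trans h rr'.
have d2 a : seg (t' 0) (g' 0) a -> disc c%:C r' (recip a) by move=> /hr2 h; exact: le_lt_trans h rr'.
have key u : u != 0 -> r' <= normc (u - c%:C) -> w' 0 (recip u) = - w' 0 0 * w 0 u / u.
  move=> u0 du.
  exact: (croot_recip (half_root hB (k := 0)) (half_root hA (k := 0)) Re0.1 Re0.2 ends0.1 ends0.2 d1 d2 u0 du).
have e1 : w' 0 (recip z) = - w' 0 0 * w 0 z / z.
  by apply: key => //; rewrite ge_min lexx.
have e2 : w' 0 (- recip z) = w' 0 0 * w 0 (- z) / z.
  rewrite -recipN key ?oppr_eq0//; last first.
    by rewrite ge_min lexx orbT.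
  by rewrite invrN; ring.
have W0 : w' 0 0 != 0 := croot_neq0 (half_root hB (k := 0)) (half_off0 hB (k := 0)).
(* In this degenerate case both sides are 0, the inverse of 0 being 0. *)
have [u0|u0] := eqVneq (w 0 z) 0.
  by rewrite /quot_flip /quot e1 u0 !(mulr0, mul0r, invr0, oppr0).
have [v0|v0] := eqVneq (w 0 (- z)) 0.
  by rewrite /quot_flip /quot e2 v0 !(mulr0, mul0r, invr0, oppr0).
have aE : amplitude s2 w = amplitude s2 w' by rewrite /amplitude chi0.
rewrite /quot_flip /quot e1 e2 -aE; set a := amplitude s2 w; set q := common _ _ _ _ _ _ z.
set W := w' 0 0 in W0 *; set u := w 0 z in u0 *; set u' := w 0 (- z) in v0 *.
by field; rewrite z0 W0 u0 v0.
Qed.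

End Reflected.
End Quotients.
End Swap.

(** * Dominated convergence for complex integrals *)

Section DominatedConvergence.
Variable R : realType.
Local Notation C := R[i].
Local Notation cRe := (@complex.Re R).
Local Notation cIm := (@complex.Im R).
Local Notation mu := (@lebesgue_measure R).

Lemma rint_dominated a b (f : nat -> R -> R) (B : R) : (forall n, rintegrable a b (f n)) ->
  (forall n t, a <= t <= b -> `|f n t| <= B) ->
  (forall t, a <= t <= b -> f n t @[n --> \oo] --> 0) ->
  forall e : R, 0 < e -> exists N, forall n, (N <= n)%N -> `|rint a b (f n)| <= e.
Proof.
move=> fi fB f0 e e0.
have mD : measurable (`[a, b] : set R) by exact: measurable_itv.
have Bi : mu.-integrable `[a, b] (EFin \o (cst B)) := rintegrable_cst a b B.
have [] := @dominated_convergence _ _ _ mu `[a, b] mD (fun n => EFin \o f n) (cst 0%E) (EFin \o cst B).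
- by move=> n; have /integrableP[] := fi n.
- exact: measurable_cst.
- apply: aeW => t; rewrite /= in_itv /= => tab; apply/cvg_EFin; first exact: nearW.
  exact: f0 t tab.
- exact: Bi.
- by apply: aeW => t n; rewrite /= in_itv /= => tab; rewrite lee_fin; exact: fB.
move=> _ _ hcv.
have : rint a b (f n) @[n --> \oo] --> 0.
  have := hcv; rewrite integral0 => /fine_cvg; exact.
move=> /cvgrPdist_le /(_ e e0)[N _ hN]; exists N => n Nn.
by have := hN n Nn; rewrite /= sub0r normrN.
Qed.

(** The large circles are real at the ends of their two halves, where the integrand is not known to
    converge. The assumptions are therefore made on the open interval, and the integrand is replaced
    by 0 outside it. *)
Lemma cint_dominated a b (u : nat -> R -> C) (B : R) : a <= b ->
  (forall n, cintegrable a b (u n)) -> (forall n t, a < t < b -> normc (u n t) <= B) ->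
  (forall t, a < t < b -> ccvg (fun n => u n t) 0) ->
  ccvg (fun n => cint a b (u n)) 0.
Proof.
move=> ab ui uB u0.
have B0 : 0 <= Num.max B 0 by rewrite le_max lexx orbT.
pose v n t := if a < t < b then u n t else 0.
have uv n : cint a b (u n) = cint a b (v n) /\ cintegrable a b (v n).
  by apply: cint_eq => // t tab; rewrite /v tab.
have vB n t : normc (v n t) <= Num.max B 0.
  by rewrite /v; case: ifP => tab; rewrite ?normc0// le_max uB.
have v0 t (p : C -> R) : (forall z, `|p z| <= normc z) -> p (v n t) @[n --> \oo] --> 0.
  move=> hp; apply/cvgrPdist_le => e e0; have [tab|tab] := boolP (a < t < b).
    have [N hN] := u0 t tab e e0; exists N => // n Nn; rewrite /= sub0r normrN /v tab.
    by apply: le_trans (hp _) _; have := hN n Nn; rewrite subr0.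
  apply: nearW => n; rewrite sub0r normrN /v (negbTE tab).
  by apply: le_trans (hp _) _; rewrite normc0 ltW.
move=> e e0; have e2 : 0 < e / 2 by rewrite divr_gt0.
have [N1 h1] := @rint_dominated a b (fun n => cRe \o v n) _ (fun n => (uv n).2.1)
  (fun n t _ => le_trans (Re_le_normc _) (vB n t)) (fun t _ => v0 t cRe (@Re_le_normc R)) _ e2.
have [N2 h2] := @rint_dominated a b (fun n => cIm \o v n) _ (fun n => (uv n).2.2)
  (fun n t _ => le_trans (Im_le_normc _) (vB n t)) (fun t _ => v0 t cIm (@Im_le_normc R)) _ e2.
exists (maxn N1 N2) => n; rewrite geq_max => /andP[n1 n2]; rewrite subr0 (uv n).1.
apply: le_trans (normc_le_ReIm _) _; have -> : e = e / 2 + e / 2 by field.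
exact: lerD (h1 n n1) (h2 n n2).
Qed.

End DominatedConvergence.

(** * Residues and normalization *)

Section Normalization.
Variable R : realType.
Local Notation C := R[i].
Local Notation twopii := (2 * pi%:C * 'i : C).
Implicit Types (z a : C) (k : int).

(** A disc that omits 0 may still touch it, but the compact cut stays in a smaller concentric
    disc. *)
Lemma half_bounds (t g : int -> C) w (A : int -> set C) : half t g w A -> forall N : nat,
  exists2 d : R, 0 < d & forall k z, (`|k| < N)%N -> seg (t k) (g k) z -> d <= normc z <= d^-1.
Proof.
move=> h; have one k : exists2 d : R, 0 < d & forall z, seg (t k) (g k) z -> d <= normc z <= d^-1.
  have [_ hs [hd off] _ _] := h; have [c [rho Ek]] := hd k.
  have sub : seg (t k) (g k) `<=` disc c rho by rewrite -Ek; exact: hs.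
  have [r rr hr] := seg_in_disc sub.
  have cr : rho <= normc c.
    by rewrite leNgt; apply/negP => hc; apply: (off k); rewrite Ek /disc /= sub0r normcNE.
  pose D := normc (t k) + normc (g k) + 1.
  have D0 : 0 < D by rewrite /D ltr_wpDl// addr_ge0 ?normc_ge0.
  have e0 : 0 < normc c - r by rewrite subr_gt0 (lt_le_trans rr).
  exists (Num.min (normc c - r) D^-1); first by rewrite lt_min e0 invr_gt0.
  move=> z hz; apply/andP; split.
    rewrite ge_min; apply/orP; left.
    by have := hr z hz; have := normc_ge_B c (c - z); rewrite subKr normcC; lra.
  apply: (@le_trans _ _ D).
    by have := seg_bounded hz; have := normcD (z - t k) (t k); rewrite subrK /D; lra.
  rewrite -[leLHS]invrK lef_pV2 ?posrE ?invr_gt0 ?lt_min ?e0 ?invr_gt0//.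
  by rewrite ge_min lexx orbT.
elim=> [|N [d d0 hd]]; first by exists 1.
have [d1 d10 h1] := one N%:Z; have [d2 d20 h2] := one (- N%:Z).
exists (Num.min d (Num.min d1 d2)); first by rewrite !lt_min d0 d10.
have key (e x : R) : 0 < e -> Num.min d (Num.min d1 d2) <= e -> e <= x <= e^-1 ->
    Num.min d (Num.min d1 d2) <= x <= (Num.min d (Num.min d1 d2))^-1.
  move=> e0 le /andP[ex xe]; rewrite (le_trans le ex)/= (le_trans xe)//.
  by rewrite lef_pV2 ?posrE// !lt_min d0 d10.
move=> k z; rewrite ltnS leq_eqVlt => /orP[/eqP kN|kN] hz; last first.
  by apply: (key d _ d0); [rewrite ge_min lexx|exact: hd kN hz].
have [E|E] : k = N%:Z \/ k = - N%:Z by lia.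
  by apply: (key d1 _ d10); [rewrite !ge_min lexx orbT|apply: h1; rewrite -E].
by apply: (key d2 _ d20); [rewrite !ge_min lexx !orbT|apply: h2; rewrite -E].
Qed.

(** The circle of radius [Rad N] separates the cuts with |k| <= N from the others, and all of them
    lie outside the inverted circle. Assumed for [Irec v] as well, this locates the cuts of the
    second family by inversion. *)
Definition isolated_by (t g : int -> C) (N : nat) := forall k z, seg (t k) (g k) z ->
  [/\ (`|k| <= N)%N -> normc z < Rad R N, (N < `|k|)%N -> Rad R N < normc z
    & (16 * Rad R N)^-1 < normc z].

Lemma Rad_large (B : R) : exists N0, forall N, (N0 <= N)%N -> B < Rad R N.
Proof.
exists (Num.truncn B).+1 => N NN; apply: lt_le_trans (truncnS_gt B) _.
have := pi_ge2 R => p2; apply: (@le_trans _ _ (N%:R * 1)); first by rewrite mulr1 ler_nat.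
by rewrite /Rad ler_pM//; lra.
Qed.

(** Far cuts are within pi/3 < pi/2 of k pi, and the finitely many others are kept away from 0 and
    infinity by [half_bounds]. *)
Lemma half_isolated (t g : int -> C) w (A : int -> set C) : half t g w A ->
  exists N0, forall N, (N0 <= N)%N -> isolated_by t g N.
Proof.
move=> h; have [_ hs _ [_ [N1 hN1]] _] := h; have p2 := pi_ge2 R.
have [d d0 hd] := half_bounds h N1.+1; have [N2 hN2] := Rad_large (d^-1 + 1).
exists (maxn N1 N2).+1 => N NN k z hz.
have dR : d^-1 + 1 < Rad R N by apply: hN2; lia.
have R0 := Rad_gt0 R N.
have dV : 0 < d^-1 by rewrite invr_gt0.
have low : (16 * Rad R N)^-1 < d.
  rewrite -[ltRHS]invrK ltf_pV2 ?posrE ?mulr_gt0//; lra.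
have [kN|kN] := ltnP `|k| N1.+1.
  have /andP[h1 h2] := hd k z kN hz; split; [|lia|exact: lt_le_trans low h1].
    by move=> _; apply: le_lt_trans h2 _; apply: lt_trans dR; rewrite ltrDl.
have Az := hs k z hz; rewrite hN1 ?(ltnW kN)// in Az.
have := normc_dist z (kpi R k); rewrite normc_kpi => /le_lt_trans /(_ Az).
rewrite ltr_norml => /andP[b1 b2].
have k1 : 1 <= `|k|%N%:R :> R by rewrite ler1n; lia.
have kp : 1 * pi <= `|k|%N%:R * pi :> R by rewrite ler_wpM2r//; lra.
split.
- rewrite -(ler_nat R) => kN'.
  have : `|k|%N%:R * pi <= N%:R * pi :> R by rewrite ler_wpM2r//; lra.
  rewrite /Rad; lra.
- rewrite -(ler_nat R) -[N.+1%:R]natr1 => kN'.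
  have : (N%:R + 1) * pi <= `|k|%N%:R * pi :> R by rewrite ler_wpM2r//; lra.
  rewrite /Rad; lra.
- have : (16 * Rad R N)^-1 <= 1 by rewrite invf_le1 ?mulr_gt0//; lra.
  lra.
Qed.

Section Cycle.
Variables (t g t' g' : int -> C) (w w' : int -> C -> C) (A B : int -> set C).
Hypothesis hA : half t g w A.
Hypothesis hB : half t' g' w' B.
Hypothesis cross : forall k l z, A k z -> ~ B l (- recip z).

Definition zone (j : root_family) k : set C :=
  if j is J1 then A k else [set z | B k (- recip z)].
(** For J2 this is the arc on which the root of [Irec v] is cut, rather than the segment G_{2,k};
    the contours encircle both. *)
Definition cut (j : root_family) k : set C :=
  if j is J1 then seg (t k) (g k) else [set z | seg (t' k) (g' k) (- recip z)].

Local Notation cuts := (cuts t g t' g').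

Lemma cutsE z : cuts z <-> z = 0 \/ exists j k, cut j k z.
Proof.
split.
  move=> [[->|[k _ [h|h]]]|[h|h]]; [by left|right..].
  - by exists J1, k.
  - by exists J2, k.
  - by exists J1, 0.
  - by exists J2, 0.
move=> [->|[j [k h]]]; first by left; left.
have [k0|k0] := eqVneq k 0; [right|left; right; exists k => //];
by move: h; rewrite ?k0; case: j => /= h; [left|right].
Qed.

Lemma cut_zone j k : cut j k `<=` zone j k.
Proof. by case: j => z /=; [exact: (half_seg hA)|exact: (half_seg hB)]. Qed.

Lemma zone_off0 j k : ~ zone j k 0.
Proof.
case: j => /=; first by have [_ _ [_ h] _ _] := hA; exact: h.
by rewrite /recip mulr0 invr0 oppr0; have [_ _ [_ h] _ _] := hB; exact: h.
Qed.

Lemma zone_disjoint j k j' k' z : zone j k z -> zone j' k' z -> j = j' /\ k = k'.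
Proof.
have [_ _ _ [dA _] _] := hA; have [_ _ _ [dB _] _] := hB.
case: j; case: j' => /= h h'.
- by split => //; exact: dA h h'.
- by case: (cross h h').
- by case: (cross h' h).
- by split => //; exact: dB h h'.
Qed.

Lemma zone_diskoid j k : diskoid (zone j k).
Proof.
case: j => /=; first by left; have [_ _ [h _] _ _] := hA; exact: h.
right; split; first exact: (@zone_off0 J2).
have [_ _ [h _] _ _] := hB; have [c [rho E]] := h k; exists (- c), rho.
rewrite eqEsubset; split => z /=.
  move=> [u + <-]; rewrite E /disc /= opprK.
  have -> : recip u + c = - (- recip u - c) by ring.
  by rewrite normcNE.
rewrite /disc /= opprK => hz; exists (recip z); rewrite ?recipK// E /disc /=.
have -> : - z - c = - (z + c) by ring.
by rewrite normcNE.
Qed.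

Definition encircles (j : root_family) m (x dx : R -> C) :=
  [/\ isAC 0 1 x dx, x 0 = x 1, forall s, 0 <= s <= 1 -> zone j m (x s) /\ ~ cut j m (x s)
    & forall a, cut j m a -> pint x dx (fun z => (z - a)^-1) = twopii].

Lemma encircles_off j m x dx s : encircles j m x dx -> 0 <= s <= 1 -> ~ cuts (x s).
Proof.
move=> [_ _ hz _] /hz[hx hc] /cutsE[E|[j' [k hk]]].
  by move: hx; rewrite E; exact: zone_off0.
by have [Ej Ek] := zone_disjoint hx (cut_zone hk); apply: hc; rewrite Ej Ek.
Qed.

Lemma encircles_wind j m x dx a : encircles j m x dx ->
  (cut j m a -> pint x dx (fun z => (z - a)^-1) = twopii) /\
  (~ zone j m a -> pint x dx (fun z => (z - a)^-1) = 0).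
Proof.
move=> [hx xc hz hw]; split; first exact: hw.
by apply: diskoid_winding hx xc _; [exact: zone_diskoid|move=> s /hz[]].
Qed.

End Cycle.
End Normalization.

(** * Residues between a large and a small circle *)

Section Residue.
Variable R : realType.
Local Notation C := R[i].
Local Notation twopii := (2 * pi%:C * 'i : C).
Implicit Types (z a : C) (k : int).
Variables (t g s1 t' g' s2 : int -> C) (w w' : int -> C -> C) (A B : int -> set C) (n : int).
Hypothesis hA : half t g w A.
Hypothesis hB : half t' g' w' B.
Hypothesis F1 : rootfam t g s1 w.
Hypothesis F2 : rootfam t' g' s2 w'.
Hypothesis n0 : n != 0.
Hypothesis cross : forall k l z, A k z -> ~ B l (- recip z).
Variables x dx : root_family -> int -> R -> C.
Hypothesis hx : forall j m, encircles t g t' g' A B j m (x j m) (dx j m).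

Local Notation Q := (quot t s1 s2 w w' n).
Local Notation cuts := (cuts t g t' g').
Local Notation cut := (cut t g t' g').
Local Notation zone := (zone A B).
Local Notation big N := (circle 0 (Rad R N) : R -> C).
Local Notation dbig N := (dcircle (Rad R N) : R -> C).
Local Notation small N := (circle 0 ((16 * Rad R N)^-1) : R -> C).
Local Notation dsmall N := (dcircle ((16 * Rad R N)^-1) : R -> C).
Local Notation pole a := (fun z : C => (z - a)^-1).

Lemma wind_sum j k a N : cut j k a ->
  \sum_(i < (2 * N).+1) pint (x j (i%:Z - N%:Z)) (dx j (i%:Z - N%:Z)) (pole a) =
  if (`|k| <= N)%N then twopii else 0.
Proof.
move=> hk; have hz := cut_zone hA hB hk.
have other m : m != k -> pint (x j m) (dx j m) (pole a) = 0.
  move=> mk; have [_] := encircles_wind hA hB a (hx j m); apply => hm.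
  by have [_ E] := zone_disjoint hA hB cross hm hz; rewrite E eqxx in mk.
case: ifPn => kN.
  have [i Ei] := pp_mem kN; rewrite (bigD1 i)//= Ei big1 ?addr0.
    by have [h _] := encircles_wind hA hB a (hx j k); exact: h.
  by move=> l li; apply: other; apply: contraNN li => /eqP E; rewrite -val_eqE /=; lia.
by apply: big1 => i _; apply: other; apply: contraNN kN => /eqP <-; have := ltn_ord i; lia.
Qed.

Lemma wind_sum0 j a N : (forall m, ~ zone j m a) ->
  \sum_(i < (2 * N).+1) pint (x j (i%:Z - N%:Z)) (dx j (i%:Z - N%:Z)) (pole a) = 0.
Proof. by move=> h; apply: big1 => i _; have [_] := encircles_wind hA hB a (hx j (i%:Z - N%:Z)); apply. Qed.

Section Fixed.
Variable N : nat.
Hypothesis iA : isolated_by t g N.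
Hypothesis iB : isolated_by t' g' N.

Let R0 : 0 < Rad R N := Rad_gt0 R N.
Let r0 : 0 < (16 * Rad R N)^-1. Proof. by rewrite invr_gt0 mulr_gt0. Qed.

Lemma normc_big s : normc (big N s) = Rad R N.
Proof. by have := circle_dist 0 s (ltW R0); rewrite subr0. Qed.

Lemma normc_small s : normc (small N s) = (16 * Rad R N)^-1.
Proof. by have := circle_dist 0 s (ltW r0); rewrite subr0. Qed.

Lemma cut2_radius k a : cut J2 k a -> [/\ (`|k| <= N)%N -> (16 * Rad R N)^-1 < normc a,
  (N < `|k|)%N -> normc a < (16 * Rad R N)^-1 & normc a < Rad R N].
Proof.
move=> /= ha; have [h1 h2 h3] := iB ha.
have a0 : 0 < normc a.
  rewrite normc_gt0; apply/eqP => E; move: h3.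
  by rewrite E /recip mulr0 invr0 oppr0 normc0; move: r0 => /lt_trans h /h; rewrite ltxx.
rewrite normcNE normc_recip in h1 h2 h3.
have e16 (p q : R) : 0 < p -> 0 < q -> ((16 * p)^-1 < q) = ((16 * q)^-1 < p).
  move=> p0 q0; rewrite -[_^-1]div1r ltr_pdivrMr ?mulr_gt0// -[(16 * q)^-1]div1r.
  by rewrite ltr_pdivrMr ?mulr_gt0//; congr (_ < _); ring.
have e16' (p q : R) : 0 < p -> 0 < q -> (p < (16 * q)^-1) = (q < (16 * p)^-1).
  move=> p0 q0; rewrite -[(16 * q)^-1]div1r -[(16 * p)^-1]div1r.
  by rewrite !ltr_pdivlMr ?mulr_gt0//; congr (_ < _); ring.
split.
- by move=> /h1; rewrite e16.
- by move=> /h2; rewrite e16'.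
- move: h3; rewrite ltf_pV2 ?posrE ?mulr_gt0 ?pi_gt0//; lra.
Qed.

Lemma big_off s : ~ cuts (big N s).
Proof.
move=> /cutsE[E|[[] [k hk]]]; first by have := normc_big s; rewrite E normc0 => E'; move: R0; rewrite -E' ltxx.
  have [h1 h2 _] := iA hk; rewrite normc_big ltxx in h1 h2.
  by have [/h1|/h2] := leqP `|k| N.
by have [_ _] := cut2_radius hk; rewrite normc_big ltxx.
Qed.

Lemma small_off s : ~ cuts (small N s).
Proof.
move=> /cutsE[E|[[] [k hk]]]; first by have := normc_small s; rewrite E normc0 => E'; move: r0; rewrite -E' ltxx.
  by have [_ _] := iA hk; rewrite normc_small ltxx.
have [h1 h2 _] := cut2_radius hk; rewrite normc_small ltxx in h1 h2.
by have [/h1|/h2] := leqP `|k| N.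
Qed.

Local Notation I := (bool + ('I_(2 * N).+1 + 'I_(2 * N).+1))%type.

Definition cyc (X : root_family -> int -> R -> C) (b s : R -> C) (i : I) : R -> C :=
  match i with
  | inl true => b | inl false => s
  | inr (inl l) => X J1 (l%:Z - N%:Z) | inr (inr l) => X J2 (l%:Z - N%:Z)
  end.

Definition cyc_coef (i : I) : C := if i is inl true then 1 else -1.

Lemma cyc_sum (f : I -> C) : \sum_i cyc_coef i * f i = f (inl true) - f (inl false)
  - (\sum_(l < (2 * N).+1) f (inr (inl l)) + \sum_(l < (2 * N).+1) f (inr (inr l))).
Proof.
rewrite big_sumType /= big_bool /= big_sumType /= mul1r mulN1r; congr (_ + _).
rewrite opprD -!sumrN; congr (_ + _); apply: eq_bigr => l _; by rewrite mulN1r.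
Qed.

Lemma curves_cyc : curves cuts (cyc x (big N) (small N)) (cyc dx (dbig N) (dsmall N)).
Proof.
have hX j m : [/\ isAC 0 1 (x j m) (dx j m), x j m 0 = x j m 1
    & forall s, 0 <= s <= 1 -> ~ cuts (x j m s)].
  have [h1 h2 _ _] := hx j m; split => // s s01.
  have := encircles_off hA hB cross (hx j m) s01. exact: id.
case=> [[]|[l|l]] /=; [| |exact: hX..].
- by split; [exact: isAC_circle|exact: circle01|move=> s _; exact: big_off].
- by split; [exact: isAC_circle|exact: circle01|move=> s _; exact: small_off].
Qed.

(** With coefficients 1, -1, -1 for the large circle, the small circle and the contours, the winding
    numbers cancel: 0 and the second cuts with |k| > N lie inside both circles, the first cuts with
    |k| > N outside both, and the cuts with |k| <= N between the circles and inside one contour. *)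
Lemma cyc_wind a : cuts a ->
  \sum_i cyc_coef i * pint (cyc x (big N) (small N) i) (cyc dx (dbig N) (dsmall N) i) (pole a) = 0.
Proof.
move=> /cutsE ha; rewrite cyc_sum /=.
case: ha => [->|[j [k hk]]].
  rewrite !wind_sum0; [|by move=> m hm; apply: (zone_off0 hA hB hm)..].
  by rewrite !circle_wind_in ?subrr ?normc0// addr0 subr0.
have hz := cut_zone hA hB hk.
case: j hk hz => hk hz.
  have [h1 h2 h3] := iA hk; rewrite (wind_sum N hk) (@wind_sum0 J2); last first.
    by move=> m hm; have [] := zone_disjoint hA hB cross hm hz.
  rewrite (circle_wind_out (rho := (16 * Rad R N)^-1)) ?subr0 ?(ltW r0)// addr0.
  case: leqP => [/h1 h|/h2 h]; first by rewrite circle_wind_in ?subr0// subrr.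
  by rewrite circle_wind_out ?subr0 ?(ltW R0).
have [h1 h2 h3] := cut2_radius hk; rewrite (wind_sum N hk) (@wind_sum0 J1); last first.
  by move=> m hm; have [] := zone_disjoint hA hB cross hm hz.
rewrite (circle_wind_in (rho := Rad R N)) ?subr0// add0r.
case: leqP => [/h1 h|/h2 h].
  by rewrite circle_wind_out ?subr0 ?(ltW r0)// subrr.
by rewrite circle_wind_in ?subr0// subrr.
Qed.

Lemma residues : [/\ cintegrable 0 1 (fun s => Q (big N s) * dbig N s),
  cintegrable 0 1 (fun s => Q (small N s) * dsmall N s) &
  pint (big N) (dbig N) Q - pint (small N) (dsmall N) Q =
    \sum_(l < (2 * N).+1) pint (x J1 (l%:Z - N%:Z)) (dx J1 (l%:Z - N%:Z)) Q +
    \sum_(l < (2 * N).+1) pint (x J2 (l%:Z - N%:Z)) (dx J2 (l%:Z - N%:Z)) Q].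
Proof.
have hc := curves_cyc; have hQ := unifrat_quot F1 F2 n0 hc.
have [hu hs] := cauchy (curves_AC hc) (curves_closed hc) (curves_off hc) cyc_wind hQ.
split.
- exact: cintegrableM (hu (inl true)) (isAC_circle 0 (Rad R N)).1.
- exact: cintegrableM (hu (inl false)) (isAC_circle 0 ((16 * Rad R N)^-1)).1.
by move: hs; rewrite cyc_sum /= => /eqP; rewrite subr_eq0 => /eqP.
Qed.

End Fixed.
End Residue.

(** * Limits of the integrals over the circles *)

Section Limit.
Variable R : realType.
Local Notation C := R[i].
Local Notation cIm := (@complex.Im R).
Local Notation pin := (@pin R).
Local Notation twopii := (2 * pi%:C * 'i : C).
Implicit Types (z a : C) (k : int).
Variables (t g s1 t' g' s2 : int -> C) (w w' : int -> C -> C) (A B : int -> set C) (n : int).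
Hypothesis hA : half t g w A.
Hypothesis hB : half t' g' w' B.
Hypothesis F1 : rootfam t g s1 w.
Hypothesis F2 : rootfam t' g' s2 w'.
Hypothesis n0 : n != 0.
Hypothesis cross : forall k l z, A k z -> ~ B l (- recip z).
Variables x dx : root_family -> int -> R -> C.
Hypothesis hx : forall j m, encircles t g t' g' A B j m (x j m) (dx j m).
Hypothesis s20 : forall k, s2 k != 0.

Local Notation Q := (quot t s1 s2 w w' n).
Local Notation E1 := (ratio_prod s1 w).
Local Notation E2 := (ratio_prod s2 w').
Local Notation big N := (circle 0 (Rad R N) : R -> C).
Local Notation dbig N := (dcircle (Rad R N) : R -> C).
Local Notation small N := (circle 0 ((16 * Rad R N)^-1) : R -> C).
Local Notation dsmall N := (dcircle ((16 * Rad R N)^-1) : R -> C).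
Local Notation amp := (amplitude s2 w).

Lemma quotE z : Q z = amp * (t n - z)^-1 * (E1 z * E2 (- recip z)).
Proof.
rewrite /quot /common (ratio_prodE F1) (ratio_prodE F2) /ratio opprK invfM.
ring.
Qed.

(** The leading coefficient at infinity, where E2(-recip z) tends to E2(0) and, far from the real
    axis, E1 to 1. The product of the zeros in E2(0) cancels against C_n and leaves chi_1(0) of
    [Irec v] in the denominator. *)
Lemma amp_E2 : amp * E2 0 = 'i * (chi1 w 0 / chi1 w' 0).
Proof.
have [l [hl El nz]] := tame_cvg (rootfam_tame_sig F2 0).
have [l' [hl' El' nz']] := tame_cvg (rootfam_tame_w F2 0).
have l0 : l != 0 by apply: nz => k; rewrite subr0 mulf_neq0 ?invr_eq0 ?pin_neq0.
have l'0 : l' != 0.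
  apply: nz' => k; rewrite mulf_neq0 ?invr_eq0 ?pin_neq0//.
  exact: croot_neq0 (half_root hB (k := k)) (half_off0 hB (k := k)).
have e : E2 0 = l / l'.
  rewrite /ratio_prod -(prodZ_div l'0 hl hl'); congr prodZ; apply/funext => k.
  by rewrite /ratio invfM invrK mulrACA mulVf ?pin_neq0// mulr1.
have q : prodZ (fun k => s2 k / pin k) = l.
  by rewrite -El; congr prodZ; apply/funext => k; rewrite subr0.
rewrite /amplitude q e /chi1 El'.
have -> : ('i : C)^-1 = - 'i by rewrite -[LHS]mul1r -[X in X / _]opprK -(sqrCi C) mulNr expr2 mulfK ?neq0Ci.
by field; rewrite l'0 l0.
Qed.

Lemma normc_dcircle (rho : R) s : 0 <= rho -> normc (dcircle rho s : C) = 2 * pi * rho.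
Proof.
move=> r0; rewrite /dcircle normcM normcM normc_circ mul1r normcM !normc_real ger0_norm//.
rewrite ger0_norm ?mulr_ge0 ?pi_ge0//.
by rewrite /= expr0n expr1n /= add0r sqrtr1 mulr1 mulrC.
Qed.

Lemma E2_far (e : R) : 0 < e -> exists N0, forall N z, (N0 <= N)%N -> normc z = Rad R N ->
  normc (E2 (- recip z) - E2 0) <= e.
Proof.
move=> e0; have [d d0 hd] := rootfam_ccont0 F2 (fun k => half_off0 hB (k := k)) e0.
have [N0 hN0] := Rad_large d^-1; exists N0 => N z NN nz.
apply/ltW; apply: hd; rewrite subr0 normcNE normc_recip nz.
have dV : 0 < d^-1 by rewrite invr_gt0.
have h := hN0 N NN; have R0 := Rad_gt0 R N.
rewrite -[ltRHS]invrK ltf_pV2; [lra|by rewrite posrE mulr_gt0|by rewrite posrE].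
Qed.

Lemma Im_big s : 0 < s < 1 / 2 \/ 1 / 2 < s < 1 -> forall Y : R, exists N0, forall N, (N0 <= N)%N ->
  Y <= `|cIm (big N s)|.
Proof.
move=> hs Y; have p0 := pi_gt0 R.
have sn : sin (2 * pi * s) != 0.
  case: hs => /andP[h1 h2].
    by rewrite gt_eqF// sin_gt0_pi//; apply/andP; split; nra.
  have -> : 2 * pi * s = (2 * pi * s - pi) + pi by ring.
  by rewrite sinDpi oppr_eq0 gt_eqF// sin_gt0_pi//; apply/andP; split; nra.
have a0 : 0 < `|sin (2 * pi * s)| by rewrite normr_gt0.
have [N0 hN0] := Rad_large (Y / `|sin (2 * pi * s)|); exists N0 => N NN.
have E : cIm (big N s) = Rad R N * sin (2 * pi * s).
  by rewrite /circle add0r circE cImM /= mul0r addr0.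
rewrite E normrM (ger0_norm (ltW (Rad_gt0 R N))) -ler_pdivrMr//.
exact/ltW/hN0.
Qed.

(** Q is compared with kap/(t_n - z), whose integral is -2 pi i kap by the winding number around
    t_n. The difference times the density is bounded and tends to 0 except at the real points of the
    circle. *)
Lemma big_limit : ccvg (fun N => pint (big N) (dbig N) Q) (2 * pi%:C * (chi1 w 0 / chi1 w' 0)).
Proof.
have [N1 [[B1 hB1] hY]] := rootfam_circle F1.
have [N2 hN2] := E2_far ltr01.
have [N3 hN3] := half_isolated hA; have [N4 hN4] := half_isolated hB.
have [N5 hN5] := Rad_large (2 * normc (t n)).
(* A shift that makes all bounds valid from the first circle on, as dominated convergence is stated
   for whole sequences. *)
pose K := (N1 + N2 + N3 + N4 + N5)%N.
have [K1 K2 K3 K4 K5] : [/\ forall N, N1 <= N + K, forall N, N2 <= N + K, forall N, N3 <= N + K,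
  forall N, N4 <= N + K & forall N, N5 <= N + K]%N by split=> N; rewrite /K; lia.
clearbody K.
pose kap := amp * E2 0.
pose u N s := (Q (big (N + K) s) - kap * (t n - big (N + K) s)^-1) * dbig (N + K) s.
have isoA N : isolated_by t g (N + K) by apply: hN3.
have isoB N : isolated_by t' g' (N + K) by apply: hN4.
have Rp N : 0 < Rad R N := Rad_gt0 R N.
have nbig N s : normc (big N s) = Rad R N := normc_big N s.
have tR N : 2 * normc (t n) < Rad R (N + K) by apply: hN5.
have tn_in N : normc (t n - 0) < Rad R (N + K).
  by rewrite subr0; have := tR N; have := normc_ge0 (t n); lra.
have tnK N s : t n - big N s = - (big N s - t n) by rewrite opprB.
have pole_in N : cintegrable 0 1 (fun s => (t n - big (N + K) s)^-1 * dbig (N + K) s) /\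
    pint (big (N + K)) (dbig (N + K)) (fun z => (t n - z)^-1) = - twopii.
  have hi : cintegrable 0 1 (fun s => (big (N + K) s - t n)^-1 * dbig (N + K) s).
    apply: cintegrableM (isAC_circle 0 _).1.
    have hc := isACB (isAC_circle 0 (Rad R (N + K))) (isAC_cst 0 1 (t n)).
    apply: isAC_ucont (isACV ler01 _ hc) => s _; rewrite subr_eq0; apply/eqP => E.
    by have := nbig (N + K)%N s; rewrite E => E'; have := tn_in N; rewrite subr0 E' ltxx.
  have hi' := cintegrableN hi; split.
    by apply: cintegrable_eq_cc hi' => s _; rewrite tnK invrN mulNr.
  rewrite -(circle_wind_in (Rp (N + K)%N) (tn_in N)) /pint -cintN//.
  by apply: cint_eq_cc => s _; rewrite tnK invrN mulNr.
have hu N : cintegrable 0 1 (u N) /\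
    cint 0 1 (u N) = pint (big (N + K)) (dbig (N + K)) Q - 2 * pi%:C * (chi1 w 0 / chi1 w' 0).
  have [i1 _ _] := residues hA hB F1 F2 n0 cross hx (isoA N) (isoB N).
  have [i2 e2] := pole_in N; have i3 := cintegrableZ kap i2.
  have Eu s : Q (big (N + K) s) * dbig (N + K) s - kap * ((t n - big (N + K) s)^-1 * dbig (N + K) s) = u N s.
    by rewrite /u; ring.
  split; first by apply: cintegrable_eq_cc (cintegrableB i1 i3) => s _; exact: Eu.
  rewrite -(@cint_eq_cc _ _ _ _ _ (fun s _ => Eu s)) cintB// cintZ//.
  rewrite (e2 : cint 0 1 _ = _) /kap amp_E2; congr (_ - _).
  have -> : 'i * (chi1 w 0 / chi1 w' 0) * - twopii = - 'i ^+ 2 * (2 * pi%:C * (chi1 w 0 / chi1 w' 0)) by ring.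
  by rewrite sqrCi opprK mul1r.
(* 4 pi bounds the quotient of |dbig| = 2 pi R by |t_n - z| >= R/2. *)
have ub N s : normc (u N s) <= 4 * pi * normc amp *
    normc (E1 (big (N + K) s) * E2 (- recip (big (N + K) s)) - E2 0).
  rewrite /u quotE /kap; set z := big _ s; set e := E1 z * _.
  have -> : (amp * (t n - z)^-1 * e - amp * E2 0 * (t n - z)^-1) * dbig (N + K) s =
    amp * (e - E2 0) * ((t n - z)^-1 * dbig (N + K) s) by ring.
  rewrite 2!normcM [normc (_^-1 * _)]normcM normcV normc_dcircle ?(ltW (Rp _))//.
  have zR : normc z = Rad R (N + K) := nbig _ _.
  have hz : Rad R (N + K) / 2 <= normc (t n - z).
    by have := normc_ge_B z (t n); rewrite normcC zR; have := tR N; lra.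
  have zp : 0 < normc (t n - z) by apply: lt_le_trans hz; rewrite divr_gt0.
  have q : (normc (t n - z))^-1 * (2 * pi * Rad R (N + K)) <= 4 * pi.
    rewrite mulrC ler_pdivrMr//; have := ler_wpM2l (pi_ge0 R) hz; lra.
  have -> : 4 * pi * normc amp * normc (e - E2 0) = normc amp * normc (e - E2 0) * (4 * pi) by ring.
  by rewrite ler_wpM2l// mulr_ge0 ?normc_ge0.
pose E2b := normc (E2 0) + 1.
have E2b0 : 0 < E2b by rewrite /E2b ltr_wpDl ?normc_ge0.
have E2bd N s : normc (E2 (- recip (big (N + K) s))) <= E2b.
  have h := hN2 (N + K)%N (big (N + K) s) (K2 N) (nbig _ _).
  have := normcD (E2 (- recip (big (N + K) s)) - E2 0) (E2 0).
  by rewrite subrK /E2b; lra.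
have split_e (e1 e2 f : C) : e1 * e2 - f = (e1 - 1) * e2 + (e2 - f) by ring.
have eb N s : normc (E1 (big (N + K) s) * E2 (- recip (big (N + K) s)) - E2 0) <= (B1 + 1) * E2b + 1.
  rewrite split_e; apply: le_trans (normcD _ _) (lerD _ _).
    rewrite normcM; apply: ler_pM; [exact: normc_ge0|exact: normc_ge0| |exact: E2bd].
    apply: le_trans (normcB _ _) _; rewrite normc1 lerD2r; exact: hB1 (K1 N) (nbig _ _).
  exact: hN2 (K2 N) (nbig _ _).
have amp0 : 0 <= 4 * pi * normc amp by rewrite mulr_ge0 ?normc_ge0// mulr_ge0 ?pi_ge0.
have up s : 0 < s < 1 / 2 \/ 1 / 2 < s < 1 -> ccvg (fun N => u N s) 0.
  move=> hs e e0; pose k := 4 * pi * normc amp + 1.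
  have k0 : 0 < k by rewrite /k ltr_wpDl.
  have [Y hY'] := hY (e / (2 * k * E2b)) (divr_gt0 e0 (mulr_gt0 (mulr_gt0 (ltr0Sn _ 1) k0) E2b0)).
  have [M1 hM1] := Im_big hs Y.
  have [M2 hM2] := E2_far (divr_gt0 e0 (mulr_gt0 (ltr0Sn _ 1) k0)).
  exists (M1 + M2)%N => N NN; rewrite subr0; apply: le_trans (ub N s) _.
  have NM1 : (M1 <= N + K)%N by apply: leq_trans (leq_addr _ _); exact: leq_trans (leq_addr _ _) NN.
  have NM2 : (M2 <= N + K)%N by apply: leq_trans (leq_addr _ _); exact: leq_trans (leq_addl _ _) NN.
  set X := normc (_ - _); have hX : X <= e / k.
    rewrite /X split_e; apply: le_trans (normcD _ _) _.
    have -> : e / k = e / (2 * k * E2b) * E2b + e / (2 * k) by field; rewrite !gt_eqF.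
    apply: lerD; last exact: hM2 NM2 (nbig _ _).
    rewrite normcM; apply: ler_pM; [exact: normc_ge0|exact: normc_ge0| |exact: E2bd].
    exact: hY' (K1 N) (nbig _ _) (hM1 _ NM1).
  apply: (@le_trans _ _ (k * X)); first by rewrite ler_wpM2r ?normc_ge0// /k lerDl.
  by rewrite mulrC -ler_pdivlMr.
have h1 : 0 <= 1 / 2 :> R by lra.
have h2 : 1 / 2 <= 1 :> R by lra.
have uB N s : normc (u N s) <= 4 * pi * normc amp * ((B1 + 1) * E2b + 1).
  by apply: le_trans (ub N s) _; rewrite ler_wpM2l.
have L1 := @cint_dominated R 0 (1 / 2) u _ h1 (fun N => cintegrableS (lexx _) h2 (hu N).1)
  (fun N s _ => uB N s) (fun s hs => up s (or_introl hs)).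
have L2 := @cint_dominated R (1 / 2) 1 u _ h2 (fun N => cintegrableS h1 (lexx _) (hu N).1)
  (fun N s _ => uB N s) (fun s hs => up s (or_intror hs)).
move=> e e0; have e2 : 0 < e / 2 by rewrite divr_gt0.
have [M1 hM1] := L1 _ e2; have [M2 hM2] := L2 _ e2.
exists (M1 + M2 + K)%N => N NN; have -> : N = (N - K + K)%N by lia.
rewrite -(hu (N - K)%N).2 (cint_split h1 h2 (hu _).1).
apply: le_trans (normcD _ _) _; have -> : e = e / 2 + e / 2 by field.
have := hM1 (N - K)%N ltac:(lia); have := hM2 (N - K)%N ltac:(lia).
by rewrite !subr0 => a b; exact: lerD.
Qed.

(** Q stays bounded while the length tends to 0: E1 is continuous at 0, and -recip z runs over the
    circle of radius [Rad N], on which E2 is bounded. *)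
Lemma small_limit : ccvg (fun N => pint (small N) (dsmall N) Q) 0.
Proof.
have [N1 [[B2 hB2] _]] := rootfam_circle F2.
have [N3 hN3] := half_isolated hA; have [N4 hN4] := half_isolated hB.
have tn0 : 0 < normc (t n).
  rewrite normc_gt0; apply/eqP => E; apply: (half_off0 hA (k := n)).
  by have := seg_center (t n) (g n); rewrite {2}E.
have [d d0 hd] := rootfam_ccont0 F1 (fun k => half_off0 hA (k := k)) ltr01.
have [N5 hN5] := Rad_large (d^-1 + (normc (t n))^-1).
pose L := normc amp * (normc (t n) / 2)^-1 * ((normc (E1 0) + 1) * Num.max B2 0).
have L0 : 0 <= L.
  apply: mulr_ge0; first by rewrite mulr_ge0 ?normc_ge0// invr_ge0 divr_ge0 ?normc_ge0.
  by rewrite mulr_ge0 ?addr_ge0 ?normc_ge0// le_max lexx orbT.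
have p0 := pi_gt0 R.
(* The integral is at most 4 pi L r, one factor 2 coming from [nrm1_le]; with r = 1/(16 Rad N) this
   choice makes it at most e. *)
move=> e e0; have [N6 hN6] := Rad_large (4 * pi * L / e).
exists (N1 + N3 + N4 + N5 + N6)%N => N NN; rewrite subr0.
have [M1 M3 M4 M5 M6] : [/\ N1 <= N, N3 <= N, N4 <= N, N5 <= N & N6 <= N]%N by split; lia.
have [_ i2 _] := residues hA hB F1 F2 n0 cross hx (hN3 N M3) (hN4 N M4).
have Rp := Rad_gt0 R N; set r := (16 * Rad R N)^-1.
have r0 : 0 < r by rewrite invr_gt0 mulr_gt0.
have nsm s : normc (small N s) = r := normc_small N s.
have hR := hN5 N M5.
have dV : 0 < d^-1 by rewrite invr_gt0.
have tV : 0 < (normc (t n))^-1 by rewrite invr_gt0.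
have rd : r < d.
  rewrite -[ltRHS]invrK ltf_pV2; [lra|by rewrite posrE mulr_gt0|by rewrite posrE].
have rt : r <= normc (t n) / 2.
  rewrite -[leRHS]invrK lef_pV2; [|by rewrite posrE mulr_gt0|by rewrite posrE invr_gt0 divr_gt0].
  by rewrite invfM invrK; lra.
have bound s : normc (Q (small N s) * dsmall N s) <= L * (2 * pi * r).
  rewrite normcM normc_dcircle ?(ltW r0)// ler_wpM2r ?mulr_ge0 ?(ltW p0) ?(ltW r0)//.
  rewrite quotE; set z := small N s; have zr : normc z = r := nsm s.
  rewrite normcM; apply: ler_pM; [exact: normc_ge0|exact: normc_ge0|..].
    rewrite normcM ler_wpM2l ?normc_ge0// normcV.
    have h : normc (t n) / 2 <= normc (t n - z).
      by have := normc_ge_B (t n) z; rewrite zr; lra.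
    have q0 : 0 < normc (t n) / 2 by rewrite divr_gt0.
    by rewrite lef_pV2 ?posrE// (lt_le_trans q0).
  rewrite normcM; apply: ler_pM; [exact: normc_ge0|exact: normc_ge0|..].
    have : normc (E1 z - E1 0) < 1 by apply: hd; rewrite subr0 zr.
    by have := normcD (E1 z - E1 0) (E1 0); rewrite subrK; lra.
  rewrite le_max; apply/orP; left; apply: (hB2 N) => //.
  by rewrite normcNE normc_recip zr /r; field; rewrite gt_eqF.
apply: (@le_trans _ _ (rint 0 1 (fun=> 2 * (L * (2 * pi * r))))).
  apply: cint_bound i2 (rintegrable_cst _ _ _) _ => s _.
  by apply: le_trans (nrm1_le _) _; rewrite ler_wpM2l.
rewrite /rint Rintegral_cst//= lebesgue_measure_itv /= lte_fin ltr01 /= subr0 mulr1.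
have hr : 4 * pi * L / e < Rad R N := hN6 N M6.
have -> : 2 * (L * (2 * pi * r)) = 4 * pi * L * r by ring.
rewrite ltr_pdivrMr// in hr.
rewrite /r ler_pdivrMr ?mulr_gt0//; have := mulr_gt0 e0 Rp; nra.
Qed.

Lemma chi1_neq0 : chi1 w' 0 != 0.
Proof.
have [l' [hl' El' nz']] := tame_cvg (rootfam_tame_w F2 0).
rewrite /chi1 El'; apply: nz' => k; rewrite mulf_neq0 ?invr_eq0 ?pin_neq0//.
exact: croot_neq0 (half_root hB (k := k)) (half_off0 hB (k := k)).
Qed.

(* The residue sum over the gaps is 2 pi, and the large circle contributes 2 pi times the
   quotient of the two values. *)
Lemma chi1_normalized :
  (forall m, pint (x J1 m) (dx J1 m) Q = 2 * pi%:C * (m == n)%:R) ->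
  (forall m, pint (x J2 m) (dx J2 m) Q = 0) -> chi1 w 0 = chi1 w' 0.
Proof.
move=> b1 b2; have [N3 hN3] := half_isolated hA; have [N4 hN4] := half_isolated hB.
have h1 : ccvg (fun N => pint (big N) (dbig N) Q + -1 * pint (small N) (dsmall N) Q) (2 * pi%:C).
  apply: ccvg_eq (ccvg_cst _); exists (`|n| + N3 + N4)%N => N NN.
  have [M1 M3 M4] : [/\ `|n| <= N, N3 <= N & N4 <= N]%N by split; lia.
  have [_ _] := residues hA hB F1 F2 n0 cross hx (hN3 N M3) (hN4 N M4).
  rewrite mulN1r => ->; rewrite [X in _ + X]big1 ?addr0; last by move=> l _; exact: b2.
  have [i Ei] := pp_mem M1; rewrite (bigD1 i)//= Ei b1 eqxx mulr1 big1 ?addr0// => l li.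
  rewrite b1; case: eqP => [E|]; last by rewrite mulr0.
  by move: li; rewrite -val_eqE /= => /eqP; lia.
have h2 : ccvg (fun N => pint (big N) (dbig N) Q + -1 * pint (small N) (dsmall N) Q)
    (2 * pi%:C * (chi1 w 0 / chi1 w' 0)).
  move=> e e0; have e2 : 0 < e / 2 by rewrite divr_gt0.
  have [M1 H1] := big_limit e2; have [M2 H2] := small_limit e2.
  exists (maxn M1 M2) => N; rewrite geq_max => /andP[m1 m2].
  have := H1 N m1; have := H2 N m2; rewrite subr0 mulN1r => a b.
  rewrite addrAC; apply: le_trans (normcB _ _) _; lra.
have p0 : 2 * pi%:C != 0 :> C.
  by rewrite mulf_neq0 ?pnatr_eq0// -normc_gt0 normc_real normr_gt0 gt_eqF ?pi_gt0.
have := ccvg_unique h1 h2; rewrite -[LHS]mulr1 => /(mulfI p0) E.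
by rewrite -[RHS]mul1r E divfK// chi1_neq0.
Qed.

End Limit.

(** * Exchange of v and Irec v *)

Section Exchange.
Variable R : realType.
Local Notation C := R[i].
Local Notation cRe := (@complex.Re R).
Local Notation twopii := (2 * pi%:C * 'i : C).
Implicit Types (z a : C) (k : int).
Variables (t g s1 t' g' s2 : int -> C) (w w' : int -> C -> C) (A B : int -> set C) (n : int).
Hypothesis hA : half t g w A.
Hypothesis hB : half t' g' w' B.
Hypothesis F1 : rootfam t g s1 w.
Hypothesis F2 : rootfam t' g' s2 w'.
Hypothesis n0 : n != 0.
Hypothesis cross : forall k l z, A k z -> ~ B l (- recip z).
Variables (c rho : R).
Hypothesis A0 : A 0 = disc c%:C rho.
Hypothesis B0 : forall z, B 0 z <-> A 0 (recip z).
Hypothesis Re0 : 0 < cRe (t' 0 + g' 0) /\ 0 < cRe (t' 0 - g' 0).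
Hypothesis ends0 : t 0 + g 0 = recip (t' 0 - g' 0) /\ t 0 - g 0 = recip (t' 0 + g' 0).
Hypothesis chi0 : chi1 w 0 = chi1 w' 0.

Local Notation Q := (quot t s1 s2 w w' n).
Local Notation Qf := (quot_flip t s1 s2 w w' n).
Local Notation pole a := (fun z : C => (z - a)^-1).
Local Notation cuts := (cuts t g t' g').
Local Notation cuts_flip := (cuts_flip t g t' g').

Lemma cross' k l z : B k z -> ~ A l (- recip z).
Proof. by move=> Bz /(@cross l k); rewrite recipN recipK opprK. Qed.

Lemma gap0_radius : exists r, [/\ 0 <= r < rho,
  forall a, seg (t 0) (g 0) a -> normc (a - c%:C) <= r &
  forall a, seg (t' 0) (g' 0) a -> normc (recip a - c%:C) <= r].
Proof.
have [|r1 r1r h1] := @seg_in_disc _ (t 0) (g 0) c%:C rho.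
  by rewrite -A0 => z; exact: (half_seg hA).
have [|r2 r2r h2] := @recip_seg_in_disc _ (t' 0) (g' 0) c%:C rho (half_off0 hB (k := 0)).
  by move=> z /(half_seg hB)/B0; rewrite A0.
have r10 : 0 <= r1 := le_trans (normc_ge0 _) (h1 _ (seg_center _ _)).
exists (Num.max r1 r2); split.
- by rewrite le_max r10 gt_max r1r r2r.
- by move=> a /h1 h; rewrite le_max h.
- by move=> a /h2 h; rewrite le_max h orbT.
Qed.

Definition other (j : root_family) := if j is J1 then J2 else J1.

Section Curve.
Variables (j : root_family) (m : int) (y dy : R -> C).
Hypothesis hy : encircles t' g' t g B A j m y dy.

Lemma inv_neq0 s : 0 <= s <= 1 -> y s != 0.
Proof.
move=> s01; apply/eqP => E; have [_ _ /(_ s s01)[hz _] _] := hy.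
by move: hz; rewrite E; exact: (zone_off0 hB hA).
Qed.

Lemma inv_AC : isAC 0 1 (inv_path y) (inv_dpath y dy).
Proof. by have [h _ _ _] := hy; exact: inv_path_isAC h inv_neq0. Qed.

Lemma inv_closed : inv_path y 0 = inv_path y 1.
Proof. by have [_ h _ _] := hy; rewrite /inv_path h. Qed.

Lemma inv_wind a : cut t' g' t g j m (recip a) -> pint (inv_path y) (inv_dpath y dy) (pole a) = twopii.
Proof.
move=> ha; have [h1 h2 h3 h4] := hy; have hz := cut_zone hB hA ha.
have a0 : recip a != 0 by apply/eqP => E; move: hz; rewrite E; exact: (zone_off0 hB hA).
have ya s : 0 <= s <= 1 -> y s != recip a.
  by move=> /h3[_ hc]; apply/eqP => E; apply: hc; rewrite E.
have := inv_winding h1 inv_neq0 ya a0; rewrite -/(recip (recip a)) recipK => ->.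
rewrite (h4 _ ha) (_ : pint y dy (pole 0) = 0) ?subr0//.
by apply: (encircles_wind hB hA 0 hy).2 => /(zone_off0 hB hA).
Qed.

(** -recip carries the data (j, m) of [Irec v] to (other j, m) of v, and for m <> 0 the oddness of
    the labels turns the remaining sign into -m. *)
Lemma inv_encircles : m != 0 -> encircles t g t' g' A B (other j) (- m) (inv_path y) (inv_dpath y dy).
Proof.
move=> m0; have [h1 h2 h3 h4] := hy; have mN0 : - m != 0 by rewrite oppr_eq0.
have cutE a : cut t g t' g' (other j) (- m) a <-> cut t' g' t g j m (recip a).
  case: (j) => /=.
    by rewrite -[seg (t' m) _ _](propext (half_segN hB _ m0)).
  by rewrite recipK -[seg (t m) _ _](propext (half_segN hA _ m0)) opprK.
have zoneE a : zone B A j m (recip a) -> zone A B (other j) (- m) a.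
  case: (j) => /=.
    by have [_ _ _ _ /(_ _ mN0)[h _ _]] := hB; rewrite opprK in h; exact: h.
  have [_ _ _ _ /(_ _ mN0)[h _ _]] := hA; rewrite opprK in h.
  by rewrite recipK => /h; rewrite opprK.
split.
- exact: inv_AC.
- exact: inv_closed.
- move=> s /h3[hz hc]; have E : y s = recip (inv_path y s) by rewrite /inv_path -/(recip _) recipK.
  by split; [apply: zoneE; rewrite -E|move=> /cutE; rewrite -E].
- by move=> a /cutE; exact: inv_wind.
Qed.

End Curve.

(** A zone contains no cut but its own, so the winding numbers around all cuts are prescribed. *)
Lemma same_encircles j m (x dx y dy : R -> C) : encircles t g t' g' A B j m x dx ->
  encircles t g t' g' A B j m y dy -> pint x dx Q = pint y dy Q.
Proof.
move=> hx hy; have hc : curves cuts (two x y) (two dx dy).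
  by case; [have [h1 h2 _ _] := hx|have [h1 h2 _ _] := hy]; split => //= s s01;
    [exact: (encircles_off hA hB cross hx s01)|exact: (encircles_off hA hB cross hy s01)].
apply: (same_pint hc) (unifrat_quot F1 F2 n0 hc) => a /cutsE ha.
have [wx wx0] := encircles_wind hA hB a hx; have [wy wy0] := encircles_wind hA hB a hy.
have [hz|hz] := pselect (zone A B j m a); last by rewrite wx0// wy0.
case: ha => [E|[j' [k hk]]]; first by move: hz; rewrite E => /(zone_off0 hA hB).
have [Ej Ek] := zone_disjoint hA hB cross hz (cut_zone hA hB hk).
by rewrite -Ej -Ek in hk; rewrite wx// wy.
Qed.

(** The image curve lies in a zone of nonzero index, away from U_0 and -U_0, so [quot_flipE] holds
    at each of its points. *)
Lemma exchange_far j m (x dx y dy : R -> C) : m != 0 ->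
  encircles t' g' t g B A j m y dy ->
  encircles t g t' g' A B (other j) (- m) x dx ->
  pint (inv_path y) (inv_dpath y dy) Qf = - pint x dx Q.
Proof.
move=> m0 hy hx; have hi := inv_encircles hy m0.
have [r [/andP[r0 rr] h1 h2]] := gap0_radius.
rewrite (same_encircles hx hi).
have hc : curves cuts (two x (inv_path y)) (two dx (inv_dpath y dy)).
  by case; [have [g1 g2 _ _] := hx|have [g1 g2 _ _] := hi]; split => //= s s01;
    [exact: (encircles_off hA hB cross hx s01)|exact: (encircles_off hA hB cross hi s01)].
have wind0 a : cuts a -> \sum_(b : bool) (0 : C) *
    pint (two x (inv_path y) b) (two dx (inv_dpath y dy) b) (pole a) = 0.
  by move=> _; apply: big1 => b _; rewrite mul0r.
have [hu _] := cauchy (curves_AC hc) (curves_closed hc) (curves_off hc) wind0 (unifrat_quot F1 F2 n0 hc).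
have hint := cintegrableM (hu false) (inv_AC hy).1.
rewrite /pint -cintN//; apply: cint_eq_cc => s s01.
have [_ _ /(_ s s01)[hz _] _] := hi; set z := inv_path y s in hz *.
have z0 : z != 0 by apply/eqP => E; move: hz; rewrite E => /(zone_off0 hA hB).
have far u : zone A B J1 0 u -> zone A B (other j) (- m) z -> u = z -> False.
  move=> hu0 hz' E; rewrite E in hu0; have [_ E'] := zone_disjoint hA hB cross hu0 hz'.
  by move/eqP: m0; apply; rewrite -[m]opprK -E' oppr0.
rewrite (quot_flipE s1 s2 n hA hB Re0 ends0 chi0 h1 h2 z0) ?mulNr//.
  rewrite ltNge; apply/negP => zr; apply: (far z) => //=; rewrite A0.
  exact: le_lt_trans zr rr.
rewrite ltNge; apply/negP => zr.
have hz0 : zone A B J2 0 z.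
  by rewrite /= B0 recipN recipK A0; exact: le_lt_trans zr rr.
have [_ E'] := zone_disjoint hA hB cross hz0 hz.
by move/eqP: m0; apply; rewrite -[m]opprK -E' oppr0.
Qed.

Lemma cuts_in j z : cuts z -> zone A B j 0 z -> cut t g t' g' j 0 z.
Proof.
move=> /cutsE[->|[j' [k hk]]] hz; first by case: (zone_off0 hA hB hz).
by have [-> ->] := zone_disjoint hA hB cross hz (cut_zone hA hB hk).
Qed.

Lemma cuts0_in j z : cuts0 t g t' g' z -> ~ zone A B j 0 z.
Proof.
move=> [->|[k k0 hk]] hz; first by case: (zone_off0 hA hB hz).
have [j' hk'] : exists j', cut t g t' g' j' k z by case: hk => h; [exists J1|exists J2].
have [_ E] := zone_disjoint hA hB cross hz (cut_zone hA hB hk').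
by rewrite -E eqxx in k0.
Qed.

Lemma zone2_0 z : zone A B J2 0 z <-> A 0 (- z).
Proof. by rewrite /= B0 recipN recipK. Qed.

(** The image curve stays in U_0 or -U_0, where the two quotients may have different cuts. They are
    opposite only in an annulus around these cuts, hence [swap_disc]. *)
Lemma exchange_near j (x dx y dy : R -> C) :
  encircles t' g' t g B A j 0 y dy -> encircles t g t' g' A B j 0 x dx ->
  pint (inv_path y) (inv_dpath y dy) Qf = - pint x dx Q.
Proof.
move=> hy hx; have [r [r0r h1 h2]] := gap0_radius; have [x1 x2 x3 x4] := hx; have [_ _ y3 _] := hy.
(* Centre of the disc that is the zone of index 0: U_0 for J1 and -U_0 for J2. *)
pose c' : C := if j is J1 then c%:C else - c%:C.
have distE z : normc (z - c') = normc ((if j is J1 then z else - z) - c%:C).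
  rewrite /c'; case: (j) => //; have -> : - z - c%:C = - (z - - c%:C) by ring.
  by rewrite normcNE.
have discE z : disc c' rho z <-> zone A B j 0 z.
  rewrite /disc /= distE; case: (j); first by rewrite /= A0.
  by rewrite zone2_0 A0.
clearbody c'.
have cut_flip z : cuts_flip z -> zone A B j 0 z -> cut t' g' t g j 0 (recip z).
  move=> [/cuts0_in h /h//|[h|h]] hz; case: (j) hz => hz /=.
  - by have /= hA0 := half_seg hA h; case: (A0N B0 cross hz).
  - by rewrite recipK.
  - exact: h.
  - by move/zone2_0: hz => hz; have := half_seg hB h => /B0; rewrite recipK => /(A0N B0 cross).
have yE s : y s = recip (inv_path y s) by rewrite /inv_path -/(recip _) recipK.
apply: (@swap_disc _ cuts cuts_flip Q Qf c' rho r x dx) => //.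
- move=> a ha /discE /(cuts_in ha); rewrite distE; case: (j) => /=; first exact: h1.
  by move=> /h2; rewrite recipN recipK.
- move=> a ha /discE /(cut_flip _ ha); rewrite distE; case: (j) => /=.
    by move=> /h2; rewrite recipK.
  by rewrite recipK => /h1.
- move=> s s01; have [hz _] := x3 s s01; split; first exact/discE.
  exact: (encircles_off hA hB cross hx s01).
- exact: inv_AC hy.
- exact: inv_closed hy.
- move=> s s01; have [hz hc] := y3 s s01.
  have hz' : zone A B j 0 (inv_path y s).
    rewrite {1}yE in hz; case: (j) hz => /=; first by move=> /B0; rewrite recipK.
    by rewrite recipK => hz; apply/zone2_0.
  split; first exact/discE.
  by move=> hf; apply: hc; rewrite yE; exact: cut_flip hf hz'.
- by move=> a ha /discE /(cuts_in ha); exact: x4.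
- by move=> a ha /discE /(cut_flip _ ha); exact: inv_wind hy _.
- by move=> X dX; exact: unifrat_quot.
- by move=> X dX; exact: unifrat_quot_flip.
move=> z /andP[z1 z2]; have hz : zone A B j 0 z by apply/discE.
have z0 : z != 0 by apply/eqP => E; move: hz; rewrite E => /(zone_off0 hA hB).
have [_ rr] := andP r0r.
apply: (quot_flipE s1 s2 n hA hB Re0 ends0 chi0 h1 h2 z0);
rewrite distE in z1; case: (j) z1 hz => z1 hz.
- exact: z1.
- rewrite ltNge; apply/negP => zr; move/zone2_0: hz => hz; apply: (A0N B0 cross hz).
  by rewrite opprK A0; exact: le_lt_trans zr rr.
- rewrite ltNge; apply/negP => zr; apply: (A0N B0 cross (z := z)) => //.
  by rewrite A0; exact: le_lt_trans zr rr.
- exact: z1.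
Qed.

End Exchange.

(** * From the listed eigenvalues to root families *)

Section Setting.
Variable R : realType.
Local Notation C := R[i].
Local Notation cRe := (@complex.Re R).
Implicit Types (z a : C) (k : int) (v : pot R).
Variable M : R -> R[i] -> pot R -> 'M[R[i]]_2.
Hypothesis M_solution : forall (v : pot R) (z : R[i]), H1c v -> z != 0 ->
  fundamental_solution z v (fun x => M x z v).
Variables (lam : pot R -> listing R) (radius : pot R -> R) (U : pot R -> int -> set R[i]).
Hypothesis lam_listing : forall v0 v : pot R, H1r v0 -> H1ball v0 (radius v0) v ->
  is_listing (chi_p M v) (lam v).
Hypothesis U_isolating : forall v0 : pot R, H1r v0 ->
  isolating (H1ball v0 (radius v0)) lam (U v0).
Hypothesis U_compatible : Irec_compatible radius U.
Variable W : set (pot R).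
Hypothesis W_sub : forall v : pot R, W v -> exists v0 : pot R, H1r v0 /\ H1ball v0 (radius v0) v.
Hypothesis W_Irec : [set Irec v | v in W] = W.
Variable w : pot R -> int -> R[i] -> R[i].
Hypothesis w_root : forall (v : pot R) (n : int), W v -> is_canonical_root (lam v) n (w v n).

Lemma WI v : W v -> W (Irec v).
Proof. by move=> Wv; rewrite -W_Irec; exists v. Qed.

Let chi_recip v z : H1c v -> z != 0 -> chi_p M v z = chi_p M (Irec v) (recip z).
Proof. by move=> hv; exact: (chi_p_reciprocal M_solution hv (H1c_Irec hv)). Qed.

Definition mid v k : C := tau (lam v) J1 k.
Definition rad v k : C := gamma (lam v) J1 k / 2.
Definition nb v0 k : set C := relabel (U v0) J1 k.

Lemma midD v k : mid v k + rad v k = lamj (lam v) J1 k true.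
Proof. by rewrite /mid /rad /tau /gamma; field. Qed.

Lemma midB v k : mid v k - rad v k = lamj (lam v) J1 k false.
Proof. by rewrite /mid /rad /tau /gamma; field. Qed.

Lemma gap_seg v k : relabel (gap (lam v)) J1 k = seg (mid v k) (rad v k).
Proof.
have key (a b : C) : [set z | exists s : R, 0 <= s <= 1 /\ z = (1 - s)%:C * a + s%:C * b] =
    seg ((b + a) / 2) ((b - a) / 2).
  rewrite eqEsubset; split => z [s [/andP[s0 s1] ->]].
    exists (2 * s - 1); split; first by apply/andP; split; lra.
    by rewrite !rmorphB rmorphM !rmorph1 rmorph_nat; field.
  exists ((s + 1) / 2); split; first by apply/andP; split; lra.
  by rewrite rmorphB /= !rmorphM rmorphD rmorph1 fmorphV rmorph_nat; field.
rewrite /mid /rad /tau /gamma /relabel /lamj; case: ifP => k0; first exact: key.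
rewrite /gap key eqEsubset /Nset; set a := lam v (- k) true; set b := lam v (- k) false.
have e1 : (- b + - a) / 2 = - ((a + b) / 2) by field.
have e2 : (- b - - a) / 2 = (a - b) / 2 by field.
rewrite e1 e2; split => z.
  by move=> [u hu <-]; apply/seg_opp; rewrite !opprK.
by move=> /seg_opp; rewrite opprK => h; exists (- z); rewrite ?opprK.
Qed.

Section Base.
Variables v0 v : pot R.
Hypothesis h0 : H1r v0.
Hypothesis hv : H1ball v0 (radius v0) v.

Lemma nbP k z : nb v0 k z <-> if 0 <= k then U v0 k z else U v0 (- k) (- z).
Proof.
rewrite /nb /=; case: ifP => k0 //; split; first by move=> [u hu <-]; rewrite opprK.
by move=> h; exists (- z) => //; rewrite opprK.
Qed.

Lemma nb_Re k z : nb v0 k z -> if 0 <= k then 0 < cRe z else cRe z < 0.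
Proof.
move=> /nbP; case: ifP => k0 h; first exact: (U_Re_gt0 U_isolating h0 h).
by have := U_Re_gt0 U_isolating h0 h; rewrite cReN oppr_gt0.
Qed.

Lemma nb_disc k : exists c rho, nb v0 k = disc c rho.
Proof.
have [_ _ _ [c [_ [hd _] _]] _] := U_isolating h0.
have pos (m : int) : 0 <= m -> exists a rho, U v0 m = disc a rho.
  by case: m => // m _; have [a [rho [_ E]]] := hd m; exists a%:C, rho.
have [k0|k0] := leP 0 k.
  by have [a [rho E]] := pos k k0; exists a, rho; rewrite /nb /= k0.
have [a [rho E]] := pos (- k) ltac:(lia); exists (- a), rho; rewrite eqEsubset.
split => z; rewrite nbP [0 <= k]leNgt k0 /= E /disc /=; have -> : z - - a = - (- z - a) by ring.
  by rewrite normcNE.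
by rewrite normcNE.
Qed.

Lemma lam_nb k s : nb v0 k (lamj (lam v) J1 k s).
Proof.
apply/nbP; rewrite /lamj; case: (0 <= k); rewrite ?opprK; exact: (lam_in_U U_isolating _ _ h0 hv).
Qed.

Lemma seg_nb k : seg (mid v k) (rad v k) `<=` nb v0 k.
Proof.
have [_ _ hg _ _] := U_isolating h0; rewrite -gap_seg => z.
rewrite nbP /relabel; case: ifP => k0; first exact: hg.
by move=> [u /(hg v hv) hu <-]; rewrite opprK.
Qed.

Lemma nb_disjoint k l z : nb v0 k z -> nb v0 l z -> k = l.
Proof.
move=> hk hl; have := nb_Re hk; have := nb_Re hl; move: hk hl; rewrite !nbP.
case: (0 <= k); case: (0 <= l) => a b x y.
- exact: (U_disjoint U_isolating h0 a b).
- by move: (lt_trans x y); rewrite ltxx.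
- by move: (lt_trans x y); rewrite ltxx.
- by apply: oppr_inj; exact: (U_disjoint U_isolating h0 a b).
Qed.

Lemma nb_far : exists N : nat, forall k, (N <= `|k|)%N -> nb v0 k = disc (kpi R k) (pi / 3).
Proof.
have [_ _ _ _ [N hN]] := U_isolating h0; exists N.+1 => k Nk.
have pos (m : int) : 0 < m -> (N <= `|m|)%N -> U v0 m = disc (kpi R m) (pi / 3).
  by move=> m0 /hN ->; rewrite /Dset gt_eqF// m0.
rewrite eqEsubset; case: (ltgtP 0 k) => k0; last by move: Nk; rewrite -k0.
  by split => z; rewrite nbP (ltW k0) (pos k k0 (ltnW Nk)); exact: id.
have E : U v0 (- k) = disc (kpi R (- k)) (pi / 3) by apply: pos; lia.
split => z; rewrite nbP leNgt k0 /= E kpiN /disc /=;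
  (have -> : - z - - kpi R k = - (z - kpi R k) by ring); rewrite normcNE; exact: id.
Qed.

Lemma setting_half (Wv : W v) : half (mid v) (rad v) (w v) (nb v0).
Proof.
split.
- move=> k z; rewrite -gap_seg => /(w_root Wv)[h1 h2 h3]; split; first exact: holo_ccont.
    rewrite h2 -midD -midB; ring.
  have E : rad v k ^+ 2 / (mid v k - z) ^+ 2 = gamma (lam v) J1 k ^+ 2 / (4 * (tau (lam v) J1 k - z) ^+ 2).
    have q (a X : C) : (a / 2) ^+ 2 / X = a ^+ 2 / (4 * X).
      rewrite expr_div_n; have -> : 2 ^+ 2 = 4 :> C by ring.
      by rewrite invfM mulrA.
    exact: q.
  rewrite E; exact: h3.
- exact: seg_nb.
- split; first exact: nb_disc.
  by move=> k /nb_Re; rewrite /= ltxx; case: ifP.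
- by split; [exact: nb_disjoint|exact: nb_far].
move=> k k0; have [kp|kn|k00] := ltgtP 0 k; last by rewrite -k00 eqxx in k0.
  have n1 : (0 <= k) = true by exact: ltW.
  have n2 : (0 <= - k) = false by lia.
  split.
  - by move=> z; rewrite !nbP n1 n2 opprK.
  - by rewrite /mid /tau /lamj n1 n2 opprK; field.
  - by rewrite /rad /gamma /lamj n1 n2 opprK; field.
have n1 : (0 <= k) = false by lia.
have n2 : (0 <= - k) = true by lia.
split.
- by move=> z; rewrite !nbP n1 n2 opprK.
- by rewrite /mid /tau /lamj n1 n2 /=; field.
- by rewrite /rad /gamma /lamj n1 n2 /=; field.
Qed.

Lemma setting_rootfam (s : int -> C) (Wv : W v) : ell2 (fun k => normc (s k - k%:~R * pi%:C)) ->
  gamma2_ell2 (fun=> True) (gamma (lam v) J1) (fun k => s k - tau (lam v) J1 k) ->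
  rootfam (mid v) (rad v) s (w v).
Proof.
move=> h1 [al [hal h2]]; have [hr _ _ _ _] := setting_half Wv; split => //.
- exact: ell2_csum2.
(* The weights in [gamma2_ell2] carry no sign condition. *)
- exists (fun k => `|al k|); split => //.
    have q (e : nat -> int) : csum (fun i => al (e i) ^+ 2) -> csum (fun i => `|al (e i)| ^+ 2).
      by apply: (csum_le (K := 0%N)) => i *; [exact: sqr_ge0|rewrite real_normK ?num_real].
    by have [a1 a2] := ell2_csum2 hal; split; apply: q.
  move=> k; apply: le_trans (h2 k I) _; have -> : gamma (lam v) J1 k = 2 * rad v k by rewrite /rad; field.
  rewrite normcM normc_nat exprMn -[2 ^+ 2]/(2 * 2).
  have -> : 2 * 2 = 4 :> R by ring.
  by rewrite ler_wpM2l ?ler_norm// mulr_ge0 ?sqr_ge0.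
have [N hN] := nb_far; exists N => k Nk; rewrite midD midB.
by have h3 := lam_nb k true; have h4 := lam_nb k false; rewrite hN// in h3 h4.
Qed.

End Base.

Lemma tau_Irec v0 v k : H1r v0 -> H1ball v0 (radius v0) v ->
  tau (lam v) J2 k = tau (lam (Irec v)) J1 k /\ gamma (lam v) J2 k = gamma (lam (Irec v)) J1 k.
Proof.
move=> h0 hv; have E := lamj_Irec U_compatible lam_listing U_isolating chi_recip _ _ h0 hv.
by rewrite /tau /gamma !E.
Qed.

Lemma zone_relabel v0 j k z : H1r v0 ->
  zone (nb v0) (nb (Irec v0)) j k z <-> relabel (U v0) j k z.
Proof.
move=> h0; case: j => //; have h0' := H1r_Irec h0.
have [_ /(_ k)[E _]] := U_compatible h0'; rewrite IrecK in E; rewrite -E /= /nb.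
split; first by move=> h; exists (- recip z) => //; rewrite -/(recip _) recipN recipK opprK.
by move=> [u hu <-]; rewrite -/(recip u) recipN recipK opprK.
Qed.

(** The first zones are U_k for k >= 0 and -U_{-k} for k < 0, the second ones -U_{-l} for l >= 0 and
    U_l for l < 0. Equal signs are separated by the indices of the U's, opposite signs by the
    half-planes. *)
Lemma setting_cross v0 k l z : H1r v0 -> nb v0 k z -> ~ nb (Irec v0) l (- recip z).
Proof.
move=> h0 hk hl; have /(zone_relabel J2 l z h0) hz : zone (nb v0) (nb (Irec v0)) J2 l z by [].
have hR := nb_Re h0 hk; move: hk hz; rewrite nbP /=.
case: (boolP (0 <= k)) hR => k0 hR hk; case: (boolP (0 <= l)) => l0 hz.
- case: hz => u hu uz; have := U_Re_gt0 U_isolating h0 hu.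
  by rewrite -[u]opprK uz cReN oppr_gt0 => /(lt_trans hR); rewrite ltxx.
- by have E := U_disjoint U_isolating h0 hk hz; rewrite E (negbTE l0) in k0.
- case: hz => u hu uz; rewrite -uz opprK in hk.
  have E := U_disjoint U_isolating h0 hk hu; lia.
- by have := lt_trans hR (U_Re_gt0 U_isolating h0 hz); rewrite ltxx.
Qed.

Lemma setting_gap0 v0 v : H1r v0 -> H1ball v0 (radius v0) v ->
  [/\ exists c rho, nb v0 0 = disc c%:C rho,
      forall z, nb (Irec v0) 0 z <-> nb v0 0 (recip z),
      0 < cRe (mid v 0 + rad v 0) /\ 0 < cRe (mid v 0 - rad v 0) &
      mid v 0 + rad v 0 = recip (mid (Irec v) 0 - rad (Irec v) 0) /\
      mid v 0 - rad v 0 = recip (mid (Irec v) 0 + rad (Irec v) 0)].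
Proof.
move=> h0 hv; split.
- have [_ _ _ [c [_ [hd _] _]] _] := U_isolating h0.
  by have [a [rho [_ E]]] := hd 0%N; exists a, rho; rewrite /nb.
- move=> z; split => hz; first by have := U_recip U_compatible (H1r_Irec h0) hz; rewrite IrecK.
  by have := U_recip U_compatible h0 hz; rewrite recipK.
- have h s := nb_Re h0 (lam_nb h0 hv 0 s); have ht := h true; have hf := h false.
  by rewrite midD midB; rewrite lexx in ht hf.
- rewrite !midD !midB /lamj /=.
  have E s := lam_Irec U_compatible lam_listing U_isolating chi_recip 0 s h0 hv.
  have Et := E true; have Ef := E false; rewrite oppr0 /= in Et Ef.
  by rewrite Et Ef !recipK.
Qed.

Section Contours.
Variable Gam : pot R -> pot R -> root_family -> int -> R -> R[i].
Hypothesis Gam_contour : are_contours W lam radius U Gam.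

(** [encircled] contains the arc on which the second root is cut, so the winding numbers around it
    are prescribed. *)
Lemma setting_encircles v0 v j m : H1r v0 -> W v -> H1ball v0 (radius v0) v ->
  encircles (mid v) (rad v) (mid (Irec v)) (rad (Irec v)) (nb v0) (nb (Irec v0)) j m
    (Gam v0 v j m) (cderive (Gam v0 v j m)).
Proof.
move=> h0 Wv hv; have [h1 h2 h3 h4] := Gam_contour h0 Wv hv j m.
have sub : cut (mid v) (rad v) (mid (Irec v)) (rad (Irec v)) j m `<=` encircled lam v j m.
  case: (j) => z /=; first by rewrite -gap_seg.
  rewrite -gap_seg => h; right; exists (- recip z) => //.
  by rewrite -/(recip _) recipN recipK opprK.
split => //; first exact: piecewise_isAC.
- by move=> s /h3[hU hn]; split; [exact/zone_relabel|move=> /sub].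
- by move=> a /sub; exact: h4.
Qed.

End Contours.
End Setting.

(** * Periods of psi_n and of its reflection *)

Section Integrals.
Variable R : realType.
Local Notation C := R[i].
Implicit Types (z a : C) (k : int) (v : pot R).
Variable M : R -> R[i] -> pot R -> 'M[R[i]]_2.
Hypothesis M_solution : forall (v : pot R) (z : R[i]), H1c v -> z != 0 ->
  fundamental_solution z v (fun x => M x z v).
Variables (lam : pot R -> listing R) (radius : pot R -> R) (U : pot R -> int -> set R[i]).
Hypothesis lam_listing : forall v0 v : pot R, H1r v0 -> H1ball v0 (radius v0) v ->
  is_listing (chi_p M v) (lam v).
Hypothesis U_isolating : forall v0 : pot R, H1r v0 ->
  isolating (H1ball v0 (radius v0)) lam (U v0).
Hypothesis U_compatible : Irec_compatible radius U.
Variable W : set (pot R).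
Hypothesis W_sub : forall v : pot R, W v -> exists v0 : pot R, H1r v0 /\ H1ball v0 (radius v0) v.
Hypothesis W_Irec : [set Irec v | v in W] = W.
Variable w : pot R -> int -> R[i] -> R[i].
Hypothesis w_root : forall (v : pot R) (n : int), W v -> is_canonical_root (lam v) n (w v n).
Variable Gam : pot R -> pot R -> root_family -> int -> R -> R[i].
Hypothesis Gam_contour : are_contours W lam radius U Gam.
Variables (n : nat) (psi : R[i] -> pot R -> R[i]) (sig : root_family -> int -> pot R -> R[i]).
Hypothesis psi_prop : psi_properties W lam radius U Gam w n psi sig.
Hypothesis n1 : (1 <= n)%N.

Section Potential.
Variables u0 u : pot R.
Hypothesis h0 : H1r u0.
Hypothesis hu : H1ball u0 (radius u0) u.
Hypothesis Wu : W u.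

Local Notation u' := (Irec u).
Local Notation u0' := (Irec u0).
Let h0' : H1r u0' := H1r_Irec h0.
Let hu' : H1ball u0' (radius u0') u' := ball_Irec U_compatible h0 hu.
Let Wu' : W u' := WI W_Irec Wu.
Local Notation t := (mid lam u).
Local Notation g := (rad lam u).
Local Notation t' := (mid lam u').
Local Notation g' := (rad lam u').
Local Notation s1 := (fun k => sig J1 k u).
Local Notation s2 := (fun k => sig J2 k u).
Local Notation A := (nb U u0).
Local Notation B := (nb U u0').
Local Notation Q := (quot t s1 s2 (w u) (w u') n%:Z).
Local Notation Qf := (quot_flip t s1 s2 (w u) (w u') n%:Z).

Let hA : half t g (w u) A := setting_half U_isolating w_root h0 hu Wu.
Let hB : half t' g' (w u') B := setting_half U_isolating w_root h0' hu' Wu'.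
Let n0 : n%:Z != 0. Proof. by case: (n) n1. Qed.

Lemma sig_rootfam1 : rootfam t g s1 (w u).
Proof.
have [_ [_ _ h2] _ _ [h3 _]] := psi_prop.
exact: (setting_rootfam (s := s1) U_isolating w_root h0 hu Wu (h2 u J1 Wu) (h3 u J1 Wu)).
Qed.

Lemma sig_rootfam2 : rootfam t' g' s2 (w u').
Proof.
have [_ [_ _ h2] _ _ [h3 _]] := psi_prop.
apply: (setting_rootfam (s := s2) U_isolating w_root h0' hu' Wu' (h2 u J2 Wu)).
have [al [a1 a2]] := h3 u J2 Wu; exists al; split => // k _.
have [<- <-] := tau_Irec M_solution lam_listing U_isolating U_compatible k h0 hu.
exact: a2.
Qed.

Let cross k l z : A k z -> ~ B l (- recip z).
Proof. by move=> h; exact: (setting_cross U_isolating U_compatible h0 h). Qed.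

Let s1n : s1 n%:Z = t n%:Z.
Proof. by have [h _ _ _ _] := psi_prop; exact: h. Qed.

Let sig_zone j k : (j, k) <> (J1, n%:Z) -> zone A B j k (if j is J1 then sig J1 k u else - recip (sig J2 k u)).
Proof.
have [_ [_ h _] _ _ _] := psi_prop; have [h1 h2] := h u0 u h0 Wu hu k.
case: j => jk; apply/(zone_relabel U_compatible _ _ _ h0).
  by apply: h1; apply/eqP => E; apply: jk; rewrite E.
by rewrite -recipN /recip mulrN.
Qed.

Lemma sig2_neq0 k : s2 k != 0.
Proof.
have hz : zone A B J2 k (- recip (sig J2 k u)) by apply: (@sig_zone J2 k) => -[].
apply/eqP => E; rewrite E in hz; apply: (zone_off0 hA hB (j := J2) (k := k)).
by rewrite /recip mulr0 invr0 oppr0 in hz.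
Qed.

Lemma psi_formE z : z != 0 -> psi z u = psi_form s1 s2 n%:Z z.
Proof. by move=> z0; have [_ [h _ _] _ _ _] := psi_prop; rewrite (h u z Wu z0). Qed.

Let hX j m := setting_encircles U_compatible Gam_contour j m h0 Wu hu.
Let hY j m := setting_encircles U_compatible Gam_contour j m h0' Wu' hu'.

Lemma contour_quot j m : contour_int (Gam u0 u j m) (fun z => psi z u / croot_chi_p w u z) =
  pint (Gam u0 u j m) (cderive (Gam u0 u j m)) Q.
Proof.
apply: cint_eq_cc => s s01; congr (_ * _); set z := Gam _ _ _ _ _.
have off : ~ cuts t g t' g' z := encircles_off hA hB cross (hX j m) s01.
have off0' : ~ cuts0 t g t' g' z by move=> h; apply: off; left.
have [z0 hz hn] := off_cuts0 n0 off0'.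
rewrite psi_formE//; apply: (quotient_form hA hB sig_rootfam1 sig_rootfam2 s1n n0 z0 hz _ _ hn) => h; apply: off; right;
  by [left|right].
Qed.

Let period j m : pint (Gam u0 u j m) (cderive (Gam u0 u j m)) Q =
  2 * pi%:C * (if j is J1 then (m == n%:Z)%:R else 0).
Proof.
have [_ _ h _ _] := psi_prop; have [h1 h2] := h u0 u h0 Wu hu m.
have p0 : 2 * pi%:C != 0 :> C.
  by rewrite mulf_neq0 ?pnatr_eq0// -normc_gt0 normc_real normr_gt0 gt_eqF ?pi_gt0.
by rewrite -contour_quot; case: j; rewrite -?h1 -?h2 mulVKf.
Qed.

Let chi0 : chi1 (w u) 0 = chi1 (w u') 0.
Proof.
apply: (chi1_normalized hA hB sig_rootfam1 sig_rootfam2 n0 cross hX sig2_neq0) => m; rewrite period//.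
by rewrite mulr0.
Qed.

Let exchange j m : pint (inv_path (Gam u0' u' j m))
    (inv_dpath (Gam u0' u' j m) (cderive (Gam u0' u' j m))) Qf =
  - (2 * pi%:C * (if j is J2 then (m == - n%:Z)%:R else 0)).
Proof.
have [[c [rho A0]] B0 _ ends0] := setting_gap0 M_solution lam_listing U_isolating U_compatible h0 hu.
have [_ _ Re0 _] := setting_gap0 M_solution lam_listing U_isolating U_compatible h0' hu'.
have hYj j' m' : encircles t' g' t g B A j' m' (Gam u0' u' j' m') (cderive (Gam u0' u' j' m')).
  by have := hY j' m'; rewrite !IrecK.
have [m0|m0] := eqVneq m 0; last first.
  rewrite (exchange_far hA hB sig_rootfam1 sig_rootfam2 n0 cross A0 B0 Re0 ends0 chi0 m0 (hYj j m) (hX (other j) (- m))).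
  by rewrite period; case: (j) => //=; rewrite eqr_oppLR.
rewrite m0 (exchange_near hA hB sig_rootfam1 sig_rootfam2 n0 cross A0 B0 Re0 ends0 chi0 (hYj j 0) (hX j 0)) period.
by case: (j) => //=; rewrite [0 == _]eq_sym ?oppr_eq0 (negbTE n0).
Qed.

Let inv_off y : ~ cuts t' g' t g y -> ~ cuts_flip t g t' g' (recip y).
Proof.
move=> off [[/eqP y0|[k k0 h]]|h]; apply: off; apply/cutsE.
- by left; apply/eqP; rewrite -recip_eq0.
- have kN0 : - k != 0 by rewrite oppr_eq0.
  right; case: h => h; first by exists J2, (- k) => /=; apply/(half_segN hA _ k0).
  by exists J1, (- k); rewrite recipK in h; apply/(half_segN hB _ kN0); rewrite opprK.
- by right; rewrite recipK in h; case: h => h; [exists J2, 0|exists J1, 0].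
Qed.

(** Here u is the potential at which psi_n itself is evaluated, whereas the contour and the root of
    chi_p belong to [Irec u]. *)
Lemma contour_neg j m : contour_int (Gam u0' u' j m)
    (fun z => psi_neg psi z u' / croot_chi_p w u' z) =
  2 * pi%:C * (if j is J2 then (m == - n%:Z)%:R else 0).
Proof.
have hYj : encircles t' g' t g B A j m (Gam u0' u' j m) (cderive (Gam u0' u' j m)).
  by have := hY j m; rewrite !IrecK.
rewrite -[RHS]opprK -exchange /pint.
have cross' := cross' cross.
(* The sign is that of d(1/(16 y)) = - dy/(16 y^2), whose factor enters [psi_neg] positively; it
   cancels the sign in [exchange]. *)
have conv s : 0 <= s <= 1 -> psi_neg psi (Gam u0' u' j m s) u' / croot_chi_p w u' (Gam u0' u' j m s)
    * cderive (Gam u0' u' j m) s =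
    -1 * (Qf (inv_path (Gam u0' u' j m) s) *
      inv_dpath (Gam u0' u' j m) (cderive (Gam u0' u' j m)) s).
  move=> s01; rewrite /inv_path /inv_dpath -/(recip _); set y := Gam _ _ _ _ s; set dy := cderive _ s.
  have off := inv_off (encircles_off hB hA cross' hYj s01); rewrite -/y in off.
  have off0' : ~ cuts0 t g t' g' (recip y) by move=> h; apply: off; left.
  have [z0 hz hn] := off_cuts0 n0 off0'.
  have a0 : ~ seg (t 0) (g 0) (- recip y) by move=> h; apply: off; right; left.
  have b0 : ~ seg (t' 0) (g' 0) (recip (recip y)) by move=> h; apply: off; right; right.
  have E := quotient_flip hA hB sig_rootfam1 sig_rootfam2 s1n n0 z0 hz a0 b0 hn.
  have E2 : psi (recip y) u / croot_chi_p w u' y = Qf (recip y).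
    have -> : croot_chi_p w u' y = chi_form (w u') (w u) (recip (recip y)).
      by rewrite recipK /croot_chi_p /croot_chi /wj IrecK.
    by rewrite psi_formE//; exact: E.
  rewrite -E2 /psi_neg IrecK -/(recip y); ring.
have hi : cintegrable 0 1 (fun s => Qf (inv_path (Gam u0' u' j m) s) *
    inv_dpath (Gam u0' u' j m) (cderive (Gam u0' u' j m)) s).
  have hc : curves (cuts_flip t g t' g') (fun _ : unit => inv_path (Gam u0' u' j m))
      (fun _ => inv_dpath (Gam u0' u' j m) (cderive (Gam u0' u' j m))).
    move=> _; split; [exact: (inv_AC hA hB hYj)|exact: (inv_closed hYj)|move=> s s01].
    exact: inv_off (encircles_off hB hA cross' hYj s01).
  have wind0 a : cuts_flip t g t' g' a -> \sum_(b : unit) (0 : C) *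
      pint (inv_path (Gam u0' u' j m)) (inv_dpath (Gam u0' u' j m) (cderive (Gam u0' u' j m)))
        (fun z => (z - a)^-1) = 0.
    by move=> _; apply: big1 => b _; rewrite mul0r.
  have [hc' _] := cauchy (curves_AC hc) (curves_closed hc) (curves_off hc) wind0
    (unifrat_quot_flip sig_rootfam1 sig_rootfam2 n0 hc).
  exact: cintegrableM (hc' tt) (curves_AC hc tt).1.
by rewrite /contour_int (@cint_eq_cc _ _ _ _ _ conv) cintZ// mulN1r.
Qed.

End Potential.
End Integrals.

(** * Reflected roots *)

Section Analytic.
Variable R : realType.
Local Notation C := R[i].
Implicit Types (v h : pot R) (W : set (pot R)).

Lemma H1analytic_Irec W (f : pot R -> C) : (forall v, W v -> W (Irec v)) -> H1analytic W f ->
  H1analytic W (fun v => f (Irec v)).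
Proof.
move=> WI hf v Wv; have [L [lin [K bd] hd]] := hf _ (WI v Wv).
have IZ (a : C) (h k : pot R) : Irec (a *: h + k) = a *: Irec h + Irec k.
  rewrite /Irec; apply/pair_equal_spec; split => //=.
  by apply/funext => x; rewrite !fctE opprD scalerN.
have ID (h k : pot R) : Irec (h + k) = Irec h + Irec k.
  by have := IZ 1 h k; rewrite !scale1r.
exists (fun h => L (Irec h)); split.
- by move=> a h k hh hk; rewrite IZ; exact: lin (H1c_Irec hh) (H1c_Irec hk).
- by exists K => h hh; rewrite -H1norm_Irec; exact: bd (H1c_Irec hh).
move=> e /hd[d [d0 hdd]]; exists d; split; first exact: d0.
move=> h hh hn; rewrite -H1norm_Irec in hn; rewrite ID -(H1norm_Irec h).
exact: hdd (H1c_Irec hh) hn.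
Qed.

Lemma H1norm_ge0 h : 0 <= H1norm h.
Proof. exact: sqrtr_ge0. Qed.

Lemma H1analytic_recip W (f : pot R -> C) : (forall v, W v -> f v != 0) -> H1analytic W f ->
  H1analytic W (fun v => recip (f v)).
Proof.
have eqW (x y : R) : x = y -> x <= y by move=> ->.
move=> f0 hf v Wv; have [L [lin [K0 bd0] hd]] := hf v Wv.
set a := f v in hd *; have a0 : a != 0 := f0 v Wv.
have na : 0 < normc a by rewrite normc_gt0.
pose K := Num.max K0 0; have K_0 : 0 <= K by rewrite le_max lexx orbT.
have bd h : H1c h -> normc (L h) <= K * H1norm h.
  move=> hh; apply: le_trans (bd0 h hh) _; rewrite ler_wpM2r ?H1norm_ge0//.
  by rewrite le_max lexx.
exists (fun h => - (16 * a ^+ 2)^-1 * L h); split.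
- by move=> b h k hh hk; rewrite (lin b h k hh hk); ring.
- exists (normc (- (16 * a ^+ 2)^-1) * K) => h hh.
  by rewrite normcM -mulrA ler_wpM2l ?normc_ge0// bd.
move=> e e0.
(* The remainder is (dl^2/(a^2 (a + dl)) - r/a^2)/16. [d4] and [d2] bound the two terms by 8 e H
   each, [d1] gives |dl| <= (K + 1) H, and [d3] keeps |a + dl| >= |a|/2. *)
have [d1 [d10 h1]] := hd 1 ltr01.
have e8 : 0 < 8 * e * normc a ^+ 2 by rewrite !mulr_gt0 ?exprn_gt0.
have [d2 [d20 h2]] := hd _ e8.
have K1 : 0 < K + 1 by rewrite ltr_wpDl.
pose d3 := normc a / (2 * (K + 1)); have d30 : 0 < d3 by rewrite divr_gt0 ?mulr_gt0.
pose d4 := 4 * e * normc a ^+ 3 / (K + 1) ^+ 2.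
have d40 : 0 < d4 by rewrite divr_gt0 ?mulr_gt0 ?exprn_gt0.
exists (Num.min (Num.min d1 d2) (Num.min d3 d4)); split; first by rewrite !lt_min d10 d20 d30.
move=> h hh; rewrite !lt_min => /andP[/andP[n1 n2] /andP[n3 n4]].
set H := H1norm h in n1 n2 n3 n4 *; have H0 : 0 <= H := H1norm_ge0 h.
set dl := f (v + h) - a; set r := dl - L h.
have r1 : normc r <= H by have := h1 h hh n1; rewrite mul1r.
have r2 : normc r <= 8 * e * normc a ^+ 2 * H := h2 h hh n2.
have dlb : normc dl <= (K + 1) * H.
  have -> : dl = r + L h by rewrite /r subrK.
  by apply: le_trans (normcD _ _) _; have := bd h hh; rewrite -/H; lra.
have dla : normc dl <= normc a / 2.
  apply: le_trans dlb _; rewrite mulrC -ler_pdivlMr//.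
  by apply/ltW; apply: lt_le_trans n3 _; rewrite /d3; apply: eqW; field; rewrite gt_eqF.
have adl : normc a / 2 <= normc (a + dl).
  by have := normc_ge_B a (- dl); rewrite opprK normcNE; lra.
have ad0 : a + dl != 0 by rewrite -normc_gt0; apply: lt_le_trans adl; rewrite divr_gt0.
have -> : f (v + h) = a + dl by rewrite /dl; ring.
have -> : recip (a + dl) - recip a - - (16 * a ^+ 2)^-1 * L h =
    16^-1 * (dl ^+ 2 / (a ^+ 2 * (a + dl)) - r / a ^+ 2).
  by rewrite /recip /r; field; rewrite a0 ad0.
rewrite normcM normcV normc_nat.
apply: (@le_trans _ _ (16^-1 * (8 * e * H + 8 * e * H))); last first.
  by apply: eqW; field.
rewrite ler_wpM2l ?invr_ge0//; apply: le_trans (normcB _ _) _; apply: lerD.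
  rewrite [normc (_ / _)]normcM normcV [normc (a ^+ 2 * _)]normcM !normcX.
  have p : normc a ^+ 3 / 2 <= normc a ^+ 2 * normc (a + dl).
    by rewrite exprS mulrAC mulrC ler_wpM2l// sqr_ge0.
  have p0 : 0 < normc a ^+ 3 / 2 by rewrite divr_gt0 ?exprn_gt0.
  rewrite ler_pdivrMr; last exact: lt_le_trans p.
  apply: (@le_trans _ _ (8 * e * H * (normc a ^+ 3 / 2))); last first.
    by rewrite ler_wpM2l// !mulr_ge0 ?(ltW e0).
  apply: (@le_trans _ _ (((K + 1) * H) ^+ 2)).
    by rewrite lerXn2r ?nnegrE ?normc_ge0// mulr_ge0 ?(ltW K1).
  rewrite exprMn [H ^+ 2]expr2 mulrA [leRHS](_ : _ = 4 * e * normc a ^+ 3 * H); last by field.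
  rewrite ler_wpM2r// mulrC -ler_pdivlMr ?exprn_gt0//; exact: ltW.
rewrite normcM normcV normcX ler_pdivrMr ?exprn_gt0//.
by apply: le_trans r2 _; apply: eqW; ring.
Qed.

(** The free value at 0 accommodates the index that is inverted instead of reflected. *)
Lemma ell2_reflect (al : int -> R) (b : R) : ell2 al ->
  ell2 (fun k => if k == 0 then b else al (- k)).
Proof.
rewrite /ell2 => hal.
have nn (f : int -> R) k : (0 <= (f k ^+ 2)%:E)%E by rewrite lee_fin sqr_ge0.
pose f k : \bar R := ((al (- k)) ^+ 2)%:E; pose e k : \bar R := (if k == 0 :> int then b ^+ 2 else 0)%:E.
have e0 k : (0 <= e k)%E by rewrite lee_fin; case: ifP => _ //; exact: sqr_ge0.
have f0 k : (0 <= f k)%E by rewrite lee_fin sqr_ge0.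
apply: (@le_lt_trans _ _ (\esum_(k in [set: int]) (f k + e k))%E).
  apply: le_esum => k _; rewrite /f /e -EFinD lee_fin; case: eqP => _; last by rewrite addr0.
  by rewrite lerDr sqr_ge0.
rewrite esumD//; apply: lte_add_pinfty.
  have -> : (\esum_(k in [set: int]) f k = \esum_(k in [set: int]) ((al k) ^+ 2)%:E)%E; last exact: hal.
  rewrite (reindex_esum [set: int] [set: int] (fun k : int => - k)) //.
  - by apply: eq_esum => k _; rewrite /f opprK.
have -> : (\esum_(k in [set: int]) e k = \esum_(k in [set (0 : int)]) (b ^+ 2)%:E)%E.
  rewrite [RHS]esum_mkcond; apply: eq_esum => k _; rewrite /e.
  by case: eqP => [->|k0]; [rewrite mem_set|rewrite memNset].
by rewrite esum_set1 ?ltry// lee_fin sqr_ge0.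
Qed.

End Analytic.

(** * Zeros of psi_n and symmetries of the labels *)

Section Roots.
Variable R : realType.
Local Notation C := R[i].
Local Notation cRe := (@complex.Re R).
Local Notation pin := (@pin R).
Implicit Types (z a : C) (k : int) (v : pot R).

Lemma tame_skip (a : int -> C) n : tame a -> tame (fun k => if k == n then 1 else a k).
Proof.
move=> ha; apply: (csum_le (K := `|n|.+1) _ _ ha) => [i|i ni]; first exact: normc_ge0.
case: i ni => [|i] ni //=.
have -> : ((i.+1%:Z : int) == n) = false by apply/negP => /eqP E; move: ni; rewrite -E; lia.
by have -> : ((- i.+1%:Z : int) == n) = false by apply/negP => /eqP E; move: ni; rewrite -E; lia.
Qed.

Lemma tame_prodZ_neq0 (a : int -> C) : tame a -> (prodZ a != 0 <-> forall k, a k != 0).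
Proof.
move=> ha; have [l [_ El nz]] := tame_cvg ha; split; last by rewrite El.
by move=> a0 k; apply: contra a0 => /eqP ak; rewrite (prodZ_eq0 ak).
Qed.

(** A [tame] product vanishes only together with one of its factors. *)
Lemma psi_form_eq0 (t g s1 t' g' s2 : int -> C) (w w' : int -> C -> C) n z :
  rootfam t g s1 w -> rootfam t' g' s2 w' -> (forall k, s2 k != 0) ->
  psi_form s1 s2 n z = 0 <-> (exists2 k, k != n & z = s1 k) \/ (exists k, z = recip (- s2 k)).
Proof.
move=> F1 F2 s20.
have t1 := tame_skip n (rootfam_tame_sig F1 z); have t2 := rootfam_tame_sig F2 (- recip z).
have t3 := rootfam_tame_sig F2 0.
have e2 : (fun k => (s2 k + recip z) / pin k) = (fun k => (s2 k - - recip z) / pin k).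
  by apply/funext => k; rewrite opprK.
have e3 : (fun k => s2 k / pin k) = (fun k => (s2 k - 0) / pin k).
  by apply/funext => k; rewrite subr0.
have pn k : (pin k)^-1 != 0 by rewrite invr_eq0 pin_neq0.
have q0 : - (pin n)^-1 * (prodZ (fun k => s2 k / pin k))^-1 != 0.
  rewrite mulf_neq0 ?oppr_eq0// invr_eq0 e3; apply/(tame_prodZ_neq0 t3) => k.
  by rewrite subr0 mulf_neq0.
rewrite /psi_form e2; split.
  move=> /eqP h; apply: contrapT => hn; move: h; apply/negP.
  apply: mulf_neq0; first apply: mulf_neq0; first exact: q0.
    apply/(tame_prodZ_neq0 t1) => k; case: ifPn => k0; first exact: (oner_neq0 C).
    by rewrite mulf_neq0// subr_eq0; apply/eqP => E; apply: hn; left; exists k.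
  apply/(tame_prodZ_neq0 t2) => k; rewrite mulf_neq0// opprK addr_eq0.
  by apply/eqP => E; apply: hn; right; exists k; rewrite E opprK recipK.
move=> [[k kn E]|[k E]].
  have h : prodZ (fun k => if k == n then 1 else (s1 k - z) / pin k) = 0.
    by apply: (prodZ_eq0 (k := k)); rewrite (negbTE kn) E subrr mul0r.
  by rewrite h mulr0 mul0r.
have h : prodZ (fun k => (s2 k - - recip z) / pin k) = 0.
  by apply: (prodZ_eq0 (k := k)); rewrite E recipK opprK subrr mul0r.
by rewrite h mulr0.
Qed.

Lemma lamj_opp (l : listing R) j k s : k != 0 -> lamj l j (- k) s = - lamj l j k (~~ s).
Proof.
move=> k0; have [kp|kn|k00] := ltgtP 0 k; last by rewrite -k00 eqxx in k0.
  have n1 : (0 <= k) = true by exact: ltW.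
  have n2 : (0 <= - k) = false by lia.
  by case: j; rewrite /lamj n1 n2 ?opprK ?negbK.
have n1 : (0 <= k) = false by lia.
have n2 : (0 <= - k) = true by lia.
by case: j; rewrite /lamj n1 n2 ?opprK ?negbK.
Qed.

Lemma relabel_opp (S : int -> set C) j k z : k != 0 -> relabel S j (- k) z -> relabel S j k (- z).
Proof.
move=> k0; have [kp|kn|k00] := ltgtP 0 k; last by rewrite -k00 eqxx in k0.
  have n1 : (0 <= k) = true by exact: ltW.
  have n2 : (0 <= - k) = false by lia.
  case: j; rewrite /relabel n1 n2 ?opprK; first by move=> [u hu <-]; rewrite opprK.
  by move=> h; exists z.
have n1 : (0 <= k) = false by lia.
have n2 : (0 <= - k) = true by lia.
case: j; rewrite /relabel n1 n2 ?opprK; first by move=> h; exists z.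
by move=> [u hu <-]; rewrite opprK.
Qed.

Lemma relabel_Irec (radius : pot R -> R) (U : pot R -> int -> set C) v0 j k z :
  Irec_compatible radius U -> H1r v0 ->
  relabel (U (Irec v0)) j k z -> relabel (U v0) (other j) k (- recip z).
Proof.
move=> hU h0 hz; have [_ /(_ k)[E1 E2]] := hU _ (H1r_Irec h0); rewrite IrecK in E1 E2.
by case: j hz => hz; rewrite /other; [rewrite -E1|rewrite -E2]; exists z.
Qed.

Lemma real_betweenN (a x b : C) : real_between a x b -> real_between (- b) (- x) (- a).
Proof.
move=> [ar /andP[ax xb]]; split; last by rewrite !lerN2 ax xb.
have br : b \is Num.real by rewrite -(ler_real (le_trans ax xb)).
by rewrite realN.
Qed.

Lemma real_between_recip (a x b : C) : 0 < cRe a -> real_between a x b ->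
  real_between (recip b) (recip x) (recip a).
Proof.
move=> a0 [ar /andP[ax xb]].
have ap : 0 < a by have /complex_realP[r E] := ar; move: a0; rewrite E ltcR.
have xp : 0 < x := lt_le_trans ap ax.
have bp : 0 < b := lt_le_trans xp xb.
have p16 : 0 < 16 :> C by [].
split; first by apply: gtr0_real; rewrite invr_gt0 mulr_gt0.
by rewrite /recip !lef_pV2 ?posrE ?mulr_gt0// !ler_pM2l// ax xb.
Qed.

End Roots.

(** * Roots of the reflected function *)

Section ReflectedRoots.
Variable R : realType.
Local Notation C := R[i].
Local Notation cRe := (@complex.Re R).
Implicit Types (z a : C) (k : int) (v : pot R).
Variable M : R -> R[i] -> pot R -> 'M[R[i]]_2.
Hypothesis M_solution : forall (v : pot R) (z : R[i]), H1c v -> z != 0 ->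
  fundamental_solution z v (fun x => M x z v).
Variables (lam : pot R -> listing R) (radius : pot R -> R) (U : pot R -> int -> set R[i]).
Hypothesis lam_listing : forall v0 v : pot R, H1r v0 -> H1ball v0 (radius v0) v ->
  is_listing (chi_p M v) (lam v).
Hypothesis U_isolating : forall v0 : pot R, H1r v0 ->
  isolating (H1ball v0 (radius v0)) lam (U v0).
Hypothesis U_compatible : Irec_compatible radius U.
Variable W : set (pot R).
Hypothesis W_real : forall v : pot R, H1r v -> W v.
Hypothesis W_sub : forall v : pot R, W v -> exists v0 : pot R, H1r v0 /\ H1ball v0 (radius v0) v.
Hypothesis W_Irec : [set Irec v | v in W] = W.
Variable w : pot R -> int -> R[i] -> R[i].
Hypothesis w_root : forall (v : pot R) (n : int), W v -> is_canonical_root (lam v) n (w v n).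
Variable Gam : pot R -> pot R -> root_family -> int -> R -> R[i].
Variables (n : nat) (psi : R[i] -> pot R -> R[i]) (sig : root_family -> int -> pot R -> R[i]).
Hypothesis psi_prop : psi_properties W lam radius U Gam w n psi sig.
Hypothesis n1 : (1 <= n)%N.

Let n0 : n%:Z != 0. Proof. by case: (n) n1. Qed.

(** With v' = [Irec v] the roots are recip(sigma_{1,k}(v')) and -sigma_{2,k}(v'). By their position
    those of index k <> 0 belong to the other family with index -k, those of index 0 to their own
    family. The omitted (J1, n) becomes (J2, -n), where the formula yields -tau_{1,n}(v'). *)
Definition reflected_root j k v : C :=
  if k == 0 then recip (sig j 0 (Irec v)) else - sig (other j) (- k) (Irec v).

Let base v : W v -> exists v0, [/\ H1r v0, H1ball v0 (radius v0) v, H1r (Irec v0),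
  H1ball (Irec v0) (radius (Irec v0)) (Irec v) & W (Irec v)].
Proof.
move=> Wv; have [v0 [h0 hv]] := W_sub Wv.
exists v0; split; [exact: h0|exact: hv|exact: (H1r_Irec h0)|exact: (ball_Irec U_compatible h0 hv)|].
exact: (WI W_Irec Wv).
Qed.

Lemma lamj_other v j k s : W v -> lamj (lam v) j k s = lamj (lam (Irec v)) (other j) k s.
Proof.
move=> Wv; have [v0 [h0 hv h0' hv' _]] := base Wv.
have chi_recip v' z : H1c v' -> z != 0 -> chi_p M v' z = chi_p M (Irec v') (recip z).
  by move=> hc; exact: (chi_p_reciprocal M_solution hc (H1c_Irec hc)).
case: j => /=; last exact: (lamj_Irec U_compatible lam_listing U_isolating chi_recip _ _ h0 hv).
have := lamj_Irec U_compatible lam_listing U_isolating chi_recip k s h0' hv'.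
by rewrite IrecK.
Qed.

Lemma lamj_zero v j s : W v -> lamj (lam v) j 0 s = recip (lamj (lam (Irec v)) j 0 (~~ s)).
Proof.
have J1_case u b : W u -> lamj (lam u) J1 0 b = recip (lamj (lam (Irec u)) J1 0 (~~ b)).
  move=> Wu; have [u0 [h0 hu h0' hu' _]] := base Wu.
  have [_ _ _ [e1 e2]] := setting_gap0 M_solution lam_listing U_isolating U_compatible h0 hu.
  by rewrite !midD !midB in e1 e2; case: b; [exact: e1|exact: e2].
move=> Wv; case: j; first exact: J1_case.
have Wv' : W (Irec v) by exact: (WI W_Irec).
by rewrite (lamj_other _ _ _ Wv) J1_case// IrecK [in RHS](lamj_other _ _ _ Wv') IrecK.
Qed.

Lemma lamj_refl v j k s : W v -> k != 0 ->
  lamj (lam v) j k s = - lamj (lam (Irec v)) (other j) (- k) (~~ s).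
Proof. by move=> Wv k0; rewrite (lamj_other _ _ _ Wv) lamj_opp// negbK opprK. Qed.

Lemma tau_refl v j k : W v -> k != 0 ->
  tau (lam v) j k = - tau (lam (Irec v)) (other j) (- k) /\
  gamma (lam v) j k = gamma (lam (Irec v)) (other j) (- k).
Proof.
by move=> Wv k0; rewrite /tau /gamma !(lamj_refl _ _ Wv k0) /=; split; [field|ring].
Qed.

Lemma reflected_roots v z : W v -> z != 0 ->
  psi_neg psi z v = 0 <-> (exists k, z = reflected_root J1 k v) \/
    (exists k, k <> - n%:Z /\ z = (- (16 * reflected_root J2 k v))^-1).
Proof.
move=> Wv z0; have [v0 [h0 hv h0' hv' Wv']] := base Wv.
have rz0 : recip z != 0 by rewrite recip_eq0.
have nz : (16 * z ^+ 2)^-1 != 0 by rewrite invr_eq0 mulf_neq0 ?expf_neq0 ?pnatr_eq0.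
have F1 := sig_rootfam1 U_isolating w_root psi_prop h0' hv' Wv'.
have F2 := sig_rootfam2 M_solution lam_listing U_isolating U_compatible W_Irec w_root psi_prop h0' hv' Wv'.
have s20 := sig2_neq0 U_isolating U_compatible W_Irec w_root psi_prop h0' hv' Wv'.
have iff1 : psi_neg psi z v = 0 <-> psi_form (fun k => sig J1 k (Irec v)) (fun k => sig J2 k (Irec v)) n%:Z (recip z) = 0.
  rewrite -(psi_formE psi_prop Wv' rz0) /psi_neg -/(recip z); split; last by move=> ->; rewrite mul0r.
  by move/eqP; rewrite mulf_eq0 (negbTE nz) orbF => /eqP.
rewrite iff1 (psi_form_eq0 n%:Z (recip z) F1 F2 s20).
have e1 x : (- (16 * x))^-1 = recip (- x) by rewrite /recip mulrN.
split.
- move=> [[k kn E]|[k E]].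
    have Ez : z = recip (sig J1 k (Irec v)) by rewrite -E recipK.
    have [k0|k0] := eqVneq k 0.
      by left; exists 0; rewrite /reflected_root eqxx Ez k0.
    right; exists (- k); split; first by move/oppr_inj => E'; rewrite E' eqxx in kn.
    by rewrite e1 /reflected_root oppr_eq0 (negbTE k0) !opprK.
  have Ez : z = - sig J2 k (Irec v) by apply: recip_inj.
  have [k0|k0] := eqVneq k 0.
    right; exists 0; split; first by move=> E'; move: n0; rewrite -[n%:Z]opprK -E' oppr0 eqxx.
    by rewrite e1 /reflected_root eqxx Ez k0 -recipN recipK.
  by left; exists (- k); rewrite /reflected_root oppr_eq0 (negbTE k0) opprK.
move=> [[k E]|[k [kn E]]].
  move: E; rewrite /reflected_root; case: eqVneq => k0 E.
    by left; exists 0; [rewrite eq_sym|rewrite E recipK].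
  by right; exists (- k); rewrite E.
move: E; rewrite e1 /reflected_root; case: eqVneq => k0 E.
  by right; exists 0; rewrite E -recipN recipK.
left; exists (- k); last by rewrite E recipK opprK.
by apply/eqP => E'; apply: kn; rewrite -E' opprK.
Qed.

Lemma reflected_zone v0 v k : H1r v0 -> W v -> H1ball v0 (radius v0) v ->
  relabel (U v0) J1 k (reflected_root J1 k v) /\
  (k <> - n%:Z -> relabel (U v0) J2 k (- (16 * reflected_root J2 k v))^-1).
Proof.
move=> h0 Wv hv; have h0' := H1r_Irec h0; have hv' := ball_Irec U_compatible h0 hv.
have Wv' : W (Irec v) by exact: (WI W_Irec).
have [_ [_ hz _] _ _ _] := psi_prop; have mem m := hz _ _ h0' Wv' hv' m.
have e1 x : (- (16 * x))^-1 = recip (- x) by rewrite /recip mulrN.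
have m1 m : m != n%:Z -> relabel (U v0) J2 m (- recip (sig J1 m (Irec v))).
  by move=> mn; apply: (relabel_Irec (j := J1) U_compatible h0); apply: (mem m).1.
have m2 m : relabel (U v0) J1 m (sig J2 m (Irec v)).
  have := relabel_Irec (j := J2) U_compatible h0 (mem m).2.
  by rewrite e1 recipK opprK.
rewrite e1 /reflected_root; split; last move=> kn; case: eqVneq => [->|k0].
- have := (mem 0).1; rewrite eq_sym => /(_ n0) hs; have := U_recip U_compatible h0' hs.
  by rewrite IrecK.
- by apply: relabel_opp => //; exact: m2.
- by rewrite -recipN recipK; exists (sig J2 0 (Irec v)) => //; rewrite oppr0; exact: m2 0.
rewrite opprK -[recip _]opprK; apply: relabel_opp => //; apply: m1.
by apply/eqP => E; apply: kn; rewrite -E opprK.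
Qed.

Lemma relabel_neq0 v0 j k z : H1r v0 -> relabel (U v0) j k z -> z != 0.
Proof.
move=> h0 hz; apply/eqP => E; rewrite E in hz.
have no m : ~ U v0 m 0 by move=> /(U_Re_gt0 U_isolating h0); rewrite /= ltxx.
have no' m : ~ Nset (U v0 m) 0 by move=> [u hu /eqP]; rewrite oppr_eq0 => /eqP E'; apply: (no m); rewrite -E'.
by move: hz; case: (j); rewrite /relabel; case: ifP => _; [exact: no|exact: no'|exact: no'|exact: no].
Qed.

Lemma reflected_analytic k : H1analytic W (reflected_root J1 k) /\
  (k <> - n%:Z -> H1analytic W (fun v => (- (16 * reflected_root J2 k v))^-1)).
Proof.
have [_ [_ hz _] _ han _] := psi_prop.
have e1 x : (- (16 * x))^-1 = recip (- x) by rewrite /recip mulrN.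
have WI' v : W v -> W (Irec v) by exact: (WI W_Irec).
have refl f : (forall v, W v -> f v != 0) -> H1analytic W f ->
    H1analytic W (fun v => recip (f (Irec v))).
  move=> f0 hf; apply: H1analytic_recip; last exact: H1analytic_Irec.
  by move=> v /WI'; exact: f0.
have a1 m : m != n%:Z -> H1analytic W (fun v => recip (sig J1 m (Irec v))).
  move=> mn; apply: refl; last exact: (han m).1.
  move=> v Wv; have [v0 [h0 hv _ _ _]] := base Wv.
  exact: relabel_neq0 h0 ((hz v0 v h0 Wv hv m).1 mn).
have a2 m : H1analytic W (fun v => - sig J2 m (Irec v)).
  have := refl _ _ (han m).2.
  have -> : (fun v => recip (- (16 * sig J2 m (Irec v)))^-1) = (fun v => - sig J2 m (Irec v)).
    by apply/funext => v; rewrite e1 recipK.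
  apply=> v Wv; have [v0 [h0 hv _ _ _]] := base Wv.
  exact: relabel_neq0 h0 ((hz v0 v h0 Wv hv m).2).
split; last move=> kn; rewrite /reflected_root; have [k0|k0] := eqVneq k 0.
- by apply: a1; rewrite eq_sym.
- exact: a2.
- have -> : (fun v => (- (16 * recip (sig J2 0 (Irec v))))^-1) = (fun v => - sig J2 0 (Irec v)).
    by apply/funext => v; rewrite e1 -recipN recipK.
  exact: a2.
have -> : (fun v => (- (16 * - sig J1 (- k) (Irec v)))^-1) = (fun v => recip (sig J1 (- k) (Irec v))).
  by apply/funext => v; rewrite e1 opprK.
by apply: a1; apply/eqP => E; apply: kn; rewrite -E opprK.
Qed.

(** Away from index 0 the estimate is reflected exactly. At index 0 a single inequality is at stake;
    it holds with the quotient of its two sides as weight unless the gap is closed, and then the gap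
    of [Irec v] is closed too and the root is its midpoint. *)
Lemma reflected_gap v j : W v -> gamma2_ell2 (fun k => (j, k) <> (J2, - n%:Z)) (gamma (lam v) j)
  (fun k => reflected_root j k v - tau (lam v) j k).
Proof.
move=> Wv; have Wv' : W (Irec v) by exact: (WI W_Irec).
have [_ _ _ _ [hd _]] := psi_prop.
have [al [al2 hal]] := hd _ (other j) Wv'; have [be [_ hbe]] := hd _ j Wv'.
pose b := normc (reflected_root j 0 v - tau (lam v) j 0) / normc (gamma (lam v) j 0) ^+ 2.
exists (fun k => if k == 0 then b else al (- k)); split; first exact: ell2_reflect.
move=> k _; have [->|k0] := eqVneq k 0; last first.
  have [e1 e2] := tau_refl j Wv k0; rewrite e1 e2 /reflected_root (negbTE k0).
  have -> : - sig (other j) (- k) (Irec v) - - tau (lam (Irec v)) (other j) (- k) =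
    - (sig (other j) (- k) (Irec v) - tau (lam (Irec v)) (other j) (- k)) by ring.
  by rewrite normcNE; exact: hal.
have [g0|g0] := eqVneq (gamma (lam v) j 0) 0; last first.
  have q : normc (gamma (lam v) j 0) ^+ 2 != 0 by rewrite expf_neq0// normc_eq0.
  by rewrite /b mulrCA divff// mulr1.
rewrite g0 normc0 expr0n mul0r.
have Et := lamj_zero j true Wv; have Ef := lamj_zero j false Wv; rewrite /= in Et Ef.
have E : lamj (lam (Irec v)) j 0 true = lamj (lam (Irec v)) j 0 false.
  by apply: recip_inj; rewrite -Et -Ef; apply/eqP; rewrite eq_sym -subr_eq0; apply/eqP.
have g0' : gamma (lam (Irec v)) j 0 = 0 by rewrite /gamma E subrr.
have := hbe 0 I; rewrite g0' normc0 expr0n mul0r => h.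
have Es : sig j 0 (Irec v) = tau (lam (Irec v)) j 0.
  by apply/eqP; rewrite -subr_eq0 -normc_eq0; apply/eqP/le_anti; rewrite h normc_ge0.
have half (y : C) : (y + y) / 2 = y by field.
by rewrite /reflected_root eqxx Es /tau Et Ef E !half subrr normc0.
Qed.

(** Change of sign and, on positive numbers, inversion both reverse the order, which is matched by
    the exchange of the signs in [lamj]. *)
Lemma reflected_real v j k : H1r v ->
  real_between (lamj (lam v) j k false) (reflected_root j k v) (lamj (lam v) j k true).
Proof.
move=> hv; have Wv := W_real hv; have [v0 [h0 hb h0' hb' Wv']] := base Wv.
have [_ _ _ _ [_ hr]] := psi_prop; have hr' := hr _ _ _ (H1r_Irec hv).
rewrite /reflected_root; have [->|k0] := eqVneq k 0; last first.
  by rewrite !(lamj_refl _ _ Wv k0); apply: real_betweenN; exact: hr'.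
rewrite !(lamj_zero _ _ Wv); apply: real_between_recip; last exact: hr'.
have pos u u0 : H1r u0 -> H1ball u0 (radius u0) u -> 0 < cRe (lamj (lam u) J1 0 false).
  by move=> hu0 hu; apply: (U_Re_gt0 U_isolating hu0 (n := 0)); exact: (lam_in_U U_isolating _ _ hu0 hu).
case: (j); first exact: pos h0' hb'.
by rewrite (lamj_other _ _ _ Wv') IrecK; exact: pos h0 hb.
Qed.

End ReflectedRoots.

Theorem corollary1p3 (R : realType)
  (M : R -> R[i] -> pot R -> 'M[R[i]]_2)
  (M_solution : forall (v : pot R) (z : R[i]), H1c v -> z != 0 ->
     fundamental_solution z v (fun x => M x z v))
  (lam : pot R -> listing R) (radius : pot R -> R)
  (U : pot R -> int -> set R[i])
  (radius_gt0 : forall v0 : pot R, H1r v0 -> 0 < radius v0)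
  (lam_listing : forall v0 v : pot R, H1r v0 -> H1ball v0 (radius v0) v ->
     is_listing (chi_p M v) (lam v))
  (U_isolating : forall v0 : pot R, H1r v0 ->
     isolating (H1ball v0 (radius v0)) lam (U v0))
  (U_compatible : Irec_compatible radius U)
  (W : set (pot R)) (W_open : H1open W)
  (W_real : forall v : pot R, H1r v -> W v)
  (W_sub : forall v : pot R, W v ->
     exists v0 : pot R, H1r v0 /\ H1ball v0 (radius v0) v)
  (W_Irec : [set Irec v | v in W] = W)
  (w : pot R -> int -> R[i] -> R[i])
  (w_root : forall (v : pot R) (n : int), W v ->
     is_canonical_root (lam v) n (w v n))
  (Gam : pot R -> pot R -> root_family -> int -> R -> R[i])
  (Gam_contour : are_contours W lam radius U Gam)
  (psi : nat -> R[i] -> pot R -> R[i])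
  (sig : nat -> root_family -> int -> pot R -> R[i])
  (psi_prop : forall n : nat,
     psi_properties W lam radius U Gam w n (psi n) (sig n)) :
  forall n : nat, (1 <= n)%N ->
    (forall v0 v : pot R, H1r v0 -> W v -> H1ball v0 (radius v0) v ->
       forall m : int,
         contour_int (Gam v0 v J1 m)
           (fun z => psi_neg (psi n) z v / croot_chi_p w v z) = 0 /\
         contour_int (Gam v0 v J2 m)
           (fun z => psi_neg (psi n) z v / croot_chi_p w v z)
           = 2 * pi%:C * (m == - n%:Z)%:R) /\
    exists sigm : root_family -> int -> pot R -> R[i],
      [/\ forall v : pot R, W v -> forall z : R[i], z != 0 ->
            (psi_neg (psi n) z v = 0 <->
             (exists k : int, z = sigm J1 k v) \/
             (exists k : int, k <> - n%:Z /\ z = (- (16 * sigm J2 k v))^-1)),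
          forall v0 v : pot R, H1r v0 -> W v -> H1ball v0 (radius v0) v ->
            forall k : int, relabel (U v0) J1 k (sigm J1 k v) /\
              (k <> - n%:Z ->
               relabel (U v0) J2 k (- (16 * sigm J2 k v))^-1),
          forall k : int, H1analytic W (sigm J1 k) /\
            (k <> - n%:Z ->
             H1analytic W (fun v => (- (16 * sigm J2 k v))^-1)),
          forall (v : pot R) (j : root_family), W v ->
            gamma2_ell2 (fun k => (j, k) <> (J2, - n%:Z)) (gamma (lam v) j)
              (fun k => sigm j k v - tau (lam v) j k)
        & forall (v : pot R) (j : root_family) (k : int), H1r v ->
            (j, k) <> (J2, - n%:Z) ->
            real_between (lamj (lam v) j k false) (sigm j k v)
              (lamj (lam v) j k true)].
Proof.
move=> n n1; have hp := psi_prop n; split.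
  move=> v0 v h0 Wv hv m.
  (* Applied to [Irec v], whose image under [Irec] is v. *)
  have h := contour_neg M_solution lam_listing U_isolating U_compatible W_Irec w_root
    Gam_contour hp n1 (H1r_Irec h0) (ball_Irec U_compatible h0 hv) (WI W_Irec Wv).
  have hJ1 := h J1 m; have hJ2 := h J2 m; rewrite !IrecK in hJ1 hJ2.
  by split; [rewrite hJ1 mulr0|rewrite hJ2].
exists (reflected_root (sig n)); split.
- by move=> v Wv z z0; exact: (reflected_roots M_solution lam_listing U_isolating U_compatible
    W_sub W_Irec w_root hp n1 Wv z0).
- by move=> v0 v h0 Wv hv k; exact: (reflected_zone U_compatible W_Irec hp n1 k h0 Wv hv).
- by move=> k; exact: (reflected_analytic U_isolating U_compatible W_sub W_Irec hp n1 k).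
- by move=> v j Wv; exact: (reflected_gap M_solution lam_listing U_isolating U_compatible
    W_sub W_Irec hp j Wv).
- by move=> v j k hv _; exact: (reflected_real M_solution lam_listing U_isolating U_compatible
    W_real W_sub W_Irec hp j k hv).
Qed.
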